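(* Let $W_1,W_2,\dots$ be i.i.d. real random variables with continuous distribution function $F$. Assume that: (A1) $F$ is invertible for $0<p<1$ and absolutely continuous with density $f$; (A2) $E(W_1^2)<\infty$; (A3) for $0<p<1$, $F$ is twice differentiable at $F^{-1}(p)$. Let $G_n$ be the Empirical Cross-over Function of $W_1,\dots,W_n$, let $G$ be the cross-over function of $F$, and for $0<p<1$ let $$\theta_p=\frac1pW_1\mathbf 1_{\{W_1<F^{-1}(p)\}}-\frac1pF^{-1}(p)\mathbf 1_{\{W_1<F^{-1}(p)\}}+\frac1{1-p}W_1\mathbf 1_{\{W_1\ge F^{-1}(p)\}}-\frac1{1-p}F^{-1}(p)\mathbf 1_{\{W_1\ge F^{-1}(p)\}}+\frac{2\,\mathbf 1_{\{W_1<F^{-1}(p)\}}}{f(F^{-1}(p))}.$$ Then, as $n\to\infty$, for $0<p<1$, $$\sqrt n\,\bigl(G_n(p)-G(p)\bigr)\overset{d}{\to}N(0,\sigma),\qquad \sigma=\mathrm{Var}(\theta_p),$$ where the second parameter of $N(0,\sigma)$ is the variance. Furthermore, for $0<a<b<1$, the processes $U_n(p)=\sqrt n\,\bigl(G_n(p)-G(p)\bigr)$, $a\le p\le b$, satisfy $$U_n\Rightarrow U$$ (weak convergence) in the Skorohod space $D[a,b]$ equipped with the $J_1$ topology, where $U$ is a Gaussian process with mean $0$ and covariance $$\mathrm{Cov}(U(p),U(q))=\mathrm{Cov}(\theta_p,\theta_q).$$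
   Context: $F^{-1}$ denotes the inverse of $F$, defined on $(0,1)$, and $\mathbf 1_A$ is the indicator of $A$. Cross-over function: for $0<p<1$, $$G(p)=\mu_l+\mu_u-2F^{-1}(p),\qquad \mu_l=\frac1p\int_0^p F^{-1}(q)\,dq,\qquad \mu_u=\frac1{1-p}\int_p^1F^{-1}(q)\,dq .$$ Empirical Cross-over Function (ECF): let $W_{(1)}\le W_{(2)}\le\cdots\le W_{(n)}$ be the order statistics of $W_1,\dots,W_n$. For $0<p<1$, $$G_n(p)=\frac1k\sum_{j=1}^kW_{(j)}-W_{(k)}+\frac1{n-k}\sum_{j=k+1}^nW_{(j)}-W_{(k+1)}\qquad\text{for }\frac{k-1}{n}\le p<\frac kn .$$ (The expression makes sense when $k\le n-1$, which holds for all sufficiently large $n$ when $p$ is fixed, and simultaneously for all $p\in[a,b]$ with $b<1$ once $n$ is large enough.) $D[a,b]$ is the space of real functions on $[a,b]$ that are right-continuous with left limits.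
   Formalization: f(F^{-1}(p)) is read as F'(F^{-1}(p)) and assumed nonzero, at p for the first claim and on all of [a,b] for the second; (A1)-(A3) do not imply this (F(x)=(1+x^3)/2 on [-1,1], p=1/2), and θ_p is undefined without it. *)

(* Defs.v *)
From HB Require Import structures.
From mathcomp Require Import all_boot all_order all_algebra.
From mathcomp Require Import finmap.
From mathcomp Require Import all_classical all_reals all_analysis.

Set Implicit Arguments.
Unset Strict Implicit.
Unset Printing Implicit Defensive.

Import Order.TTheory GRing.Theory Num.Theory.
Import numFieldNormedType.Exports.

Local Open Scope classical_set_scope.
Local Open Scope ring_scope.

Section skorohod_space.
Context {R : realType}.
Implicit Types a b : R.

(* Only the values of [x] on [a, b] matter: one-sided neighbourhoods within
   [a, b] are the only ones used. *)
Definition cadlag a b (x : R -> R) :=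
  (forall t, a <= t < b -> x s @[s --> t^'+] --> x t) /\
  (forall t, a < t <= b -> cvg (x s @[s --> t^'-])).

(* D[a, b]: a function on [a, b] is encoded as a function on R vanishing
   outside [a, b], so that equality is equality on [a, b]. *)
Record skorohod a b := Skorohod {
  path :> R -> R ;
  path_cadlag : cadlag a b path ;
  path_out : forall t, ~~ (a <= t <= b) -> path t = 0 }.

Definition time_change a b (l : R -> R) :=
  [/\ {in `[a, b] &, {homo l : s t / s < t}},
      {within `[a, b], continuous l} &
      l @` `[a, b]%classic = `[a, b]%classic].

Definition skorohod_dist a b (x y : R -> R) : \bar R :=
  ereal_inf [set e%:E | e in [set e | 0 <= e /\
    exists2 l, time_change a b l &
      forall t, a <= t <= b -> `|l t - t| <= e /\ `|x t - y (l t)| <= e]].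

Lemma time_change_incr_surj a b (l : R -> R) :
  {in `[a, b] &, {homo l : s t / s < t}} -> l @` `[a, b]%classic = `[a, b]%classic ->
  time_change a b l.
Proof.
move=> l_homo l_im; split=> //.
have [ab|ba] := leP a b; last first.
  by rewrite set_itv_ge ?bnd_simp -?ltNge//; exact: continuous_subspace0.
apply: segment_inc_surj_continuous; first exact: le_mono_in.
have mem_l t : t \in `[a, b] -> l t \in `[a, b].
  by move=> tab; have : (l @` `[a, b]%classic) (l t) by [exists t]; rewrite l_im.
have /mem_l : a \in `[a, b] by rewrite bound_itvE.
have /mem_l : b \in `[a, b] by rewrite bound_itvE.
rewrite !in_itv/= => /andP[_ lb] /andP[la _] u /=; rewrite in_itv/=.
move=> /andP[lu ul].
have : `[a, b]%classic u.
  by rewrite /= in_itv/= (le_trans la lu) (le_trans ul lb).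
by rewrite -[in X in X -> _]l_im.
Qed.

Lemma time_change_mem a b l t : time_change a b l ->
  a <= t <= b -> a <= l t <= b.
Proof.
move=> [_ _ l_im] tab.
have : (l @` `[a, b]%classic) (l t) by exists t => //=; rewrite in_itv.
by rewrite l_im /= in_itv.
Qed.

Lemma time_change_id a b : time_change a b idfun.
Proof. by apply: time_change_incr_surj => [s t|] //; rewrite image_id. Qed.

Lemma time_change_comp a b l m :
  time_change a b l -> time_change a b m -> time_change a b (m \o l).
Proof.
move=> tl tm; have [l_homo _ l_im] := tl; have [m_homo _ m_im] := tm.
apply: time_change_incr_surj; last by rewrite -image_comp l_im m_im.
move=> s t sab tab st /=; apply: m_homo; last exact: l_homo.
- by rewrite in_itv/=; apply: time_change_mem tl _; rewrite in_itv in sab.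
- by rewrite in_itv/=; apply: time_change_mem tl _; rewrite in_itv in tab.
Qed.

Lemma time_change_inv a b l : time_change a b l ->
  exists2 m, time_change a b m &
    forall t, a <= t <= b -> l (m t) = t.
Proof.
move=> tl; have [l_homo _ l_im] := tl.
have l_mono := le_mono_in l_homo.
pose m t := xget a [set s | (a <= s <= b) /\ l s = t].
have mP t : a <= t <= b -> (a <= m t <= b) /\ l (m t) = t.
  move=> tab; rewrite /m; case: xgetP => [_ _ //|H].
  have : `[a, b]%classic t by rewrite /= in_itv.
  rewrite -[in X in X -> _]l_im => -[s /= sab lst].
  by case: (H s); split=> //; rewrite in_itv in sab.
have ml t : a <= t <= b -> m (l t) = t.
  move=> tab; have [mab lm] := mP _ (time_change_mem tl tab).
  by apply: (inc_inj_in l_mono) => //; rewrite in_itv.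
exists m => [|t /mP[]//]; apply: time_change_incr_surj.
  move=> s t; rewrite !in_itv/= => /mP[ms lms] /mP[mt lmt] st.
  rewrite ltNge -l_mono ?in_itv// lms lmt -ltNge//.
apply/seteqP; split=> [_ [t /= tab <-]|t /= tab]; rewrite in_itv/= in tab *.
  by have [] := mP _ tab.
by exists (l t); [rewrite /= in_itv/= (time_change_mem tl)|exact: ml].
Qed.

End skorohod_space.

Section skorohod_topology.
Context {R : realType} (a b : R).
Local Notation D := (skorohod a b).
Implicit Types x y z : D.

HB.instance Definition _ := gen_eqMixin D.
HB.instance Definition _ := gen_choiceMixin D.

Definition skorohod_ball x (e : R) y := (skorohod_dist a b x y < e%:E)%E.

Lemma skorohod_ballP x (e : R) y : skorohod_ball x e y <->
  exists2 e', e' < e & 0 <= e' /\ exists2 l, time_change a b l &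
    forall t, a <= t <= b -> `|l t - t| <= e' /\ `|x t - y (l t)| <= e'.
Proof.
split=> [/ereal_inf_lt[_ [e' he' <-]]|[e' e'e he']].
  by rewrite lte_fin => e'e; exists e'.
by apply: le_lt_trans (ereal_inf_lbound _) _; [exists e'; first exact: he'|].
Qed.

Let ent : set_system (D * D) := entourage_ skorohod_ball.
Let nbhs_skorohod (x : D) : set_system D := nbhs_ ent x.

HB.instance Definition _ := hasNbhs.Build D nbhs_skorohod.

Let nbhsE : nbhs = nbhs_ ent :> (D -> _). Proof. by []. Qed.

Let ball_center x (e : R) : 0 < e -> skorohod_ball x e x.
Proof.
move=> e0; apply/skorohod_ballP; exists 0 => //; split=> //.
by exists idfun => [|t _]; [exact: time_change_id|rewrite !subrr normr0].
Qed.

Let ball_sym x y (e : R) : skorohod_ball x e y -> skorohod_ball y e x.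
Proof.
move=> /skorohod_ballP[e' e'e [e'0 [l tl le']]]; apply/skorohod_ballP.
exists e' => //; split=> //; have [m tm lm] := time_change_inv tl.
exists m => // t tab; have := le' _ (time_change_mem tm tab).
by rewrite lm// !(distrC t) (distrC (x _)).
Qed.

Let ball_triangle x y z e1 e2 : skorohod_ball x e1 y ->
  skorohod_ball y e2 z -> skorohod_ball x (e1 + e2) z.
Proof.
move=> /skorohod_ballP[d1 de1 [d10 [l tl hl]]].
move=> /skorohod_ballP[d2 de2 [d20 [m tm hm]]].
apply/skorohod_ballP; exists (d1 + d2); first exact: ltrD.
split; first exact: addr_ge0.
exists (m \o l) => [|t tab /=]; first exact: time_change_comp.
have [l1 l2] := hl _ tab; have [m1 m2] := hm _ (time_change_mem tl tab).
split.
  rewrite (_ : m (l t) - t = (l t - t) + (m (l t) - l t)); last first.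
    by rewrite [RHS]addrC subrKA.
  by rewrite (le_trans (ler_normD _ _))// lerD.
rewrite (_ : x t - z (m (l t)) =
  (x t - y (l t)) + (y (l t) - z (m (l t)))); last by rewrite subrKA.
by rewrite (le_trans (ler_normD _ _))// lerD.
Qed.

Let entE : ent = entourage_ skorohod_ball. Proof. by []. Qed.

(* J1 topology *)
HB.instance Definition _ := @Nbhs_isPseudoMetric.Build R D
  ent nbhsE skorohod_ball ball_center ball_sym ball_triangle entE.

End skorohod_topology.

Section weak_convergence.
Context {R : realType}.
Local Open Scope ereal_scope.

(* Borel measurability *)
Definition random_element d (T : measurableType d) (E : topologicalType)
  (X : T -> E) := forall A : set E, open A -> measurable (X @^-1` A).

(* X_n converges in distribution to Y, the X_n being defined on (T, P) and
   Y on a possibly different probability space (T', P'). *)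
Definition cvg_in_law d (T : measurableType d) (P : probability T R)
    d' (T' : measurableType d') (P' : probability T' R) (E : topologicalType)
    (X : nat -> T -> E) (Y : T' -> E) :=
  [/\ forall n, random_element (X n), random_element Y &
      forall h : E -> R, continuous h ->
        (exists M : R, forall x, (`|h x| <= M)%R) ->
        'E_P[h \o X n] @[n --> \oo] --> 'E_P'[h \o Y]].

(* Normal law with mean m and variance v, degenerate when v = 0
   ([normal_prob] is parameterized by the standard deviation). *)
Definition gaussian (m v : R) : probability (measurableTypeR R) R :=
  if v == 0%R then \d_(m : measurableTypeR R) : probability _ R
  else normal_prob m (Num.sqrt v) : probability _ R.

Definition gaussian_rv d (T : measurableType d) (P : probability T R)
    (X : T -> R) :=
  measurable_fun setT X /\
  exists m v : R, (0 <= v)%R /\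
    forall A : set R, measurable A -> P (X @^-1` A) = gaussian m v A.

Definition gaussian_process d (T : measurableType d) (P : probability T R)
    (I : set R) (U : T -> R -> R) :=
  forall (k : nat) (t c : 'I_k -> R), (forall i, I (t i)) ->
    gaussian_rv P (fun w => \sum_(i < k) c i * U w (t i))%R.

Definition independent_seq d (T : measurableType d) (P : probability T R)
    (X : nat -> {RV P >-> R}) :=
  forall (J : {fset nat}) (A : nat -> set R), (forall i, measurable (A i)) ->
    P (\bigcap_(i in [set` J]) (X i @^-1` A i)) =
    \prod_(i <- J) P (X i @^-1` A i).

Definition identically_distributed d (T : measurableType d)
    (P : probability T R) (X : nat -> {RV P >-> R}) :=
  forall i (A : set R), measurable A ->
    distribution P (X i) A = distribution P (X 0%N) A.

End weak_convergence.

Section crossover.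
Context {R : realType}.
Local Notation mu := (@lebesgue_measure R).
Implicit Types (F f : R -> R) (p x : R).

(* F^{-1}(p), when p has a unique preimage *)
Definition cdf_inv F p : R := xget 0 [set x | F x = p].

Definition has_density F f :=
  [/\ measurable_fun setT f, forall x, 0 <= f x &
      forall x, (F x)%:E = (\int[mu]_(t in `]-oo, x]) (f t)%:E)%E].

Definition twice_derivable F x :=
  (\forall y \near x, derivable F y 1) /\ derivable (derive1 F) x 1.

Definition crossover F p : R :=
  p^-1 * (\int[mu]_(q in `]0, p[) cdf_inv F q)
  + (1 - p)^-1 * (\int[mu]_(q in `]p, 1[) cdf_inv F q)
  - 2 * cdf_inv F p.

Definition order_stat (s : seq R) (j : nat) : R :=
  nth 0 (sort <=%R s) j.-1.

(* the k such that (k - 1) / n <= p < k / n, see [ecf_rankP] *)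
Definition ecf_rank (n : nat) p : nat := (Num.truncn (n%:R * p)).+1.

Lemma ecf_rankP (n k : nat) p : (0 < n)%N -> (0 < k)%N -> 0 <= p ->
  (k.-1%:R / n%:R <= p < k%:R / n%:R) = (k == ecf_rank n p).
Proof.
case: k => // k n0 _ p0; have n0' : 0 < n%:R :> R by rewrite ltr0n.
rewrite ler_pdivrMr// ltr_pdivlMr// (mulrC p) eqSS eq_sym.
by apply/esym; rewrite truncn_eq// mulr_ge0.
Qed.

(* Total in n and p: for k = n the upper average is 0 and the (n+1)-st order
   statistic is 0; for p < 1 this only concerns finitely many n. *)
Definition ecf (s : seq R) p : R :=
  let n := size s in
  let k := ecf_rank n p in
  k%:R^-1 * (\sum_(1 <= j < k.+1) order_stat s j) - order_stat s k
  + (n - k)%:R^-1 * (\sum_(k.+1 <= j < n.+1) order_stat s j)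
  - order_stat s k.+1.

Definition theta F f p x : R :=
  let q := cdf_inv F p in
  let lo := \1_[set y | y < q] x in
  let hi := \1_[set y | q <= y] x in
  p^-1 * x * lo - p^-1 * q * lo
  + (1 - p)^-1 * x * hi - (1 - p)^-1 * q * hi
  + 2 * lo / f q.

(* sqrt n (G_n(p) - G(p)) for the sample w 0, ..., w (n - 1) *)
Definition ecf_error F (n : nat) (w : nat -> R) p : R :=
  Num.sqrt n%:R * (ecf (mkseq w n) p - crossover F p).

End crossover.

(* Main.v *)
(** The cross-over error is linearized. Since the sum of [W_(k) - W_(j)] over
    [j <= k] is the sum over the sample of the positive parts of [W_(k) - W_i],
    the averages in [ecf] are sums of positive parts evaluated at order
    statistics; expanding around [cdf_inv F p] shows that [ecf_error] is a
    normalized sum of centred variables [psi p (W_i)], up to a remainder that is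
    small in probability uniformly on [a, b], and [psi p] is almost surely
    [theta p] minus its mean. Uniformity rests on the fourth moments of the
    increments of the uniform empirical process and chaining.

    Finite-dimensional convergence follows from characteristic functions. The
    Gaussian limit is built on the sample space itself: the variables [F (W_i)]
    are uniform, hence yield independent normal variables, which a Cholesky
    factorization turns into a Gaussian family on a countable union of grids.
    The bounds on the oscillations of the prelimit processes pass to this family,
    so that step functions on finer and finer grids converge uniformly. A
    functional that is uniformly continuous for the Skorohod distance is so for
    the supremum distance, for which the paths may be replaced by step
    functions, that is, by finitely many coordinates. *)

Require Import Defs.
From HB Require Import structures.
From mathcomp Require Import all_boot all_order all_algebra.
From mathcomp Require Import finmap.
From mathcomp Require Import all_classical all_reals all_analysis.
From mathcomp Require Import measurable_realfun.
From mathcomp Require Import lra ring zify.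

Set Implicit Arguments.
Unset Strict Implicit.
Unset Printing Implicit Defensive.

Import Order.TTheory GRing.Theory Num.Theory.
Import numFieldNormedType.Exports.

Local Open Scope classical_set_scope.
Local Open Scope ring_scope.

(** * Expectations and independence *)

(** Only second moments of the sample are available, whereas chaining uses fourth moments. Chaining
    is therefore applied to the empirical process [alpha] of the bounded variables [F (W_i)] alone.
    The process [Aproc] of positive parts is morally the integral of [alpha] along [F], so a uniform
    bound on [alpha] makes it Lipschitz in the quantile. Below the scale [1 / n] the fourth moments
    of the increments of [alpha] stop decaying quadratically; there the monotonicity of the
    empirical distribution function takes over.

    Paths do not form a separable space for the supremum distance, so its Borel sets are avoided:
    measurability and convergence are tested on bounded functionals that are uniformly continuous
    for that distance. Besides the Skorohod ones they include evaluations at a point, which are not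
    Skorohod continuous; this is how the marginal limit and the finite-dimensional laws of the limit
    come out of the same functional convergence.

    Characteristic functions are kept real: [cos (c + u X)] with a free phase [c] carries the real
    and the imaginary part at once. *)

Definition Ex d (T : measurableType d) (R : realType) (P : probability T R)
  (X : T -> R) : R := \int[P]_w X w.

Definition L1 d (T : measurableType d) (R : realType) (P : probability T R)
  (X : T -> R) : Prop := P.-integrable setT (EFin \o X).

Section expectation.
Context d (T : measurableType d) (R : realType) (P : probability T R).
Implicit Types X Y : T -> R.
Local Notation Ex := (Ex P).
Local Notation L1 := (L1 P).

Lemma L1_meas X : L1 X -> measurable_fun setT X.
Proof. by move=> /measurable_int /measurable_EFinP. Qed.

Lemma L1_bounded X (M : R) : measurable_fun setT X ->
  (forall w, `|X w| <= M) -> L1 X.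
Proof.
move=> mX XM; apply: measurable_bounded_integrable => //.
  by rewrite (le_lt_trans (probability_le1 _ _))// ltry.
exists M; split; first exact: num_real.
by move=> x Mx w _ /=; rewrite (le_trans (XM w))// ltW.
Qed.

Lemma L1_le X Y : measurable_fun setT X -> L1 Y ->
  (forall w, `|X w| <= Y w) -> L1 X.
Proof.
move=> mX LY XY; apply: le_integrable LY => //; first exact/measurable_EFinP.
by move=> w _; rewrite /= lee_fin (le_trans (XY w))// ler_norm.
Qed.

Lemma L1_cst c : L1 (fun=> c).
Proof. exact: (@L1_bounded _ `|c|). Qed.

Lemma L1D X Y : L1 X -> L1 Y -> L1 (fun w => X w + Y w).
Proof. by move=> LX LY; apply: eq_integrable (integrableD _ LX LY). Qed.

Lemma L1Z (c : R) X : L1 X -> L1 (fun w => c * X w).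
Proof. by move=> LX; apply: eq_integrable (integrableZl _ c LX). Qed.

Lemma L1B X Y : L1 X -> L1 Y -> L1 (fun w => X w - Y w).
Proof. by move=> LX LY; apply: eq_integrable (integrableB _ LX LY). Qed.

Lemma L1_norm X : L1 X -> L1 (fun w => `|X w|).
Proof. by move=> LX; apply: eq_integrable (integrable_abse LX). Qed.

Lemma L1_sum I (s : seq I) (X : I -> T -> R) : (forall i, L1 (X i)) ->
  L1 (fun w => \sum_(i <- s) X i w).
Proof.
move=> LX; elim: s => [|i s IH].
  by under eq_fun do rewrite big_nil; exact: L1_cst.
by under eq_fun do rewrite big_cons; exact: L1D.
Qed.

Lemma ExE X : L1 X -> (Ex X)%:E = (\int[P]_w (X w)%:E)%E.
Proof. by move=> LX; rewrite /Ex /Rintegral fineK//; exact: integrable_fin_num. Qed.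

Lemma expectation_Ex X : L1 X -> 'E_P[X]%E = (Ex X)%:E.
Proof. by move=> LX; rewrite unlock ExE. Qed.

Lemma Ex_cst c : Ex (fun=> c) = c.
Proof.
rewrite /Ex Rintegral_cst//=.
have := probability_setT P. by move=> ->; rewrite mulr1.
Qed.

Lemma ExD X Y : L1 X -> L1 Y -> Ex (fun w => X w + Y w) = Ex X + Ex Y.
Proof. by move=> LX LY; rewrite /Ex RintegralD. Qed.

Lemma ExB X Y : L1 X -> L1 Y -> Ex (fun w => X w - Y w) = Ex X - Ex Y.
Proof. by move=> LX LY; rewrite /Ex RintegralB. Qed.

Lemma ExZ (c : R) X : L1 X -> Ex (fun w => c * X w) = c * Ex X.
Proof. by move=> LX; rewrite /Ex RintegralZl. Qed.

Lemma Ex_sum I (s : seq I) (X : I -> T -> R) : (forall i, L1 (X i)) ->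
  Ex (fun w => \sum_(i <- s) X i w) = \sum_(i <- s) Ex (X i).
Proof.
move=> LX; elim: s => [|i s IH].
  by under eq_fun do rewrite big_nil; rewrite big_nil Ex_cst.
under eq_fun do rewrite big_cons; rewrite big_cons ExD ?IH//; exact: L1_sum.
Qed.

Lemma Ex_le X Y : L1 X -> L1 Y -> (forall w, X w <= Y w) -> Ex X <= Ex Y.
Proof. by move=> LX LY XY; apply: le_Rintegral. Qed.

Lemma Ex_ge0 X : (forall w, 0 <= X w) -> 0 <= Ex X.
Proof. by move=> X0; apply: Rintegral_ge0. Qed.

Lemma Ex_norm X : L1 X -> `|Ex X| <= Ex (fun w => `|X w|).
Proof. by move=> LX; apply: le_normr_Rintegral. Qed.

Lemma Ex_norm_le X Y : L1 X -> L1 Y -> (forall w, `|X w| <= Y w) ->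
  `|Ex X| <= Ex Y.
Proof.
by move=> LX LY XY; rewrite (le_trans (Ex_norm LX))// Ex_le//; exact: L1_norm.
Qed.

Lemma Ex_bound X (M : R) : measurable_fun setT X -> (forall w, `|X w| <= M) ->
  `|Ex X| <= M.
Proof.
move=> mX XM; rewrite -[leRHS]Ex_cst; apply: Ex_norm_le => //.
  exact: L1_bounded XM.
exact: L1_cst.
Qed.

Lemma Ex_ae_eq X Y : measurable_fun setT X -> measurable_fun setT Y ->
  {ae P, forall w, X w = Y w} -> Ex X = Ex Y.
Proof.
move=> mX mY XY; rewrite /Ex /Rintegral; congr fine.
apply: ae_eq_integral => //; [exact/measurable_EFinP..|].
by apply: filterS XY => w /= ->.
Qed.

Lemma Ex_indic A : measurable A -> Ex \1_A = fine (P A).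
Proof. by move=> mA; rewrite /Ex /Rintegral integral_indic// setIT. Qed.

Lemma L1_indic A : measurable A -> L1 \1_A.
Proof. by move=> mA; apply: integrable_indic. Qed.

Lemma EFin_prob A : measurable A -> (fine (P A))%:E = P A.
Proof. by move=> mA; rewrite fineK// fin_num_measure. Qed.

Lemma prob_markov X (a : R) : L1 X -> (forall w, 0 <= X w) -> 0 < a ->
  (P [set w | (a <= X w)%R] <= (a^-1 * Ex X)%:E)%E.
Proof.
move=> LX X0 a0; have mX := L1_meas LX.
have mA : measurable [set w | a <= X w].
  by rewrite -[X in measurable X]setTI; exact: measurable_fun_le.
rewrite -EFin_prob// -Ex_indic// lee_fin ler_pdivlMl// -ExZ; last exact: L1_indic.
apply: Ex_le => // [|w]; first by apply: L1Z; exact: L1_indic.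
rewrite indicE; case: (boolP (w \in _)) => /=.
  by rewrite inE /= mulr1.
by rewrite mulr0.
Qed.

Lemma Ex_dct (X_ : nat -> T -> R) X Y :
  (forall n, measurable_fun setT (X_ n)) -> measurable_fun setT X -> L1 Y ->
  {ae P, forall w, X_ n w @[n --> \oo] --> X w} ->
  (forall n w, `|X_ n w| <= Y w) -> Ex (X_ n) @[n --> \oo] --> Ex X.
Proof.
move=> mX_ mX LY XX XY.
have [] := @dominated_convergence _ _ _ P setT measurableT
  (fun n => EFin \o X_ n) (EFin \o X) (EFin \o Y) _ _ _ LY _.
- by move=> n; exact/measurable_EFinP.
- exact/measurable_EFinP.
- by apply: filterS XX => w h _ /=; apply: cvg_EFin => //; exact: nearW.
- by apply: aeW => w n _; rewrite /= lee_fin.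
move=> LX _ h; rewrite /Ex /Rintegral; apply: fine_cvg.
by rewrite fineK//; exact: integrable_fin_num.
Qed.

End expectation.

Section independence.
Context d (T : measurableType d) (R : realType) (P : probability T R).

Definition indep2 (X Y : T -> R) : Prop := forall A B : set R,
  measurable A -> measurable B ->
  P (X @^-1` A `&` Y @^-1` B) = (P (X @^-1` A) * P (Y @^-1` B))%E.

Definition mkRV d' (T' : measurableType d') (X : T -> T')
    (mX : measurable_fun setT X) : {mfun T >-> T'} :=
  HB.pack X (isMeasurableFun.Build _ _ _ _ X mX).

Lemma measurable_preimage d' (T' : measurableType d') (X : T -> T') A :
  measurable_fun setT X -> measurable A -> measurable (X @^-1` A).
Proof. by move=> mX mA; rewrite -[X in measurable X]setTI; apply: mX. Qed.

(** A measure on the plane is determined by its values on rectangles; uniqueness of the product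
    measure is applied to the law of the pair under [P] restricted to [C] and normalized, the case
    of a null [C] being trivial. The extra event [C] carries the remaining variables through the
    induction on the number of summands. *)
Lemma indep2_joint (X Y : T -> R) (mX : measurable_fun setT X)
    (mY : measurable_fun setT Y) (C : set T) (E : set (R * R)) :
  measurable C -> measurable E ->
  (forall A B : set R, measurable A -> measurable B ->
    P ((X @^-1` A `&` Y @^-1` B) `&` C) =
    (P (X @^-1` A) * P (Y @^-1` B) * P C)%E) ->
  P ((fun w => (X w, Y w)) @^-1` E `&` C) =
  ((distribution P (mkRV mX) \x distribution P (mkRV mY)) E * P C)%E.
Proof.
move=> mC mE XYC; have mXY : measurable_fun setT (fun w => (X w, Y w)).
  exact: measurable_fun_pair.
have [PC0|PC0] := eqVneq (P C) 0.
  rewrite PC0 mule0; apply: (subset_measure0 _ _ _ PC0) => //.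
  by apply: measurableI => //; exact: measurable_preimage.
have PCfin : P C \is a fin_num by exact: fin_num_measure.
have PCgt0 : 0 < fine (P C).
  by rewrite fine_gt0// lt0e PC0/= measure_ge0 ltey_eq PCfin.
have r0 : 0 <= (fine (P C))^-1 by rewrite invr_ge0 ltW.
pose m' : {measure set (R * R) -> \bar R} := mscale (NngNum r0) (pushforward (mrestr P mC) (mkRV mXY)).
rewrite (@product_measure_unique _ _ _ _ _ _ _ (m' mXY) _ E mE).
  rewrite /m' /mscale /pushforward /mrestr/= -muleA muleC.
  by rewrite -[X in (_ * X * _)%E](fineK PCfin) -muleA -EFinM divff ?mule1// gt_eqF.
move=> A B mA mB; rewrite /m' /mscale /pushforward /mrestr/=.
transitivity (((fine (P C))^-1)%:E * P ((X @^-1` A `&` Y @^-1` B) `&` C))%E => //.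
rewrite XYC// muleC -[X in (_ * X * _)%E](fineK PCfin) -muleA -EFinM.
by rewrite divff ?mule1// gt_eqF.
Qed.

(** The law of the pair is the product of the two laws, so integrability of the product is Tonelli's
    theorem and the factorization is Fubini's. *)
Lemma indep2_ExM (X Y : T -> R) : indep2 X Y -> L1 P X -> L1 P Y ->
  L1 P (fun w => X w * Y w) /\ Ex P (fun w => X w * Y w) = Ex P X * Ex P Y.
Proof.
move=> XY LX LY; have mX := L1_meas LX; have mY := L1_meas LY.
pose dX := distribution P (mkRV mX); pose dY := distribution P (mkRV mY).
have mXY : measurable_fun setT (fun w => (X w, Y w)) by exact: measurable_fun_pair.
pose dXY := distribution P (mkRV mXY).
have dE E : measurable E -> (dX \x dY)%E E = dXY E.
  move=> mE; have := @indep2_joint X Y mX mY setT E measurableT mE.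
  rewrite setIT probability_setT mule1 => <-// A B mA mB.
  by rewrite setIT mule1 XY.
pose f (z : R * R) := ((z.1 * z.2)%R)%:E.
have mf : measurable_fun setT f.
  by apply/measurable_EFinP; apply: measurable_funM.
have fE x y : f (x, y) = (x%:E * y%:E)%E by rewrite /f -EFinM.
have mfst : measurable_fun setT (EFin : R -> \bar R) by exact/measurable_EFinP.
have absE (Z : T -> R) (mZ : measurable_fun setT Z) :
    (\int[distribution P (mkRV mZ)]_y `|y%:E| = \int[P]_w `|(Z w)%:E|)%E.
  by rewrite ge0_integral_distribution//; exact: measurableT_comp.
have intE (Z : T -> R) (mZ : measurable_fun setT Z) : L1 P Z ->
    (\int[distribution P (mkRV mZ)]_y y%:E = (Ex P Z)%:E)%E.
  by move=> LZ; rewrite integral_distribution// ExE.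
have Lfin (Z : T -> R) : L1 P Z -> (\int[P]_w `|(Z w)%:E| < +oo)%E.
  by case/integrableP.
have intLE (Z : T -> R) : L1 P Z ->
    exists2 a : R, 0 <= a & (\int[P]_w `|(Z w)%:E| = a%:E)%E.
  move=> /Lfin Zfin; exists (fine (\int[P]_w `|(Z w)%:E|)).
    by rewrite fine_ge0// integral_ge0.
  by rewrite fineK// ge0_fin_numE// integral_ge0.
have imf : (dX \x dY)%E.-integrable setT f.
  apply/integrable12ltyP => //.
  under eq_integral => x _.
    under eq_integral => y _ do rewrite fE abseM.
    rewrite ge0_integralZl//=; last exact: measurableT_comp.
    rewrite absE; over.
  rewrite /=; have [a a0 ->] := intLE _ LY.
  rewrite ge0_integralZr//=; [|exact: measurableT_comp].
  by rewrite absE; have [b b0 ->] := intLE _ LX; rewrite -EFinM ltry.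
have LXY : L1 P (fun w => X w * Y w).
  apply/integrableP; split; first exact/measurable_EFinP/measurable_funM.
  have := (integrableP _ _ _ imf).2.
  rewrite (eq_measure_integral dXY); last by move=> A mA _; exact: dE.
  by rewrite /dXY ge0_integral_distribution//; exact: measurableT_comp.
split=> //; apply: EFin_inj; rewrite ExE//.
have -> : (\int[P]_w (X w * Y w)%:E = \int[dXY]_z f z)%E.
  by rewrite /dXY integral_distribution.
rewrite (eq_measure_integral (dX \x dY)%E); last by move=> A mA _; exact/esym/dE.
rewrite -integral12_prod_meas1//.
have LdY : dY.-integrable setT (fun x : R => x%:E).
  apply/integrableP; split=> //; rewrite absE; exact: Lfin.
have LdX : dX.-integrable setT (fun x : R => x%:E).
  apply/integrableP; split=> //; rewrite absE; exact: Lfin.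
under eq_integral => x _.
  rewrite /fubini_F; under eq_integral => y _ do rewrite fE.
  rewrite integralZl// intE//; over.
by rewrite /= integralZr// intE// EFinM.
Qed.

End independence.

Section independent_sums.
Context d (T : measurableType d) (R : realType) (P : probability T R).

(** Initial segments suffice, since [A i] may be [setT]; they suit inductions on the number of
    summands. *)
Definition indep_fam (X : nat -> T -> R) : Prop :=
  forall n (A : nat -> set R), (forall i, measurable (A i)) ->
  P (\bigcap_(i < n) (X i @^-1` A i)) = (\prod_(i < n) P (X i @^-1` A i))%E.

Lemma indep_fam_comp (X : nat -> T -> R) (phi : nat -> R -> R) :
  indep_fam X -> (forall i, measurable_fun setT (phi i)) ->
  indep_fam (fun i w => phi i (X i w)).
Proof.
move=> iX mphi n A mA.
have := iX n (fun i => phi i @^-1` A i); apply.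
by move=> i; exact: measurable_preimage.
Qed.

(** Induction on [k]: the variable [X k] is taken out of the tail, so that the joint law of the
    partial sum and [X k], on the event described by the rest of the tail, is a product; the event
    on their sum is then a planar event for that law. *)
Lemma indep_fam_sum_tail (X : nat -> T -> R) :
  (forall i, measurable_fun setT (X i)) -> indep_fam X ->
  forall k r (A : set R) (B : nat -> set R), measurable A ->
  (forall i, measurable (B i)) ->
  P ((fun w => \sum_(i < k) X i w) @^-1` A `&`
     \bigcap_(i < r) (X (k + i)%N @^-1` B i)) =
  (P ((fun w => \sum_(i < k) X i w)%R @^-1` A) *
   \prod_(i < r) P (X (k + i)%N @^-1` B i))%E.
Proof.
move=> mX iX; elim=> [|k IH] r A B mA mB.
  under eq_fun do rewrite big_ord0.
  rewrite (_ : (fun=> 0) @^-1` A = if 0 \in A then setT else set0); last first.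
    by apply/seteqP; split=> w /=; case: ifPn => //; rewrite ?inE// notin_setE.
  case: ifPn => _.
    by rewrite setTI probability_setT mul1e -iX.
  by rewrite set0I measure0 mul0e.
pose S w := \sum_(i < k) X i w.
have mS : measurable_fun setT S by apply: measurable_sum.
pose E := (fun z : R * R => z.1 + z.2) @^-1` A.
have mE : measurable E.
  by apply: measurable_preimage => //; exact: measurable_funD.
pose C := \bigcap_(i < r) (X (k.+1 + i)%N @^-1` B i).
have mC : measurable C.
  apply: bigcap_measurableType => i _; exact: measurable_preimage.
have SE : (fun w => \sum_(i < k.+1) X i w) @^-1` A = (fun w => (S w, X k w)) @^-1` E.
  by apply/seteqP; split=> w /=; rewrite /E /= big_ord_recr.
(* The induction hypothesis for the whole space and a tail whose first condition is void yields
   independence of the tail alone. *)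
have prodC : (\prod_(i < r) P (X (k.+1 + i)%N @^-1` B i))%E = P C.
  have := IH r.+1 setT (fun i => if i is i'.+1 then B i' else setT) measurableT _.
  rewrite preimage_setT setTI probability_setT mul1e big_ord_recl/= preimage_setT.
  rewrite probability_setT mul1e.
  under eq_bigr do rewrite /bump/= add1n addnS -addSn.
  move=> <-; last by case.
  congr (P _); apply/seteqP; split=> w /= h.
    by move=> i /= ir; have := h i.+1 ir; rewrite addnS.
  by case=> [//|i] /= ir; rewrite addnS; exact: h.
rewrite SE prodC.
have key (D : set T) (r' : nat) (B' : nat -> set R) : (forall i, measurable (B' i)) ->
   D = \bigcap_(i < r') (X (k.+1 + i)%N @^-1` B' i) ->
   forall A1 B1 : set R, measurable A1 -> measurable B1 ->
    P ((S @^-1` A1 `&` X k @^-1` B1) `&` D) =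
    (P (S @^-1` A1) * P (X k @^-1` B1) *
      \prod_(i < r') P (X (k.+1 + i)%N @^-1` B' i))%E.
  move=> mB' -> A1 B1 mA1 mB1.
  have := IH r'.+1 A1 (fun i => if i is i'.+1 then B' i' else B1) mA1 _.
  rewrite big_ord_recl/= addn0 muleA.
  under eq_bigr do rewrite /bump/= add1n addnS -addSn.
  move=> <-; last by case.
  congr (P _); apply/seteqP; split=> w /=.
    move=> [[h1 h2] h3]; split=> // -[|i] /= ir; first by rewrite addn0.
    by rewrite addnS; exact: h3.
  move=> [h1 h2]; split; first by split=> //; have := h2 0%N isT; rewrite /= addn0.
  by move=> i /= ir; have := h2 i.+1 ir; rewrite addnS.
rewrite (indep2_joint mS (mX k) mC mE); last first.
  by move=> A1 B1 mA1 mB1; rewrite (key _ r B)// prodC.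
rewrite -[X in (_ * _)%E = (P X * _)%E]setIT (indep2_joint mS (mX k) measurableT mE).
  by rewrite probability_setT mule1.
move=> A1 B1 mA1 mB1; rewrite (key setT 0%N (fun=> setT))//.
  by rewrite big_ord0 probability_setT.
by apply/seteqP; split.
Qed.

Lemma indep_fam_sum (X : nat -> T -> R) k :
  (forall i, measurable_fun setT (X i)) -> indep_fam X ->
  indep2 P (fun w => \sum_(i < k) X i w) (X k).
Proof.
move=> mX iX A B mA mB.
have := @indep_fam_sum_tail X mX iX k 1%N A (fun=> B) mA (fun=> mB).
rewrite big_ord_recl big_ord0 mule1/= addn0 => <-; congr (P (_ `&` _)).
by apply/seteqP; split=> w /= => [h [|]//|/(_ 0%N isT)]; rewrite addn0.
Qed.

Lemma indep2_comp (X Y : T -> R) (g h : R -> R) : indep2 P X Y ->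
  measurable_fun setT g -> measurable_fun setT h ->
  indep2 P (g \o X) (h \o Y).
Proof.
move=> XY mg mh A B mA mB; apply: (XY (g @^-1` A) (h @^-1` B)).
  exact: measurable_preimage.
exact: measurable_preimage.
Qed.

End independent_sums.

(** * Approximation by trigonometric polynomials *)

Section bernstein.
Context (R : realType).
Implicit Types (x : R) (f : nat -> R).

(* Binomial weights, by Pascal's recursion: their moments follow by induction. *)
Fixpoint bern x (N k : nat) : R :=
  match N, k with
  | 0, 0 => 1
  | 0, _.+1 => 0
  | N'.+1, 0 => (1 - x) * bern x N' 0
  | N'.+1, k'.+1 => x * bern x N' k' + (1 - x) * bern x N' k'.+1
  end.

Lemma bern_ge0 x N k : 0 <= x <= 1 -> 0 <= bern x N k.
Proof.
move=> /andP[x0 x1]; have x1' : 0 <= 1 - x by rewrite subr_ge0.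
elim: N k => [|N IH] [|k] //=; first exact: mulr_ge0.
by rewrite addr_ge0// mulr_ge0.
Qed.

Lemma bern_gt x N k : (N < k)%N -> bern x N k = 0.
Proof.
elim: N k => [|N IH] [|k]//= Nk.
by rewrite !IH ?mulr0 ?addr0// ltnW.
Qed.

(** One more Bernoulli trial, in terms of expectations: each binomial moment follows from the
    previous ones by induction on [N]. *)
Lemma sum_bernS x N f : \sum_(k < N.+2) bern x N.+1 k * f k =
  x * (\sum_(k < N.+1) bern x N k * f k.+1) +
  (1 - x) * (\sum_(k < N.+1) bern x N k * f k).
Proof.
rewrite big_ord_recl/= !big_distrr/=.
under eq_bigr do rewrite /bump/= add1n mulrDl.
rewrite big_split/= addrCA; congr (_ + _).
  by apply: eq_bigr => i _; rewrite mulrA.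
rewrite [RHS]big_ord_recl/= mulrA; congr (_ + _).
rewrite big_ord_recr/= bern_gt// mulr0 mul0r addr0.
by apply: eq_bigr => i _; rewrite mulrA.
Qed.

Lemma sum_bern x N : \sum_(k < N.+1) bern x N k = 1.
Proof.
under eq_bigr do rewrite -[bern _ _ _]mulr1.
elim: N => [|N IH]; first by rewrite big_ord1 /= mulr1.
by rewrite (@sum_bernS x N (fun=> 1)) IH; ring.
Qed.

Lemma sum_bern_var x N :
  \sum_(k < N.+1) bern x N k * (k%:R - N%:R * x) ^+ 2 = N%:R * x * (1 - x).
Proof.
have H1 n : \sum_(k < n.+1) bern x n k * k%:R = n%:R * x.
  elim: n => [|n IH]; first by rewrite big_ord1/= mulr0 mul0r.
  rewrite (@sum_bernS x n (fun k => k%:R)) IH.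
  under eq_bigr do rewrite -natr1 mulrDr mulr1.
  by rewrite big_split/= IH sum_bern -natr1; ring.
have H2 : \sum_(k < N.+1) bern x N k * k%:R ^+ 2 = N%:R * x * (1 - x) + (N%:R * x) ^+ 2.
  elim: N => [|N IH]; first by rewrite big_ord1/=; ring.
  rewrite (@sum_bernS x N (fun k => k%:R ^+ 2)) IH.
  have sqS i : bern x N i * i.+1%:R ^+ 2 = bern x N i * i%:R ^+ 2 +
      (2 * (bern x N i * i%:R) + bern x N i) by rewrite -natr1; ring.
  under eq_bigr do rewrite sqS.
  rewrite !big_split/= -mulr_sumr IH H1 sum_bern -natr1; ring.
have sqE (i : nat) : bern x N i * (i%:R - N%:R * x) ^+ 2 = bern x N i * i%:R ^+ 2 +
    (- 2 * (N%:R * x) * (bern x N i * i%:R) + (N%:R * x) ^+ 2 * bern x N i) by ring.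
under eq_bigr do rewrite sqE.
rewrite !big_split/= H2 -!mulr_sumr H1 sum_bern; ring.
Qed.

End bernstein.

Section sin_gap.
Context (R : realType).
Implicit Types a b D : R.

(** Among increments of the sine over a length [2 D] inside [[- pi / 2, pi / 2]] the smallest is at
    an end of the interval, where it equals [1 - cos (2 D)], that is [2 sin D ^ 2]. *)
Lemma sin_gap a b D : - (pi / 2) <= b -> a <= pi / 2 -> 0 < D ->
  b + 2 * D <= a -> sin b + 2 * sin D ^+ 2 <= sin a.
Proof.
move=> b1 a1 D0 ba.
apply: (@le_trans _ _ (sin (b + 2 * D))); last first.
  by rewrite leNgt (@ltr_sin R) ?in_itv/= -?leNgt//; apply/andP; split; lra.
rewrite [b + _](_ : _ = (b + D) + D); last by ring.
rewrite {1}[b](_ : _ = (b + D) - D); last by ring.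
rewrite (sinB (b + D)) (sinD (b + D)).
have sD : 0 < sin D by apply: sin_gt0_pi; apply/andP; split; lra.
suff : sin D <= cos (b + D) by nra.
have -> : cos (b + D) = cos `|b + D|.
  by case: (ler0P (b + D)) => _; rewrite ?cosN.
have -> : sin D = cos (pi / 2 - D) by rewrite -cosN opprB cosBpihalf.
rewrite leNgt (@ltr_cos R) -?leNgt.
- by rewrite ler_norml; apply/andP; split; lra.
- by rewrite in_itv/=; apply/andP; split; lra.
- by rewrite in_itv/= normr_ge0 ler_norml/=; apply/andP; split; lra.
Qed.

(** Uniform continuity of the arcsine up to the ends, where it is not Lipschitz: by the gap of the
    sine, a distance above [2 D] between the angles would separate the sines by more than
    [sin D ^ 2]. *)
Lemma asin_modulus (e : R) : 0 < e ->
  exists2 eta, 0 < eta & forall v u : R, -1 <= v <= 1 -> -1 <= u <= 1 ->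
    `|v - sin u| <= eta -> `|asin v - u| <= e.
Proof.
move=> e0; pose D := Num.min (e / 2) (1 / 2) : R.
have D0 : 0 < D by rewrite lt_min; apply/andP; split; lra.
have De : 2 * D <= e.
  have : D <= e / 2 by rewrite /D ge_min lexx.
  lra.
have p2 := @pi_ge2 R.
have sD : 0 < sin D.
  apply: sin_gt0_pihalf; rewrite D0/=.
  have : D <= 1/2 by rewrite /D ge_min lexx orbT.
  lra.
exists (sin D ^+ 2); first by rewrite exprn_gt0.
move=> v u hv hu; rewrite leNgt => h; rewrite leNgt; apply: contra h => h.
have := @asinK R v; rewrite in_itv/= => /(_ hv) sa.
have a1 := asin_geNpi2 hv; have a2 := asin_lepi2 hv.
have sD2 : 0 < sin D ^+ 2 by rewrite exprn_gt0.
rewrite -{1}sa; move/andP: hu => [u1 u2].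
move: h; rewrite ltr_normr => /orP[h|h]; rewrite ltr_normr; apply/orP.
  left; have := @sin_gap (asin v) u D; lra.
by right; have := @sin_gap u (asin v) D; lra.
Qed.

End sin_gap.

Section trig_polynomials.
Context (R : realType) (M : nat).
Implicit Types (y : 'I_M -> R) (f g : ('I_M -> R) -> R).

(** The phase [c] puts the sines in the span, which is therefore closed under products. *)
Inductive trigpoly : (('I_M -> R) -> R) -> Prop :=
| trigpoly_cos c u : trigpoly (fun y => cos (c + \sum_(i < M) u i * y i))
| trigpolyD f g : trigpoly f -> trigpoly g -> trigpoly (fun y => f y + g y)
| trigpolyZ a f : trigpoly f -> trigpoly (fun y => a * f y).

Lemma trigpoly_cst a : trigpoly (fun=> a).
Proof.
have := trigpolyZ a (trigpoly_cos 0 (fun=> 0)).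
congr trigpoly; apply/funext => y.
by rewrite big1 ?addr0 ?cos0 ?mulr1// => i _; rewrite mul0r.
Qed.

Lemma trigpoly_sin l j : trigpoly (fun y => sin (l * y j)).
Proof.
have := trigpoly_cos (- (pi / 2)) (fun i => l *+ (i == j)).
congr trigpoly; apply/funext => y.
rewrite (bigD1 j)//= eqxx mulr1n big1 ?addr0; last first.
  by move=> i /negPf ->; rewrite mulr0n mul0r.
by rewrite addrC cosBpihalf.
Qed.

Lemma trigpolyM f g : trigpoly f -> trigpoly g -> trigpoly (fun y => f y * g y).
Proof.
elim=> [c u|f1 f2 _ IH1 _ IH2|a f1 _ IH].
- elim=> [c' u'|g1 g2 _ IH1 _ IH2|a g1 _ IH].
  + have := trigpolyZ (1 / 2) (trigpolyD
      (trigpoly_cos (c + c') (fun i => u i + u' i))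
      (trigpoly_cos (c - c') (fun i => u i - u' i))).
    congr trigpoly; apply/funext => y.
    under eq_bigr do rewrite mulrDl.
    rewrite big_split/=.
    under [X in _ + cos (_ + X)]eq_bigr do rewrite mulrBl.
    rewrite sumrB [X in cos X + _]addrACA [X in _ + cos X]addrACA -opprD.
    rewrite cosD cosB; lra.
  + have := trigpolyD IH1 IH2.
    by congr trigpoly; apply/funext => y; rewrite mulrDr.
  + have := trigpolyZ a IH.
    by congr trigpoly; apply/funext => y; rewrite mulrCA.
- move=> tg; have := trigpolyD (IH1 tg) (IH2 tg).
  by congr trigpoly; apply/funext => y; rewrite mulrDl.
- move=> tg; have := trigpolyZ a (IH tg).
  by congr trigpoly; apply/funext => y; rewrite mulrA.
Qed.

Lemma trigpoly_sum I (s : seq I) (f : I -> ('I_M -> R) -> R) :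
  (forall i, trigpoly (f i)) -> trigpoly (fun y => \sum_(i <- s) f i y).
Proof.
move=> tf; elim: s => [|i s IH].
  under eq_fun do rewrite big_nil; exact: trigpoly_cst.
under eq_fun do rewrite big_cons; exact: trigpolyD.
Qed.

Lemma trigpoly_prod I (s : seq I) (f : I -> ('I_M -> R) -> R) :
  (forall i, trigpoly (f i)) -> trigpoly (fun y => \prod_(i <- s) f i y).
Proof.
move=> tf; elim: s => [|i s IH].
  under eq_fun do rewrite big_nil; exact: trigpoly_cst.
under eq_fun do rewrite big_cons; exact: trigpolyM.
Qed.

Lemma trigpoly_bern f N k : trigpoly f -> trigpoly (fun y => bern (f y) N k).
Proof.
move=> tf; have tf1 : trigpoly (fun y => 1 - f y).
  have := trigpolyD (trigpoly_cst 1) (trigpolyZ (-1) tf).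
  by congr trigpoly; apply/funext => y; rewrite mulN1r.
elim: N k => [|N IH] [|k] /=; [exact: trigpoly_cst..| |].
- exact: trigpolyM.
- by apply: trigpolyD; apply: trigpolyM.
Qed.

Definition unif_cont (H : ('I_M -> R) -> R) : Prop :=
  forall e : R, 0 < e -> exists2 dl : R, 0 < dl &
    forall y y', (forall i, `|y i - y' i| <= dl) -> `|H y - H y'| <= e.

(* On the box of half-width [L], [H] is a continuous function of the variables
   [sin (y i / L)], to which Bernstein's approximation applies. *)
Lemma trigpoly_approx (H : ('I_M -> R) -> R) (C L e : R) :
  (forall y, `|H y| <= C) -> unif_cont H -> 0 < L -> 0 < e ->
  exists2 g, trigpoly g & (forall y, `|g y| <= C) /\
    forall y, (forall i, `|y i| <= L) -> `|g y - H y| <= e.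
Proof.
move=> HC Hu L0 e0; have C0 : 0 <= C by rewrite (le_trans _ (HC (fun=> 0))).
have [dl dl0 Hdl] := Hu _ (divr_gt0 e0 (ltr0n R 2)).
have [eta eta0 Heta] := asin_modulus (divr_gt0 dl0 L0).
(* The degree is fixed by Chebyshev's inequality: [M] coordinates, each of variance at most [1 / N],
   deviating by more than [eta]. *)
have [N N0 HN] : exists2 N : nat, (0 < N)%N &
    2 * C * (M%:R * (1 / N%:R) / eta ^+ 2) <= e / 2.
  pose K := 2 * C * (M%:R / eta ^+ 2) / (e / 2).
  have K0 : 0 <= K.
    by rewrite !mulr_ge0// ?invr_ge0 ?exprn_ge0 ?ltW// divr_gt0.
  exists (Num.bound K).+1 => //.
  have := archi_boundP K0; rewrite -natr1 => hK.
  rewrite [leLHS](_ : _ = K * (e / 2) / ((Num.bound K)%:R + 1)); last first.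
    by rewrite /K; field; rewrite !gt_eqF.
  by rewrite ler_pdivrMr// mulrC ler_pM2l ?divr_gt0// ltW// (lt_trans hK)// ltrDl.
(* The sines, rescaled to [[0, 1]], are the Bernstein variables; [node] sends a grid point of the
   cube back to the box through the arcsine. *)
pose x y (i : 'I_M) : R := (1 + sin (L^-1 * y i)) / 2.
have x01 y i : 0 <= x y i <= 1.
  have := sin_geN1 (L^-1 * y i); have := sin_le1 (L^-1 * y i); rewrite /x => h1 h2.
  by apply/andP; split; lra.
pose nu (k : 'I_N.+1) : R := 2 * k%:R / N%:R - 1.
pose node (kp : {ffun 'I_M -> 'I_N.+1}) (i : 'I_M) := L * asin (nu (kp i)).
pose w y (kp : {ffun 'I_M -> 'I_N.+1}) := \prod_(i < M) bern (x y i) N (kp i).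
have w0 y kp : 0 <= w y kp by apply: prodr_ge0 => i _; exact: bern_ge0.
have w1 y : \sum_kp w y kp = 1.
  rewrite /w -(bigA_distr_bigA (fun i k => bern (x y i) N (nat_of_ord k))).
  by rewrite big1// => i _; exact: sum_bern.
exists (fun y => \sum_kp H (node kp) * w y kp).
  apply: trigpoly_sum => kp; apply: trigpolyZ; apply: trigpoly_prod => i.
  apply: trigpoly_bern; rewrite /x.
  have := trigpolyZ (1 / 2) (trigpolyD (trigpoly_cst 1) (trigpoly_sin L^-1 i)).
  by congr trigpoly; apply/funext => y; rewrite mulrC mul1r.
split=> [y|y yL].
  rewrite (le_trans (ler_norm_sum _ _ _))// -[C]mulr1 -(w1 y) mulr_sumr.
  by apply: ler_sum => kp _; rewrite normrM (ger0_norm (w0 _ _)) ler_wpM2r.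
have N0' : 0 < N%:R :> R by rewrite ltr0n.
(* Either all coordinates of the node are close and uniform continuity applies, or one of them is
   off by more than [eta] and its squared deviation over [eta ^ 2] exceeds 1, which pays for the
   crude bound [2 C]. *)
have pt kp : `|H (node kp) - H y| <= e / 2 +
    2 * C * (\sum_j (4 * (kp j)%:R / N%:R - 4 * x y j) ^+ 2 / 4 / eta ^+ 2).
  have [/forallP h|] := boolP [forall j, `|nu (kp j) - sin (L^-1 * y j)| <= eta].
    rewrite (@le_trans _ _ (e / 2))//; last first.
      rewrite lerDl !mulr_ge0// sumr_ge0// => j _.
      by rewrite !divr_ge0 ?sqr_ge0 ?exprn_ge0// ltW.
    apply: Hdl => i; rewrite /node.
    have -> : L * asin (nu (kp i)) - y i = L * (asin (nu (kp i)) - L^-1 * y i).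
      by rewrite mulrBr mulVKf// gt_eqF.
    rewrite normrM gtr0_norm// mulrC -ler_pdivlMr//; apply: Heta; last exact: h.
      have kN : (kp i)%:R <= N%:R :> R by rewrite ler_nat -ltnS.
      rewrite /nu lerBrDr lerBlDr addNr -mulrA !mulr_ge0//= ?invr_ge0 ?ler0n//.
      by rewrite (_ : 1 + 1 = 2 * 1 :> R) ?ler_pM2l ?ler_pdivrMr ?mul1r//; ring.
    rewrite -ler_norml normrM ger0_norm ?invr_ge0 ?(ltW L0)//.
    by rewrite mulrC ler_pdivrMr// mul1r.
  rewrite negb_forall => /existsP[j]; rewrite -ltNge => h.
  rewrite (@le_trans _ _ (2 * C))//.
    rewrite (le_trans (ler_normB _ _))// (_ : 2 * C = C + C) ?lerD//; ring.
  apply: ler_wpDl; first by rewrite divr_ge0// ltW.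
  rewrite ler_peMr ?mulr_ge0// (bigD1 j)//= ler_wpDr//.
    apply: sumr_ge0 => i _.
    by rewrite !divr_ge0 ?sqr_ge0 ?exprn_ge0// ltW.
  rewrite ler_pdivlMr ?exprn_gt0// mul1r.
  rewrite [leRHS](_ : _ = `|nu (kp j) - sin (L^-1 * y j)| ^+ 2); last first.
    rewrite real_normK ?num_real// /nu /x; field; exact: lt0r_neq0.
  by rewrite ler_pXn2r ?nnegrE// ltW.
rewrite -[H y]mulr1 -(w1 y) mulr_sumr -sumrB.
rewrite (le_trans (ler_norm_sum _ _ _))//.
apply: (@le_trans _ _ (\sum_(kp : {ffun 'I_M -> 'I_N.+1}) (e / 2 + 2 * C *
   (\sum_j (4 * (kp j)%:R / N%:R - 4 * x y j) ^+ 2 / 4 / eta ^+ 2)) * w y kp)).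
  apply: ler_sum => kp _.
  by rewrite -mulrBl normrM (ger0_norm (w0 _ _)) ler_wpM2r.
under eq_bigr do rewrite mulrDl.
rewrite big_split/= -mulr_sumr w1 mulr1.
rewrite [e in _ <= e]splitr lerD2l (le_trans _ HN)//.
under eq_bigr do rewrite -mulrA mulr_suml.
rewrite -mulr_sumr ler_wpM2l ?mulr_ge0//.
rewrite exchange_big/=.
have -> : M%:R * (1 / N%:R) / eta ^+ 2 = \sum_(j < M) (1 / N%:R) / eta ^+ 2.
  by rewrite sumr_const card_ord -[RHS]mulr_natl !mulrA.
apply: ler_sum => j _.
under eq_bigr do rewrite mulrAC.
rewrite -mulr_suml ler_pM2r ?invr_gt0 ?exprn_gt0//.
(* Written as a product over coordinates, the sum factorizes: all factors but the [j]-th are total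
   binomial masses. *)
have -> : \sum_(kp : {ffun 'I_M -> 'I_N.+1})
    (4 * (kp j)%:R / N%:R - 4 * x y j) ^+ 2 / 4 * w y kp =
  \sum_(kp : {ffun 'I_M -> 'I_N.+1}) \prod_(i < M)
    (bern (x y i) N (kp i) *
     (if i == j then (4 * (kp i)%:R / N%:R - 4 * x y i) ^+ 2 / 4 else 1)).
  apply: eq_bigr => kp _; rewrite big_split/= mulrC; congr (_ * _).
  rewrite (bigD1 j)//= eqxx big1 ?mulr1// => i /negPf -> //.
rewrite -(bigA_distr_bigA (fun i (k : 'I_N.+1) => bern (x y i) N k *
     (if i == j then (4 * k%:R / N%:R - 4 * x y i) ^+ 2 / 4 else 1))).
rewrite (bigD1 j)//= eqxx [X in _ * X]big1 ?mulr1; last first.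
  move=> i /negPf ->; under eq_bigr do rewrite mulr1; exact: sum_bern.
have -> : \sum_(k < N.+1) bern (x y j) N k *
    ((4 * k%:R / N%:R - 4 * x y j) ^+ 2 / 4) =
  4 / N%:R ^+ 2 * \sum_(k < N.+1) bern (x y j) N k * (k%:R - N%:R * x y j) ^+ 2.
  rewrite mulr_sumr; apply: eq_bigr => k _; field; exact: lt0r_neq0.
rewrite sum_bern_var.
have -> : 4 / N%:R ^+ 2 * (N%:R * x y j * (1 - x y j)) =
    (4 * (x y j * (1 - x y j))) / N%:R by field; exact: lt0r_neq0.
rewrite ler_pM2r ?invr_gt0//.
have := sqr_ge0 (x y j - 1 / 2); lra.
Qed.

End trig_polynomials.

(** * Convergence in law through uniformly continuous functions *)

Section with_probability.
Context d (T : measurableType d) (R : realType) (P : probability T R).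
Implicit Types (A B : nat -> T -> Prop) (X : nat -> T -> R) (e : R).

(* Asymptotically, the (possibly non measurable) property holds outside an
   event of probability at most [e]. *)
Definition wpe e A : Prop := exists N, forall n, (N <= n)%N ->
  exists B : set T, [/\ measurable B, (P B <= e%:E)%E & forall w, ~ B w -> A n w].

Definition whp A : Prop := forall e, 0 < e -> wpe e A.

Definition tight X : Prop := forall e, 0 < e ->
  exists2 K, 0 < K & wpe e (fun n w => `|X n w| <= K).

Lemma wpe_sub e A B : (exists N, forall n, (N <= n)%N -> forall w, A n w -> B n w) ->
  wpe e A -> wpe e B.
Proof.
move=> [N1 AB] [N2 HA]; exists (maxn N1 N2) => n; rewrite geq_max => /andP[n1 n2].
have [D [mD PD AD]] := HA n n2; exists D; split=> // w Dw; apply: AB => //; exact: AD.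
Qed.

Lemma wpe_and e1 e2 A B : wpe e1 A -> wpe e2 B ->
  wpe (e1 + e2) (fun n w => A n w /\ B n w).
Proof.
move=> [N1 HA] [N2 HB]; exists (maxn N1 N2) => n; rewrite geq_max => /andP[n1 n2].
have [D [mD PD AD]] := HA n n1; have [E [mE PE BE]] := HB n n2.
exists (D `|` E); split; first exact: measurableU.
  rewrite (le_trans (measureU2 _ mD mE))// EFinD; exact: leeD.
by move=> w /not_orP[Dw Ew]; split; [exact: AD|exact: BE].
Qed.

Lemma wpe_all (I : finType) e (A : I -> nat -> T -> Prop) : (forall i, wpe e (A i)) ->
  wpe (#|I|%:R * e) (fun n w => forall i, A i n w).
Proof.
move=> HA; suff : forall s : seq I,
    wpe ((size s)%:R * e) (fun n w => forall i, i \in s -> A i n w).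
  move=> /(_ (enum I)); rewrite -cardE; apply: wpe_sub.
  by exists 0%N => n _ w h i; apply: h; rewrite mem_enum.
elim=> [|i s IH] /=.
  exists 0%N => n _; exists set0; split => //.
  by rewrite measure0 mul0r.
have := wpe_and (HA i) IH; rewrite -add1n natrD mulrDl mul1r; apply: wpe_sub.
by exists 0%N => n _ w [h1 h2] j; rewrite inE => /predU1P[->//|]; exact: h2.
Qed.

Lemma whp_sub A B : (exists N, forall n, (N <= n)%N -> forall w, A n w -> B n w) ->
  whp A -> whp B.
Proof. by move=> AB HA e e0; apply: wpe_sub AB (HA e e0). Qed.

Lemma Ex_close (X Y : T -> R) (C a e : R) (B : set T) :
  measurable_fun setT X -> measurable_fun setT Y ->
  (forall w, `|X w| <= C) -> (forall w, `|Y w| <= C) ->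
  measurable B -> (P B <= e%:E)%E -> 0 <= a ->
  (forall w, ~ B w -> `|X w - Y w| <= a) ->
  `|Ex P X - Ex P Y| <= a + 2 * C * e.
Proof.
move=> mX mY XC YC mB PB a0 XY.
have C0 : 0 <= C by apply: le_trans (XC point).
have LX : L1 P X by exact: L1_bounded XC.
have LY : L1 P Y by exact: L1_bounded YC.
rewrite -ExB//; apply: (@le_trans _ _ (Ex P (fun w => a + 2 * C * \1_B w))).
  apply: Ex_norm_le; first exact: L1B.
    by apply: L1D; [exact: L1_cst|apply: L1Z; exact: L1_indic].
  move=> w; have [Bw|Bw] := pselect (B w).
    rewrite indicE mem_set// mulr1 (le_trans (ler_normB _ _))// ler_wpDl//.
    by rewrite mulr_natl mulr2n lerD.
  by rewrite (le_trans (XY w Bw))// lerDl mulr_ge0// mulr_ge0.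
rewrite ExD; [|exact: L1_cst|by apply: L1Z; exact: L1_indic].
rewrite Ex_cst ExZ; last exact: L1_indic.
by rewrite lerD2l ler_wpM2l ?mulr_ge0// Ex_indic// -lee_fin EFin_prob.
Qed.

(** The indicators of the events that [Y] exceeds [n + 1] in absolute value tend to 0 pointwise,
    hence in mean. *)
Lemma tight_cst (Y : T -> R) : measurable_fun setT Y -> tight (fun=> Y).
Proof.
move=> mY e e0.
pose A n := [set w | (n.+1%:R : R) <= `|Y w|].
have mA n : measurable (A n).
  rewrite -[X in measurable X]setTI; apply: measurable_fun_le => //.
  exact: measurableT_comp.
have /(_ _ _) : Ex P (\1_(A n)) @[n --> \oo] --> Ex P (fun=> 0).
  apply: (@Ex_dct _ _ _ _ _ _ (fun=> 1)).
  - by move=> n; exact: measurable_indic.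
  - exact: measurable_cst.
  - exact: L1_cst.
  - apply: aeW => w; apply: cvg_near_cst.
    exists (Num.bound `|Y w|) => // n /= hn; rewrite indicE.
    case: (boolP (w \in A n)) => //; rewrite inE /A /= => h.
    have h2 := archi_boundP (normr_ge0 (Y w)).
    have : (Num.bound `|Y w|)%:R <= n.+1%:R :> R by rewrite ler_nat (leq_trans hn).
    by move=> h3; have := lt_le_trans h2 (le_trans h3 h); rewrite ltxx.
  - by move=> n w; rewrite indicE; case: (w \in A n); rewrite /= ?normr1 ?normr0.
rewrite Ex_cst => /cvgrPdist_le /(_ e e0)[n _ /(_ n (leqnn n))] /=.
rewrite sub0r normrN Ex_indic// => hn; exists n.+1%:R; first by rewrite ltr0n.
exists 0%N => k _; exists (A n); split => //.
  by rewrite -EFin_prob// lee_fin (le_trans (ler_norm _)).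
by move=> w /negP; rewrite -ltNge => /ltW.
Qed.

End with_probability.

Section trig_measurable.
Context d (T : measurableType d) (R : realType) (M : nat).
Implicit Types (X : 'I_M -> T -> R).

Lemma trigpoly_meas X g : (forall i, measurable_fun setT (X i)) -> trigpoly g ->
  measurable_fun setT (fun w => g (X ^~ w)).
Proof.
move=> mX; elim=> [c u|f h _ mf _ mh|a f _ mf].
- have mcos : measurable_fun setT (@cos R).
    by apply: continuous_measurable_fun; exact: continuous_cos.
  apply: (measurableT_comp mcos).
  apply: measurable_funD; first exact: measurable_cst.
  by apply: measurable_sum => i; exact: measurable_funM.
- exact: measurable_funD.
- exact: measurable_funM.
Qed.

Lemma trigpoly_bounded g : @trigpoly R M g -> exists C, forall y, `|g y| <= C.
Proof.
elim=> [c u|f h _ [C1 H1] _ [C2 H2]|a f _ [C HC]].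
- by exists 1 => y; rewrite ler_norml cos_geN1 cos_le1.
- by exists (C1 + C2) => y; rewrite (le_trans (ler_normD _ _))// lerD.
- by exists (`|a| * C) => y; rewrite normrM ler_wpM2l.
Qed.

(** [H] is a pointwise limit of trigonometric polynomials, the [n]-th one being accurate on the box
    of half-width [n + 1]; any given point eventually lies in the boxes. *)
Lemma unif_cont_meas X (H : ('I_M -> R) -> R) (C : R) :
  (forall i, measurable_fun setT (X i)) -> (forall y, `|H y| <= C) ->
  unif_cont H -> measurable_fun setT (fun w => H (X ^~ w)).
Proof.
move=> mX HC Hu.
have inv0 n : 0 < n.+1%:R^-1 :> R by rewrite invr_gt0 ltr0n.
have /choice[g Hg] n : exists g, trigpoly g /\
    forall y, (forall i, `|y i| <= n.+1%:R) -> `|g y - H y| <= n.+1%:R^-1.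
  by have [g tg [_ gH]] := trigpoly_approx HC Hu (ltr0n R n.+1) (inv0 n); exists g.
apply: (@measurable_fun_cvg _ _ _ _ (fun n w => g n (X ^~ w))).
  by move=> n; apply: trigpoly_meas => //; exact: (Hg n).1.
move=> w _; apply/cvgrPdist_le => e e0.
have [n0 _ Hn0] := near_infty_natSinv_lt (PosNum e0).
pose n1 := \max_(i < M) Num.bound `|X i w|.
exists (maxn n0 n1) => // n /=; rewrite geq_max => /andP[hn0 hn1].
rewrite distrC (le_trans ((Hg n).2 _ _))//; last exact/ltW/Hn0.
move=> i; have /ltW h := archi_boundP (normr_ge0 (X i w)).
rewrite (le_trans h)// ler_nat (leq_trans _ (leqW hn1))//.
exact: (leq_bigmax (F := fun i => Num.bound `|X i w|)).
Qed.

End trig_measurable.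

Section levy_continuity.
Context d (T : measurableType d) d' (T' : measurableType d') (R : realType).
Context (P : probability T R) (P' : probability T' R) (M : nat).
Variables (X : nat -> 'I_M -> T -> R) (Y : 'I_M -> T' -> R).
Hypothesis mX : forall n i, measurable_fun setT (X n i).
Hypothesis mY : forall i, measurable_fun setT (Y i).
Hypothesis tX : forall i, tight P (fun n => X n i).
Hypothesis cosXY : forall c (u : 'I_M -> R),
  Ex P (fun w => cos (c + \sum_(i < M) u i * X n i w)) @[n --> \oo] -->
  Ex P' (fun w => cos (c + \sum_(i < M) u i * Y i w)).

Lemma trigpoly_cvg g : trigpoly g ->
  Ex P (fun w => g ((X n) ^~ w)) @[n --> \oo] --> Ex P' (fun w => g (Y ^~ w)).
Proof.
have Lg d0 (T0 : measurableType d0) (P0 : probability T0 R) (Z : 'I_M -> T0 -> R)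
    h : (forall i, measurable_fun setT (Z i)) -> trigpoly h ->
    L1 P0 (fun w => h (Z ^~ w)).
  move=> mZ th; have [C HC] := trigpoly_bounded th.
  by apply: (@L1_bounded _ _ _ _ _ C); first exact: trigpoly_meas.
elim=> [c u|f h tf cf th ch|a f tf cf].
- exact: cosXY.
- rewrite ExD; [|exact: Lg..]; rewrite (_ : (fun n => _) = fun n =>
      Ex P (fun w => f ((X n) ^~ w)) + Ex P (fun w => h ((X n) ^~ w))); last first.
    by apply/funext => n; rewrite ExD//; exact: Lg.
  exact: cvgD.
- rewrite ExZ; last exact: Lg.
  rewrite (_ : (fun n => _) = fun n => a * Ex P (fun w => f ((X n) ^~ w))); last first.
    by apply/funext => n; rewrite ExZ//; exact: Lg.
  exact: cvgMr.
Qed.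

(** Continuity theorem with tightness given: on a box that carries nearly all the mass of both
    families, [H] is replaced by a trigonometric polynomial with the same bound [C], so that the
    mass outside the box stays harmless. *)
Lemma unif_cont_cvg (H : ('I_M -> R) -> R) (C : R) :
  (forall y, `|H y| <= C) -> unif_cont H ->
  Ex P (fun w => H ((X n) ^~ w)) @[n --> \oo] --> Ex P' (fun w => H (Y ^~ w)).
Proof.
move=> HC Hu; have C0 : 0 <= C by rewrite (le_trans _ (HC (fun=> 0))).
apply/cvgrPdist_lt => e e0.
(* Exceptional probability per coordinate; over the [M] coordinates it costs at most [e / 8] in the
   expectation of a function bounded by [C]. *)
pose e1 := e / (16 * (C + 1) * (M%:R + 1)).
have C1 : 0 < C + 1 by rewrite ltr_wpDl.
have e10 : 0 < e1 by rewrite /e1 divr_gt0// !mulr_gt0.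
have Me1 : 2 * C * (M%:R * e1) <= e / 8.
  rewrite [leLHS](_ : _ = e / 8 * ((C * M%:R) / ((C + 1) * (M%:R + 1)))).
    rewrite ler_piMr ?divr_ge0 ?(ltW e0)// ler_pdivrMr ?mulr_gt0// mul1r.
    by rewrite ler_pM// lerDl.
  by rewrite /e1; field; rewrite !gt_eqF.
have boxX : exists2 L, 0 < L & wpe P (M%:R * e1) (fun n w => forall i, `|X n i w| <= L).
  have /choice[K HK] i : exists K, 0 < K /\ wpe P e1 (fun n w => `|X n i w| <= K).
    by have [K K0 ?] := tX i e10; exists K.
  exists (1 + \sum_i K i).
    by rewrite ltr_pwDl// sumr_ge0// => i _; exact/ltW/(HK i).1.
  have := wpe_all (fun i => (HK i).2); rewrite card_ord; apply: wpe_sub.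
  exists 0%N => n _ w h i; rewrite (le_trans (h i))// (bigD1 i)//= addrCA lerDl.
  by rewrite addr_ge0// sumr_ge0// => j _; exact/ltW/(HK j).1.
have boxY : exists2 L, 0 < L &
    wpe P' (M%:R * e1) (fun n w => forall i, `|Y i w| <= L).
  have /choice[K HK] i : exists K, 0 < K /\ wpe P' e1 (fun n w => `|Y i w| <= K).
    by have [K K0 ?] := tight_cst P' (mY i) e10; exists K.
  exists (1 + \sum_i K i).
    by rewrite ltr_pwDl// sumr_ge0// => i _; exact/ltW/(HK i).1.
  have := wpe_all (fun i => (HK i).2); rewrite card_ord; apply: wpe_sub.
  exists 0%N => n _ w h i; rewrite (le_trans (h i))// (bigD1 i)//= addrCA lerDl.
  by rewrite addr_ge0// sumr_ge0// => j _; exact/ltW/(HK j).1.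
have [LX LX0 [NX HX]] := boxX; have [LY LY0 [NY HY]] := boxY.
have e8 : 0 < e / 8 by rewrite divr_gt0.
have [g tg [gC gH]] := trigpoly_approx HC Hu (addr_gt0 LX0 LY0) e8.
have [N2 _ HN2] := (cvgrPdist_lt _ _).1 (trigpoly_cvg tg) _ (divr_gt0 e0 (ltr0n R 4)).
exists (maxn NX N2) => // n /=; rewrite geq_max => /andP[n1 n2].
have [B [mB PB XB]] := HX n n1; have [D [mD PD YD]] := HY NY (leqnn _).
have E1 : `|Ex P (fun w => g ((X n) ^~ w)) - Ex P (fun w => H ((X n) ^~ w))| <=
    e / 8 + 2 * C * (M%:R * e1).
  apply: (Ex_close _ _ _ _ mB PB) => //.
  - exact: trigpoly_meas.
  - exact: unif_cont_meas HC Hu.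
  - exact: ltW.
  - by move=> w Bw; apply: gH => i; rewrite (le_trans (XB w Bw i))// lerDl ltW.
have E2 : `|Ex P' (fun w => g (Y ^~ w)) - Ex P' (fun w => H (Y ^~ w))| <=
    e / 8 + 2 * C * (M%:R * e1).
  apply: (Ex_close _ _ _ _ mD PD) => //.
  - exact: trigpoly_meas.
  - exact: unif_cont_meas HC Hu.
  - exact: ltW.
  - by move=> w Dw; apply: gH => i; rewrite (le_trans (YD w Dw i))// lerDr ltW.
have E3 := HN2 n n2; move: E1 E2 E3 Me1 => /=.
set a := Ex _ _; set b := Ex _ _; set a' := Ex _ _; set b' := Ex _ _.
rewrite !ler_norml !ltr_norml => /andP[? ?] /andP[? ?] /andP[? ?] ?.
by apply/andP; split; lra.
Qed.

End levy_continuity.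

(** * Uniformly continuous test functions on a pseudometric space *)

Section bounded_distance.
Context (R : realType) (E : pseudoMetricType R).
Implicit Types (x y z : E).

(* The distance associated with the balls, truncated at 1. *)
Definition pdist x y : R := inf [set e : R | 0 < e /\ (1 <= e \/ ball x e y)].

Let S x y := [set e : R | 0 < e /\ (1 <= e \/ ball x e y)].

Let S1 x y : S x y 1. Proof. by split=> //; left. Qed.

Let S_lb x y : has_lbound (S x y). Proof. by exists 0 => e [/ltW]. Qed.

Lemma pdist_ge0 x y : 0 <= pdist x y.
Proof. by apply: lb_le_inf; [exists 1; exact: S1|move=> e [/ltW]]. Qed.

Lemma pdist_le1 x y : pdist x y <= 1.
Proof. by apply: ge_inf; [exact: S_lb|exact: S1]. Qed.

Lemma pdist_ball x y e : 0 < e -> ball x e y -> pdist x y <= e.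
Proof. by move=> e0 xy; apply: ge_inf; [exact: S_lb|split=> //; right]. Qed.

Lemma pdist_lt x y e : e <= 1 -> pdist x y < e -> ball x e y.
Proof.
move=> e1 /inf_lt[|e' [e'0 [e'1|xy]] e'e]; first by exists 1; exact: S1.
  by have := lt_le_trans e'e (le_trans e1 e'1); rewrite ltxx.
exact: le_ball (ltW e'e) _ xy.
Qed.

Lemma pdist_xx x : pdist x x = 0.
Proof.
apply/eqP; rewrite eq_le pdist_ge0 andbT; apply/ler_addgt0Pl => e e0.
by rewrite addr0; apply: pdist_ball => //; exact: ballxx.
Qed.

Lemma pdist_sym x y : pdist x y = pdist y x.
Proof.
rewrite /pdist; congr inf; apply/seteqP; split=> e [e0 [e1|h]]; split=> //.
- by left.
- by right; exact: ball_sym.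
- by left.
- by right; exact: ball_sym.
Qed.

Lemma pdist_triangle x y z : pdist x z <= pdist x y + pdist y z.
Proof.
apply/ler_addgt0Pl => e e0; have e2 : 0 < e / 2 by rewrite divr_gt0.
have [|a [a0 ha] aS] := inf_adherent e2 (E := S x y).
  by split; [exists 1; exact: S1|exact: S_lb].
have [|b [b0 hb] bS] := inf_adherent e2 (E := S y z).
  by split; [exists 1; exact: S1|exact: S_lb].
apply: (@le_trans _ _ (a + b)); last first.
  move: aS bS; rewrite -/(pdist x y) -/(pdist y z); lra.
apply: ge_inf; first exact: S_lb.
split; first exact: addr_gt0.
case: ha => [a1|xy]; first by left; rewrite (le_trans a1)// lerDl ltW.
case: hb => [b1|yz]; first by left; rewrite (le_trans b1)// lerDr ltW.
by right; exact: ball_triangle xy yz.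
Qed.

Definition unifc (g : E -> R) : Prop := forall e, 0 < e ->
  exists2 dl : R, 0 < dl & forall x y, ball x dl y -> `|g x - g y| <= e.

Lemma unifc_continuous g : unifc g -> continuous g.
Proof.
move=> ug x; apply/cvgrPdist_le => e e0; have [dl dl0 gdl] := ug e e0.
apply/nbhs_ballP; exists dl => // y xy; exact: gdl.
Qed.

(* Lipschitz regularization, by which uniformly continuous test functions suffice
   for convergence in law. *)
Definition infconv (A : set E) (a : E -> R) (k : R) x : R :=
  inf [set a y + k * pdist x y | y in A].

Section infconv.
Variables (A : set E) (a : E -> R) (k m : R).
Hypotheses (A0 : A !=set0) (am : forall y, A y -> m <= a y) (k0 : 0 <= k).

Lemma infconv_le x y : A y -> infconv A a k x <= a y + k * pdist x y.
Proof.
move=> Ay; apply: ge_inf; last by exists y.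
exists m => _ [z Az <-]; rewrite (le_trans (am Az))// lerDl mulr_ge0//.
exact: pdist_ge0.
Qed.

Lemma le_infconv x c : (forall y, A y -> c <= a y + k * pdist x y) ->
  c <= infconv A a k x.
Proof.
move=> h; apply: lb_le_inf; last by move=> _ [y Ay <-]; exact: h.
by have [y Ay] := A0; exists (a y + k * pdist x y); exists y.
Qed.

Lemma infconv_lip x y : infconv A a k x <= infconv A a k y + k * pdist x y.
Proof.
rewrite -lerBlDr; apply: le_infconv => z Az; rewrite lerBlDr.
rewrite (le_trans (infconv_le x Az))// -addrA lerD2l -mulrDr ler_wpM2l// addrC.
exact: pdist_triangle.
Qed.

Lemma infconv_unifc : unifc (infconv A a k).
Proof.
move=> e e0; exists (e / (k + 1)); first by rewrite divr_gt0// ltr_wpDl.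
move=> x y xy; have k1 : 0 < k + 1 by rewrite ltr_wpDl.
have /pdist_ball/(_ xy) h : 0 < e / (k + 1) by rewrite divr_gt0.
have ke : k * pdist x y <= e.
  rewrite (le_trans (ler_wpM2l k0 h))// mulrCA ler_piMr ?(ltW e0)//.
  by rewrite ler_pdivrMr// mul1r lerDl.
have := infconv_lip x y; have := infconv_lip y x; rewrite (pdist_sym y x) => h1 h2.
by rewrite ler_norml; apply/andP; split; lra.
Qed.

End infconv.

End bounded_distance.

Section random_elements.
Context d (T : measurableType d) (R : realType) (E : pseudoMetricType R).

(** An open set is the set where the truncated distance to its complement is positive, and that
    distance, the regularization of 0 over the complement with slope 1, is uniformly continuous. *)
Lemma random_element_unifc (X : T -> E) :
  (forall g : E -> R, unifc g -> (forall x, `|g x| <= 1) ->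
    measurable_fun setT (g \o X)) -> random_element X.
Proof.
move=> mX A oA; have [AT|A0] := pselect (~` A = set0).
  by rewrite -[A]setCK AT setC0 preimage_setT.
have {}A0 : ~` A !=set0 by apply/set0P/eqP.
pose u := infconv (~` A) (fun=> 0) 1.
have u0 x : 0 <= u x.
  by apply: le_infconv => // y _; rewrite add0r mul1r pdist_ge0.
have mu : measurable_fun setT (u \o X).
  apply: mX; first exact: (@infconv_unifc _ _ _ _ _ 0).
  move=> x; rewrite ger0_norm//; have [y Ay] := A0.
  rewrite (le_trans (@infconv_le _ _ _ _ _ 0 _ _ x y Ay))//.
  by rewrite add0r mul1r pdist_le1.
have -> : X @^-1` A = (u \o X) @^-1` `]0, +oo[.
  apply/seteqP; split=> w /= Aw; rewrite ?in_itv/= ?andbT in Aw *.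
    have /nbhs_ballP[e /= e0 eA] : nbhs (X w) A by exact: open_nbhs_nbhs.
    apply: (@lt_le_trans _ _ (Num.min e 1)); first by rewrite lt_min e0 ltr01.
    apply: le_infconv => // y Ay; rewrite add0r mul1r leNgt; apply/negP => h.
    apply: Ay; apply: eA; apply: (@le_ball _ _ _ (Num.min e 1)).
      by rewrite ge_min lexx.
    by apply: pdist_lt => //; rewrite ge_min lexx orbT.
  apply: contrapT => nA; move: Aw; apply/negP; rewrite -leNgt.
  rewrite (le_trans (@infconv_le _ _ _ _ _ 0 _ _ (X w) (X w) nA))//.
  by rewrite add0r mul1r pdist_xx.
by rewrite -[X in measurable X]setTI; apply: mu => //; exact: measurable_itv.
Qed.

Lemma random_element_comp (E' : topologicalType) (X : T -> E') (h : E' -> R) :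
  random_element X -> continuous h -> measurable_fun setT (h \o X).
Proof.
move=> rX ch _; apply: (measurability _ (RGenOpens.measurableE R)) => //.
move=> _ [_ [a [b ->] <-]]; rewrite setTI comp_preimage; apply: rX.
by move/continuousP : ch; apply; exact: interval_open.
Qed.

End random_elements.

Section portmanteau.
Context d (T : measurableType d) d' (T' : measurableType d') (R : realType).
Context (P : probability T R) (P' : probability T' R) (E : pseudoMetricType R).

(** A bounded continuous [h] is the pointwise limit from below of its Lipschitz regularizations.
    This gives an asymptotic lower bound for the expectations of [h]; the same bound for [- h] gives
    the upper one. *)
Lemma cvg_in_law_unifc (X : nat -> T -> E) (Y : T' -> E) :
  (forall n, random_element (X n)) -> random_element Y ->
  (forall g : E -> R, unifc g -> (exists M, forall x, `|g x| <= M) ->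
    Ex P (g \o X n) @[n --> \oo] --> Ex P' (g \o Y)) ->
  cvg_in_law P P' X Y.
Proof.
move=> rX rY gXY.
have LX n (h : E -> R) : continuous h -> (exists M, forall x, `|h x| <= M) ->
    L1 P (h \o X n).
  move=> ch [M hM]; apply: (@L1_bounded _ _ _ _ _ M) => //.
    exact: random_element_comp.
  by move=> w; exact: hM.
have LY (h : E -> R) : continuous h -> (exists M, forall x, `|h x| <= M) ->
    L1 P' (h \o Y).
  move=> ch [M hM]; apply: (@L1_bounded _ _ _ _ _ M) => //.
    exact: random_element_comp.
  by move=> w; exact: hM.
(* The slope [k] is fixed by dominated convergence under the limit law, before [n] goes to infinity;
   under the law of [X n] only the inequality between the regularization and [h] is used. *)
have lower (h : E -> R) e : continuous h -> (exists M, forall x, `|h x| <= M) ->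
    0 < e -> \forall n \near \oo, Ex P' (h \o Y) - e <= Ex P (h \o X n).
  move=> ch hb e0; have [M hM] := hb; have hl y : - M <= h y.
    by have := hM y; rewrite ler_norml => /andP[].
  have M0 : 0 <= M by apply: le_trans (hM (Y point)).
  have S0 : [set: E] !=set0 by exists (Y point).
  pose hk (k : nat) := infconv setT h k%:R.
  have hkE k x : hk k x <= h x.
    rewrite (le_trans (@infconv_le _ _ _ _ _ (- M) _ _ x x I))//.
    by rewrite pdist_xx mulr0 addr0.
  have hkl k x : - M <= hk k x.
    by apply: le_infconv => // y _; rewrite ler_wpDr// mulr_ge0// pdist_ge0.
  have hkM k x : `|hk k x| <= M.
    rewrite ler_norml hkl (le_trans (hkE k x))//.
    by have := hM x; rewrite ler_norml => /andP[].
  have uk k : unifc (hk k) by apply: (@infconv_unifc _ _ _ _ _ (- M)).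
  have hkb k : exists M, forall x, `|hk k x| <= M by exists M.
  have ck k := unifc_continuous (uk k).
  have hkh x : hk k x @[k --> \oo] --> h x.
    apply/cvgrPdist_le => e1 e10.
    have /cvgrPdist_le/(_ e1 e10)/nbhs_ballP[dl /= dl0 hdl] := ch x.
    pose del := Num.min dl 1; have del0 : 0 < del by rewrite lt_min dl0 ltr01.
    exists (Num.bound (2 * M / del)) => // k /= hk'.
    have kM : 2 * M <= k%:R * del.
      rewrite -ler_pdivrMr// ltW// (lt_le_trans (archi_boundP _)) ?ler_nat//.
      by rewrite divr_ge0 ?mulr_ge0// ltW.
    rewrite ger0_norm ?subr_ge0// lerBlDr -lerBlDl.
    apply: le_infconv => // y _; have [xy|xy] := ltP (pdist x y) del.
      have : ball x dl y.
        apply: (@le_ball _ _ _ del); first by rewrite ge_min lexx.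
        by apply: pdist_lt => //; rewrite ge_min lexx orbT.
      move/hdl => /=; rewrite ler_norml => /andP[_ h1].
      have := mulr_ge0 (ler0n R k) (pdist_ge0 x y); lra.
    have : k%:R * del <= k%:R * pdist x y by rewrite ler_wpM2l.
    have := hl y; have := hM x; rewrite ler_norml => /andP[]; lra.
  have e2 : 0 < e / 2 by rewrite divr_gt0.
  have /cvgrPdist_le/(_ _ e2)[k _ /(_ k (leqnn k))/=] :
      Ex P' (hk k \o Y) @[k --> \oo] --> Ex P' (h \o Y).
    apply: (@Ex_dct _ _ _ _ _ _ (fun=> M)).
    - by move=> k; exact: random_element_comp.
    - exact: random_element_comp.
    - exact: L1_cst.
    - by apply: aeW => w; exact: hkh.
    - by move=> n w; exact: hkM.
  rewrite ler_norml => /andP[_ h2].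
  have /cvgrPdist_le/(_ _ e2) := gXY _ (uk k) (hkb k).
  apply: filterS => n; rewrite ler_norml => /andP[_ h1].
  have : Ex P (hk k \o X n) <= Ex P (h \o X n).
    by apply: Ex_le => [||w]; [exact: LX|exact: LX|exact: hkE].
  lra.
split=> // h ch hb.
rewrite expectation_Ex; last exact: LY.
rewrite (_ : (fun n => _) = fun n => (Ex P (h \o X n))%:E); last first.
  by apply/funext => n; rewrite expectation_Ex//; exact: LX.
apply: cvg_EFin; first exact: nearW.
apply/cvgrPdist_le => e e0.
have [M hM] := hb; pose h' x := - h x.
have ch' : continuous h' by move=> x; apply: continuousN; exact: ch.
have hb' : exists M, forall x, `|h' x| <= M.
  by exists M => x; rewrite /h' normrN.
have ExN d0 (T0 : measurableType d0) (P0 : probability T0 R) (Z : T0 -> E) :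
    L1 P0 (h \o Z) -> Ex P0 (h' \o Z) = - Ex P0 (h \o Z).
  move=> LZ; rewrite -mulN1r -ExZ//; congr Ex; apply/funext => w.
  by rewrite /h' /= mulN1r.
near=> n; rewrite ler_norml.
have : Ex P' (h \o Y) - e <= Ex P (h \o X n) by near: n; exact: lower.
have : Ex P' (h' \o Y) - e <= Ex P (h' \o X n) by near: n; exact: lower.
rewrite !ExN; [|exact: LX|exact: LY] => h1 h2.
by apply/andP; split => /=; lra.
Unshelve. all: by end_near. Qed.

End portmanteau.

Section law_of_trig.
Context d (T : measurableType d) d' (T' : measurableType d') (R : realType).
Context (P : probability T R) (P' : probability T' R).

(** The continuity theorem for a constant sequence transfers equality from cosines to uniformly
    continuous functions; ramps then reach the indicators of open rays, which generate the Borel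
    sets. *)
Lemma law_unique (X : T -> R) (Y : T' -> R) :
  measurable_fun setT X -> measurable_fun setT Y ->
  (forall c u : R, Ex P (fun w => cos (c + u * X w)) =
                   Ex P' (fun w => cos (c + u * Y w))) ->
  forall A : set R, measurable A -> P (X @^-1` A) = P' (Y @^-1` A).
Proof.
move=> mX mY cXY.
have HXY (H : ('I_1 -> R) -> R) : (forall y, `|H y| <= 1) -> unif_cont H ->
    Ex P (fun w => H (fun=> X w)) = Ex P' (fun w => H (fun=> Y w)).
  move=> H1 uH.
  have := @unif_cont_cvg _ _ _ _ _ P P' 1 (fun _ _ => X) (fun=> Y)
    (fun _ _ => mX) (fun=> mY) (fun=> tight_cst P mX) _ H 1 H1 uH.
  move=> h; apply: (@cvg_unique _ _ (Ex P (fun w => H (fun=> X w)) @[_ --> \oo])) => //.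
    exact: cvg_cst.
  apply: h => c u; under eq_fun do under eq_fun do rewrite big_ord1.
  have -> : (fun w => cos (c + \sum_(i < 1) u i * Y w)) = fun w => cos (c + u ord0 * Y w).
    by apply/funext => w; rewrite big_ord1.
  rewrite -cXY; exact: cvg_cst.
(* Ramp of slope [n] that vanishes on [[x, +oo[] and tends to the indicator of []-oo, x[]. *)
pose rmp (x : R) (n : nat) (t : R) : R := Num.max 0 (Num.min 1 (n%:R * (x - t))).
have rmp01 x n t : 0 <= rmp x n t <= 1.
  by rewrite /rmp le_max lexx/= ge_max ler01/= ge_min lexx.
have rmp1 x n t : `|rmp x n t| <= 1.
  by have /andP[h1 h2] := rmp01 x n t; rewrite ger0_norm.
have rmp_lip x n s t : `|rmp x n s - rmp x n t| <= n%:R * `|s - t|.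
  have -> : n%:R * `|s - t| = `|n%:R * (x - s) - n%:R * (x - t)|.
    rewrite -mulrBr normrM ger0_norm//; congr (_ * _).
    by rewrite distrC; congr `|_|; ring.
  rewrite /rmp; move: (n%:R * (x - s)) (n%:R * (x - t)) => a b.
  rewrite /Num.max /Num.min.
  have := ler_norm (a - b); have := ler_norm (b - a); rewrite (distrC b a) => h1 h2.
  rewrite ler_norml; apply/andP.
  have h0 := normr_ge0 (a - b); clear -h0 h1 h2.
  by have [a1|a1] := ltP 1 a; have [b1|b1] := ltP 1 b; rewrite ?ltr01;
    have [a0|a0] := ltP 0 a; have [b0|b0] := ltP 0 b; split; lra.
have Hlt x : P (X @^-1` `]-oo, x[) = P' (Y @^-1` `]-oo, x[).
  have lim d0 (T0 : measurableType d0) (P0 : probability T0 R) (Z : T0 -> R) :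
      measurable_fun setT Z ->
      Ex P0 (fun w => rmp x n (Z w)) @[n --> \oo] --> fine (P0 (Z @^-1` `]-oo, x[)).
    move=> mZ; have mA : measurable (Z @^-1` `]-oo, x[) by exact: measurable_preimage.
    rewrite -Ex_indic//; apply: (@Ex_dct _ _ _ _ _ _ (fun=> 1)) => //.
    - move=> n; apply: (measurable_funS measurableT) => //.
      apply: measurable_maxr => //; apply: measurable_minr => //.
      by apply: measurable_funM => //; apply: measurable_funB.
    - exact: L1_cst.
    - apply: aeW => w; rewrite indicE; have [xZ|Zx] := leP x (Z w).
        rewrite memNset; last by rewrite /= in_itv/= => h; move: xZ; rewrite leNgt h.
        rewrite (_ : (fun n => _) = fun=> 0); first exact: cvg_cst.
        apply/funext => n; rewrite /rmp max_l// ge_min; apply/orP; right.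
        by rewrite mulr_ge0_le0// subr_le0.
      rewrite mem_set; last by rewrite /= in_itv.
      apply: cvg_near_cst; have xZ0 : 0 < x - Z w by rewrite subr_gt0.
      exists (Num.bound (x - Z w)^-1) => // n /= hn.
      rewrite /rmp min_l ?max_r//.
      rewrite -ler_pdivrMr// mul1r ltW// (lt_le_trans (archi_boundP _)) ?ler_nat//.
      by rewrite invr_ge0 ltW.
  have fP : fine (P (X @^-1` `]-oo, x[)) = fine (P' (Y @^-1` `]-oo, x[)).
    apply: (cvg_unique _ (lim _ _ P X mX)) => //.
    rewrite (_ : (fun n => Ex P _) = fun n => Ex P' (fun w => rmp x n (Y w))).
      exact: lim.
    apply/funext => n; apply: (HXY (fun y => rmp x n (y ord0))) => // e e0.
    exists (e / (n%:R + 1)); first by rewrite divr_gt0// ltr_wpDl.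
    move=> y y' /(_ ord0) h; rewrite (le_trans (rmp_lip _ _ _ _))//.
    rewrite (le_trans (ler_wpM2l _ h))// mulrCA ler_piMr ?(ltW e0)//.
    by rewrite ler_pdivrMr ?mul1r ?lerDl// ltr_wpDl.
  by rewrite -EFin_prob ?fP ?EFin_prob//; exact: measurable_preimage.
pose G := [set A : set R | exists x, A = `]-oo, x[%classic].
move=> A mA.
apply: (@measure_unique _ R _ G (fun n => `]-oo, n%:R[%classic) _ _ _ _
  (distribution P (mkRV mX)) (distribution P' (mkRV mY)) _ _ A mA).
- exact: RGenInftyO.measurableE.
- move=> _ _ [x ->] [y ->]; exists (Num.min x y).
  by apply/seteqP; split=> z /=; rewrite !in_itv/= lt_min => /andP.
- by move=> n; exists n%:R.
- apply/seteqP; split=> // x _; exists (Num.bound `|x : R|) => //=.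
  by rewrite in_itv/= (le_lt_trans (ler_norm _))// archi_boundP.
- by move=> _ [x ->]; exact: Hlt.
- by move=> n; rewrite (le_lt_trans (probability_le1 _ _)) ?ltry.
Qed.

End law_of_trig.

(** * Normal laws and the central limit theorem *)

Section normal_characteristic_function.
Context (R : realType).
Local Notation mu := (@lebesgue_measure R).

(** Change of variables through the Radon-Nikodym derivative, which agrees almost everywhere with
    [normal_pdf]. *)
Lemma integral_normal_prob (m s : R) (f : R -> \bar R) :
  measurable_fun setT f -> (\int[normal_prob m s]_x `|f x| < +oo)%E ->
  (\int[normal_prob m s]_x f x = \int[mu]_x (f x * (normal_pdf m s x)%:E))%E.
Proof.
move=> mf finf; have dom := normal_prob_dominates m s.
have mpdf : measurable_fun setT (fun x : R => (normal_pdf m s x)%:E).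
  by apply/measurable_EFinP; exact: measurable_normal_pdf.
rewrite -(Radon_Nikodym_change_of_variables dom)//=; last first.
  by apply/integrableP; split.
apply: ae_eq_integral => //.
- apply: emeasurable_funM; first exact: mf.
  apply: (measurable_int mu); apply: (integrableS _ _ (@subsetT _ _)) => //=.
  by apply: Radon_Nikodym_integrable; exact: dom.
- by apply: emeasurable_funM; [exact: mf|exact: mpdf].
- apply: ae_eqe_mul2l => /=.
  rewrite Radon_NikodymE//=.
  case: cid => /= h [h1 h2 h3].
  apply: integral_ae_eq => //=.
  + by move=> E E01 mE; rewrite -h3.
Qed.

Section standard_deviation.
Variable s : R.
Hypothesis s0 : 0 < s.
Let g := normal_pdf 0 s.
Let sn0 : s != 0. Proof. by rewrite gt_eqF. Qed.

Lemma normal_pdf0E x : g x = normal_peak s * expR (- (x ^+ 2 / (2 * s ^+ 2))).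
Proof.
by rewrite /g normal_pdfE// /normal_fun subr0 mulNr mulr_natl.
Qed.

Lemma is_derive_normal_pdf (x : R) : is_derive x 1 g (- (x / s ^+ 2) * g x).
Proof.
have -> : g = fun x => normal_peak s * expR (- (x ^+ 2 / (2 * s ^+ 2))).
  by apply/funext => y; rewrite normal_pdf0E.
apply: is_derive_eq.
rewrite /GRing.scale /=; field.
exact: sn0.
Qed.

Let g0 x : 0 <= g x. Proof. exact: normal_pdf_ge0. Qed.

(** Half of the exponent absorbs the factor [|x|], by [1 + y <= expR y] and a completed square; the
    other half is a normal density of variance [2 s ^ 2]. This gives the domination for
    differentiating under the integral and the decay of the boundary terms. *)
Lemma normM_normal_pdf_le : exists2 C, 0 <= C &
  forall x, `|x| * g x <= C * normal_pdf 0 (s * Num.sqrt 2) x.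
Proof.
have s20 : 0 < s * Num.sqrt 2 by rewrite mulr_gt0// sqrtr_gt0.
have p1 := normal_peak_gt0 sn0; have p2 := normal_peak_gt0 (lt0r_neq0 s20).
exists (s * normal_peak s / normal_peak (s * Num.sqrt 2)).
  by rewrite divr_ge0 ?mulr_ge0 ?ltW.
move=> x; rewrite normal_pdf0E normal_pdfE ?lt0r_neq0// /normal_fun subr0.
rewrite [leRHS]mulrA divfK ?lt0r_neq0// exprMn sqr_sqrtr//.
rewrite mulrCA [s * normal_peak s]mulrC -[leRHS]mulrA ler_wpM2l ?(ltW p1)//.
set y := x ^+ 2 / (4 * s ^+ 2).
have -> : expR (- (x ^+ 2 / (2 * s ^+ 2))) = expR (- y) * expR (- y).
  by rewrite -expRD /y; congr expR; field.
have -> : - x ^+ 2 / (s ^+ 2 * 2 *+ 2) = - y.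
  by rewrite /y -mulr_natr; field.
rewrite mulrA ler_wpM2r ?expR_ge0//.
rewrite -ler_pdivlMr ?expR_gt0// expRN invrK.
apply: (@le_trans _ _ (s * (1 + y))); last by rewrite ler_wpM2l ?(ltW s0)// expR_ge1Dx.
have xE : x ^+ 2 = `|x| ^+ 2 by rewrite real_normK ?num_real.
rewrite /y xE; rewrite -subr_ge0.
have -> : s * (1 + `|x| ^+ 2 / (4 * s ^+ 2)) - `|x| = (`|x| / 2 - s) ^+ 2 / s by field.
by rewrite divr_ge0 ?sqr_ge0// ltW.
Qed.

Let intg : mu.-integrable setT (EFin \o g).
Proof. exact: integrable_normal_pdf. Qed.

Let mg : measurable_fun setT g. Proof. exact: measurable_normal_pdf. Qed.

Let intxg : mu.-integrable setT (EFin \o (fun x => `|x| * g x)).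
Proof.
have [C C0 HC] := normM_normal_pdf_le.
have h : mu.-integrable setT (fun x => (C%:E * (normal_pdf 0 (s * Num.sqrt 2) x)%:E)%E).
  by apply: integrableZl => //; exact: integrable_normal_pdf.
apply: le_integrable h => //.
  apply/measurable_EFinP; apply: measurable_funM => //; exact: measurableT_comp.
move=> x _; rewrite /= lee_fin (le_trans _ (ler_norm _))//.
by rewrite ger0_norm ?mulr_ge0.
Qed.

Let mcos c u : measurable_fun setT (fun x : R => cos (c + u * x)).
Proof.
have mc : measurable_fun setT (@cos R).
  by apply: continuous_measurable_fun; exact: continuous_cos.
by apply: (measurableT_comp mc); apply: measurable_funD => //; apply: measurable_funM.
Qed.

Let msin c u : measurable_fun setT (fun x : R => sin (c + u * x)).
Proof.
have mc : measurable_fun setT (@sin R).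
  by apply: continuous_measurable_fun; exact: continuous_sin.
by apply: (measurableT_comp mc); apply: measurable_funD => //; apply: measurable_funM.
Qed.

Let intcos c u : mu.-integrable setT (EFin \o (fun x => cos (c + u * x) * g x)).
Proof.
apply: le_integrable intg => //; first by apply/measurable_EFinP; apply: measurable_funM; [exact: mcos|exact: mg].
move=> x _; rewrite /= lee_fin normrM ler_piMl//.
by rewrite ler_norml cos_geN1 cos_le1.
Qed.

Let intsin c u : mu.-integrable setT (EFin \o (fun x => x * sin (c + u * x) * g x)).
Proof.
apply: le_integrable intxg => //.
  by apply/measurable_EFinP; apply: measurable_funM; [apply: measurable_funM => //; exact: msin|exact: mg].
move=> x _; rewrite /= lee_fin !normrM normr_id ler_wpM2r// ler_piMr//.
by rewrite ler_norml sin_geN1 sin_le1.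
Qed.

Let phi c u := \int[mu]_x (cos (c + u * x) * g x).

Let dcos (c x u : R) : is_derive u 1 (fun u => cos (c + u * x) * g x)
  (- (x * sin (c + u * x) * g x)).
Proof.
rewrite (_ : (fun u => _) = (cos \o (fun u => c + u * x)) * cst (g x)); last first.
  by apply/funext.
apply: is_derive_eq; rewrite /GRing.scale/=; ring.
Qed.

Lemma is_derive_phi (c u : R) : is_derive u 1 (phi c)
  (- (\int[mu]_x (x * sin (c + u * x) * g x))).
Proof.
pose f (u x : R) := cos (c + u * x) * g x.
have dE v x : partial1of2 f v x = - (x * sin (c + v * x) * g x).
  by rewrite /partial1of2 derive1E; exact: (@derive_val _ _ _ _ _ _ _ (dcos c x v)).
have Iu : `]u - 1, u + 1[%classic u.
  by rewrite /= in_itv/=; apply/andP; split; lra.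
have G_ub v x : `|partial1of2 f v x| <= `|x| * g x.
  rewrite dE normrN !normrM (ger0_norm (g0 _)) ler_wpM2r// ler_piMr//.
  by rewrite ler_norml sin_geN1 sin_le1.
have df v x : derivable (f ^~ x) v 1 by exact: (@ex_derive _ _ _ _ _ _ _ (dcos c x v)).
have G0 x : 0 <= `|x| * g x by rewrite mulr_ge0.
have D1 : derivable (phi c) u 1.
  by apply: (@derivable_under_integral R _ _ mu f setT measurableT u _ _ Iu
    (fun x _ => intcos c x) (fun v x _ _ => df v x) _ G0 intxg (fun v x _ _ => G_ub v x)).
have D2 := @differentiation_under_integral R _ _ mu f setT measurableT u _ _ Iu
    (fun x _ => intcos c x) (fun v x _ _ => df v x) _ G0 intxg (fun v x _ _ => G_ub v x).
have -> : - (\int[mu]_x (x * sin (c + u * x) * g x)) = 'D_1 (phi c) u.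
  rewrite -derive1E /phi D2 -mulN1r -RintegralZl//.
  by apply: eq_Rintegral => x _; rewrite dE mulN1r.
exact: derivableP.
Qed.

(** Integration by parts: [h] is the derivative of [sin (c + u x) g x], which vanishes at infinity,
    so [h] has integral 0; its two terms are the two sides. *)
Lemma phi_ibp c u :
  \int[mu]_x (x * sin (c + u * x) * g x) = s ^+ 2 * u * phi c u.
Proof.
pose h x := u * (cos (c + u * x) * g x) + (- (s ^+ 2)^-1) * (x * sin (c + u * x) * g x).
pose H x := sin (c + u * x) * g x.
have dH (x : R) : is_derive x 1 H (h x).
  have h1 : is_derive x 1 (fun x => c + u * x) u.
    by apply: is_derive_eq; rewrite /GRing.scale/=; ring.
  have h2 := @is_derive1_comp _ (@sin R) (fun x => c + u * x) x _ _ (is_derive_sin _) h1.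
  have h3 := is_derive_normal_pdf x.
  rewrite (_ : H = (sin \o (fun x => c + u * x)) * g); last by apply/funext.
  apply: is_derive_eq; rewrite /GRing.scale/= /h; ring.
have ch x : {for x, continuous h}.
  have c1 (F dF : R -> R) : (forall x : R, is_derive x 1 F (dF x)) -> continuous F.
    move=> hF y; apply/differentiable_continuous/derivable1_diffP.
    exact: (@ex_derive _ _ _ _ _ _ _ (hF y)).
  have cg := c1 _ _ is_derive_normal_pdf.
  have cl : continuous (fun x : R => c + u * x).
    apply: (c1 _ (fun=> u)) => y.
    by apply: is_derive_eq; rewrite /GRing.scale/=; ring.
  have cc : {for x, continuous (fun x : R => cos (c + u * x))}.
    apply: (@continuous_comp _ _ _ (fun x => c + u * x) cos); first exact: cl.
    exact: continuous_cos.
  have cs : {for x, continuous (fun x : R => sin (c + u * x))}.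
    apply: (@continuous_comp _ _ _ (fun x => c + u * x) sin); first exact: cl.
    exact: continuous_sin.
  apply: cvgD; (apply: cvgM; first exact: cvg_cst).
    by apply: cvgM; [exact: cc|exact: cg].
  apply: cvgM; last exact: cg.
  by apply: cvgM; [exact: cvg_id|exact: cs].
have inth : mu.-integrable setT (EFin \o h).
  have i1 := integrableZl measurableT u (intcos c u).
  have i2 := integrableZl measurableT (- (s ^+ 2)^-1) (intsin c u).
  by apply: eq_integrable (integrableD measurableT i1 i2).
have mh : measurable_fun setT h by move/measurable_int : inth => /measurable_EFinP.
pose J (n : nat) : set R := `[(- n.+1%:R), n.+1%:R]%classic.
have FTC (n : nat) : (\int[mu]_(x in J n) (h x)%:E =
    (H n.+1%:R)%:E - (H (- n.+1%:R)%R)%:E)%E.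
  apply: continuous_FTC2.
  - by rewrite -subr_gt0 opprK addr_gt0// ltr0n.
  - exact: continuous_subspaceT.
  - split=> [x _||].
    + exact: (@ex_derive _ _ _ _ _ _ _ (dH x)).
    + apply: cvg_at_right_filter; apply/differentiable_continuous/derivable1_diffP.
      exact: (@ex_derive _ _ _ _ _ _ _ (dH _)).
    + apply: cvg_at_left_filter; apply/differentiable_continuous/derivable1_diffP.
      exact: (@ex_derive _ _ _ _ _ _ _ (dH _)).
  - by move=> x _; rewrite derive1E; exact: (@derive_val _ _ _ _ _ _ _ (dH x)).
have lim1 : (\int[mu]_(x in J n) (h x)%:E)%E @[n --> \oo] -->
    (\int[mu]_x (h x)%:E)%E.
  under eq_fun do rewrite integral_mkcond.
  have [] := @dominated_convergence _ _ _ mu setT measurableT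
    (fun n => (EFin \o h) \_ (J n)) (EFin \o h)
    (fun x => `|(EFin \o h) x|%E) _ _ _ _ _ => //.
  - move=> n; have mJ : measurable (J n) by exact: measurable_itv.
    apply/(measurable_restrictT _ mJ); apply: measurable_funTS.
    exact/measurable_EFinP.
  - exact/measurable_EFinP.
  - apply: aeW => x _; apply: cvg_near_cst.
    exists (Num.bound `|x|) => // n /= hn; rewrite patchE mem_set//=.
    rewrite /J /= in_itv/= -ler_norml ltW// (lt_le_trans (archi_boundP _))// ler_nat.
    exact: (leq_trans hn).
  - exact: integrable_abse.
  - apply: aeW => x n _; rewrite patchE; case: ifP => //= _.
    by rewrite normr0 lee_fin.
(* The same integrals tend to 0 through their boundary values: [|x| g x] is bounded by [K], so each
   of them is at most [K / (n + 1)]. *)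
have lim2 : (\int[mu]_(x in J n) (h x)%:E)%E @[n --> \oo] --> 0%E.
  under eq_fun do rewrite FTC -EFinB.
  apply: cvg_EFin; first exact: nearW.
  have [C C0 HC] := normM_normal_pdf_le.
  pose K := C * normal_peak (s * Num.sqrt 2).
  have s20 : s * Num.sqrt 2 != 0 by rewrite gt_eqF// mulr_gt0// sqrtr_gt0.
  have K0 : 0 <= K by rewrite mulr_ge0// normal_peak_ge0.
  have HK (n : nat) t : `|t| = n.+1%:R -> `|H t| <= K / n.+1%:R.
    move=> tn; rewrite /H normrM (ger0_norm (g0 _)).
    apply: (@le_trans _ _ (g t)).
      by rewrite ler_piMl// ler_norml sin_geN1 sin_le1.
    rewrite ler_pdivlMr ?ltr0n// -tn mulrC (le_trans (HC t))// ler_wpM2l//.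
    exact: normal_pdf_ub.
  apply/cvgrPdist_le => e e0.
  exists (Num.bound ((K + K) / e)) => // n /= hn.
  rewrite sub0r normrN (le_trans (ler_normB _ _))//.
  have h1 := HK n n.+1%:R (ger0_norm (ler0n _ _)).
  have h2 : `|H (- n.+1%:R)| <= K / n.+1%:R by apply: HK; rewrite normrN ger0_norm.
  rewrite (le_trans (lerD h1 h2))// -mulrDl ler_pdivrMr ?ltr0n//.
  rewrite mulrC -ler_pdivrMr// ltW// (lt_le_trans (archi_boundP _))//.
    by rewrite divr_ge0 ?addr_ge0// ltW.
  by rewrite ler_nat (leq_trans hn).
have h0 : \int[mu]_x h x = 0.
  by rewrite /Rintegral (cvg_unique _ lim1 lim2).
move: h0; rewrite /h RintegralD//; last 2 first.
- exact: (integrableZl measurableT u (intcos c u)).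
- exact: (integrableZl measurableT (- (s ^+ 2)^-1) (intsin c u)).
rewrite RintegralZl// RintegralZl// => /eqP; rewrite mulNr subr_eq0 => /eqP h0.
rewrite -mulrA /phi h0 mulVKf// expf_neq0//.
Qed.

(** The derivative of [phi] being [- s ^ 2 u phi], its product with [expR (s ^ 2 u ^ 2 / 2)] is
    constant, equal to its value at 0. *)
Lemma phiE c u : phi c u = cos c * expR (- (s ^+ 2 * u ^+ 2 / 2)).
Proof.
pose e u := expR (s ^+ 2 * u ^+ 2 / 2).
pose G u := phi c u * e u.
have de (v : R) : is_derive v 1 e (s ^+ 2 * v * e v).
  by apply: is_derive_eq; rewrite /GRing.scale/= /e; field.
have dG (v : R) : is_derive v 1 G 0.
  have h1 := is_derive_phi c v.
  rewrite (_ : G = phi c * e); last by apply/funext.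
  by apply: is_derive_eq; rewrite /GRing.scale/= phi_ibp; ring.
have := is_derive_0_is_cst u 0 dG.
have phi0 : phi c 0 = cos c.
  rewrite /phi; under eq_Rintegral do rewrite mul0r addr0.
  by rewrite RintegralZl// /Rintegral integral_normal_pdf mulr1.
rewrite /G phi0 {2}/e expr0n/= mulr0 mul0r expR0 mulr1 => <-.
by rewrite /e -(mulrA (phi c u)) -expRD subrr expR0 mulr1.
Qed.

Lemma Ex_cos_normal c u : Ex (normal_prob 0 s) (fun x => cos (c + u * x)) =
  cos c * expR (- (s ^+ 2 * u ^+ 2 / 2)).
Proof.
rewrite -phiE /Ex /Rintegral integral_normal_prob//; first exact/measurable_EFinP.
apply: (@le_lt_trans _ _ (\int[normal_prob 0 s]_x (cst 1%E x))%E); last first.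
  by rewrite integral_cst// mul1e (le_lt_trans (probability_le1 _ _))// ltry.
apply: ge0_le_integral => //.
  have mc : measurable_fun setT (fun x : R => `|cos (c + u * x)|).
    by apply: measurableT_comp => //; exact: mcos.
  by apply/measurable_EFinP; exact: mc.
by move=> x _; rewrite lee_fin ler_norml cos_geN1 cos_le1.
Qed.

End standard_deviation.

End normal_characteristic_function.

(** * Taylor inequalities for sine, cosine and the exponential *)

Section trig_inequalities.
Context (R : realType).
Implicit Types (x y : R).

(** Each Taylor inequality below is the previous one integrated from 0. *)
Lemma ge0_of_derive (f df : R -> R) : f 0 = 0 ->
  (forall x : R, is_derive x 1 f (df x)) -> (forall x, 0 <= x -> 0 <= df x) ->
  forall x, 0 <= x -> 0 <= f x.
Proof.
move=> f0 hf hdf x; rewrite le_eqVlt => /predU1P[<-|x0]; first by rewrite f0.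
have cf : {within `[0, x], continuous f}.
  apply: continuous_subspaceT => y; apply/differentiable_continuous/derivable1_diffP.
  exact: (@ex_derive _ _ _ _ _ _ _ (hf y)).
have [c] := MVT x0 (fun y _ => hf y) cf.
rewrite in_itv/= => /andP[c0 _]; rewrite f0 !subr0 => ->.
by rewrite mulr_ge0 ?hdf// ltW.
Qed.

Lemma sin_le x : 0 <= x -> sin x <= x.
Proof.
move=> x0; rewrite -subr_ge0.
apply: (@ge0_of_derive (fun x => x - sin x) (fun x => 1 - cos x)) => //.
by rewrite sin0 subrr.
Qed.

Lemma cos_ge x : 1 - x ^+ 2 / 2 <= cos x.
Proof.
wlog x0 : x / 0 <= x.
  move=> h; case: (lerP 0 x) => [/h//|xn].
  by rewrite -cosN -sqrrN h// oppr_ge0 ltW.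
rewrite -subr_ge0.
apply: (@ge0_of_derive (fun x => cos x - (1 - x ^+ 2 / 2)) (fun x => x - sin x)) => //.
- by rewrite cos0 expr0n/= mul0r subr0 subrr.
- by move=> y; apply: is_derive_eq; rewrite /GRing.scale/=; field.
- by move=> y y0; rewrite subr_ge0 sin_le.
Qed.

Lemma sin_ge x : 0 <= x -> x - x ^+ 3 / 6 <= sin x.
Proof.
move=> x0; rewrite -subr_ge0.
apply: (@ge0_of_derive (fun x => sin x - (x - x ^+ 3 / 6))
  (fun x => cos x - (1 - x ^+ 2 / 2))) => //.
- by rewrite sin0 expr0n/= mul0r !subr0.
- by move=> y; apply: is_derive_eq; rewrite /GRing.scale/=; field.
- by move=> y y0; rewrite subr_ge0 cos_ge.
Qed.

Lemma cos_le x : cos x <= 1 - x ^+ 2 / 2 + x ^+ 4 / 24.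
Proof.
wlog x0 : x / 0 <= x.
  move=> h; case: (lerP 0 x) => [/h//|xn].
  by rewrite -cosN -sqrrN (_ : x ^+ 4 = (- x) ^+ 4) ?h ?oppr_ge0 ?ltW//; ring.
rewrite -subr_ge0.
apply: (@ge0_of_derive (fun x => 1 - x ^+ 2 / 2 + x ^+ 4 / 24 - cos x)
  (fun x => sin x - (x - x ^+ 3 / 6))) => //.
- by rewrite cos0 !expr0n/= !mul0r subr0 addr0 subrr.
- by move=> y; apply: is_derive_eq; rewrite /GRing.scale/=; field.
- by move=> y y0; rewrite subr_ge0 sin_ge.
Qed.

Lemma normr_sin_le x : `|sin x| <= `|x|.
Proof.
case: (ler0P x) => [x0|/ltW x0].
  have nx0 : 0 <= - x by rewrite oppr_ge0.
  rewrite -normrN -sinN ler_norml sin_le// andbT.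
  have [x1|x1] := lerP (- x) 1; last first.
    by rewrite (le_trans _ (sin_geN1 _))// lerN2 ltW.
  have p2 := @pi_ge2 R.
  rewrite (@le_trans _ _ 0) ?oppr_le0//; apply: sin_ge0_pi.
  by rewrite nx0 (le_trans x1)// (le_trans _ p2)// ler1n.
rewrite ler_norml sin_le// andbT.
have [x1|x1] := lerP x 1; last first.
  by rewrite (le_trans _ (sin_geN1 _))// lerN2 ltW.
have p2 := @pi_ge2 R.
rewrite (@le_trans _ _ 0) ?oppr_le0//; apply: sin_ge0_pi.
by rewrite x0 (le_trans x1)// (le_trans _ p2)// ler1n.
Qed.

Lemma normr_sinB_le3 x : `|sin x - x| <= `|x| ^+ 3 / 6.
Proof.
wlog x0 : x / 0 <= x.
  move=> h; case: (lerP 0 x) => [/h//|xn].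
  have := h (- x); rewrite sinN normrN -opprD normrN; apply.
  by rewrite oppr_ge0 ltW.
rewrite (ger0_norm x0) ler0_norm ?subr_le0 ?sin_le//.
by have := sin_ge x0; lra.
Qed.

Lemma normr_sinB_le2 x : `|sin x - x| <= x ^+ 2.
Proof.
have [x6|x6] := lerP `|x| 6.
  rewrite (le_trans (normr_sinB_le3 x))// -(real_normK (num_real x)).
  have := normr_ge0 x; have := sqr_ge0 `|x|; nra.
rewrite (le_trans (ler_normB _ _))// -(real_normK (num_real x)).
by have := normr_sin_le x; nra.
Qed.

Lemma expRN_le2 x : 0 <= x -> 0 <= expR (- x) - 1 + x <= x ^+ 2 / 2.
Proof.
move=> x0.
have h1 y : 0 <= y -> 0 <= expR (- y) - 1 + y.
  by move=> y0; have := expR_ge1Dx (- y); lra.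
rewrite h1//= -subr_ge0.
apply: (@ge0_of_derive (fun x => x ^+ 2 / 2 - (expR (- x) - 1 + x))
  (fun x => expR (- x) - 1 + x)) => //.
- by rewrite oppr0 expR0 subrr expr0n/= mul0r addr0 subrr.
- by move=> y; apply: is_derive_eq; rewrite /GRing.scale/=; field.
Qed.

Lemma cvg_harmonic_scale (C : R) : C / n.+1%:R @[n --> \oo] --> (0 : R).
Proof.
have -> : (0 : R) = C * 0 by rewrite mulr0.
by apply: cvgMr; exact: cvg_harmonic.
Qed.

Lemma cvg_cosS x : n.+1%:R ^+ 2 * (1 - cos (x / n.+1%:R)) @[n --> \oo] --> x ^+ 2 / 2.
Proof.
apply/cvgrPdist_le => e e0.
have /cvgrPdist_le/(_ _ e0) := cvg_harmonic_scale (x ^+ 4 / 24).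
apply: filterS => n; rewrite sub0r normrN => h; apply: le_trans h.
have n0 : n.+1%:R != 0 :> R by rewrite pnatr_eq0.
have n1 : 1 <= n.+1%:R :> R by rewrite ler1n.
have h1 := cos_ge (x / n.+1%:R); have h2 := cos_le (x / n.+1%:R).
set t := n.+1%:R in n0 n1 h1 h2 *.
have xt : x = t * (x / t) by field.
set y := x / t in xt h1 h2 *.
have -> : x ^+ 4 / 24 / t = t ^+ 3 * (y ^+ 4 / 24) by rewrite xt; field.
have t2 : 0 <= t ^+ 2 by rewrite sqr_ge0.
rewrite ger0_norm; last first.
  have -> : x ^+ 2 / 2 - t ^+ 2 * (1 - cos y) = t ^+ 2 * (cos y - (1 - y ^+ 2 / 2)).
    by rewrite xt; field.
  by rewrite mulr_ge0// subr_ge0.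
have -> : x ^+ 2 / 2 - t ^+ 2 * (1 - cos y) = t ^+ 2 * (cos y - (1 - y ^+ 2 / 2)).
  by rewrite xt; field.
have y4 : 0 <= y ^+ 4 by rewrite exprn_even_ge0.
rewrite ger0_norm; last first.
  by apply: mulr_ge0; [exact/exprn_ge0/ltW|exact: divr_ge0].
apply: (@le_trans _ _ (t ^+ 2 * (y ^+ 4 / 24))).
  by rewrite ler_wpM2l//; lra.
by rewrite ler_wpM2r ?divr_ge0 ?exprn_even_ge0// ler_weXn2l.
Qed.

Lemma cvg_sinS x : n.+1%:R * sin (x / n.+1%:R) @[n --> \oo] --> x.
Proof.
apply/cvgrPdist_le => e e0.
have /cvgrPdist_le/(_ _ e0) := cvg_harmonic_scale (x ^+ 2).
apply: filterS => n; rewrite sub0r normrN => h; apply: le_trans h.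
have h1 := normr_sinB_le2 (x / n.+1%:R).
have -> : x - n.+1%:R * sin (x / n.+1%:R) =
    - (n.+1%:R * (sin (x / n.+1%:R) - x / n.+1%:R)) by field.
rewrite normrN normrM ger0_norm// [leRHS]ger0_norm ?divr_ge0 ?sqr_ge0//.
have -> : x ^+ 2 / n.+1%:R = n.+1%:R * (x / n.+1%:R) ^+ 2 by field.
by rewrite ler_wpM2l.
Qed.

End trig_inequalities.

Lemma measurable_cosu d (T : measurableType d) (R : realType) (X : T -> R) c u :
  measurable_fun setT X ->
  measurable_fun setT (fun w => cos (c + u * X w)).
Proof.
move=> mX; have mc : measurable_fun setT (@cos R).
  by apply: continuous_measurable_fun; exact: continuous_cos.
by apply: (measurableT_comp mc); apply: measurable_funD => //; apply: measurable_funM.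
Qed.

Section trig_expectations.
Context d (T : measurableType d) (R : realType) (P : probability T R).
Implicit Types X : T -> R.

Lemma cosu_le1 X c u w : `|cos (c + u * X w)| <= 1 :> R.
Proof. by rewrite ler_norml cos_geN1 cos_le1. Qed.

Lemma L1_cosu X c u : measurable_fun setT X -> L1 P (fun w => cos (c + u * X w)).
Proof.
by move=> mX; apply: (@L1_bounded _ _ _ _ _ 1); [exact: measurable_cosu|move=> w; exact: cosu_le1].
Qed.

Lemma L1_cos X : measurable_fun setT X -> L1 P (fun w => cos (X w)).
Proof.
move=> mX; have := L1_cosu 0 1 mX; congr (L1 P _).
by apply/funext => w; rewrite add0r mul1r.
Qed.

Lemma L1_sin X : measurable_fun setT X -> L1 P (fun w => sin (X w)).
Proof.
move=> mX; have := L1_cosu (- (pi / 2)) 1 mX; congr (L1 P _).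
by apply/funext => w; rewrite mul1r addrC cosBpihalf.
Qed.

Lemma Ex_cosD_indep (S X : T -> R) c : measurable_fun setT S -> measurable_fun setT X ->
  indep2 P S X ->
  Ex P (fun w => cos (c + (S w + X w))) =
  Ex P (fun w => cos (c + S w)) * Ex P (fun w => cos (X w)) -
  Ex P (fun w => sin (c + S w)) * Ex P (fun w => sin (X w)).
Proof.
move=> mS mX SX.
have mcos : measurable_fun setT (@cos R).
  by apply: continuous_measurable_fun; exact: continuous_cos.
have msin : measurable_fun setT (@sin R).
  by apply: continuous_measurable_fun; exact: continuous_sin.
have mc : measurable_fun setT (fun s : R => c + s) by exact: measurable_funD.
have mcS : measurable_fun setT (fun w => c + S w) by exact: measurable_funD.
have [L1c E1] := indep2_ExM (indep2_comp SX (measurableT_comp mcos mc) mcos)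
  (L1_cos mcS) (L1_cos mX).
have [L1s E2] := indep2_ExM (indep2_comp SX (measurableT_comp msin mc) msin)
  (L1_sin mcS) (L1_sin mX).
rewrite -[in RHS]E1 -[in RHS]E2 -ExB//; congr Ex; apply/funext => w /=.
by rewrite addrA (cosD (c + S w)).
Qed.

(** Centred normal law of variance [v], given by its characteristic function: [c = 0] is the real
    part and [c = - pi / 2] the imaginary one. The value [v = 0] is the unit mass at 0. *)
Definition isN X (v : R) : Prop := measurable_fun setT X /\ forall c u,
  Ex P (fun w => cos (c + u * X w)) = cos c * expR (- (v * u ^+ 2 / 2)).

Lemma isN_law X v : 0 <= v -> isN X v -> forall A : set R, measurable A ->
  P (X @^-1` A) = gaussian 0 v A.
Proof.
move=> v0 [mX hX] A mA.
rewrite (@law_unique _ _ _ _ _ P (gaussian 0 v) X idfun mX (@measurable_id _ _ setT) _ A mA)//.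
move=> c u; rewrite hX /gaussian; case: eqVneq => [->|vn0].
  rewrite !mul0r oppr0 expR0 mulr1 /Ex /Rintegral integral_dirac//=.
    by rewrite indicE in_setT mul1r mulr0 addr0.
  by have /measurable_EFinP := @measurable_cosu _ (measurableTypeR R) R idfun c u (@measurable_id _ _ setT).
have s0 : 0 < Num.sqrt v by rewrite sqrtr_gt0 lt0r vn0.
by rewrite (Ex_cos_normal s0) sqr_sqrtr.
Qed.

Lemma isN_sin X v u : isN X v -> Ex P (fun w => sin (u * X w)) = 0.
Proof.
move=> [mX /(_ (- (pi / 2)) u)]; rewrite cosN cos_pihalf mul0r => h.
rewrite -[RHS]h; congr Ex; apply/funext => w.
by rewrite [in RHS]addrC cosBpihalf.
Qed.

Lemma isN_cos X v u : isN X v -> Ex P (fun w => cos (u * X w)) = expR (- (v * u ^+ 2 / 2)).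
Proof.
move=> [mX /(_ 0 u)]; rewrite cos0 mul1r => <-.
by congr Ex; apply/funext => w; rewrite add0r.
Qed.

(** The quotients [2 n ^ 2 (1 - cos (X / n))] tend to [X ^ 2], and their expectations, read off the
    characteristic function, are at most [v] because [1 - expR (- t) <= t]. Fatou's lemma concludes,
    no integrability being known beforehand. *)
Lemma isN_L2 X v : 0 <= v -> isN X v -> L1 P (fun w => X w ^+ 2).
Proof.
move=> v0 NX; have mX := NX.1.
have mX2 : measurable_fun setT (fun w => X w ^+ 2) by exact: measurable_funX.
pose f (n : nat) w := 2 * (n.+1%:R ^+ 2 * (1 - cos (X w / n.+1%:R))).
have mcn n : measurable_fun setT (fun w => cos (X w / n.+1%:R)).
  have := measurable_cosu 0 n.+1%:R^-1 mX; congr measurable_fun.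
  by apply/funext => w; rewrite add0r mulrC.
have mf n : measurable_fun setT (f n).
  by apply: measurable_funM => //; apply: measurable_funM => //; exact: measurable_funB.
have f0 n w : 0 <= f n w.
  by rewrite !mulr_ge0// ?subr_ge0 ?cos_le1// sqr_ge0.
have Ln n : L1 P (fun w => cos (X w / n.+1%:R)) by apply: L1_cos; exact: measurable_funM.
have Lf n : L1 P (f n).
  by apply: L1Z; apply: L1Z; apply: L1B; [exact: L1_cst|exact: Ln].
have Ef n : Ex P (f n) <= v.
  rewrite ExZ; last by apply: L1Z; apply: L1B; [exact: L1_cst|exact: Ln].
  rewrite ExZ; last by apply: L1B; [exact: L1_cst|exact: Ln].
  rewrite ExB; [|exact: L1_cst|exact: Ln]; rewrite Ex_cst.
  have -> : Ex P (fun w => cos (X w / n.+1%:R)) = expR (- (v * n.+1%:R^-1 ^+ 2 / 2)).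
    rewrite -(isN_cos _ NX); congr Ex; apply/funext => w; by rewrite mulrC.
  have := expR_ge1Dx (- (v * n.+1%:R^-1 ^+ 2 / 2)) => h.
  apply: (@le_trans _ _ (2 * (n.+1%:R ^+ 2 * (v * n.+1%:R^-1 ^+ 2 / 2)))).
    by rewrite ler_wpM2l// ler_wpM2l ?sqr_ge0// lerBlDl -lerBlDr.
  rewrite le_eqVlt; apply/orP; left; apply/eqP; field.
  by rewrite addrC natr1 pnatr_eq0.
have fX w : f n w @[n --> \oo] --> X w ^+ 2.
  have -> : X w ^+ 2 = 2 * (X w ^+ 2 / 2) by field.
  by apply: cvgMr; exact: cvg_cosS.
apply/integrableP; split; first exact/measurable_EFinP.
have := @fatou _ _ _ P setT measurableT (fun n => EFin \o f n) _ _.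
have -> : (\int[P]_x limn_einf (fun n => (EFin \o f n) x) = \int[P]_x `|(EFin \o (fun w => (X w ^+ 2)%R)) x|)%E.
  apply: eq_integral => w _; rewrite gee0_abs ?lee_fin ?sqr_ge0//=.
  have h : (f n w)%:E @[n --> \oo] --> (X w ^+ 2)%:E.
    by apply: cvg_EFin; [exact: nearW|exact: fX].
  by rewrite (cvg_limn_einf_sup h).1.
move=> /(_ _ _)/le_lt_trans; apply.
- by move=> n; exact/measurable_EFinP.
- by move=> n w _; rewrite lee_fin.
rewrite limn_einf_lim; apply: (@le_lt_trans _ _ v%:E); last exact: ltry.
apply: lime_le; first exact: is_cvg_einfs.
apply: nearW => n; apply: le_trans (ereal_inf_lbound _) _; first by exists n => //=.
by rewrite -ExE// lee_fin.
Qed.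

Lemma L1_of_L2 X : measurable_fun setT X -> L1 P (fun w => X w ^+ 2) -> L1 P X.
Proof.
move=> mX LX; apply: (L1_le mX (L1D (L1_cst P 1) LX)) => w.
rewrite -(real_normK (num_real (X w))).
have := sqr_ge0 (`|X w| - 1 / 2); have := normr_ge0 (X w); lra.
Qed.

(** [n sin (X / n)] has expectation 0 and tends to [X], dominated by [|X|]. *)
Lemma isN_mean X v : 0 <= v -> isN X v -> Ex P X = 0.
Proof.
move=> v0 NX; have mX := NX.1; have LX := L1_of_L2 mX (isN_L2 v0 NX).
have h : Ex P (fun w => n.+1%:R * sin (X w / n.+1%:R)) @[n --> \oo] --> Ex P X.
  apply: (Ex_dct _ mX (L1_norm LX)).
  - move=> n; apply: measurable_funM => //.
    have := measurable_cosu (- (pi / 2)) n.+1%:R^-1 mX; congr measurable_fun.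
    by apply/funext => w; rewrite addrC cosBpihalf mulrC.
  - by apply: aeW => w; exact: cvg_sinS.
  - move=> n w; rewrite normrM ger0_norm//.
    rewrite -ler_pdivlMl ?ltr0n// (le_trans (normr_sin_le _))//.
    by rewrite normrM normfV (ger0_norm (ler0n _ _)) mulrC.
apply: cvg_unique h _ => //.
rewrite (_ : (fun n => _) = fun=> 0); first exact: cvg_cst.
apply/funext => n; rewrite ExZ; last by apply: L1_sin; exact: measurable_funM.
rewrite (_ : (fun w => _) = fun w => sin (n.+1%:R^-1 * X w)); last first.
  by apply/funext => w; rewrite mulrC.
by rewrite (isN_sin _ NX) mulr0.
Qed.

(** Now that [X ^ 2] is integrable it dominates the quotients [2 n ^ 2 (1 - cos (X / n))], so their
    expectations converge to its own. *)
Lemma isN_var X v : 0 <= v -> isN X v -> Ex P (fun w => X w ^+ 2) = v.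
Proof.
move=> v0 NX; have mX := NX.1; have LX := isN_L2 v0 NX.
have mX2 : measurable_fun setT (fun w => X w ^+ 2) by exact: measurable_funX.
have Ln n : L1 P (fun w => cos (X w / n.+1%:R)) by apply: L1_cos; exact: measurable_funM.
pose f (n : nat) w := 2 * (n.+1%:R ^+ 2 * (1 - cos (X w / n.+1%:R))).
have h : Ex P (f n) @[n --> \oo] --> Ex P (fun w => X w ^+ 2).
  apply: (Ex_dct _ mX2 LX).
  - move=> n; apply: measurable_funM => //; apply: measurable_funM => //.
    by apply: measurable_funB => //; exact: L1_meas (Ln n).
  - apply: aeW => w; have -> : X w ^+ 2 = 2 * (X w ^+ 2 / 2) by field.
    by apply: cvgMr; exact: cvg_cosS.
  - move=> n w; rewrite ger0_norm ?mulr_ge0 ?subr_ge0 ?cos_le1 ?sqr_ge0//.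
    have -> : X w ^+ 2 = 2 * (n.+1%:R ^+ 2 * ((X w / n.+1%:R) ^+ 2 / 2)).
      by field; rewrite addrC natr1 pnatr_eq0.
    have := cos_ge (X w / n.+1%:R) => h.
    by rewrite /f ler_wpM2l// ler_wpM2l ?sqr_ge0// lerBlDl -lerBlDr.
apply: cvg_unique h _ => //.
apply/cvgrPdist_le => e e0.
have /cvgrPdist_le/(_ _ e0) := cvg_harmonic_scale (v ^+ 2).
apply: filterS => n; rewrite sub0r normrN => h; apply: le_trans h.
rewrite ExZ; last by apply: L1Z; apply: L1B; [exact: L1_cst|exact: Ln].
rewrite ExZ; last by apply: L1B; [exact: L1_cst|exact: Ln].
rewrite ExB; [|exact: L1_cst|exact: Ln]; rewrite Ex_cst.
have -> : Ex P (fun w => cos (X w / n.+1%:R)) = expR (- (v * n.+1%:R^-1 ^+ 2 / 2)).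
  rewrite -(isN_cos _ NX); congr Ex; apply/funext => w; by rewrite mulrC.
have n1 : 1 <= n.+1%:R :> R by rewrite ler1n.
set t := n.+1%:R in n1 *; have t0 : 0 < t by rewrite (lt_le_trans ltr01).
set y := v * t^-1 ^+ 2 / 2; have y0 : 0 <= y.
  by apply: divr_ge0 => //; apply: mulr_ge0 => //; exact: sqr_ge0.
have vt : v = 2 * (t ^+ 2 * y) by rewrite /y; field.
have /andP[h1 h2] := expRN_le2 y0.
have -> : v - 2 * (t ^+ 2 * (1 - expR (- y))) = 2 * (t ^+ 2 * (expR (- y) - 1 + y)).
  by rewrite [in LHS]vt; ring.
rewrite !ger0_norm ?divr_ge0 ?sqr_ge0 ?(ltW t0)// ?mulr_ge0 ?sqr_ge0//.
apply: (@le_trans _ _ (2 * (t ^+ 2 * (y ^+ 2 / 2)))).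
  by rewrite ler_wpM2l// ler_wpM2l ?sqr_ge0.
rewrite ler_pdivlMr//.
have -> : v ^+ 2 = 4 * (t ^+ 4 * y ^+ 2) by rewrite vt; ring.
have -> : 2 * (t ^+ 2 * (y ^+ 2 / 2)) * t = t ^+ 3 * y ^+ 2 by field.
have h3 : t ^+ 3 * y ^+ 2 <= t ^+ 4 * y ^+ 2 by rewrite ler_wpM2r ?sqr_ge0// ler_weXn2l.
have : 0 <= t ^+ 4 * y ^+ 2 by rewrite mulr_ge0 ?sqr_ge0 ?exprn_ge0// ltW.
lra.
Qed.

End trig_expectations.

Lemma Ex_law d (T : measurableType d) d' (T' : measurableType d') (R : realType)
    (P : probability T R) (P' : probability T' R) (X : T -> R) (Y : T' -> R) (h : R -> R) :
  measurable_fun setT X -> measurable_fun setT Y ->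
  (forall A : set R, measurable A -> P (X @^-1` A) = P' (Y @^-1` A)) ->
  measurable_fun setT h -> L1 P (h \o X) -> L1 P' (h \o Y) ->
  Ex P (h \o X) = Ex P' (h \o Y).
Proof.
move=> mX mY XY mh LX LY; apply: EFin_inj; rewrite !ExE//.
have mEh : measurable_fun setT (EFin \o h) by exact/measurable_EFinP.
have h1 := @integral_distribution _ _ _ _ _ P (mkRV mX) (EFin \o h) mEh LX.
have h2 := @integral_distribution _ _ _ _ _ P' (mkRV mY) (EFin \o h) mEh LY.
rewrite /= in h1 h2; rewrite -h1 -h2.
by apply: eq_measure_integral => A mA _; exact: XY.
Qed.

(** * Central limit theorem by characteristic functions *)

Section clt.
Context d (T : measurableType d) (R : realType) (P : probability T R).

(* One step of the recursion for characteristic functions: multiplying by the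
   characteristic function [a + i b] of a summand or by [w] differs little. *)
Lemma trig_step (a b w C D : R) : `|C| <= 1 -> `|D| <= 1 ->
  `|(C * a - D * b) - w * C| <= `|a - w| + `|b|.
Proof.
move=> C1 D1; have -> : C * a - D * b - w * C = C * (a - w) - D * b by ring.
by rewrite (le_trans (ler_normB _ _))// !normrM lerD// ler_piMl.
Qed.

(** The characteristic function of the sum is compared with the [n]-th power of [w n]. Replacing one
    factor [a n + i b n] by [w n] costs [|a n - w n| + |b n|], and [n] times this tends to 0: [a n]
    and [w n] have the same expansion [1 - v / (2 n)] up to [o (1 / n)], and [b n] is [o (1 / n)] as
    the mean vanishes. *)
Lemma central_limit (X : nat -> T -> R) (v : R) :
  (forall i, measurable_fun setT (X i)) -> indep_fam P X ->
  (forall i (A : set R), measurable A -> P (X i @^-1` A) = P (X 0 @^-1` A)) ->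
  L1 P (fun w => X 0 w ^+ 2) -> Ex P (X 0) = 0 -> Ex P (fun w => X 0 w ^+ 2) = v ->
  forall c, Ex P (fun w => cos (c + (Num.sqrt n%:R)^-1 * \sum_(i < n) X i w))
    @[n --> \oo] --> cos c * expR (- (v / 2)).
Proof.
move=> mX iX idX LX2 EX0 EX2 c; have LX := L1_of_L2 (mX 0%N) LX2.
have v0 : 0 <= v by rewrite -EX2; apply: Ex_ge0 => w; rewrite sqr_ge0.
pose a (n : nat) := Ex P (fun w => cos ((Num.sqrt n%:R)^-1 * X 0 w)).
pose b (n : nat) := Ex P (fun w => sin ((Num.sqrt n%:R)^-1 * X 0 w)).
(* The [n]-th power of [w n] is exactly the limit, so no limit of powers has to be taken. *)
pose w (n : nat) := expR (- (v / 2 / n%:R)).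
have key n : (0 < n)%N ->
    `|Ex P (fun w => cos (c + (Num.sqrt n%:R)^-1 * \sum_(i < n) X i w))
      - cos c * expR (- (v / 2))| <= n%:R * (`|a n - w n| + `|b n|).
  move=> n0; set r := (Num.sqrt n%:R)^-1.
  have w1 : w n <= 1.
    by rewrite -[leRHS]expR0 ler_expR oppr_le0 !divr_ge0.
  have step k : `|Ex P (fun t => cos (c + r * \sum_(i < k) X i t)) - cos c * w n ^+ k|
      <= k%:R * (`|a n - w n| + `|b n|).
    elim: k => [|k IH].
      rewrite mul0r expr0 mulr1; under eq_fun do rewrite big_ord0 mulr0 addr0.
      by rewrite Ex_cst subrr normr0.
    have mS : measurable_fun setT (fun t => r * \sum_(i < k) X i t).
      by apply: measurable_funM => //; exact: measurable_sum.
    have mr : measurable_fun setT (fun t => r * X k t) by exact: measurable_funM.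
    have mrr : measurable_fun setT ( *%R r) by exact: measurable_funM.
    have := @Ex_cosD_indep _ _ _ P (fun t => r * \sum_(i < k) X i t)
       (fun t => r * X k t) c mS mr (indep2_comp (indep_fam_sum k mX iX) mrr mrr).
    have -> : (fun t => cos (c + (r * (\sum_(i < k) X i t) + r * X k t))) =
              (fun t => cos (c + r * \sum_(i < k.+1) X i t)).
      by apply/funext => t; rewrite big_ord_recr/= mulrDr.
    have -> : Ex P (fun t => cos (r * X k t)) = a n.
      apply: (@Ex_law _ _ _ _ _ P P (X k) (X 0%N) (fun x => cos (r * x)) (mX _) (mX _) (idX k)).
      - have := measurable_cosu 0 r (@measurable_id _ R setT); congr measurable_fun.
        by apply/funext => t; rewrite add0r.
      - exact: L1_cos.
      - by apply: L1_cos; exact: measurable_funM.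
    have -> : Ex P (fun t => sin (r * X k t)) = b n.
      apply: (@Ex_law _ _ _ _ _ P P (X k) (X 0%N) (fun x => sin (r * x)) (mX _) (mX _) (idX k)).
      - have := measurable_cosu (- (pi / 2)) r (@measurable_id _ R setT).
        by congr measurable_fun; apply/funext => t; rewrite addrC cosBpihalf.
      - exact: L1_sin.
      - by apply: L1_sin; exact: measurable_funM.
    move=> ->; set C := Ex P _ in IH *; set D := Ex P _.
    have mcS : measurable_fun setT (fun t => c + r * \sum_(i < k) X i t).
      exact: measurable_funD.
    have C1 : `|C| <= 1.
      apply: Ex_bound; first exact: L1_meas (L1_cos P mcS).
      by move=> t; rewrite ler_norml cos_geN1 cos_le1.
    have D1 : `|D| <= 1.
      apply: Ex_bound; first exact: L1_meas (L1_sin P mcS).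
      by move=> t; rewrite ler_norml sin_geN1 sin_le1.
    have -> : C * a n - D * b n - cos c * w n ^+ k.+1 =
        (C * a n - D * b n - w n * C) + w n * (C - cos c * w n ^+ k).
      by rewrite exprS; ring.
    rewrite (le_trans (ler_normD _ _))// -natr1 mulrDl mul1r addrC lerD//.
      rewrite normrM ger0_norm ?expR_ge0// (le_trans _ IH)// ler_piMl//.
    exact: trig_step.
  have := step n; rewrite /w -expRM_natl.
  have -> : n%:R * - (v / 2 / n%:R) = - (v / 2) :> R.
    by field; rewrite pnatr_eq0 -lt0n.
  by [].
have sqS (n : nat) : (Num.sqrt n.+1%:R : R) ^+ 2 = n.+1%:R by rewrite sqr_sqrtr.
have sq0 (n : nat) : 0 < Num.sqrt n.+1%:R :> R by rewrite sqrtr_gt0 ltr0n.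
have lim0 : (Num.sqrt n.+1%:R)^-1 @[n --> \oo] --> (0 : R).
  apply/cvgrPdist_le => e e0.
  have e20 : 0 < e ^+ 2 by rewrite exprn_gt0.
  have /cvgrPdist_le/(_ _ e20) := @cvg_harmonic R.
  apply: filterS => n; rewrite !sub0r !normrN.
  rewrite !ger0_norm ?invr_ge0 ?(ltW (sq0 n))// => h.
  by rewrite -(@ler_pXn2r _ 2) ?nnegrE ?(ltW e0) ?invr_ge0 ?(ltW (sq0 n))// exprVn sqS.
have la : n.+1%:R * (a n.+1 - 1) @[n --> \oo] --> - (v / 2).
  have -> : - (v / 2) = Ex P (fun t => (- (1 / 2)) * X 0 t ^+ 2).
    by rewrite ExZ// EX2; field.
  rewrite (_ : (fun n => _) = fun n : nat => Ex P (fun t =>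
      n.+1%:R * (cos ((Num.sqrt n.+1%:R)^-1 * X 0 t) - 1))); last first.
    have Lc n : L1 P (fun t => cos ((Num.sqrt n.+1%:R)^-1 * X 0 t)).
      by apply: L1_cos; exact: measurable_funM.
    apply/funext => n; rewrite ExZ; last by apply: L1B; [exact: Lc|exact: L1_cst].
    by rewrite ExB; [rewrite Ex_cst|exact: Lc|exact: L1_cst].
  apply: (Ex_dct (Y := fun t => X 0 t ^+ 2)) => //.
  - move=> n; apply: measurable_funM => //; apply: measurable_funB => //.
    by apply: L1_meas (L1_cos P _); exact: measurable_funM.
  - by apply: measurable_funM => //; exact: measurable_funX.
  - apply: aeW => t; set x := X 0 t; apply/cvgrPdist_le => e e0.
    have /cvgrPdist_le/(_ _ e0) := cvg_harmonic_scale (x ^+ 4 / 24).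
    apply: filterS => n; rewrite sub0r normrN => h; apply: le_trans h.
    set q : R := Num.sqrt n.+1%:R; have q0 : 0 < q := sq0 n.
    rewrite -(sqS n) -/q; set y := q^-1 * x.
    have xq : x = q * y by rewrite /y mulVKf// gt_eqF.
    have h1 := cos_ge y; have h2 := cos_le y.
    have -> : x ^+ 4 / 24 / q ^+ 2 = q ^+ 2 * (y ^+ 4 / 24).
      by rewrite xq; field; rewrite gt_eqF.
    have -> : - (1 / 2) * x ^+ 2 - q ^+ 2 * (cos y - 1) =
       - (q ^+ 2 * (cos y - (1 - y ^+ 2 / 2))) by rewrite xq; field.
    rewrite normrN !(normrM (q ^+ 2)) (ger0_norm (sqr_ge0 q)) ler_wpM2l ?sqr_ge0//.
    rewrite ger0_norm ?subr_ge0// ger0_norm ?divr_ge0//; lra.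
  - move=> n t; set x := X 0 t; set q : R := Num.sqrt n.+1%:R.
    have q0 : 0 < q := sq0 n; rewrite -(sqS n) -/q; set y := q^-1 * x.
    have xq : x = q * y by rewrite /y mulVKf// gt_eqF.
    rewrite normrM (ger0_norm (sqr_ge0 q)) xq exprMn ler_wpM2l ?sqr_ge0//.
    have := cos_ge y; have := cos_le1 y; have := sqr_ge0 y => h1 h2 h3.
    by rewrite ler0_norm; lra.
(* The mean being 0, the sine may be replaced by the sine minus its argument; this is of order 3
   pointwise and dominated by the square, so that second moments suffice. *)
have lb : n.+1%:R * b n.+1 @[n --> \oo] --> (0 : R).
  rewrite -[X in _ --> X](Ex_cst P 0).
  rewrite (_ : (fun n => _) = fun n : nat => Ex P (fun t => n.+1%:R *
      (sin ((Num.sqrt n.+1%:R)^-1 * X 0 t) - (Num.sqrt n.+1%:R)^-1 * X 0 t))); last first.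
    have Ls n : L1 P (fun t => sin ((Num.sqrt n.+1%:R)^-1 * X 0 t)).
      by apply: L1_sin; exact: measurable_funM.
    apply/funext => n; rewrite ExZ ?ExB//.
    + by rewrite ExZ// EX0 mulr0 subr0.
    + exact: L1Z.
    + by apply: L1B => //; exact: L1Z.
  apply: (Ex_dct (Y := fun t => X 0 t ^+ 2)) => //.
  - move=> n; apply: measurable_funM => //; apply: measurable_funB => //.
      by apply: L1_meas (L1_sin P _); exact: measurable_funM.
    exact: measurable_funM.
  - apply: aeW => t; set x := X 0 t; apply/cvgrPdist_le => e e0.
    have l3 : `|x| ^+ 3 / 6 * (Num.sqrt n.+1%:R)^-1 @[n --> \oo] --> (0 : R).
      by rewrite -[X in _ --> X](mulr0 (`|x| ^+ 3 / 6)); apply: cvgMr.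
    have /cvgrPdist_le/(_ _ e0) := l3.
    apply: filterS => n; rewrite sub0r normrN => h; rewrite sub0r normrN.
    apply: le_trans h; set q : R := Num.sqrt n.+1%:R; have q0 : 0 < q := sq0 n.
    rewrite -(sqS n) -/q; set y := q^-1 * x.
    have xq : x = q * y by rewrite /y mulVKf// gt_eqF.
    rewrite normrM (ger0_norm (sqr_ge0 q)).
    have -> : `|x| ^+ 3 / 6 / q = q ^+ 2 * (`|y| ^+ 3 / 6).
      by rewrite xq normrM (gtr0_norm q0); field; rewrite gt_eqF.
    rewrite [leRHS]ger0_norm ?mulr_ge0 ?sqr_ge0 ?exprn_ge0// ?invr_ge0 ?(ltW q0)//.
    by rewrite ler_wpM2l ?sqr_ge0// normr_sinB_le3.
  - move=> n t; set x := X 0 t; set q : R := Num.sqrt n.+1%:R.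
    have q0 : 0 < q := sq0 n; rewrite -(sqS n) -/q; set y := q^-1 * x.
    have xq : x = q * y by rewrite /y mulVKf// gt_eqF.
    rewrite normrM (ger0_norm (sqr_ge0 q)) xq exprMn ler_wpM2l ?sqr_ge0//.
    exact: normr_sinB_le2.
have lw : n.+1%:R * (w n.+1 - 1) @[n --> \oo] --> - (v / 2).
  apply/cvgrPdist_le => e e0.
  have /cvgrPdist_le/(_ _ e0) := cvg_harmonic_scale ((v / 2) ^+ 2).
  apply: filterS => n; rewrite sub0r normrN => h; apply: le_trans h.
  have t0 : 0 < n.+1%:R :> R by rewrite ltr0n.
  rewrite /w; set t := n.+1%:R in t0 *; set y := v / 2 / t.
  have y0 : 0 <= y by rewrite !divr_ge0// ltW.
  have vt : v / 2 = t * y by rewrite [RHS]mulrC /y divfK// gt_eqF.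
  have /andP[h1 h2] := expRN_le2 y0.
  rewrite vt [leRHS]ger0_norm ?divr_ge0 ?sqr_ge0 ?(ltW t0)//.
  have -> : - (t * y) - t * (expR (- y) - 1) = - (t * (expR (- y) - 1 + y)) by ring.
  have -> : (t * y) ^+ 2 / t = t * y ^+ 2 by field; rewrite gt_eqF.
  rewrite normrN normrM (gtr0_norm t0) ler_wpM2l ?(ltW t0)// ger0_norm//.
  by rewrite (le_trans h2)// ler_pdivrMr// ler_peMr ?sqr_ge0// ler1n.
have lim : n.+1%:R * (`|a n.+1 - w n.+1| + `|b n.+1|) @[n --> \oo] --> (0 : R).
  have h : `|n.+1%:R * (a n.+1 - 1) - n.+1%:R * (w n.+1 - 1)| + `|n.+1%:R * b n.+1|
      @[n --> \oo] --> (0 : R).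
    have -> : (0 : R) = `|- (v / 2) - - (v / 2)| + `|0 : R| by rewrite subrr !normr0 addr0.
    by apply: cvgD; apply: cvg_norm => //; exact: cvgB.
  apply: cvg_trans h.
  apply: near_eq_cvg; apply: nearW => n /=.
  rewrite -mulrBr !normrM (ger0_norm (ler0n _ _)) mulrDr; congr (_ * `|_| + _).
  by rewrite opprB addrA subrK.
apply/cvgrPdist_le => e e0.
have /cvgrPdist_le/(_ _ e0)[N _ HN] := lim; exists N.+1 => // -[//|n] /= hn.
have := HN n hn; rewrite /= sub0r normrN => h; rewrite distrC (le_trans (key _ _))// (le_trans _ h)//.
exact: ler_norm.
Qed.

Lemma isN_sum (Z : nat -> T -> R) (x : nat -> R) : indep_fam P Z ->
  (forall i, isN P (Z i) 1) -> forall k,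
  isN P (fun w => \sum_(i < k) x i * Z i w) (\sum_(i < k) x i ^+ 2).
Proof.
move=> iZ NZ; have mZ i := (NZ i).1.
have mxZ i : measurable_fun setT (fun w => x i * Z i w) by exact: measurable_funM.
elim=> [|k [_ IH]].
  split; first by under eq_fun do rewrite big_ord0; exact: measurable_cst.
  move=> c u; under eq_fun do rewrite big_ord0 mulr0 addr0.
  by rewrite Ex_cst big_ord0 !mul0r oppr0 expR0 mulr1.
split; first by apply: measurable_sum.
move=> c u.
have ixZ : indep_fam P (fun i w => x i * Z i w).
  apply: (@indep_fam_comp _ _ _ _ Z (fun i z => x i * z)) => // i.
  exact: measurable_funM.
have muu : measurable_fun setT ( *%R u) by exact: measurable_funM.
have := @Ex_cosD_indep _ _ _ P (fun t => u * \sum_(i < k) x i * Z i t)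
  (fun t => u * (x k * Z k t)) c _ _ (indep2_comp (indep_fam_sum k mxZ ixZ) muu muu).
have -> : (fun t => cos (c + (u * (\sum_(i < k) x i * Z i t) + u * (x k * Z k t)))) =
          (fun t => cos (c + u * \sum_(i < k.+1) x i * Z i t)).
  by apply/funext => t; rewrite big_ord_recr/= mulrDr.
move=> ->; last 2 first.
- by apply: measurable_funM => //; exact: measurable_sum.
- exact: measurable_funM.
have -> : Ex P (fun t => sin (u * (x k * Z k t))) = 0.
  rewrite -(isN_sin (u * x k) (NZ k)); congr Ex; apply/funext => t.
  by rewrite mulrA.
have -> : Ex P (fun t => cos (u * (x k * Z k t))) = expR (- (1 * (u * x k) ^+ 2 / 2)).
  rewrite -(isN_cos (u * x k) (NZ k)); congr Ex; apply/funext => t.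
  by rewrite mulrA.
rewrite IH mulr0 subr0 -mulrA -expRD big_ord_recr/=; congr (_ * expR _).
by field.
Qed.

End clt.

(** * Quantile transform and Gaussian families *)

Lemma law_eq_rays d (T : measurableType d) d' (T' : measurableType d') (R : realType)
    (P : probability T R) (P' : probability T' R) (X : T -> R) (Y : T' -> R) :
  measurable_fun setT X -> measurable_fun setT Y ->
  (forall y, P (X @^-1` `]y, +oo[) = P' (Y @^-1` `]y, +oo[)) ->
  forall A : set R, measurable A -> P (X @^-1` A) = P' (Y @^-1` A).
Proof.
move=> mX mY XY A mA.
apply: (@measure_unique _ R _ (@RGenOInfty.G R) (fun n => `](- n%:R), +oo[%classic) _ _ _ _
  (distribution P (mkRV mX)) (distribution P' (mkRV mY)) _ _ A mA).
- exact: RGenOInfty.measurableE.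
- move=> _ _ [x ->] [y ->]; exists (Num.max x y).
  by apply/seteqP; split=> z /=; rewrite !in_itv/= !andbT gt_max => /andP.
- by move=> n; exists (- n%:R).
- apply/seteqP; split=> // x _; exists (Num.bound `|x : R|) => //=.
  rewrite in_itv/= andbT ltrNl (le_lt_trans (ler_norm _))// normrN.
  by rewrite archi_boundP.
- by move=> _ [x ->]; exact: XY.
- by move=> n; rewrite (le_lt_trans (probability_le1 _ _)) ?ltry.
Qed.

Section quantile_function.
Context d (T : measurableType d) (R : realType) (P : probability T R).
Variables (X : T -> R) (F : R -> R).
Hypothesis mX : measurable_fun setT X.
Hypothesis XF : forall x, P (X @^-1` `]-oo, x]) = (F x)%:E.
Hypothesis F_inv : forall p : R, 0 < p < 1 -> exists! x : R, F x = p.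
Local Notation Q := (cdf_inv F).

Let mray (x : R) : measurable (X @^-1` `]-oo, x]).
Proof. exact: measurable_preimage. Qed.

Lemma cdf_homo x y : x <= y -> F x <= F y.
Proof.
move=> xy; rewrite -lee_fin -!XF; apply: le_measure; rewrite ?inE//.
by move=> w /=; rewrite !in_itv/= => /le_trans; apply.
Qed.

Lemma cdf_fun_ge0 x : 0 <= F x.
Proof. by rewrite -lee_fin -XF. Qed.

Lemma cdf_fun_le1 x : F x <= 1.
Proof. by rewrite -lee_fin -XF probability_le1. Qed.

Lemma cdf_invK p : 0 < p < 1 -> F (Q p) = p.
Proof.
move=> /F_inv[x [Fx _]]; rewrite /cdf_inv; case: xgetP => [y _ //|/(_ x)].
by rewrite /= Fx.
Qed.

Lemma cdf_inv_uniq p x : 0 < p < 1 -> F x = p -> x = Q p.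
Proof.
move=> p01 Fx; have [y [_ yu]] := F_inv p01.
by rewrite -(yu x Fx) -(yu (Q p) (cdf_invK p01)).
Qed.

Lemma cdf_le_inv p x : 0 < p < 1 -> (F x <= p) = (x <= Q p).
Proof.
move=> p01; apply/idP/idP => [Fx|/cdf_homo]; last by rewrite cdf_invK.
rewrite leNgt; apply/negP => Qx; have := cdf_homo (ltW Qx); rewrite cdf_invK// => pF.
have /cdf_inv_uniq -/(_ p01) xQ : F x = p by apply/eqP; rewrite eq_le Fx.
by move: Qx; rewrite -xQ ltxx.
Qed.

Lemma cdf_lt_inv p x : 0 < p < 1 -> (F x < p) = (x < Q p).
Proof.
move=> p01; rewrite lt_neqAle [RHS]lt_neqAle cdf_le_inv//; congr (_ && _).
apply/idP/idP; apply: contra => /eqP h; apply/eqP; first by rewrite h cdf_invK.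
exact: cdf_inv_uniq.
Qed.

Lemma cdf_inv_le p q : 0 < p < 1 -> 0 < q < 1 -> p <= q -> Q p <= Q q.
Proof. by move=> p01 q01 pq; rewrite -cdf_le_inv// cdf_invK. Qed.

(** By inversion [F (Q p - e) < p < F (Q p + e)]; a level close enough to [p] still lies between
    these two values, and its quantile within [e] of [Q p]. *)
Lemma cdf_inv_continuous p : 0 < p < 1 -> {for p, continuous Q}.
Proof.
move=> p01; apply/cvgrPdist_lt => e e0.
have h1 : F (Q p - e) < p by rewrite cdf_lt_inv// ltrBlDr ltrDl.
have h2 : p < F (Q p + e) by rewrite ltNge cdf_le_inv// -ltNge ltrDl.
have /andP[p0 p1] := p01.
pose dl := Num.min (Num.min p (1 - p)) (Num.min (p - F (Q p - e)) (F (Q p + e) - p)).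
have dl0 : 0 < dl by rewrite !lt_min p0 !subr_gt0 p1 h1 h2.
apply/nbhs_ballP; exists dl => // q; rewrite /ball/= !lt_min => /andP[/andP[k1 k2] /andP[k3 k4]].
move: k1 k2 k3 k4; rewrite !ltr_norml => /andP[? ?] /andP[? ?] /andP[? ?] /andP[? ?].
have q01 : 0 < q < 1 by apply/andP; split; lra.
have a1 : Q p - e < Q q by rewrite -cdf_lt_inv//; lra.
have a2 : Q q < Q p + e by rewrite ltNge -cdf_le_inv// -ltNge; lra.
by apply/andP; split; lra.
Qed.

(** Inside []0, 1[] the event is [X <= Q t]. The endpoints are treated apart, [F] being invertible
    only between them; level 0 is reached by letting a positive level decrease. *)
Lemma cdf_uniform t : 0 <= t <= 1 -> P [set w | F (X w) <= t] = t%:E.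
Proof.
move=> /andP[t0 t1].
have in01 s : 0 < s < 1 -> P [set w | F (X w) <= s] = s%:E.
  move=> s01; have -> : [set w | F (X w) <= s] = X @^-1` `]-oo, (Q s)].
    by apply/seteqP; split=> w /=; rewrite in_itv/= cdf_le_inv.
  by rewrite XF cdf_invK.
move: t1; rewrite le_eqVlt => /predU1P[->|t1].
  rewrite (_ : [set w | _] = setT) ?probability_setT//.
  by apply/seteqP; split=> w //= _; exact: cdf_fun_le1.
move: t0; rewrite le_eqVlt => /predU1P[<-|t0]; last by rewrite in01 ?t0.
have m0 : measurable [set w | F (X w) <= 0].
  have -> : [set w | F (X w) <= 0] = \bigcap_n [set w | F (X w) <= n.+2%:R^-1].
    apply/seteqP; split=> w /= h; first by move=> n _ /=; rewrite (le_trans h)// invr_ge0.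
    apply/ler_addgt0Pl => e e0; rewrite addr0.
    have [n _ /(_ n (leqnn n))] := near_infty_natSinv_lt (PosNum e0).
    move=> /ltW ne; rewrite (le_trans _ ne)// (le_trans (h n I))//.
    by rewrite lef_pV2 ?posrE ?ltr0n// ler_nat.
  apply: bigcap_measurableType => n _.
  have s01 : 0 < (n.+2%:R^-1 : R) < 1.
    by rewrite invr_gt0 ltr0n/= invf_lt1 ?ltr0n// ltr1n.
  have -> : [set w | F (X w) <= n.+2%:R^-1] = X @^-1` `]-oo, (Q n.+2%:R^-1)].
    by apply/seteqP; split=> w /=; rewrite in_itv/= cdf_le_inv.
  exact: mray.
apply/eqP; rewrite eq_le measure_ge0 andbT; apply/lee_addgt0Pr => e e0.
rewrite add0e; have [e1|e1] := ltP e 1; last first.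
  by rewrite (le_trans (probability_le1 _ _))// lee_fin.
have e01 : 0 < e < 1 by rewrite e0.
rewrite -(in01 _ e01); apply: le_measure; rewrite ?inE//.
  have -> : [set w | F (X w) <= e] = X @^-1` `]-oo, (Q e)].
    by apply/seteqP; split=> w /=; rewrite in_itv/= cdf_le_inv.
  exact: mray.
by move=> w /= h; rewrite (le_trans h)// ltW.
Qed.

Lemma prob_eq_off (A B C : set T) : measurable A -> measurable B -> measurable C ->
  P C = 0 -> (forall w, ~ C w -> A w <-> B w) -> P A = P B.
Proof.
move=> mA mB mC PC AB; rewrite -EFin_prob// -[RHS]EFin_prob// -!Ex_indic//; congr EFin.
apply: Ex_ae_eq; [exact: measurable_indic|exact: measurable_indic|].
exists C; split=> // w /= h; apply: contrapT => /AB AB'; apply: h.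
by rewrite !indicE; congr (_%:R); congr nat_of_bool; apply/idP/idP; rewrite !inE => /AB'.
Qed.

Lemma cdf_meas : measurable_fun setT F.
Proof. by apply: nondecreasing_measurable => // x y; exact: cdf_homo. Qed.

(* The quantile transform turns the uniform variable [F (X w)] into a normal one. *)
Lemma isN_quantile : exists2 h : R -> R, measurable_fun setT h &
  isN P (fun w => h (X w)) 1.
Proof.
pose N : probability (measurableTypeR R) R := normal_prob (0 : R) 1.
pose idR : {mfun (measurableTypeR R) >-> R} :=
  @mkRV _ (measurableTypeR R) _ R idfun (@measurable_id _ _ setT).
pose Phi (x : R) := fine (N `]-oo, x]%classic).
have PhiE x : (Phi x)%:E = N `]-oo, x]%classic by rewrite EFin_prob.
have cE x : cdf (P := N) idR x = (Phi x)%:E by rewrite PhiE.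
have cdfE : cdf (P := N) idR = EFin \o Phi by apply/funext => x; exact: cE.
have Phi_homo x y : x <= y -> Phi x <= Phi y.
  by move=> xy; rewrite -lee_fin -!cE; exact: cdf_nondecreasing.
pose S v := [set x | v <= Phi x].
have S0 v : v < 1 -> S v !=set0.
  move=> v1; have := @cvg_cdfy1 _ _ _ N idR.
  rewrite cdfE.
  move=> /fine_cvg/= /cvgrPdist_lt/(_ (1 - v)).
  rewrite subr_gt0 => /(_ v1)[M [_ HM]].
  exists (M + 1); rewrite /S /=; have := HM (M + 1).
  by rewrite ltrDl ltr01 => /(_ isT)/=; rewrite ltr_norml => /andP[_]; lra.
have Slb v : 0 < v -> has_lbound (S v).
  move=> v0; have := @cvg_cdfNy0 _ _ _ N idR.
  rewrite cdfE.
  move=> /fine_cvg/= /cvgrPdist_lt/(_ v v0)[M [_ HM]].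
  exists (M - 1) => x Sx; rewrite leNgt; apply/negP => xM.
  have := HM (M - 1); rewrite ltrBlDr ltrDl ltr01 => /(_ isT)/=.
  rewrite sub0r normrN ltr_norml => /andP[_ h].
  have := Phi_homo _ _ (ltW xM); move: Sx; rewrite /S/=; lra.
pose q v := inf (S v).
(* The generalized inverse [q] of the normal distribution function is adjoint to it, thanks to right
   continuity alone. *)
have qP v x : 0 < v < 1 -> (q v <= x) = (v <= Phi x).
  move=> /andP[v0 v1]; apply/idP/idP => [qx|vx]; last first.
    by apply: ge_inf => //; exact: Slb.
  rewrite leNgt; apply/negP => xv.
  have := @cdf_right_continuous _ _ _ N idR x.
  rewrite cdfE.
  move=> /fine_cvg/= /cvgrPdist_lt/(_ (v - Phi x)).
  rewrite subr_gt0 => /(_ xv)[e /= e0 He].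
  have : q v < x + e / 2 by rewrite (le_lt_trans qx)// ltrDl divr_gt0.
  move=> /inf_lt -/(_ (S0 _ v1))[y Sy ye].
  have [yx|xy] := leP y x.
    by have := Phi_homo _ _ yx; move: Sy; rewrite /S/=; lra.
  have := He y; rewrite /= distrC gtr0_norm ?subr_gt0// => /(_ _ xy).
  have -> : y - x < e by lra.
  by move=> /(_ isT); rewrite ltr_norml => /andP[h _]; move: Sy; rewrite /S/=; lra.
(* The value 0 is a default on the levels 0 and 1, which [F (X w)] takes with probability 0. *)
pose h x := if 0 < F x < 1 then q (F x) else 0.
have mFlt t : measurable [set x | F x <= t].
  have -> : [set x | F x <= t] = F @^-1` `]-oo, t] by apply/seteqP; split=> x /=; rewrite in_itv.
  by apply: measurable_preimage => //; exact: cdf_meas.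
have mA : measurable [set x | 0 < F x < 1].
  have -> : [set x | 0 < F x < 1] = F @^-1` `]0, 1[ by apply/seteqP; split=> x /=; rewrite in_itv.
  by apply: measurable_preimage => //; exact: cdf_meas.
have hP y x : 0 < F x < 1 -> (y < h x) = (Phi y < F x).
  by move=> Fx; rewrite /h Fx ltNge qP// -ltNge.
have mh : measurable_fun setT h.
  move=> _; apply: (measurability _ (RGenOInfty.measurableE R)) => // _ [_ [y ->] <-].
  rewrite setTI (_ : _ @^-1` _ = ([set x | 0 < F x < 1] `&` ~` [set x | F x <= Phi y]) `|`
     (~` [set x | 0 < F x < 1] `&` [set _ | y < 0])).
    apply: measurableU; apply: measurableI => //.
    - exact: measurableC.
    - exact: measurableC.
    - by have [y0|y0] := boolP (y < 0); [rewrite (_ : [set _ | _] = setT)|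
        rewrite (_ : [set _ | _] = set0)] => //; apply/seteqP; split.
  apply/seteqP; split=> x /=; rewrite in_itv/= andbT.
    have [Fx|Fx] := boolP (0 < F x < 1); first by rewrite hP// => h1; left; split=> //; apply/negP; rewrite -ltNge.
    by rewrite /h (negbTE Fx) => y0; right; split=> //; exact/negP.
  case=> [[Fx /negP]|[/negP/negbTE Fx y0]]; first by rewrite -ltNge hP.
  by rewrite /h Fx.
have mhX : measurable_fun setT (h \o X) by exact: measurableT_comp.
have mFX t : measurable [set w | F (X w) <= t].
  exact: (measurable_preimage mX (mFlt t)).
have mAX : measurable [set w | 0 < F (X w) < 1].
  exact: (measurable_preimage mX mA).
have PA : P (~` [set w | 0 < F (X w) < 1]) = 0.
  apply/eqP; rewrite eq_le measure_ge0 andbT; apply/lee_addgt0Pr => e e0; rewrite add0e.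
  pose e' := Num.min e (1 / 2).
  have e'0 : 0 < e' by rewrite lt_min e0 divr_gt0.
  have e'1 : e' <= 1 / 2 by rewrite ge_min lexx orbT.
  have le01 : 0 <= 1 - e' <= 1 by apply/andP; split; lra.
  apply: (@le_trans _ _ (P ([set w | F (X w) <= 0] `|` ~` [set w | F (X w) <= 1 - e']))).
    apply: le_measure; rewrite ?inE//; first exact: measurableC.
      by apply: measurableU => //; exact: measurableC.
    move=> w /= /negP; rewrite negb_and -!leNgt => /orP[?|h1]; [by left|right].
    by apply/negP; rewrite -ltNge (lt_le_trans _ h1)// ltrBlDr ltrDl.
  have u0 : P [set w | F (X w) <= 0] = 0%:E by apply: cdf_uniform; rewrite lexx ler01.
  have u1 := cdf_uniform le01.
  have u2 : (P [set w | (F (X w) <= 0)%R] + P (~` [set w | (F (X w) <= 1 - e')%R]) <= e%:E)%E.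
    rewrite probability_setC// u0 u1 add0e -EFinB lee_fin opprB addrC subrK.
    by rewrite ge_min lexx.
  exact: (le_trans (measureU2 _ (mFX 0) (measurableC (mFX (1 - e')))) u2).
have law A : measurable A -> P ((h \o X) @^-1` A) = N A.
  move=> {}mA.
  apply: (@law_eq_rays _ _ _ _ _ P N (h \o X) idfun mhX (@measurable_id _ _ setT)) => // y.
  rewrite preimage_id.
  rewrite (@prob_eq_off _ (~` [set w | F (X w) <= Phi y]) _ _ _ (measurableC mAX) PA).
    + rewrite probability_setC//.
      rewrite cdf_uniform; last first.
        rewrite -!lee_fin PhiE measure_ge0/=; exact: probability_le1.
      by rewrite PhiE -probability_setC// setCitvl.
    + exact: measurable_preimage.
    + exact: measurableC.
    + move=> w /contrapT Fw /=; rewrite in_itv/= andbT.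
      by rewrite hP// ltNge; split=> /negP.
exists h => //; split=> // c u.
have mcu : measurable_fun setT (fun x : R => cos (c + u * x)).
  exact: (measurable_cosu c u (@measurable_id _ R setT)).
have := @Ex_cos_normal R 1 ltr01 c u; rewrite expr1n => <-.
have L1c : L1 P (fun w => cos (c + u * h (X w))) by exact: L1_cosu.
apply: (@Ex_law _ _ _ _ _ P N (h \o X) idfun (fun x => cos (c + u * x)) mhX
  (@measurable_id _ _ setT) law mcu L1c).
exact: (@L1_cosu _ (measurableTypeR R) R N idfun c u (@measurable_id _ _ setT)).
Qed.

End quantile_function.

(** * Gaussian families by Cholesky factorization *)

Section cholesky.
Context (R : realType).
Implicit Types (A : nat -> nat -> R) (s : seq (R * nat)).

(** The form is evaluated on lists of coefficient-index pairs, in which indices may repeat; adding a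
    pair then never requires a case distinction. *)
Definition qform A s : R := \sum_(p <- s) \sum_(q <- s) p.1 * q.1 * A p.2 q.2.

Definition psd A : Prop := (forall i j, A i j = A j i) /\ forall s, 0 <= qform A s.

(* A vanishing pivot is harmless: its row is null and [x / 0 = 0]. *)
Definition schur A r i j : R := A i j - A i r * A j r / A r r.

Lemma qform_cons A t r s : (forall i j, A i j = A j i) -> qform A ((t, r) :: s) =
  t ^+ 2 * A r r + 2 * t * (\sum_(p <- s) p.1 * A p.2 r) + qform A s.
Proof.
move=> sA; rewrite /qform !big_cons/=.
under [X in _ + X = _]eq_bigr do rewrite big_cons/=.
rewrite big_split/= -expr2 -addrA -[RHS]addrA; congr (_ + _); rewrite addrA; congr (_ + _).
rewrite [2 * t]mulr_natl mulr2n mulrDl !mulr_sumr; congr (_ + _).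
  by apply: eq_bigr => p _; rewrite sA mulrA.
by apply: eq_bigr => p _; ring.
Qed.

Lemma psd_diag A i : psd A -> 0 <= A i i.
Proof.
move=> [sA pA]; have := pA [:: (1, i)].
by rewrite /qform !big_seq1/= !mul1r.
Qed.

(** Along the direction [r] the form is affine in the coefficient [t]; a nonzero slope [2 A i r]
    would make it negative somewhere. *)
Lemma psd_diag0 A r i : psd A -> A r r = 0 -> A i r = 0.
Proof.
move=> [sA pA] Ar0; apply/eqP; rewrite eq_le.
have h t : 0 <= 2 * t * A i r + A i i.
  have := pA [:: (t, r); (1, i)].
  by rewrite qform_cons// Ar0 mulr0 add0r /qform !big_seq1/= !mul1r.
have [A0|A0] := eqVneq (A i r) 0; first by rewrite A0 lexx.
(* With this coefficient the form takes the value -1. *)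
have := h (- (A i i + 1) / (2 * A i r)).
by rewrite (_ : 2 * _ * _ + _ = -1) ?ler0N1//; field.
Qed.

(** The value of the reduced form at [s] is the minimum over [t] of the original form at [s]
    enlarged by the pair [(t, r)], attained at the coefficient used here. *)
Lemma psd_schur A r : psd A -> psd (schur A r).
Proof.
move=> pA; have [sA qA] := pA; split=> [i j|s].
  by rewrite /schur sA [A i r * _]mulrC.
have -> : qform (schur A r) s =
    qform A s - (\sum_(p <- s) p.1 * A p.2 r) ^+ 2 / A r r.
  rewrite /qform /schur expr2 -mulrA mulr_suml -sumrB; apply: eq_bigr => p _.
  rewrite mulr_suml mulr_sumr -sumrB; apply: eq_bigr => q _.
  by ring.
have [Ar0|Ar0] := eqVneq (A r r) 0; first by rewrite Ar0 invr0 mulr0 subr0.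
have := qA ((- (\sum_(p <- s) p.1 * A p.2 r) / A r r, r) :: s).
rewrite qform_cons// => h; apply: le_trans h _; rewrite le_eqVlt; apply/orP; left.
by apply/eqP; field.
Qed.

Fixpoint schurs A r : nat -> nat -> R :=
  if r is r'.+1 then schur (schurs A r') r' else A.

Lemma psd_schurs A r : psd A -> psd (schurs A r).
Proof. by move=> pA; elim: r => //= r; exact: psd_schur. Qed.

Lemma schurs0 A r i j : psd A -> (i < r)%N -> schurs A r i j = 0.
Proof.
move=> pA; elim: r i j => // r IH i j; rewrite ltnS leq_eqVlt => /predU1P[->|ir]/=.
  rewrite /schur; have [Ar0|Ar0] := eqVneq (schurs A r r r) 0.
    rewrite Ar0 !mul0r subr0 (psd_schurs r pA).1.
    exact: psd_diag0 (psd_schurs r pA) Ar0.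
  by rewrite (psd_schurs r pA).1 mulrAC mulfV// mul1r subrr.
by rewrite /schur (IH i j ir) (IH i r ir) !mul0r subr0.
Qed.

(** Entry in row [i], column [r] of the Cholesky factor; a zero pivot gives a zero column by the
    convention on division. *)
Definition chol A (r i : nat) : R := schurs A r i r / Num.sqrt (schurs A r r r).

Lemma chol0 A r i : psd A -> (i < r)%N -> chol A r i = 0.
Proof. by move=> pA ir; rewrite /chol schurs0// mul0r. Qed.

(** Each elimination removes one rank-one term; after [n] steps the rows below [n] are exhausted and
    nothing is left. *)
Lemma cholE A i j n : psd A -> (i < n)%N -> A i j = \sum_(r < n) chol A r i * chol A r j.
Proof.
move=> pA i_n.
have h m : A i j = \sum_(r < m) chol A r i * chol A r j + schurs A m i j.
  elim: m => [|m IH]; first by rewrite big_ord0 add0r.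
  rewrite big_ord_recr/= {1}IH -addrA; congr (_ + _); rewrite /schur /chol.
  have d0 := psd_diag m (psd_schurs m pA).
  have -> : schurs A m i m / Num.sqrt (schurs A m m m) *
      (schurs A m j m / Num.sqrt (schurs A m m m)) =
      schurs A m i m * schurs A m j m / schurs A m m m.
    by rewrite -[X in _ = _ / X](sqr_sqrtr d0) expr2 invfM; ring.
  by rewrite addrC subrK.
by rewrite {1}(h n) schurs0// addr0.
Qed.

(** As the factor is triangular, the [i]-th variable uses [Z 0] to [Z i] only. A whole sequence is
    thus built by finite sums, with no limit and no extension theorem. *)
Lemma gaussian_family d (T : measurableType d) (P : probability T R)
    (Z : nat -> T -> R) A : indep_fam P Z -> (forall i, isN P (Z i) 1) -> psd A ->
  exists G : nat -> T -> R, forall n (x : nat -> R),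
    isN P (fun w => \sum_(i < n) x i * G i w)
      (\sum_(i < n) \sum_(j < n) x i * x j * A i j).
Proof.
move=> iZ NZ pA; exists (fun i w => \sum_(r < i.+1) chol A r i * Z r w) => n x.
have -> : (fun w => \sum_(i < n) x i * \sum_(r < i.+1) chol A r i * Z r w) =
    fun w => \sum_(r < n) (\sum_(i < n) x i * chol A r i) * Z r w.
  apply/funext => w.
  under [RHS]eq_bigr do rewrite mulr_suml.
  rewrite exchange_big/=; apply: eq_bigr => i _; rewrite mulr_sumr.
  rewrite (big_ord_widen n (fun r => x i * (chol A r i * Z r w)))//.
  rewrite [LHS]big_mkcond/=; apply: eq_bigr => r _; rewrite mulrA.
  by case: ltnP => // ir; rewrite chol0// mulr0 mul0r.
have -> : \sum_(i < n) \sum_(j < n) x i * x j * A i j =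
    \sum_(r < n) (\sum_(i < n) x i * chol A r i) ^+ 2.
  under [RHS]eq_bigr do rewrite expr2 mulr_suml.
  rewrite [RHS]exchange_big/=; apply: eq_bigr => i _.
  under [RHS]eq_bigr do rewrite mulr_sumr.
  rewrite [RHS]exchange_big/=; apply: eq_bigr => j _.
  rewrite (@cholE A i j n)// mulr_sumr; apply: eq_bigr => r _; ring.
exact: (isN_sum (fun r => \sum_(i < n) x i * chol A r i) iZ NZ n).
Qed.

End cholesky.

(** * Uniform empirical process *)

Section moments.
Context d (T : measurableType d) (R : realType) (P : probability T R).
Variables (X : nat -> T -> R) (h : R).
Hypothesis mX : forall i, measurable_fun setT (X i).
Hypothesis iX : indep_fam P X.
Hypothesis X1 : forall i w, `|X i w| <= 1.
Hypothesis EX : forall i, Ex P (X i) = 0.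
Hypothesis EX2 : forall i, Ex P (fun w => X i w ^+ 2) <= h.

Let S n w := \sum_(i < n) X i w.

Let mS n : measurable_fun setT (S n). Proof. exact: measurable_sum. Qed.

Let Sn n w : `|S n w| <= n%:R.
Proof.
rewrite (le_trans (ler_norm_sum _ _ _))//.
rewrite (le_trans (ler_sum _ (fun (i : 'I_n) _ => X1 i w)))// sumr_const card_ord.
by rewrite -mulr_natl mulr1.
Qed.

Let LSX n a b : L1 P (fun w => S n w ^+ a * X n w ^+ b).
Proof.
apply: (@L1_bounded _ _ _ _ _ (n%:R ^+ a)).
  by apply: measurable_funM; exact: measurable_funX.
move=> w; rewrite normrM !normrX -[leRHS]mulr1 ler_pM ?exprn_ge0//.
  by rewrite lerXn2r ?nnegrE ?Sn.
by rewrite exprn_ile1.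
Qed.

Let LS n a : L1 P (fun w => S n w ^+ a).
Proof.
by have := LSX n a 0; congr (L1 P _); apply/funext => w; rewrite expr0 mulr1.
Qed.

Let LX n b : L1 P (fun w => X n w ^+ b).
Proof.
by have := LSX n 0 b; congr (L1 P _); apply/funext => w; rewrite expr0 mul1r.
Qed.

Let ESX n a b : Ex P (fun w => S n w ^+ a * X n w ^+ b) =
  Ex P (fun w => S n w ^+ a) * Ex P (fun w => X n w ^+ b).
Proof.
have i2 := indep2_comp (indep_fam_sum n mX iX)
  (@measurable_funX _ _ R setT idfun a (@measurable_id _ _ setT))
  (@measurable_funX _ _ R setT idfun b (@measurable_id _ _ setT)).
exact: (indep2_ExM i2 (LS n a) (LX n b)).2.
Qed.

Let LSZ c n a b : L1 P (fun w => c * (S n w ^+ a * X n w ^+ b)).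
Proof. exact: L1Z. Qed.

Let EX1 n : Ex P (fun w => X n w ^+ 1) = 0.
Proof. exact: EX. Qed.

Let ES1 n : Ex P (fun w => S n w ^+ 1) = 0.
Proof.
rewrite -[RHS](_ : \sum_(i < n) Ex P (X i) = 0); last by rewrite big1.
by rewrite -(@Ex_sum _ _ _ P _ _ (fun i : 'I_n => X i) (fun i => LX i 1)).
Qed.

Lemma sum_moment2 n : Ex P (fun w => (\sum_(i < n) X i w) ^+ 2) <= n%:R * h.
Proof.
elim: n => [|n IH].
  under eq_fun do rewrite big_ord0 expr0n/=.
  by rewrite Ex_cst mul0r.
have -> : (fun w => (\sum_(i < n.+1) X i w) ^+ 2) =
    (fun w => (S n w ^+ 2 + 2 * (S n w ^+ 1 * X n w ^+ 1)) + X n w ^+ 2).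
  by apply/funext => w; rewrite big_ord_recr/= /S; ring.
rewrite ExD//; last by apply: L1D.
rewrite ExD//.
rewrite ExZ// ESX EX1 mulr0 mulr0 addr0 -natr1 mulrDl mul1r.
by rewrite lerD.
Qed.

(** In the expansion of the fourth power of a sum with one more term, the cross terms with a factor
    of degree 1 vanish by independence and centring; as the variables are bounded by 1, their fourth
    moments are also at most [h]. *)
Lemma sum_moment4 n : Ex P (fun w => (\sum_(i < n) X i w) ^+ 4) <=
  3 * (n%:R * h) ^+ 2 + n%:R * h.
Proof.
elim: n => [|n IH].
  under eq_fun do rewrite big_ord0 expr0n/=.
  by rewrite Ex_cst mul0r expr0n/= mulr0 addr0.
have -> : (fun w => (\sum_(i < n.+1) X i w) ^+ 4) =
    (fun w => (((S n w ^+ 4 + 4 * (S n w ^+ 3 * X n w ^+ 1)) +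
      6 * (S n w ^+ 2 * X n w ^+ 2)) + 4 * (S n w ^+ 1 * X n w ^+ 3)) + X n w ^+ 4).
  by apply/funext => w; rewrite big_ord_recr/= /S; ring.
rewrite ExD//; last by do 3 (apply: L1D => //).
rewrite ExD//; last by do 2 (apply: L1D => //).
rewrite ExD//; last by apply: L1D.
rewrite ExD//.
rewrite !ExZ// !ESX EX1 ES1 !mulr0 !mul0r !mulr0 !addr0.
have X4 : Ex P (fun w => X n w ^+ 4) <= h.
  rewrite (le_trans _ (EX2 n))//; apply: Ex_le => // w.
  have : `|X n w| ^+ 2 <= 1 by rewrite exprn_ile1.
  rewrite real_normK ?num_real// (_ : X n w ^+ 4 = X n w ^+ 2 * X n w ^+ 2); last by ring.
  by move=> ?; rewrite ler_piMr// sqr_ge0.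
have M2 := sum_moment2 n; rewrite -/(S n) in M2.
have M2X : Ex P (fun w => S n w ^+ 2) * Ex P (fun w => X n w ^+ 2) <= n%:R * h * h.
  by rewrite ler_pM//; apply: Ex_ge0 => w; rewrite sqr_ge0.
rewrite -/(S n) in IH; rewrite -natr1; nra.
Qed.

End moments.

(** * Chaining along dyadic points *)

Section chaining.
Context (R : realType).
Implicit Types (a : R -> R) (s t : R).

Lemma geom_le (x : R) n : 0 <= x < 1 -> \sum_(i < n) x ^+ i <= (1 - x)^-1.
Proof.
move=> /andP[x0 x1]; have x1' : 0 < 1 - x by rewrite subr_gt0.
rewrite -(@ler_pM2l _ (1 - x))// mulfV ?gt_eqF//.
rewrite -[1 - x]opprB mulNr -subrX1 opprB.
by rewrite lerBlDr lerDl exprn_ge0.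
Qed.

(** The ratio balances two series: the increments allowed at successive levels must be summable, so
    [r < 1], and so must the probabilities of exceeding them, which calls for [2 r ^ 4 > 1]. *)
Let r : R := 9 / 10.

Let dy j i : R := i%:R / 2 ^+ j.

Let k2 j t : nat := Num.truncn (2 ^+ j * t).

Let p2 j : 0 < 2 ^+ j :> R. Proof. by rewrite exprn_gt0. Qed.

Let k2P j t : 0 <= t -> dy j (k2 j t) <= t < dy j (k2 j t).+1.
Proof.
move=> t0; have : 0 <= 2 ^+ j * t by rewrite mulr_ge0// ltW.
move=> /truncn_itv/andP[h1 h2].
by rewrite /dy ler_pdivrMr// ltr_pdivlMr// ![t * _]mulrC h1.
Qed.

Let k2_le j t : 0 <= t <= 1 -> (k2 j t <= 2 ^ j)%N.
Proof.
move=> /andP[t0 t1]; rewrite -(ler_nat R) natrX.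
have /andP[h _] := k2P j t0; move: h; rewrite /dy ler_pdivrMr// => h.
by rewrite (le_trans h)// ler_piMl// ltW.
Qed.

Let k2S j t : 0 <= t -> k2 j.+1 t = (k2 j t).*2 \/ k2 j.+1 t = (k2 j t).*2.+1.
Proof.
move=> t0; have /andP[a1 a2] := k2P j t0; have /andP[b1 b2] := k2P j.+1 t0.
have dbl k : dy j k = dy j.+1 k.*2.
  by rewrite /dy -muln2 natrM exprS; field; rewrite expf_neq0.
have h1 : ((k2 j t).*2 < (k2 j.+1 t).+1)%N.
  by have := le_lt_trans a1 b2; rewrite dbl /dy ltr_pM2r ?invr_gt0// ltr_nat.
have h2 : (k2 j.+1 t < (k2 j t).+1.*2)%N.
  by have := le_lt_trans b1 a2; rewrite dbl /dy ltr_pM2r ?invr_gt0// ltr_nat.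
by move: h1 h2; rewrite ltnS doubleS; lia.
Qed.

(** A point is approached by its dyadic truncations from level [m] to level [L]; beyond [L] nothing
    is known on increments, but [a] plus a linear drift is nondecreasing, which confines [a] between
    its values at neighbouring points of level [L]. The cost is [10 e + dl] per point, plus [e]
    between the truncations of the two points. *)
Lemma chaining_bound a (c e dl : R) (m L : nat) : (m <= L)%N -> 0 <= e ->
  (forall s t, 0 <= s -> s <= t -> t <= 1 -> a s + c * s <= a t + c * t) ->
  0 <= c -> c / 2 ^+ L <= dl ->
  (forall j i, (m <= j <= L)%N -> (i < 2 ^ j)%N ->
    `|a (i.+1%:R / 2 ^+ j) - a (i%:R / 2 ^+ j)| <= e * r ^+ (j - m)) ->
  forall s t, 0 <= s <= 1 -> 0 <= t <= 1 -> `|s - t| <= (2 ^+ m)^-1 ->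
  `|a s - a t| <= 21 * e + 2 * dl.
Proof.
move=> mL e0 amon c0 cL hinc.
have r0 : 0 <= r by rewrite /r; lra.
have r1 : r <= 1 by rewrite /r; lra.
have up t k : 0 <= t <= 1 -> (m + k <= L)%N ->
    `|a (dy (m + k) (k2 (m + k) t)) - a (dy m (k2 m t))| <= e * \sum_(i < k) r ^+ i.+1.
  move=> t01; have /andP[t0 t1] := t01; elim: k => [|k IH] kL.
    by rewrite addn0 subrr normr0 big_ord0 mulr0.
  have {IH} := IH (ltnW (leq_trans _ kL)); rewrite addnS ltnSn => /(_ isT) IH.
  rewrite big_ord_recr/= mulrDr [leRHS]addrC.
  set x := a (dy (m + k) _) in IH; set y := a (dy m _) in IH *.
  have -> : a (dy (m + k).+1 (k2 (m + k).+1 t)) - y =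
     (a (dy (m + k).+1 (k2 (m + k).+1 t)) - x) + (x - y) by rewrite addrA subrK.
  rewrite (le_trans (ler_normD _ _))// lerD//.
  have xE : x = a (((k2 (m + k) t).*2)%:R / 2 ^+ (m + k).+1).
    rewrite /x /dy; congr a; rewrite -muln2 natrM exprS.
    by field; rewrite expf_neq0.
  rewrite xE; have [E|E] := k2S (m + k) t0.
    by rewrite E subrr normr0 mulr_ge0// exprn_ge0.
  have kb := k2_le (m + k).+1 t01; rewrite E in kb.
  have := hinc (m + k).+1 _ _ kb; rewrite -addnS kL leq_addr => /(_ isT).
  by rewrite addnS E subSn ?leq_addr// addKn.
(* 9 is [r / (1 - r)]. *)
have sumr k : \sum_(i < k) r ^+ i.+1 <= 9.
  under eq_bigr do rewrite exprS.
  rewrite -mulr_sumr; have h : 0 <= r < 1 by rewrite /r; apply/andP; split; lra.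
  have := geom_le k h.
  have -> : (1 - r)^-1 = 10 :> R by rewrite /r; field.
  by rewrite /r; lra.
have near t : 0 <= t <= 1 -> `|a t - a (dy m (k2 m t))| <= 10 * e + dl.
  move=> t01; have /andP[t0 t1] := t01.
  have := up t (L - m)%N t01; rewrite subnKC// => /(_ (leqnn _)) h1.
  have {}h1 := le_trans h1 (ler_wpM2l e0 (sumr _)).
  have /andP[tL1 tL2] := k2P L t0.
  set x := a (dy L _) in h1.
  (* Last scale: lower bound by monotonicity from the left neighbour, upper bound from the right
     one, whose value differs by at most [e]; the drift over one cell is at most [dl]. *)
  have h2 : `|a t - x| <= e + dl.
    have d0 : 0 <= dy L (k2 L t) by rewrite /dy divr_ge0// ltW.
    have lo := amon _ _ d0 tL1 t1; rewrite -/x in lo.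
    have dyS : dy L (k2 L t).+1 = dy L (k2 L t) + (2 ^+ L)^-1.
      by rewrite /dy -natr1 mulrDl mul1r.
    have ct : c * t <= c * (dy L (k2 L t) + (2 ^+ L)^-1).
      by rewrite ler_wpM2l// -dyS ltW.
    rewrite mulrDr in ct.
    have [kL|kL] := ltnP (k2 L t) (2 ^ L); last first.
      have tE : t = dy L (k2 L t).
        apply/eqP; rewrite eq_le tL1 andbT (le_trans t1)//.
        by rewrite /dy ler_pdivlMr// mul1r -natrX ler_nat.
      have dl0 : 0 <= dl by rewrite (le_trans _ cL)// divr_ge0// ltW.
      by rewrite /x -tE subrr normr0 addr_ge0.
    have u1 : dy L (k2 L t).+1 <= 1.
      by rewrite /dy ler_pdivrMr// mul1r -natrX ler_nat.
    have hi := amon _ _ t0 (ltW tL2) u1.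
    have := hinc L (k2 L t) _ kL; rewrite mL leqnn => /(_ isT).
    rewrite -/(dy L (k2 L t)) -/(dy L (k2 L t).+1) -/x => h3.
    have {}h3 := le_trans h3 (ler_piMr e0 (exprn_ile1 (L - m) r0 r1)).
    have ct2 : c * dy L (k2 L t) <= c * t by rewrite ler_wpM2l.
    move: h3 hi; rewrite dyS mulrDr !ler_norml => /andP[? ?] hi.
    by apply/andP; split; lra.
  have -> : a t - a (dy m (k2 m t)) = (a t - x) + (x - a (dy m (k2 m t))).
    by rewrite addrA subrK.
  rewrite (le_trans (ler_normD _ _))//; move: h1 h2; lra.
move=> s t; wlog st : s t / s <= t.
  move=> H s01 t01 st; have [/H|/ltW/H] := leP s t; first exact.
  by move=> h; rewrite distrC; apply: h => //; rewrite distrC.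
move=> s01 t01; have /andP[s0 s1] := s01; have /andP[t0 t1] := t01.
rewrite distrC ger0_norm ?subr_ge0// => hst.
(* At distance at most one cell of level [m], the two truncations are equal or adjacent. *)
have mid : `|a (dy m (k2 m s)) - a (dy m (k2 m t))| <= e.
  have /andP[a1 a2] := k2P m s0; have /andP[b1 b2] := k2P m t0.
  have k1 : (k2 m s < (k2 m t).+1)%N.
    rewrite -(ltr_nat R) -(ltr_pM2r (_ : 0 < (2 ^+ m)^-1)) ?invr_gt0//.
    by rewrite (le_lt_trans a1)// (le_lt_trans st).
  have k3 : (k2 m t < (k2 m s).+2)%N.
    rewrite -(ltr_nat R) -(ltr_pM2r (_ : 0 < (2 ^+ m)^-1)) ?invr_gt0//.
    rewrite (le_lt_trans b1)// -natr1 mulrDl mul1r.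
    by move: a2 hst; rewrite /dy; lra.
  have [->|E] : k2 m t = k2 m s \/ k2 m t = (k2 m s).+1.
    by move: (k2 m t) (k2 m s) k1 k3; clear; lia.
    by rewrite subrr normr0.
  have kb := k2_le m t01; rewrite E in kb.
  have := hinc m _ _ kb; rewrite leqnn mL subnn expr0 mulr1 => /(_ isT).
  by rewrite distrC -E.
have h1 := near s s01; have h2 := near t t01.
move: mid h1 h2; rewrite !ler_norml => /andP[? ?] /andP[? ?] /andP[? ?].
by apply/andP; split; lra.
Qed.

End chaining.

Section empirical_process.
Context d (T : measurableType d) (R : realType) (P : probability T R).
Variable V : nat -> T -> R.
Hypothesis mV : forall i, measurable_fun setT (V i).
Hypothesis iV : indep_fam P V.
Hypothesis V1 : forall i w, V i w <= 1.
Hypothesis uV : forall i t, 0 <= t <= 1 -> P [set w | V i w <= t] = t%:E.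

Definition alpha (n : nat) (t : R) (w : T) : R :=
  (Num.sqrt n%:R)^-1 * \sum_(i < n) (((V i w <= t)%R)%:R - t).

Let ind (i : nat) (t : R) (w : T) : R := ((V i w <= t)%R)%:R.

Let indE i t : ind i t = \1_[set w | V i w <= t].
Proof.
by apply/funext => w; rewrite /ind indicE; congr (nat_of_bool _)%:R; apply/idP/idP; rewrite inE.
Qed.

Let mset i t : measurable [set w | V i w <= t].
Proof. by rewrite -[X in measurable X]setTI; apply: measurable_fun_le. Qed.

Let Lind i t : L1 P (ind i t).
Proof. by rewrite indE; exact: L1_indic. Qed.

Let Eind i t : 0 <= t <= 1 -> Ex P (ind i t) = t.
Proof. by move=> t01; rewrite indE Ex_indic// uV. Qed.

(** The term [(t - s) / n] is the trace of discreteness: it is dominated by the quadratic one only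
    for gaps of at least [1 / n], which bounds the depth of chaining. *)
Lemma alpha_increment4 n s t : (0 < n)%N -> 0 <= s -> s <= t -> t <= 1 ->
  L1 P (fun w => (alpha n t w - alpha n s w) ^+ 4) /\
  Ex P (fun w => (alpha n t w - alpha n s w) ^+ 4) <= 3 * (t - s) ^+ 2 + (t - s) / n%:R.
Proof.
move=> n0 s0 st t1; have nR0 : 0 < n%:R :> R by rewrite ltr0n.
have t01 : 0 <= t <= 1 by rewrite (le_trans s0 st).
have s01 : 0 <= s <= 1 by rewrite s0 (le_trans st).
pose h := t - s; have h0 : 0 <= h by rewrite subr_ge0.
have h1 : h <= 1 by rewrite /h; lra.
pose phi x : R := (((x <= t)%R)%:R - ((x <= s)%R)%:R) - h.
pose X (i : nat) w := phi (V i w).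
have phi01 x : phi x = - h \/ phi x = 1 - h.
  rewrite /phi; have [xt|tx] := leP x t; have [xs|sx] := leP x s.
  - by left; rewrite subrr sub0r.
  - by right; rewrite subr0.
  - by have := lt_le_trans (le_lt_trans st tx) xs; rewrite ltxx.
  - by left; rewrite subrr sub0r.
have mle (u : R) : measurable_fun setT (fun x : R => ((x <= u)%R)%:R : R).
  have -> : (fun x : R => ((x <= u)%R)%:R : R) = \1_`]-oo, u].
    apply/funext => x; rewrite indicE; congr (nat_of_bool _)%:R.
    by apply/idP/idP; rewrite inE /= in_itv.
  exact: measurable_indic.
have mphi : measurable_fun setT phi.
  by apply: measurable_funB => //; exact: measurable_funB.
have mX i : measurable_fun setT (X i) by exact: measurableT_comp.
have iX : indep_fam P X by exact: (indep_fam_comp (phi := fun=> phi) iV).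
have X1 i w : `|X i w| <= 1.
  by rewrite ler_norml; case: (phi01 (V i w)) => E; rewrite /X E; apply/andP; split; lra.
have XE i : X i = fun w => (ind i t w - ind i s w) - h by [].
have LX i : L1 P (X i) by rewrite XE; do 2 (apply: L1B => //); exact: L1_cst.
have EX i : Ex P (X i) = 0.
  rewrite XE ExB; [|exact: L1B|exact: L1_cst].
  by rewrite ExB// !Eind// Ex_cst subrr.
have EX2 i : Ex P (fun w => X i w ^+ 2) <= h.
  (* A variable with the two values [- h] and [1 - h] has a square affine in itself, so its second
     moment follows from its mean. *)
  have -> : (fun w => X i w ^+ 2) = (fun w => (1 - 2 * h) * X i w + (h - h ^+ 2)).
    by apply/funext => w; rewrite /X; case: (phi01 (V i w)) => ->; ring.
  rewrite ExD; [|exact: L1Z|exact: L1_cst]; rewrite ExZ// EX Ex_cst mulr0 add0r.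
  by rewrite lerBlDr lerDl sqr_ge0.
have aE : (fun w => (alpha n t w - alpha n s w) ^+ 4) =
    (fun w => (n%:R ^+ 2)^-1 * (\sum_(i < n) X i w) ^+ 4).
  apply/funext => w; rewrite /alpha -mulrBr -sumrB exprMn; congr (_ * _ ^+ 4).
    have := sqr_sqrtr (ltW nR0) => E.
    by rewrite -[X in (X ^+ 2)^-1]E -exprM -exprVn.
  by apply: eq_bigr => i _; rewrite /X /phi /h; ring.
have L4 : L1 P (fun w => (\sum_(i < n) X i w) ^+ 4).
  apply: (@L1_bounded _ _ _ _ _ (n%:R ^+ 4)).
    by apply: measurable_funX; exact: measurable_sum.
  move=> w; rewrite normrX lerXn2r ?nnegrE//.
  rewrite (le_trans (ler_norm_sum _ _ _))//.
  rewrite (le_trans (ler_sum _ (fun (i : 'I_n) _ => X1 i w)))// sumr_const card_ord.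
  by rewrite -mulr_natl mulr1.
rewrite aE; split; first exact: L1Z.
rewrite ExZ// ler_pdivrMl ?exprn_gt0//.
rewrite (le_trans (sum_moment4 mX iX X1 EX EX2 n))// -/h.
rewrite le_eqVlt; apply/orP; left; apply/eqP; field.
by rewrite gt_eqF.
Qed.

(** With the drift restored, the process is a normalized counting function. *)
Lemma alpha_mono n s t w : s <= t ->
  alpha n s w + Num.sqrt n%:R * s <= alpha n t w + Num.sqrt n%:R * t.
Proof.
move=> st; have [->|n0] := posnP n; first by rewrite /alpha !big_ord0 sqrtr0 !mulr0 !mul0r.
have q0 : 0 < Num.sqrt n%:R :> R by rewrite sqrtr_gt0 ltr0n.
have q2 : Num.sqrt n%:R = (Num.sqrt n%:R)^-1 * n%:R :> R.
  by rewrite -[X in _ = _ * X](@sqr_sqrtr R n%:R)// expr2 mulKf// gt_eqF.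
have E u : alpha n u w + Num.sqrt n%:R * u = (Num.sqrt n%:R)^-1 * \sum_(i < n) ((V i w <= u)%R)%:R.
  rewrite /alpha sumrB sumr_const card_ord mulrBr.
  by rewrite -[u *+ n]mulr_natl mulrA -q2 subrK.
rewrite !E ler_wpM2l ?invr_ge0 ?(ltW q0)//; apply: ler_sum => i _.
have [Vs|//] := boolP (V i w <= s).
by rewrite (le_trans Vs st).
Qed.

(** A single Markov inequality for the sum [S] of the fourth powers of all dyadic increments at
    levels [m] to [L], weighted by [r ^ (- 4 k)]: as long as [S < b ^ 4], every increment obeys the
    bound required by chaining. *)
Lemma alpha_modulus e eta : 0 < e -> 0 < eta -> exists m : nat,
  wpe P eta (fun n w => forall s t, 0 <= s <= 1 -> 0 <= t <= 1 ->
    `|s - t| <= (2 ^+ m)^-1 -> `|alpha n s w - alpha n t w| <= e).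
Proof.
(* Chaining yields [21 b + 2 (e / 4)], which is [e] for this [b]. *)
move=> e0 eta0; pose b := e / 42; have b0 : 0 < b by rewrite divr_gt0.
pose r : R := 9 / 10; have r0 : 0 < r by rewrite /r; lra.
have p2 j : 0 < 2 ^+ j :> R by rewrite exprn_gt0.
(* Any [m] with [20 / 2 ^ m <= b ^ 4 eta] would do; [k < 2 ^ k] makes this one suitable. *)
pose m := Num.bound (20 / b ^+ 4 / eta).
have b4 : 0 < b ^+ 4 by rewrite exprn_gt0.
have mP : 20 * (2 ^+ m)^-1 <= b ^+ 4 * eta.
  rewrite ler_pdivrMr// mulrC -ler_pdivrMr ?mulr_gt0// invfM mulrA ltW//.
  have K0 : 0 <= 20 / b ^+ 4 / eta by rewrite !divr_ge0// ltW.
  rewrite (lt_le_trans (archi_boundP K0))// -/m -natrX ler_nat.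
  exact/ltnW/ltn_expl.
exists m.
exists (maxn (2 ^ m) (Num.bound ((8 / e) ^+ 2)).+1) => n.
rewrite geq_max => /andP[n2m nb].
have n0 : (0 < n)%N by rewrite (leq_trans _ nb).
have nR0 : 0 < n%:R :> R by rewrite ltr0n.
(* The finest level whose cells are not shorter than [1 / n]: there the moment bound is still
   quadratic, and the drift [sqrt n / 2 ^ L] of one cell is already small. *)
pose L := trunc_log 2 n.
have /andP[L1' L2] := @trunc_log_bounds 2 n isT n0.
have mL : (m <= L)%N by rewrite trunc_log_max.
have q0 : 0 < Num.sqrt n%:R :> R by rewrite sqrtr_gt0.
have cL : Num.sqrt n%:R / 2 ^+ L <= e / 4.
  rewrite ler_pdivrMr//.
  have h1 : n%:R <= 2 * 2 ^+ L :> R.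
    by rewrite -exprS -natrX ler_nat ltnW.
  have h2 : 8 / e <= Num.sqrt n%:R.
    rewrite -(@ler_pXn2r _ 2) ?nnegrE ?sqr_sqrtr ?divr_ge0 ?(ltW e0) ?(ltW q0)//.
    rewrite ltW// (lt_le_trans (archi_boundP _)) ?sqr_ge0// ler_nat ltnW//.
  have h3 : Num.sqrt n%:R * Num.sqrt n%:R = n%:R :> R by rewrite -expr2 sqr_sqrtr// ltW.
  have h4 : 8 <= Num.sqrt n%:R * e by rewrite -ler_pdivrMr.
  have h5 : 2 * Num.sqrt n%:R <= e * (Num.sqrt n%:R * Num.sqrt n%:R) / 4 by nra.
  rewrite h3 in h5; nra.
pose Dl j i w := alpha n (i.+1%:R / 2 ^+ j) w - alpha n (i%:R / 2 ^+ j) w.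
pose K := (L - m).+1.
have Lj j i : (i < 2 ^ j)%N -> (j <= L)%N ->
    L1 P (fun w => Dl j i w ^+ 4) /\ Ex P (fun w => Dl j i w ^+ 4) <= 4 * ((2 ^+ j)^-1) ^+ 2.
  move=> ij jL.
  have [|||LD ED] := @alpha_increment4 n (i%:R / 2 ^+ j) (i.+1%:R / 2 ^+ j) n0.
  - by rewrite divr_ge0// ltW.
  - by rewrite ler_pM2r ?invr_gt0// ler_nat.
  - by rewrite ler_pdivrMr// mul1r -natrX ler_nat.
  split=> //; rewrite (le_trans ED)//.
  have -> : i.+1%:R / 2 ^+ j - i%:R / 2 ^+ j = (2 ^+ j)^-1 :> R.
    by rewrite -mulrBl -natr1 addrAC subrr add0r mul1r.
  have : (n%:R)^-1 <= (2 ^+ j)^-1 :> R.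
    rewrite lef_pV2 ?posrE// -natrX ler_nat (leq_trans _ L1')//.
    by rewrite leq_exp2l.
  have : 0 < (2 ^+ j)^-1 :> R by rewrite invr_gt0.
  set y := (2 ^+ j)^-1 => y0 ny; have := ler_wpM2l (ltW y0) ny; nra.
have Lj' k i : (i < 2 ^ (m + k))%N -> (k < K)%N ->
    L1 P (fun w => Dl (m + k) i w ^+ 4) /\
    Ex P (fun w => Dl (m + k) i w ^+ 4) <= 4 * ((2 ^+ (m + k))^-1) ^+ 2.
  by move=> ik kK; apply: Lj => //; rewrite -(subnKC mL) leq_add2l -ltnS.
pose S w := \sum_(k < K) \sum_(i < 2 ^ (m + k)) Dl (m + k) i w ^+ 4 / r ^+ (4 * k).
have Li (k : 'I_K) (i : 'I_(2 ^ (m + k))) : L1 P (fun w => Dl (m + k) i w ^+ 4 / r ^+ (4 * k)).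
  have [LD _] := Lj' k i (ltn_ord i) (ltn_ord k).
  by have := L1Z (r ^+ (4 * k))^-1 LD; congr L1; apply/funext => w; rewrite mulrC.
have LS : L1 P S by apply: L1_sum => k; apply: L1_sum => i; exact: Li.
have ES : Ex P S <= 20 * (2 ^+ m)^-1.
  rewrite /S Ex_sum; last by move=> k; apply: L1_sum => i; exact: Li.
  (* Level [m + k] contributes [4 / 2 ^ m] times the [k]-th power of [1 / (2 r ^ 4)], a ratio below
     [4 / 5]. *)
  have -> : 20 * (2 ^+ m)^-1 = 4 * (2 ^+ m)^-1 * (1 - 4 / 5)^-1 :> R by field; rewrite gt_eqF.
  apply: (@le_trans _ _ (4 * (2 ^+ m)^-1 * \sum_(k < K) (4 / 5) ^+ k)); last first.
    rewrite ler_wpM2l ?mulr_ge0 ?invr_ge0 ?(ltW (p2 _))//.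
    by apply: geom_le; apply/andP; split; lra.
  rewrite mulr_sumr; apply: ler_sum => k _; rewrite Ex_sum//.
  apply: (@le_trans _ _ (\sum_(i < 2 ^ (m + k)) 4 * ((2 ^+ (m + k))^-1) ^+ 2 / r ^+ (4 * k))).
    apply: ler_sum => i _.
    have [LD ED] := Lj' k i (ltn_ord i) (ltn_ord k).
    have -> : (fun w => Dl (m + k) i w ^+ 4 / r ^+ (4 * k)) =
        (fun w => (r ^+ (4 * k))^-1 * Dl (m + k) i w ^+ 4).
      by apply/funext => w; rewrite mulrC.
    by rewrite ExZ// mulrC ler_wpM2r// invr_ge0 exprn_ge0// ltW.
  rewrite sumr_const card_ord -[leLHS]mulr_natl natrX.
  have -> : 2 ^+ (m + k) * (4 * (2 ^+ (m + k))^-1 ^+ 2 / r ^+ (4 * k)) =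
      4 * (2 ^+ m)^-1 * ((2 * r ^+ 4)^-1) ^+ k.
    have -> : (2 * r ^+ 4)^-1 ^+ k = (2 ^+ k * r ^+ (4 * k))^-1.
      by rewrite exprVn exprM; congr (_^-1); exact: exprMn.
    have G (x y z : R) : x != 0 -> y != 0 -> z != 0 ->
        x * y * (4 * (x * y)^-1 ^+ 2 / z) = 4 / x * (y * z)^-1.
      by move=> ? ? ?; field; apply/and3P.
    by rewrite exprD; apply: G; rewrite expf_neq0// gt_eqF.
  rewrite ler_wpM2l ?mulr_ge0 ?invr_ge0 ?(ltW (p2 _))//.
  rewrite lerXn2r ?nnegrE ?invr_ge0 ?mulr_ge0 ?exprn_ge0 ?(ltW r0)//.
  by rewrite /r; lra.
exists [set w | b ^+ 4 <= S w]; split.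
- rewrite -[X in measurable X]setTI; apply: measurable_fun_le => //; exact: L1_meas LS.
- have S0 w : 0 <= S w.
    apply: sumr_ge0 => k _; apply: sumr_ge0 => i _.
    by apply: divr_ge0; [exact: exprn_even_ge0|rewrite exprn_ge0// ltW].
  rewrite (le_trans (prob_markov LS S0 b4))// lee_fin ler_pdivrMl//.
  exact: le_trans ES mP.
move=> w /negP; rewrite -ltNge => Sw s t s01 t01 st.
have -> : e = 21 * b + 2 * (e / 4) by rewrite /b; field.
apply: (@chaining_bound R (alpha n ^~ w) (Num.sqrt n%:R) b (e / 4) m L) => //.
- exact: ltW.
- by move=> u v _ uv _; exact: alpha_mono.
move=> j i /andP[mj jL] ij; rewrite -/r.
rewrite -(@ler_pXn2r _ 4) ?nnegrE ?mulr_ge0 ?exprn_ge0 ?(ltW b0) ?(ltW r0)//.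
have E4 (x : R) : `|x| ^+ 4 = x ^+ 4.
  by rewrite -normrX ger0_norm// exprn_even_ge0.
rewrite E4 exprMn -exprM -ler_pdivrMr ?exprn_gt0// mulnC.
apply: le_trans (ltW Sw); have jK : (j - m < K)%N by rewrite ltnS leq_sub2r.
rewrite /S (bigD1 (Ordinal jK))//= subnKC//.
have T0 (k : nat) (I : 'I_(2 ^ (m + k))) : 0 <= Dl (m + k) I w ^+ 4 / r ^+ (4 * k).
  by apply: divr_ge0; [exact: exprn_even_ge0|rewrite exprn_ge0// ltW].
rewrite ler_wpDr//; first by apply: sumr_ge0 => k _; apply: sumr_ge0.
rewrite (bigD1 (Ordinal ij))//=; apply: ler_wpDr; last first.
  by rewrite (subnKC mj : (m + (j - m)%N)%R = j).
by apply: sumr_ge0 => k _; apply: divr_ge0; [exact: exprn_even_ge0|rewrite exprn_ge0// ltW].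
exact: ltW.
Qed.

Lemma alpha1 n w : alpha n 1 w = 0.
Proof.
by rewrite /alpha big1 ?mulr0// => i _; rewrite V1 subrr.
Qed.

(** The process vanishes at 1, and any other point is reached from there in at most [2 ^ m] steps on
    each of which it varies by at most 1. *)
Lemma alpha_tight eta : 0 < eta -> exists2 K, 0 < K &
  wpe P eta (fun n w => forall t, 0 <= t <= 1 -> `|alpha n t w| <= K).
Proof.
move=> eta0; have [m Hm] := alpha_modulus ltr01 eta0.
exists (2 ^ m)%:R; first by rewrite ltr0n expn_gt0.
apply: wpe_sub Hm; exists 0%N => n _ w H.
suff h k t : 0 <= t <= 1 -> 1 - t <= k%:R / 2 ^+ m -> `|alpha n t w| <= k%:R.
  move=> t t01; apply: h => //; rewrite natrX divff ?gt_eqF//.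
  by case/andP: t01; lra.
elim: k t => [|k IH] t t01.
  rewrite mul0r => t1; have -> : t = 1 by case/andP: t01 => ? ?; lra.
  by rewrite alpha1 normr0.
move=> tk; have /andP[t0 t1] := t01.
pose u := Num.min 1 (t + (2 ^+ m)^-1).
have tu : t <= u by rewrite le_min t1 lerDl ltW.
have u01 : 0 <= u <= 1 by rewrite (le_trans t0 tu) ge_min lexx.
have ut : u - t <= (2 ^+ m)^-1 by rewrite lerBlDl ge_min lexx orbT.
have h1 : `|alpha n t w - alpha n u w| <= 1.
  by apply: H => //; rewrite distrC ger0_norm ?subr_ge0.
have h2 : `|alpha n u w| <= k%:R.
  apply: IH => //; rewrite /u lerBlDr.
  case: (leP 1 (t + _)) => _; first by rewrite lerDr.
  by move: tk; rewrite -natr1 mulrDl mul1r; lra.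
have -> : alpha n t w = (alpha n t w - alpha n u w) + alpha n u w by rewrite subrK.
by rewrite (le_trans (ler_normD _ _))// -natr1 addrC lerD.
Qed.

End empirical_process.

(** * Linearization of the empirical cross-over function *)

Lemma L1_law d (T : measurableType d) d' (T' : measurableType d') (R : realType)
    (P : probability T R) (P' : probability T' R) (X : T -> R) (Y : T' -> R) (h : R -> R) :
  measurable_fun setT X -> measurable_fun setT Y ->
  (forall A : set R, measurable A -> P (X @^-1` A) = P' (Y @^-1` A)) ->
  measurable_fun setT h -> L1 P (h \o X) -> L1 P' (h \o Y).
Proof.
move=> mX mY XY mh LX.
have mhY : measurable_fun setT (EFin \o (h \o Y)).
  by apply/measurable_EFinP; exact: measurableT_comp.
have mEh : measurable_fun setT (fun x : R => `|(h x)%:E|%E).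
  by apply: measurableT_comp => //; exact/measurable_EFinP.
move/integrableP : LX => [_ fin]; apply/integrableP; split => //.
have h1 := @ge0_integral_pushforward _ _ _ _ R X mX P setT (fun x : R => `|(h x)%:E|%E)
  measurableT mEh (fun _ _ => abse_ge0 _).
have h2 := @ge0_integral_pushforward _ _ _ _ R Y mY P' setT (fun x : R => `|(h x)%:E|%E)
  measurableT mEh (fun _ _ => abse_ge0 _).
rewrite preimage_setT in h1; rewrite preimage_setT in h2.
rewrite -h2; rewrite -h1 in fin; apply: le_lt_trans fin; rewrite le_eqVlt; apply/orP; left.
by apply/eqP; apply: eq_measure_integral => A mA _; exact: (esym (XY A mA)).
Qed.

Section uniform_on_segment.
Context (R : realType) (a b : R).
Implicit Types c : R -> R.

(** Only [p] is confined to [[a, b]]: the neighbouring level [t], in practice the level of an order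
    statistic, may fall slightly outside. *)
Definition unif_on c := forall e : R, 0 < e -> exists2 dl : R, 0 < dl &
  forall p t, a <= p <= b -> `|t - p| <= dl -> `|c t - c p| <= e.

Lemma unif_on_continuous c : (forall p, a <= p <= b -> {for p, continuous c}) ->
  unif_on c.
Proof.
move=> cc e e0.
have /compact_near_coveringP/near_covering_withinP H := @segment_compact R a b.
have [|] := H R (0 : R)^'+ (fun i x => a <= x <= b -> forall t, `|t - x| <= i -> `|c t - c x| <= e).
  move=> x; rewrite /= in_itv/= => xab.
  have /cvgrPdist_le /(_ (e / 2)) := cc x xab; rewrite divr_gt0// => /(_ isT).
  move=> /nbhs_ballP[r /= r0 hr].
  exists (ball x (r / 2), [set i | i < r / 2]) => /=.
    split; first by apply: nbhsx_ballx; rewrite divr_gt0.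
    by apply: nbhs_right_lt; rewrite divr_gt0.
  move=> [x' i]/= [xx' ir] _ _ t ti; rewrite /ball/= in xx'.
  have rr : r / 2 < r by lra.
  have h1 : `|c x - c x'| <= e / 2 by apply: hr; rewrite /ball/= (lt_trans xx').
  have h2 : `|c x - c t| <= e / 2.
    apply: hr; rewrite /ball/= (_ : x - t = (x - x') - (t - x')); last by ring.
    by rewrite (le_lt_trans (ler_normB _ _))// [ltRHS]splitr ltr_leD// (le_trans ti)// ltW.
  rewrite (_ : c t - c x' = (c x - c x') - (c x - c t)); last by ring.
  by rewrite (le_trans (ler_normB _ _))// [leRHS]splitr lerD.
move=> dl /= dl0 hdl; exists (dl / 2); first by rewrite divr_gt0.
move=> p t pab; apply: (hdl (dl / 2)) => //=.
- by rewrite sub0r normrN gtr0_norm ?divr_gt0//; lra.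
- by rewrite divr_gt0.
Qed.

Lemma bounded_on_continuous c : (forall p, a <= p <= b -> {for p, continuous c}) ->
  exists2 M : R, 0 < M & forall p, a <= p <= b -> `|c p| <= M.
Proof.
move=> cc.
have [ab|ba] := leP a b; last first.
  by exists 1 => // p /andP[ap pb]; have := le_lt_trans (le_trans ap pb) ba; rewrite ltxx.
have [dl dl0 hdl] := unif_on_continuous cc ltr01.
suff h k : forall t, a <= t <= b -> t - a <= k%:R * dl -> `|c t| <= `|c a| + k%:R.
  exists (`|c a| + (Num.bound ((b - a) / dl))%:R + 1).
    by rewrite ltr_wpDl// addr_ge0.
  move=> p pab; rewrite (le_trans (h (Num.bound ((b - a) / dl)) _ pab _)) ?lerDl//.
  rewrite -ler_pdivrMr// (le_trans _ (ltW (archi_boundP _))) ?divr_ge0 ?subr_ge0 ?(ltW dl0)//.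
  by rewrite ler_pM2r ?invr_gt0//; case/andP: pab; lra.
elim: k => [|k IH] t tab.
  by rewrite mul0r => ta; have -> : t = a by [case/andP: tab; lra]; rewrite addr0.
move=> tk; pose u := Num.max a (t - dl); have /andP[t0 t1] := tab.
have ut : u <= t by rewrite ge_max t0 gerBl ltW.
have uab : a <= u <= b by rewrite le_max lexx (le_trans ut).
have : `|c u| <= `|c a| + k%:R.
  apply: IH => //; rewrite /u lerBlDr ge_max lerDr mulr_ge0 ?(ltW dl0)//=.
  by move: tk; rewrite -natr1 mulrDl mul1r; lra.
have : `|c t - c u| <= 1.
  by apply: hdl => //; rewrite ger0_norm ?subr_ge0// lerBlDr -lerBlDl le_max lexx orbT.
move=> h1 h2; rewrite -(subrK (c u) (c t)) (le_trans (ler_normD _ _))// -natr1.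
by move: h1 h2; lra.
Qed.

End uniform_on_segment.

Section processes.
Context d (T : measurableType d) (R : realType) (P : probability T R) (a b : R).
Implicit Types (Z : nat -> T -> R -> R) (c : R -> R).

Definition tightp Z := forall eta : R, 0 < eta -> exists2 K : R, 0 < K &
  wpe P eta (fun n w => forall p, a <= p <= b -> `|Z n w p| <= K).

(** Asymptotic equicontinuity in probability. *)
Definition oscp Z := forall e eta : R, 0 < e -> 0 < eta -> exists2 dl : R, 0 < dl &
  wpe P eta (fun n w => forall p p', a <= p <= b -> a <= p' <= b ->
    `|p - p'| <= dl -> `|Z n w p - Z n w p'| <= e).

Lemma tightpD Z Z' : tightp Z -> tightp Z' -> tightp (fun n w p => Z n w p + Z' n w p).
Proof.
move=> tZ tZ' eta eta0; have e2 : 0 < eta / 2 by rewrite divr_gt0.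
have [K K0 H] := tZ _ e2; have [K' K0' H'] := tZ' _ e2.
exists (K + K'); first exact: addr_gt0.
rewrite [eta]splitr; apply: wpe_sub (wpe_and H H'); exists 0%N => n _ w [h h'] p pab.
by rewrite (le_trans (ler_normD _ _))// lerD ?h ?h'.
Qed.

Lemma oscpD Z Z' : oscp Z -> oscp Z' -> oscp (fun n w p => Z n w p + Z' n w p).
Proof.
move=> oZ oZ' e eta e0 eta0.
have e2 : 0 < e / 2 by rewrite divr_gt0. have eta2 : 0 < eta / 2 by rewrite divr_gt0.
have [dl dl0 H] := oZ _ _ e2 eta2; have [dl' dl0' H'] := oZ' _ _ e2 eta2.
exists (Num.min dl dl'); first by rewrite lt_min dl0.
rewrite [eta]splitr; apply: wpe_sub (wpe_and H H'); exists 0%N => n _ w [h h'] p p' pab pab'.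
rewrite le_min => /andP[d1 d2].
rewrite opprD addrACA [leRHS]splitr (le_trans (ler_normD _ _))// lerD//.
  exact: h.
exact: h'.
Qed.

Lemma tightpM c Z : (forall p, a <= p <= b -> {for p, continuous c}) ->
  tightp Z -> tightp (fun n w p => c p * Z n w p).
Proof.
move=> /bounded_on_continuous[M M0 hM] tZ eta eta0; have [K K0 H] := tZ _ eta0.
exists (M * K); first exact: mulr_gt0.
apply: wpe_sub H; exists 0%N => n _ w h p pab.
by rewrite normrM ler_pM ?hM ?h.
Qed.

Lemma oscpM c Z : (forall p, a <= p <= b -> {for p, continuous c}) ->
  tightp Z -> oscp Z -> oscp (fun n w p => c p * Z n w p).
Proof.
move=> cc tZ oZ e eta e0 eta0; have eta2 : 0 < eta / 2 by rewrite divr_gt0.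
have [M M0 hM] := bounded_on_continuous cc.
have [K K0 H] := tZ _ eta2.
have eM : 0 < e / 2 / M by rewrite !divr_gt0.
have eK : 0 < e / 2 / K by rewrite !divr_gt0.
have [dl dl0 H'] := oZ _ _ eM eta2.
have [dl' dl0' hc] := unif_on_continuous cc eK.
exists (Num.min dl dl'); first by rewrite lt_min dl0.
rewrite [eta]splitr; apply: wpe_sub (wpe_and H H'); exists 0%N => n _ w [h h'] p p' pab pab'.
rewrite le_min => /andP[d1 d2].
rewrite (_ : _ - _ = c p * (Z n w p - Z n w p') + (c p - c p') * Z n w p'); last by ring.
rewrite (le_trans (ler_normD _ _))// !normrM [leRHS]splitr lerD//.
  rewrite (le_trans (ler_pM _ _ (hM _ pab) (h' _ _ pab pab' d1)))//.
  by rewrite mulrCA divff ?gt_eqF// mulr1.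
rewrite (le_trans (ler_pM _ _ (hc _ _ pab' d2) (h _ pab')))//.
by rewrite divfK ?gt_eqF.
Qed.

End processes.

Section normalized_sums.
Context d (T : measurableType d) (R : realType) (P : probability T R).
Implicit Types X : nat -> T -> R.

Definition nsum X n w : R := (Num.sqrt n%:R)^-1 * \sum_(i < n) X i w.

Lemma measurable_nsum X n : (forall i, measurable_fun setT (X i)) ->
  measurable_fun setT (nsum X n).
Proof. by move=> mX; apply: measurable_funM => //; exact: measurable_sum. Qed.

Lemma sum_moment2_L2 X v : (forall i, measurable_fun setT (X i)) -> indep_fam P X ->
  (forall i, L1 P (fun w => X i w ^+ 2)) -> (forall i, Ex P (X i) = 0) ->
  (forall i, Ex P (fun w => X i w ^+ 2) = v) -> forall n,
  L1 P (fun w => (\sum_(i < n) X i w) ^+ 2) /\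
  Ex P (fun w => (\sum_(i < n) X i w) ^+ 2) = n%:R * v.
Proof.
move=> mX iX X2 X0 Xv; elim=> [|n [L IH]].
  have -> : (fun w => (\sum_(i < 0) X i w) ^+ 2) = (fun=> 0).
    by apply/funext => w; rewrite big_ord0 expr0n.
  by rewrite Ex_cst mul0r; split=> //; exact: L1_cst.
have LX i := L1_of_L2 (mX i) (X2 i).
have LS : L1 P (fun w => \sum_(i < n) X i w) by exact: L1_sum.
have [LSX ESX] := indep2_ExM (indep_fam_sum n mX iX) LS (LX n).
have -> : (fun w => (\sum_(i < n.+1) X i w) ^+ 2) =
    (fun w => ((\sum_(i < n) X i w) ^+ 2 + 2 * ((\sum_(i < n) X i w) * X n w)) + X n w ^+ 2).
  by apply/funext => w; rewrite big_ord_recr/=; ring.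
have LZ := L1Z 2 LSX.
split; first by apply: L1D => //; exact: L1D.
rewrite ExD//; last exact: L1D.
by rewrite ExD// ExZ// ESX X0 mulr0 mulr0 addr0 IH Xv -natr1 mulrDl mul1r.
Qed.

Lemma nsum_tight X v : (forall i, measurable_fun setT (X i)) -> indep_fam P X ->
  (forall i, L1 P (fun w => X i w ^+ 2)) -> (forall i, Ex P (X i) = 0) ->
  (forall i, Ex P (fun w => X i w ^+ 2) = v) -> tight P (nsum X).
Proof.
move=> mX iX X2 X0 Xv e e0.
have v0 : 0 <= v by rewrite -(Xv 0%N); apply: Ex_ge0 => w; exact: sqr_ge0.
pose K := v / e + 1; have K1 : 1 <= K by rewrite lerDr divr_ge0// ltW.
have K0 : 0 < K by rewrite (lt_le_trans ltr01).
exists K => //; exists 1%N => n n0; have nR0 : 0 < n%:R :> R by rewrite ltr0n.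
have [L E] := sum_moment2_L2 mX iX X2 X0 Xv n.
have sE : (fun w => nsum X n w ^+ 2) = (fun w => n%:R^-1 * (\sum_(i < n) X i w) ^+ 2).
  by apply/funext => w; rewrite /nsum exprMn exprVn sqr_sqrtr// ltW.
have L2 : L1 P (fun w => nsum X n w ^+ 2) by rewrite sE; exact: L1Z.
exists [set w | K ^+ 2 <= nsum X n w ^+ 2]; split.
- rewrite -[X in measurable X]setTI; apply: measurable_fun_le => //; exact: L1_meas L2.
- rewrite (le_trans (prob_markov L2 (fun w => sqr_ge0 _) (exprn_gt0 2 K0)))//.
  rewrite lee_fin sE ExZ// E mulKf ?gt_eqF// ler_pdivrMl ?exprn_gt0//.
  rewrite (@le_trans _ _ (K * e))//; first by rewrite /K mulrDl divfK ?gt_eqF// mul1r lerDl ltW.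
  by rewrite ler_wpM2r ?(ltW e0)// expr2 ler_peMl// ltW.
move=> w /negP; rewrite -ltNge => h.
rewrite -(@ler_pXn2r _ 2) ?nnegrE ?(ltW K0)// real_normK ?num_real//.
exact: ltW.
Qed.

End normalized_sums.

Section sample.
Context d (T : measurableType d) (R : realType) (P : probability T R).
Variables (W : nat -> T -> R) (F : R -> R).
Hypothesis mW : forall i, measurable_fun setT (W i).
Hypothesis iW : indep_fam P W.
Hypothesis WF : forall i x, P (W i @^-1` `]-oo, x]) = (F x)%:E.
Hypothesis F_inv : forall p : R, 0 < p < 1 -> exists! x : R, F x = p.
Hypothesis W2 : L1 P (fun w => W 0 w ^+ 2).

Local Notation Q := (cdf_inv F).

Let V i w := F (W i w).

Let mF : measurable_fun setT F. Proof. exact: cdf_meas (mW 0) (WF 0). Qed.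

Lemma sample_cdf_meas i : measurable_fun setT (V i).
Proof. exact: measurableT_comp. Qed.

Lemma sample_cdf_indep : indep_fam P V.
Proof. exact: (indep_fam_comp (phi := fun=> F) iW). Qed.

Lemma sample_cdf_le1 i w : V i w <= 1.
Proof. exact: cdf_fun_le1 (mW 0) (WF 0) _. Qed.

Lemma sample_cdf_unif i t : 0 <= t <= 1 -> P [set w | V i w <= t] = t%:E.
Proof. exact: (cdf_uniform (mW i) (WF i) F_inv). Qed.

Lemma cdf_leE u x : 0 < F u < 1 -> (F x <= F u) = (x <= u).
Proof.
move=> u01; rewrite (cdf_le_inv (mW 0) (WF 0) F_inv)//.
by rewrite -(cdf_inv_uniq F_inv u01 erefl).
Qed.

Lemma sample_law i A : measurable A -> P (W i @^-1` A) = P (W 0 @^-1` A).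
Proof.
have E j x : W j @^-1` `]x, +oo[ = ~` (W j @^-1` `]-oo, x]) by rewrite -setCitvl.
apply: law_eq_rays => // x; rewrite !E.
by rewrite !probability_setC ?WF//; exact: measurable_preimage.
Qed.

Lemma sample_Ex (h : R -> R) i : measurable_fun setT h -> L1 P (h \o W 0) ->
  L1 P (h \o W i) /\ Ex P (h \o W i) = Ex P (h \o W 0).
Proof.
move=> mh Lh; suff L : L1 P (h \o W i).
  by split=> //; apply: Ex_law => //; exact: sample_law.
by apply: L1_law Lh => // A mA; rewrite sample_law.
Qed.

Definition pp (y : R) : R := Num.max 0 y.

Lemma pp_ge0 y : 0 <= pp y. Proof. by rewrite le_max lexx. Qed.

Lemma pp_le_norm y : pp y <= `|y|.
Proof. by rewrite ge_max normr_ge0 ler_norm. Qed.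

Lemma ppN y : pp (- y) = pp y - y.
Proof. by rewrite /pp; case: (leP 0 (- y)); case: (leP 0 y); lra. Qed.

(** The increment is the integral over [v] in [[u, u']] of the indicator of [y <= v]; both the mean
    [Abar] and the process [Aproc] are controlled through this. *)
Lemma pp_increment u u' y : u <= u' ->
  (u' - u) * ((y <= u)%R)%:R <= pp (u' - y) - pp (u - y) <= (u' - u) * ((y <= u')%R)%:R.
Proof.
rewrite /pp => uu; case: (leP y u); case: (leP y u');
case: (leP 0 (u' - y)); case: (leP 0 (u - y)) => /= *;
by rewrite ?mulr1 ?mulr0; apply/andP; split; lra.
Qed.

Lemma measurable_pp (u : R) : measurable_fun setT (fun y : R => pp (u - y)).
Proof.
by apply: measurable_maxr; [exact: measurable_cst|exact: measurable_funB].
Qed.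

Let LW : L1 P (W 0). Proof. exact: L1_of_L2. Qed.

Let Lpp u : L1 P (fun w => pp (u - W 0 w)).
Proof.
apply: (@L1_le _ _ _ _ _ (fun w => `|u| + `|W 0 w|)).
- by apply: (measurableT_comp (measurable_pp u)).
- by apply: L1D; [exact: L1_cst|exact: L1_norm].
by move=> w; rewrite ger0_norm ?pp_ge0// (le_trans (pp_le_norm _))// ler_normB.
Qed.

(** This is the integral of [F] over []-oo, u]]. *)
Definition Abar u : R := Ex P (fun w => pp (u - W 0 w)).

Let mset i u : measurable [set w | W i w <= u].
Proof. by rewrite -[X in measurable X]setTI; apply: measurable_fun_le. Qed.

Let indE i u : (fun w => ((W i w <= u)%R)%:R : R) = \1_[set w | W i w <= u].
Proof.
by apply/funext => w; rewrite indicE; congr (nat_of_bool _)%:R; apply/idP/idP; rewrite inE.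
Qed.

Lemma sample_ind_L1 u : L1 P (fun w => ((W 0 w <= u)%R)%:R).
Proof. by rewrite indE; exact: L1_indic. Qed.

Lemma sample_ind_Ex u : Ex P (fun w => ((W 0 w <= u)%R)%:R) = F u.
Proof.
rewrite indE Ex_indic// -[F u]/(fine (F u)%:E) -(WF 0); congr (fine (P _)).
Qed.

Lemma Abar_increment u u' : u <= u' ->
  (u' - u) * F u <= Abar u' - Abar u <= (u' - u) * F u'.
Proof.
move=> uu; have Lind := sample_ind_L1.
rewrite /Abar -ExB// -!sample_ind_Ex -!ExZ//.
by apply/andP; split; apply: Ex_le; [exact: L1Z|exact: L1B|
  move=> w; case/andP: (pp_increment (W 0 w) uu)|exact: L1B|exact: L1Z|
  move=> w; case/andP: (pp_increment (W 0 w) uu)].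
Qed.

Lemma Abar_lip z z' : `|Abar z' - Abar z| <= `|z' - z|.
Proof.
wlog zz : z z' / z <= z'.
  move=> H; have [/H//|/ltW/H] := leP z z'.
  by rewrite distrC [X in _ -> _ <= X]distrC.
have /andP[h2 h3] := Abar_increment zz.
have zz0 : 0 <= z' - z by rewrite subr_ge0.
rewrite [leRHS]ger0_norm// ger0_norm; last first.
  by rewrite (le_trans _ h2)// mulr_ge0// (cdf_fun_ge0 (WF 0)).
by rewrite (le_trans h3)// ler_piMr// (cdf_fun_le1 (mW 0) (WF 0)).
Qed.

(** [Abar] is an antiderivative of the monotone [F], so the error of the tangent at [u] is at most
    the length times the increment of [F]. *)
Lemma Abar_expansion u u' : `|Abar u' - Abar u - F u * (u' - u)| <=
  `|u' - u| * `|F u' - F u|.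
Proof.
have [uu|/ltW uu] := leP u u'.
  have /andP[h1 h2] := Abar_increment uu.
  have FF : F u <= F u' by exact: cdf_homo (mW 0) (WF 0) _ _ uu.
  by rewrite [ `|u' - u|]ger0_norm ?subr_ge0// [ `|F u' - F u|]ger0_norm ?subr_ge0// ler_norml; apply/andP; split; lra.
have /andP[h1 h2] := Abar_increment uu.
have FF : F u' <= F u by exact: cdf_homo (mW 0) (WF 0) _ _ uu.
by rewrite [ `|u' - u|]ler0_norm ?subr_le0// [ `|F u' - F u|]ler0_norm ?subr_le0// ler_norml; apply/andP; split; lra.
Qed.

(** Empirical counterpart of [Abar], centred and normalized: formally the integral of [alpha] at
    [F v] over [v <= u]. *)
Definition Aproc n u w : R := nsum (fun i w => pp (u - W i w) - Abar u) n w.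

Definition Sproc n w : R := nsum (fun i w => W i w - Ex P (W 0)) n w.

Lemma alphaE n t w : alpha V n t w + Num.sqrt n%:R * t =
  (Num.sqrt n%:R)^-1 * \sum_(i < n) ((V i w <= t)%R)%:R.
Proof.
have [->|n0] := posnP n; first by rewrite /alpha !big_ord0 sqrtr0 !mulr0 !mul0r addr0.
have q0 : 0 < Num.sqrt n%:R :> R by rewrite sqrtr_gt0 ltr0n.
have q2 : Num.sqrt n%:R = (Num.sqrt n%:R)^-1 * n%:R :> R.
  by rewrite -[X in _ = _ * X](@sqr_sqrtr R n%:R)// expr2 mulKf// gt_eqF.
rewrite /alpha sumrB sumr_const card_ord mulrBr.
by rewrite -[t *+ n]mulr_natl mulrA -q2 subrK.
Qed.

(** Sum and mean are both bracketed by values at the two ends. The brackets differ by the increment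
    of [F], amplified by [sqrt n], an error that disappears when the interval is subdivided. *)
Lemma Aproc_increment n w K u u' : 0 < F u -> u <= u' -> F u' < 1 ->
  (forall t, 0 <= t <= 1 -> `|alpha V n t w| <= K) ->
  `|Aproc n u' w - Aproc n u w| <= (u' - u) * (K + Num.sqrt n%:R * (F u' - F u)).
Proof.
move=> Fu uu Fu' hK.
have FF : F u <= F u' by exact: cdf_homo (mW 0) (WF 0) _ _ uu.
have u01 : 0 < F u < 1 by rewrite Fu (le_lt_trans FF).
have u'01 : 0 < F u' < 1 by rewrite Fu' (lt_le_trans Fu).
have /andP[a1 a2] := Abar_increment uu.
have q0 : 0 <= Num.sqrt n%:R :> R by exact: sqrtr_ge0.
have uu0 : 0 <= u' - u by rewrite subr_ge0.
pose s := (Num.sqrt n%:R)^-1 * \sum_(i < n) (pp (u' - W i w) - pp (u - W i w)).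
have E : Aproc n u' w - Aproc n u w = s - Num.sqrt n%:R * (Abar u' - Abar u).
  have [n0|n0] := posnP n.
    by rewrite /Aproc /nsum /s n0 !big_ord0 sqrtr0 !mulr0 !mul0r.
  have q2 : Num.sqrt n%:R = (Num.sqrt n%:R)^-1 * n%:R :> R.
    rewrite -[X in _ = _ * X](@sqr_sqrtr R n%:R)// expr2 mulKf// gt_eqF//.
    by rewrite sqrtr_gt0 ltr0n.
  rewrite /Aproc /nsum /s !sumrB !sumr_const card_ord [X in _ = _ - X * _]q2.
  by rewrite -[_ u' *+ n]mulr_natl -[_ u *+ n]mulr_natl; ring.
have NE v : 0 < F v < 1 -> alpha V n (F v) w + Num.sqrt n%:R * F v =
    (Num.sqrt n%:R)^-1 * \sum_(i < n) ((W i w <= v)%R)%:R.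
  by move=> v01; rewrite alphaE; congr (_ * _); apply: eq_bigr => i _; rewrite cdf_leE.
have s1 : (u' - u) * (alpha V n (F u) w + Num.sqrt n%:R * F u) <= s.
  rewrite NE// mulrCA ler_wpM2l// mulr_sumr; apply: ler_sum => i _.
  by case/andP: (pp_increment (W i w) uu).
have s2 : s <= (u' - u) * (alpha V n (F u') w + Num.sqrt n%:R * F u').
  rewrite NE// mulrCA ler_wpM2l// mulr_sumr; apply: ler_sum => i _.
  by case/andP: (pp_increment (W i w) uu).
have /andP[k1 _] : - K <= alpha V n (F u) w <= K.
  by rewrite -ler_norml hK// !ltW//; case/andP: u01.
have /andP[_ k2] : - K <= alpha V n (F u') w <= K.
  by rewrite -ler_norml hK// !ltW//; case/andP: u'01.
have b1 := ler_wpM2l q0 a1; have b2 := ler_wpM2l q0 a2.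
have k1' := ler_wpM2l uu0 k1; have k2' := ler_wpM2l uu0 k2.
rewrite E ler_norml; apply/andP; split; lra.
Qed.

(** On [N] equal pieces the bracketing errors telescope to at most the length of a piece times
    [sqrt n], for a fixed sample; letting [N] grow leaves the bound [K] on [alpha] as the Lipschitz
    constant. *)
Lemma Aproc_lip n w K x x' : 0 < F x -> x <= x' -> F x' < 1 ->
  (forall t, 0 <= t <= 1 -> `|alpha V n t w| <= K) ->
  `|Aproc n x' w - Aproc n x w| <= (x' - x) * K.
Proof.
move=> Fx xx Fx' hK; apply/ler_addgt0Pr => e e0.
pose c := (x' - x) * Num.sqrt n%:R.
have c0 : 0 <= c by rewrite mulr_ge0 ?subr_ge0.
(* With this many pieces the accumulated error [c / N] is below [e]. *)
pose N := (Num.bound (c / e)).+1; pose h := (x' - x) / N%:R.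
have h0 : 0 <= h by rewrite divr_ge0 ?subr_ge0// ltW.
have NhE : N%:R * h = x' - x by rewrite mulrC divfK// gt_eqF.
have ux k : (k <= N)%N -> x <= x + k%:R * h <= x'.
  move=> kN; rewrite lerDl mulr_ge0//= -lerBrDl -NhE ler_wpM2r// ler_nat//.
have step k : (k <= N)%N -> `|Aproc n (x + k%:R * h) w - Aproc n x w| <=
    k%:R * h * K + h * Num.sqrt n%:R * (F (x + k%:R * h) - F x).
  elim: k => [|k IH] kN; first by rewrite !mul0r addr0 !subrr normr0 mulr0 addr0.
  have {}IH := IH (ltnW kN).
  have /andP[l1 l2] := ux _ (ltnW kN); have /andP[l3 l4] := ux _ kN.
  have uS : x + k.+1%:R * h = (x + k%:R * h) + h by rewrite -natr1 mulrDl mul1r addrA.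
  have := @Aproc_increment n w K (x + k%:R * h) (x + k.+1%:R * h).
  rewrite {1}uS lerDl h0 => /(_ _ isT _ hK).
  rewrite (lt_le_trans Fx (cdf_homo (mW 0) (WF 0) l1))//.
  rewrite (le_lt_trans (cdf_homo (mW 0) (WF 0) l4) Fx') => /(_ isT isT).
  have -> : x + k.+1%:R * h - (x + k%:R * h) = h by rewrite uS addrC addKr.
  set A := Aproc _ (x + k.+1%:R * h) _; set B := Aproc _ (x + k%:R * h) _ in IH *.
  move=> h1; rewrite -(subrKA B) (le_trans (ler_normD _ _))//.
  move: IH h1; rewrite -natr1; lra.
have := step N (leqnn _); rewrite NhE [x + _]addrC subrK => H; rewrite (le_trans H)// lerD2l.
have -> : h * Num.sqrt n%:R = c / N%:R by rewrite /h /c mulrAC.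
have FF : F x' - F x <= 1 by have := cdf_fun_ge0 (WF 0) x; have := cdf_fun_le1 (mW 0) (WF 0) x'; lra.
rewrite (@le_trans _ _ (c / N%:R))//; first by rewrite ler_piMr// divr_ge0// ltW.
rewrite ler_pdivrMr// -ler_pdivrMl// mulrC.
by rewrite (le_trans (ltW (archi_boundP _))) ?divr_ge0 ?(ltW e0)// ler_nat.
Qed.

Let Emean v : Ex P (fun w => W 0 w - v) = Ex P (W 0) - v.
Proof. by rewrite ExB ?Ex_cst//; exact: L1_cst. Qed.

Lemma nsum_comp_tight (h : R -> R) : measurable_fun setT h ->
  L1 P (fun w => h (W 0 w) ^+ 2) -> Ex P (h \o W 0) = 0 ->
  tight P (nsum (fun i w => h (W i w))).
Proof.
move=> mh L2 E0; have mh2 : measurable_fun setT (fun x => h x ^+ 2) by exact: measurable_funX.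
have L : L1 P (h \o W 0) by apply: L1_of_L2 => //; exact: measurableT_comp.
apply: (@nsum_tight _ _ _ _ _ (Ex P (fun w => h (W 0 w) ^+ 2))).
- by move=> i; exact: (measurableT_comp mh).
- exact: (indep_fam_comp (phi := fun=> h) iW).
- by move=> i; have [] := sample_Ex i mh2 L2.
- by move=> i; have [_] := sample_Ex i mh L; rewrite E0.
- by move=> i; have [] := sample_Ex i mh2 L2.
Qed.

Lemma L1_affine_sqr (h : R -> R) (c0 : R) : measurable_fun setT h ->
  (forall y, `|h y| <= c0 + `|y|) -> L1 P (fun w => h (W 0 w) ^+ 2).
Proof.
move=> mh hc; apply: (@L1_le _ _ _ _ _ (fun w => 2 * c0 ^+ 2 + 2 * W 0 w ^+ 2)).
- by apply: measurable_funX; exact: (measurableT_comp mh).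
- by apply: L1D; [exact: L1_cst|exact: L1Z].
move=> w; rewrite normrX; have := hc (W 0 w); have := normr_ge0 (h (W 0 w)).
rewrite -[W 0 w ^+ 2]real_normK ?num_real//.
move: `|h _| `|W 0 w| => x y x0 xy.
have : x ^+ 2 <= (c0 + y) ^+ 2 by rewrite lerXn2r ?nnegrE// (le_trans x0).
have := sqr_ge0 (c0 - y); lra.
Qed.

Lemma Aproc_tight u : tight P (fun n w => Aproc n u w).
Proof.
apply: (nsum_comp_tight (h := fun y => pp (u - y) - Abar u)).
- by apply: measurable_funB => //; exact: measurable_pp.
- apply: (@L1_affine_sqr (fun y => pp (u - y) - Abar u) (`|u| + `|Abar u|)).
    by apply: measurable_funB => //; exact: measurable_pp.
  move=> y; rewrite (le_trans (ler_normB _ _))// addrAC lerD2r ger0_norm ?pp_ge0//.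
  by rewrite (le_trans (pp_le_norm _))// ler_normB.
- by rewrite /= ExB ?Ex_cst ?subrr//; exact: L1_cst.
Qed.

Lemma Sproc_tight : tight P Sproc.
Proof.
apply: (nsum_comp_tight (h := fun y => y - Ex P (W 0))).
- exact: measurable_funB.
- apply: (@L1_affine_sqr (fun y => y - Ex P (W 0)) (`|Ex P (W 0)|)); first exact: measurable_funB.
  by move=> y; rewrite (le_trans (ler_normB _ _))// addrC.
- by rewrite /= Emean subrr.
Qed.

Section interval.
Variables (a b : R).
Hypotheses (a0 : 0 < a) (b1 : b < 1).

Let in01 p : a <= p <= b -> 0 < p < 1.
Proof. by move=> /andP[ap pb]; rewrite (lt_le_trans a0)// (le_lt_trans pb). Qed.

Lemma alpha_tightp : tightp P a b (fun n w p => alpha V n p w).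
Proof.
move=> eta eta0.
have [K K0 H] := alpha_tight sample_cdf_meas sample_cdf_indep sample_cdf_le1 sample_cdf_unif eta0.
exists K => //; apply: wpe_sub H; exists 0%N => n _ w h p /in01/andP[p0 p1].
by apply: h; rewrite !ltW.
Qed.

Lemma alpha_oscp : oscp P a b (fun n w p => alpha V n p w).
Proof.
move=> e eta e0 eta0.
have [m H] := alpha_modulus sample_cdf_meas sample_cdf_indep sample_cdf_unif e0 eta0.
exists (2 ^+ m)^-1; first by rewrite invr_gt0 exprn_gt0.
apply: wpe_sub H; exists 0%N => n _ w h p p' /in01/andP[p0 p1] /in01/andP[p0' p1'].
by apply: h; rewrite !ltW.
Qed.

Lemma Aproc_norm_le n w K p p' : a <= p <= b -> a <= p' <= b ->
  (forall t, 0 <= t <= 1 -> `|alpha V n t w| <= K) ->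
  `|Aproc n (Q p) w - Aproc n (Q p') w| <= `|Q p - Q p'| * K.
Proof.
wlog pp' : p p' / p' <= p.
  move=> H pab pab' hK; have [/H|/ltW/H] := leP p' p; first exact.
  by rewrite distrC [ `|Q p - _|]distrC; exact.
move=> /in01 pab /in01 pab' hK.
have QQ : Q p' <= Q p by exact: (cdf_inv_le (mW 0) (WF 0)).
rewrite [ `|Q p - _|]ger0_norm ?subr_ge0//; apply: Aproc_lip => //.
  by rewrite cdf_invK//; case/andP: pab'.
by rewrite cdf_invK//; case/andP: pab.
Qed.

Let Qc p : a <= p <= b -> {for p, continuous Q}.
Proof. by move=> /in01; exact: (cdf_inv_continuous (mW 0) (WF 0)). Qed.

Lemma Aproc_oscp : oscp P a b (fun n w p => Aproc n (Q p) w).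
Proof.
move=> e eta e0 eta0.
have [K K0 H] := alpha_tight sample_cdf_meas sample_cdf_indep sample_cdf_le1 sample_cdf_unif eta0.
have eK : 0 < e / K by rewrite divr_gt0.
have [dl dl0 hQ] := unif_on_continuous Qc eK.
exists dl => //; apply: wpe_sub H; exists 0%N => n _ w h p p' pab pab' pp'.
rewrite (le_trans (Aproc_norm_le pab pab' h))// -ler_pdivlMr//.
exact: hQ.
Qed.

Lemma Aproc_tightp : tightp P a b (fun n w p => Aproc n (Q p) w).
Proof.
move=> eta eta0; have [ab|ba] := leP a b; last first.
  exists 1 => //; exists 0%N => n _; exists set0; split; rewrite ?measure0 ?lee_fin ?ltW//.
  by move=> w _ p /andP[ap pb]; have := lt_le_trans ba (le_trans ap pb); rewrite ltxx.
have e2 : 0 < eta / 2 by rewrite divr_gt0.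
have [K K0 H] := alpha_tight sample_cdf_meas sample_cdf_indep sample_cdf_le1 sample_cdf_unif e2.
have [K' K0' H'] := Aproc_tight (Q a) e2.
have aab : a <= a <= b by rewrite lexx.
exists (K' + (Q b - Q a) * K + 1).
  rewrite !ltr_wpDl ?addr_ge0 ?mulr_ge0 ?(ltW K0) ?(ltW K0')// subr_ge0.
  by apply: (cdf_inv_le (mW 0) (WF 0)) => //; apply: in01; rewrite ?ab ?lexx.
rewrite [eta]splitr; apply: wpe_sub (wpe_and H H'); exists 0%N => n _ w [h h'] p pab.
have h1 := Aproc_norm_le pab aab h; have /andP[ap pb] := pab.
have aQ : Q a <= Q p by apply: (cdf_inv_le (mW 0) (WF 0)) => //; exact: in01.
have Qb : Q p <= Q b.
  by apply: (cdf_inv_le (mW 0) (WF 0)) => //; apply: in01; rewrite ?ab ?lexx.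
rewrite [ `|Q p - _|]ger0_norm ?subr_ge0// in h1.
rewrite -(subrK (Aproc n (Q a) w) (Aproc n (Q p) w)) (le_trans (ler_normD _ _))//.
have : (Q p - Q a) * K <= (Q b - Q a) * K by rewrite ler_wpM2r ?(ltW K0)// lerD2r.
move: h1 h'; lra.
Qed.

Let dF p : R := derive1 F (Q p).

Hypothesis dF_cont : forall p, a <= p <= b -> {for p, continuous dF}.
Hypothesis dF_neq0 : forall p, a <= p <= b -> dF p != 0.

(** The first two terms come from the lower and upper sums of positive parts evaluated at the
    quantile itself; the last one from the displacements of the two order statistics, each close to
    [- alpha / F'] on the scale [sqrt n]. *)
Definition ecf_lin n w p : R :=
  ((1 - p)^-1 - p^-1) * Aproc n (Q p) w + (1 - p)^-1 * Sproc n w +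
  2 / derive1 F (Q p) * alpha V n p w.

Let c1_cont p : a <= p <= b -> {for p, continuous (fun p : R => (1 - p)^-1 - p^-1)}.
Proof.
move=> /in01/andP[p0 p1]; apply: cvgB; apply: cvgV.
- by rewrite subr_eq0 gt_eqF.
- by apply: cvgB; [exact: cvg_cst|exact: cvg_id].
- by rewrite gt_eqF.
- exact: cvg_id.
Qed.

Let c2_cont p : a <= p <= b -> {for p, continuous (fun p : R => (1 - p)^-1)}.
Proof.
move=> /in01/andP[p0 p1]; apply: cvgV; first by rewrite subr_eq0 gt_eqF.
by apply: cvgB; [exact: cvg_cst|exact: cvg_id].
Qed.

Lemma inv_density_continuous p : a <= p <= b ->
  {for p, continuous (fun p => 2 / derive1 F (Q p))}.
Proof.
move=> pab; apply: cvgM; first exact: cvg_cst.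
by apply: cvgV; [exact: dF_neq0|exact: dF_cont].
Qed.

Let S_tightp : tightp P a b (fun n w _ => Sproc n w).
Proof.
move=> eta eta0; have [K K0 H] := Sproc_tight eta0.
by exists K => //; apply: wpe_sub H; exists 0%N.
Qed.

Let S_oscp : oscp P a b (fun n w _ => Sproc n w).
Proof.
move=> e eta e0 eta0; exists 1 => //; exists 0%N => n _.
exists set0; split; rewrite ?measure0 ?lee_fin ?ltW//.
by move=> w _ p p' _ _ _; rewrite subrr normr0 ltW.
Qed.

Lemma ecf_lin_tightp : tightp P a b ecf_lin.
Proof.
apply: tightpD; last exact: tightpM inv_density_continuous alpha_tightp.
by apply: tightpD; [exact: tightpM c1_cont Aproc_tightp|exact: tightpM c2_cont S_tightp].
Qed.

Lemma ecf_lin_oscp : oscp P a b ecf_lin.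
Proof.
apply: oscpD; last exact: oscpM inv_density_continuous alpha_tightp alpha_oscp.
apply: oscpD; first exact: oscpM c1_cont Aproc_tightp Aproc_oscp.
exact: oscpM c2_cont S_tightp S_oscp.
Qed.

End interval.

End sample.

(** * Order statistics and counting *)

Section order_statistics.
Context (R : realType) (w : nat -> R) (n : nat).

Let s := mkseq w n.
Let t := sort <=%R s.

Let size_t : size t = n. Proof. by rewrite size_sort size_mkseq. Qed.

Let t_le i j : (i <= j)%N -> (j < n)%N -> t`_i <= t`_j.
Proof.
move=> ij jn; apply: (@sorted_leq_nth _ _ (@le_trans _ R) (@lexx _ R) 0 t) => //.
- exact: (sort_sorted (@le_total _ R)).
- by rewrite inE size_t (leq_ltn_trans ij).
- by rewrite inE size_t.
Qed.

Lemma order_stat_sum (g : R -> R) :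
  \sum_(i < n) g (w i) = \sum_(0 <= i < n) g (order_stat s i.+1).
Proof.
rewrite -(big_mkord xpredT (fun i => g (w i))) /index_iota subn0.
rewrite -[LHS](big_map w xpredT g) -/(mkseq w n).
rewrite -(perm_big _ (permEl (perm_sort <=%R s)))/= (big_nth 0) -/t size_t.
by rewrite /index_iota subn0.
Qed.

Lemma order_stat_lower k : (0 < k <= n)%N ->
  k%:R^-1 * (\sum_(1 <= j < k.+1) order_stat s j) - order_stat s k =
  - (k%:R^-1 * \sum_(i < n) pp (order_stat s k - w i)).
Proof.
move=> /andP[k0 kn]; have kR : k%:R != 0 :> R by rewrite pnatr_eq0 -lt0n.
rewrite (order_stat_sum (fun z => pp (order_stat s k - z))).
rewrite (big_cat_nat (leq0n k) kn)//= [X in _ = - (_ * (_ + X))]big_nat_cond [X in _ = - (_ * (_ + X))]big1 ?addr0; last first.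
  move=> i; rewrite andbT => /andP[ki iN]; apply/max_idPl; rewrite subr_le0.
  by apply: t_le => //; rewrite (leq_trans (leq_pred k)).
rewrite (@eq_big_nat _ _ _ 0 k _ (fun i => order_stat s k - order_stat s i.+1)); last first.
  move=> i /andP[_ ik]; apply/max_idPr; rewrite subr_ge0.
  by apply: t_le; [rewrite -ltnS (prednK k0)|rewrite (prednK k0)].
rewrite sumrB sumr_const_nat subn0 big_add1/= -[order_stat s k *+ k]mulr_natl mulrBr mulKf//.
by rewrite opprB.
Qed.

Lemma order_stat_upper k : (k < n)%N ->
  (n - k)%:R^-1 * (\sum_(k.+1 <= j < n.+1) order_stat s j) - order_stat s k.+1 =
  (n - k)%:R^-1 * \sum_(i < n) pp (w i - order_stat s k.+1).
Proof.
move=> kn; have kR : (n - k)%:R != 0 :> R by rewrite pnatr_eq0 -lt0n subn_gt0.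
rewrite (order_stat_sum (fun z => pp (z - order_stat s k.+1))).
rewrite (big_cat_nat (leq0n k) (ltnW kn))//= [X in _ = _ * (X + _)]big_nat_cond [X in _ = _ * (X + _)]big1 ?add0r; last first.
  move=> i; rewrite andbT => /andP[_ ik]; apply/max_idPl; rewrite subr_le0.
  by apply: t_le => //; exact: ltnW.
rewrite (@eq_big_nat _ _ _ k n _ (fun i => order_stat s i.+1 - order_stat s k.+1)); last first.
  by move=> i /andP[ki iN]; apply/max_idPr; rewrite subr_ge0; apply: t_le.
rewrite sumrB sumr_const_nat [in LHS]big_add1/= -[order_stat s k.+1 *+ _]mulr_natl mulrBr mulKf//.
Qed.

(** Together with the strict count that follows, this locates the empirical distribution function at
    an order statistic whether or not the sample has ties. *)
Lemma order_stat_count_le k : (0 < k <= n)%N ->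
  k%:R <= \sum_(i < n) ((w i <= order_stat s k)%R)%:R :> R.
Proof.
move=> /andP[k0 kn]; rewrite (order_stat_sum (fun z => ((z <= order_stat s k)%R)%:R)).
rewrite (big_cat_nat (leq0n k) kn)//= (@eq_big_nat _ _ _ 0 k _ (fun i => 1)); last first.
  move=> i /andP[_ ik]; suff -> : order_stat s i.+1 <= order_stat s k by [].
  by apply: t_le; [rewrite -ltnS (prednK k0)|rewrite (prednK k0)].
by rewrite sumr_const_nat subn0 lerDl; apply: sumr_ge0.
Qed.

Lemma order_stat_count_lt k : (0 < k <= n)%N ->
  \sum_(i < n) ((w i < order_stat s k)%R)%:R <= k.-1%:R :> R.
Proof.
move=> /andP[k0 kn]; rewrite (order_stat_sum (fun z => ((z < order_stat s k)%R)%:R)).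
have kn' : (k.-1 <= n)%N by rewrite (leq_trans (leq_pred k)).
rewrite (big_cat_nat (leq0n k.-1) kn')//= [X in _ + X]big_nat_cond [X in _ + X]big1 ?addr0; last first.
  move=> i; rewrite andbT => /andP[ki iN].
  suff : order_stat s k <= order_stat s i.+1 by rewrite leNgt => /negbTE ->.
  exact: t_le.
rewrite (@le_trans _ _ (\sum_(0 <= i < k.-1) 1))//.
  by apply: ler_sum => i _; case: (_ < _).
by rewrite sumr_const_nat subn0.
Qed.

End order_statistics.

Section expansion_arithmetic.
Context (R : realType).

Let tri3 (x y z a b c : R) : `|x| <= a -> `|y| <= b -> `|z| <= c -> `|x + y + z| <= a + b + c.
Proof.
move=> xa yb zc; rewrite (le_trans (ler_normD _ _))// lerD//.
by rewrite (le_trans (ler_normD _ _))// lerD.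
Qed.

Let prod_le (x y a b : R) : `|x| <= a -> `|y| <= b -> `|x * y| <= a * b.
Proof. by move=> xa yb; rewrite normrM ler_pM. Qed.

(* [sg = sqrt n], [r = n / k], [r' = n / (n - k)], [x] and [y] are the order
   statistics around [q], [ca] is the value of the empirical process divided
   by the density, and [A], [B] stand for [Aproc], [Abar]. *)
Lemma ecf_expansion (C eta sg p r r' q x y mu ca S A Ax Ay B Bx By : R) :
  1 <= C -> 0 <= eta -> eta <= 1 -> 1 <= sg ->
  `|p^-1| <= C -> `|(1 - p)^-1| <= C -> p != 0 -> 1 - p != 0 ->
  `|q| <= C -> `|mu| <= C -> `|ca| <= C -> `|S| <= C -> `|A| <= C -> `|B| <= C ->
  sg * `|r - p^-1| <= eta -> sg * `|r' - (1 - p)^-1| <= eta ->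
  `|Ax - A| <= C * eta -> `|Ay - A| <= C * eta ->
  `|sg * (x - q) + ca| <= eta -> `|sg * (y - q) + ca| <= eta ->
  `|x - q| <= eta -> `|y - q| <= eta ->
  `|Bx - B - p * (x - q)| <= `|x - q| * eta ->
  `|By - B - p * (y - q)| <= `|y - q| * eta ->
  `|Bx - B| <= `|x - q| -> `|By - B| <= `|y - q| ->
  `|(- (r * Ax) + r' * (Ay + S) + sg * (- (r * Bx) + p^-1 * B)
      + sg * (r' * (By + mu - y) - (1 - p)^-1 * (B + mu - q)))
    - (((1 - p)^-1 - p^-1) * A + (1 - p)^-1 * S + 2 * ca)| <= 23 * C ^+ 2 * eta.
Proof.
move=> C1 e0 e1 s1 hp hp' p0 p1 hq hmu hca hS hA hB hr hr' hAx hAy hx hy hxq hyq hBx hBy lBx lBy.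
have C0 : 0 <= C by rewrite (le_trans ler01).
have s0 : 0 <= sg by rewrite (le_trans ler01).
have Ce : C * eta <= C by rewrite ler_piMr.
have CC : C <= C * C by rewrite ler_peMl.
have dr : `|r - p^-1| <= eta by rewrite (le_trans _ hr)// ler_peMl.
have dr' : `|r' - (1 - p)^-1| <= eta by rewrite (le_trans _ hr')// ler_peMl.
have bAx : `|Ax| <= 2 * C.
  by rewrite -(subrK A Ax) (le_trans (ler_normD _ _))//; lra.
have bAy : `|Ay + S| <= 3 * C.
  by rewrite -(subrK A Ay) (le_trans (tri3 hAy hA hS))//; lra.
have bBx : `|Bx| <= 2 * C.
  by rewrite -(subrK B Bx) (le_trans (ler_normD _ _))//; lra.
have bBy : `|By + mu - y| <= 5 * C.
  rewrite (_ : By + mu - y = (By - B) + (B + mu - q) + - (y - q)); last by ring.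
  have bq : `|B + mu - q| <= C + C + C by apply: tri3; rewrite ?normrN.
  by rewrite (le_trans (tri3 (le_trans lBy hyq) bq (_ : _ <= eta)))//; [rewrite normrN|lra].
have sx z : `|sg * (z - q) + ca| <= eta -> sg * `|z - q| <= 2 * C.
  move=> hz; have -> : sg * `|z - q| = `|sg * (z - q)| by rewrite normrM ger0_norm.
  by rewrite -[X in `|X|](addrK ca) (le_trans (ler_normB _ _))//; lra.
have sD (u v : R) : sg * `|u| <= eta -> `|v| <= 5 * C -> `|sg * u * v| <= eta * (5 * C).
  by move=> hu hv; apply: prod_le => //; rewrite normrM (ger0_norm s0).
have sE z Bz : sg * `|z - q| <= 2 * C -> `|Bz - B - p * (z - q)| <= `|z - q| * eta ->
    `|sg * (Bz - B - p * (z - q))| <= 2 * C * eta.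
  move=> hz hBz; rewrite normrM ger0_norm// (le_trans (ler_wpM2l s0 hBz))//.
  by rewrite mulrA ler_wpM2r.
have T1 : `|- ((r - p^-1) * Ax) - p^-1 * (Ax - A)| <= eta * (2 * C) + C * (C * eta).
  rewrite (le_trans (ler_normB _ _))// normrN lerD//; exact: prod_le.
have T2 : `|(r' - (1 - p)^-1) * (Ay + S) + (1 - p)^-1 * (Ay - A)| <=
    eta * (3 * C) + C * (C * eta).
  rewrite (le_trans (ler_normD _ _))// lerD//; exact: prod_le.
(* The slope [p] of the mean at [q] cancels the factor [p^-1], which leaves exactly [- sg (x - q)],
   hence one [ca]. In [T4] the slope [p - 1] against [(1 - p)^-1] gives the second one. *)
have T3 : `|- (sg * (r - p^-1) * Bx) + - (p^-1 * (sg * (Bx - B - p * (x - q))))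
      + - (sg * (x - q) + ca)| <= eta * (5 * C) + C * (2 * C * eta) + eta.
  apply: tri3; rewrite normrN//; first by apply: sD => //; rewrite (le_trans bBx)//; lra.
  by apply: prod_le => //; apply: sE => //; exact: sx.
have T4 : `|sg * (r' - (1 - p)^-1) * (By + mu - y)
      + (1 - p)^-1 * (sg * (By - B - p * (y - q)))
      + - (sg * (y - q) + ca)| <= eta * (5 * C) + C * (2 * C * eta) + eta.
  apply: tri3; rewrite ?normrN//; first exact: sD.
  by apply: prod_le => //; apply: sE => //; exact: sx.
set X := (X in `|X|); have -> : X =
    (- ((r - p^-1) * Ax) - p^-1 * (Ax - A)) +
    ((r' - (1 - p)^-1) * (Ay + S) + (1 - p)^-1 * (Ay - A)) +
    ((- (sg * (r - p^-1) * Bx) + - (p^-1 * (sg * (Bx - B - p * (x - q))))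
      + - (sg * (x - q) + ca)) +
    (sg * (r' - (1 - p)^-1) * (By + mu - y)
      + (1 - p)^-1 * (sg * (By - B - p * (y - q)))
      + - (sg * (y - q) + ca))).
  by rewrite /X; field; rewrite p0 p1.
have T34 := le_trans (ler_normD _ _) (lerD T3 T4).
(* The four bounds add up to [15 C eta + 6 C ^ 2 eta + 2 eta], and 23 is the sum of these
   coefficients, as [C >= 1]. *)
rewrite (le_trans (tri3 T1 T2 T34))//.
have h1 : C * eta <= C * C * eta by rewrite ler_wpM2r.
have h2 : eta <= C * eta by rewrite ler_peMl.
by move: h1 h2; rewrite expr2; clear; lra.
Qed.

End expansion_arithmetic.

Section uniform_law.
Context d (T : measurableType d) (R : realType) (P : probability T R).
Variable V : T -> R.
Hypothesis mV : measurable_fun setT V.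
Hypothesis uV : forall t, 0 <= t <= 1 -> P [set w | V w <= t] = t%:E.
Local Notation mu := (@lebesgue_measure R).

Let unif : probability _ R := uniform_prob (@ltr01 R).

Let unif_sub (B : set R) : measurable B -> B `<=` `[0, 1] -> unif B = mu B.
Proof.
move=> mB B01; rewrite /unif/= /uniform_prob.
rewrite (eq_integral (fun=> 1%:E)); first by rewrite integral_cst// mul1e.
by move=> x; rewrite inE => /B01; rewrite /= in_itv/= /uniform_pdf => ->; rewrite subr0 invr1.
Qed.

Let unif_ray (t : R) : 0 <= t <= 1 -> unif `]t, +oo[%classic = (1 - t)%:E.
Proof.
move=> /andP[t0 t1].
have E : `]t, +oo[ `&` `[0, 1] = `]t, 1]%classic :> set R.
  apply/seteqP; split=> x /=; rewrite !in_itv/= ?andbT; first by case=> -> /andP[_ ->].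
  by move=> /andP[tx x1]; rewrite tx x1 (ltW (le_lt_trans t0 tx)).
have -> : unif `]t, +oo[%classic = unif `]t, 1]%classic.
  rewrite /unif/= /uniform_prob [LHS]integral_uniform_pdf E [RHS]integral_uniform_pdf.
  congr (integral _ _ _); apply/seteqP; split=> x /=; rewrite !in_itv/=; last by case.
  by move=> /andP[tx x1]; rewrite tx x1 (ltW (le_lt_trans t0 tx)).
rewrite unif_sub//; last first.
  by move=> x /=; rewrite !in_itv/= => /andP[tx ->]; rewrite (ltW (le_lt_trans t0 tx)).
rewrite lebesgue_measure_itv/= lte_fin; case: ltP => // t1'.
by have -> : t = 1 by [lra]; rewrite subrr.
Qed.

Lemma uniform_law_lebesgue (B : set R) : measurable B -> B `<=` `[0, 1] ->
  P (V @^-1` B) = mu B.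
Proof.
move=> mB B01; rewrite -(unif_sub mB B01).
have rayC (y : R) : P (V @^-1` `]y, +oo[) = (1 - fine (P [set w | V w <= y]))%:E.
  have m : measurable [set w | V w <= y].
    by rewrite -[X in measurable X]setTI; apply: measurable_fun_le.
  rewrite EFinB EFin_prob//.
  have -> : V @^-1` `]y, +oo[ = ~` [set w | V w <= y].
    by apply/seteqP; split=> w /=; rewrite in_itv/= andbT ltNge => /negP.
  by rewrite probability_setC.
have mono (x y : R) : x <= y -> (unif `]y, +oo[%classic <= unif `]x, +oo[%classic)%E.
  move=> xy; apply: le_measure; rewrite ?inE//.
  by move=> z /=; rewrite !in_itv/= !andbT; exact: le_lt_trans.
have mleV (y : R) : measurable [set w | V w <= y].
  by rewrite -[X in measurable X]setTI; apply: measurable_fun_le.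
apply: (@law_eq_rays _ _ _ _ _ P unif V idfun mV (@measurable_id _ _ setT)) => // y.
rewrite preimage_id rayC; have [y0|y0] := ltP y 0.
  have -> : P [set w | V w <= y] = 0%E.
    apply/eqP; rewrite eq_le measure_ge0 andbT -[leRHS](uV (t := 0)) ?lexx ?ler01//.
    by apply: le_measure; rewrite ?inE// => w /= h; rewrite (le_trans h)// ltW.
  rewrite subr0; apply/eqP; rewrite eq_le probability_le1// andbT.
  by rewrite -[leLHS](_ : unif `]0, +oo[%classic = _) ?mono ?(ltW y0)// unif_ray ?lexx ?ler01// subr0.
have [y1|y1] := leP y 1; first by rewrite uV ?y0// unif_ray ?y0.
have -> : P [set w | V w <= y] = 1%E.
  apply/eqP; rewrite eq_le probability_le1//= -[leLHS](uV (t := 1)) ?lexx ?ler01//.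
  by apply: le_measure; rewrite ?inE// => w /= h; rewrite (le_trans h)// ltW.
rewrite subrr; apply/esym/eqP; rewrite eq_le measure_ge0 andbT.
by rewrite -[leRHS](_ : unif `]1, +oo[%classic = _) ?mono ?(ltW y1)// unif_ray ?lexx ?ler01// subrr.
Qed.

(** Turns the integrals of the quantile function in [crossover] into expectations over the
    sample. *)
Lemma integral_uniform_law (f : R -> R) (A : set R) : measurable A ->
  A `<=` `[0, 1] -> measurable_fun A f ->
  L1 P (fun w => (f \_ A) (V w)) ->
  \int[mu]_(x in A) f x = Ex P (fun w => (f \_ A) (V w)).
Proof.
move=> mA A01 mf L; rewrite /Rintegral /Ex /Rintegral; congr fine.
have mfA : measurable_fun setT (EFin \o (f \_ A)).
  by apply/measurable_EFinP; apply/(measurable_restrictT f mA).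
have := @integral_pushforward _ _ T (measurableTypeR R) R V mV P setT (EFin \o (f \_ A)) mfA.
rewrite preimage_setT => /(_ L measurableT) /= <-.
rewrite integral_mkcond.
have fE : ((fun x => (f x)%:E) \_ A) = (fun x => ((f \_ A) x)%:E).
  by apply/funext => x; rewrite !patchE; case: ifP.
rewrite fE; have E0 (m : {measure set (measurableTypeR R) -> \bar R}) :
    (\int[m]_x ((f \_ A) x)%:E = \int[m]_(x in A) ((f \_ A) x)%:E)%E.
  rewrite [RHS]integral_mkcond; apply: eq_integral => x _.
  by rewrite !patchE; case: ifP => //; rewrite patchE => ->.
have mV' : measurable_fun setT (V : T -> measurableTypeR R) by exact: mV.
transitivity (\int[distribution P (mkRV mV')]_x ((f \_ A) x)%:E)%E; last by [].
rewrite E0 [RHS]E0; apply: eq_measure_integral => B mB BA.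
exact: (esym (uniform_law_lebesgue mB (subset_trans BA A01))).
Qed.

End uniform_law.

Section rank_bounds.
Context (R : realType).
Implicit Types (N k p c : R).

Lemma ecf_rank_itv n p : 0 <= p ->
  n%:R * p < (ecf_rank n p)%:R <= n%:R * p + 1.
Proof.
move=> p0; have /truncn_itv/andP[h1 h2] : 0 <= n%:R * p by rewrite mulr_ge0.
by rewrite /ecf_rank h2 -natr1 lerD2r.
Qed.

(** The rank differs from [N p] by at most 1, so the error on the inverse frequency is of order
    [1 / N] and survives multiplication by [sqrt n]. *)
Lemma ratio_upper N k p c : 0 < c -> c <= p -> 0 < N -> N * p < k <= N * p + 1 ->
  `|N / k - p^-1| <= (N * c ^+ 2)^-1.
Proof.
move=> c0 cp N0 /andP[k1 k2]; have p0 := lt_le_trans c0 cp.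
have k0 : 0 < k by rewrite (lt_trans _ k1)// mulr_gt0.
have -> : N / k - p^-1 = - ((k - N * p) / (k * p)) by field; rewrite !gt_eqF.
rewrite normrN ger0_norm ?divr_ge0 ?mulr_ge0 ?(ltW k0) ?(ltW p0) ?subr_ge0 ?(ltW k1)//.
rewrite ler_pdivrMr ?mulr_gt0// ler_pdivlMl ?mulr_gt0 ?exprn_gt0//.
have h1 : c ^+ 2 <= p * p by rewrite -expr2 lerXn2r// nnegrE ltW.
have h2 : N * (p * p) <= k * p by rewrite mulrA ler_wpM2r ?(ltW k1)// ltW.
have h3 : N * c ^+ 2 <= k * p by rewrite (le_trans _ h2)// ler_wpM2l// ltW.
by rewrite (le_trans _ h3)// ler_piMr ?mulr_ge0 ?exprn_ge0 ?(ltW N0) ?(ltW c0)//; lra.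
Qed.

Lemma ratio_lower N k p c : 0 < c -> c <= p -> 0 < N -> 2 <= N * c ->
  N * p - 1 <= k < N * p -> `|N / k - p^-1| <= 2 / (N * c ^+ 2).
Proof.
move=> c0 cp N0 Nc /andP[k1 k2]; have p0 := lt_le_trans c0 cp.
have Ncp : N * c <= N * p by rewrite ler_wpM2l// ltW.
have kN : N * c / 2 <= k by lra.
have k0 : 0 < k by lra.
have -> : N / k - p^-1 = (N * p - k) / (k * p) by field; rewrite !gt_eqF.
rewrite ger0_norm ?divr_ge0 ?mulr_ge0 ?(ltW k0) ?(ltW p0) ?subr_ge0 ?(ltW k2)//.
rewrite ler_pdivrMr ?mulr_gt0// mulrAC ler_pdivlMr ?mulr_gt0 ?exprn_gt0//.
have h1 : N * c / 2 * c <= k * p by rewrite ler_pM// ?divr_ge0 ?mulr_ge0 ?(ltW N0) ?(ltW c0).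
have h2 : (N * p - k) * (N * c ^+ 2) <= N * c ^+ 2.
  by rewrite ler_piMl ?mulr_ge0 ?exprn_ge0 ?(ltW N0) ?(ltW c0)//; lra.
rewrite (le_trans h2)// expr2; lra.
Qed.

Lemma sqrt_ge_bound (s : R) n : (Num.bound (s ^+ 2) <= n)%N -> s <= Num.sqrt n%:R.
Proof.
move=> h; have [s0|/ltW s0] := leP 0 s; last by rewrite (le_trans s0).
rewrite -(ger0_norm s0) -sqrtr_sqr ler_wsqrtr//.
by rewrite (le_trans (ltW (archi_boundP (sqr_ge0 _))))// ler_nat.
Qed.

Lemma le_sum9 (s x1 x2 x3 x4 x5 x6 x7 x8 x9 : R) :
  0 < x1 -> 0 < x2 -> 0 < x3 -> 0 < x4 -> 0 < x5 -> 0 < x6 -> 0 < x7 -> 0 < x8 ->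
  0 < x9 -> 1 + x1 + x2 + x3 + x4 + x5 + x6 + x7 + x8 + x9 <= s ->
  [/\ 1 <= s, [/\ x1 <= s, x2 <= s & x3 <= s], [/\ x4 <= s, x5 <= s & x6 <= s] &
      [/\ x7 <= s, x8 <= s & x9 <= s]].
Proof. by move=> *; do ?split; lra. Qed.

Lemma rank_lt N k p c : 0 < N -> p <= c -> 2 <= N * (1 - c) -> k <= N * p + 1 -> k < N.
Proof. by move=> N0 pc Nc kN; have := ler_wpM2l (ltW N0) pc; lra. Qed.

Lemma rank_compl N k p : N * p < k -> k <= N * p + 1 ->
  N * (1 - p) - 1 <= N - k < N * (1 - p).
Proof. by move=> *; apply/andP; split; lra. Qed.

Lemma half_le (h x : R) : x <= h -> h / 4 + x / 4 <= h / 2.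
Proof. lra. Qed.

End rank_bounds.

(** * Uniform negligibility of the remainder *)

Section ecf_remainder.
Context d (T : measurableType d) (R : realType) (P : probability T R).
Variables (W : nat -> T -> R) (F : R -> R).
Hypothesis mW : forall i, measurable_fun setT (W i).
Hypothesis iW : indep_fam P W.
Hypothesis WF : forall i x, P (W i @^-1` `]-oo, x]) = (F x)%:E.
Hypothesis F_inv : forall p : R, 0 < p < 1 -> exists! x : R, F x = p.
Hypothesis W2 : L1 P (fun w => W 0 w ^+ 2).

Local Notation Q := (cdf_inv F).
Local Notation mu := (@lebesgue_measure R).
Let V i w := F (W i w).
Let A := Abar P W.
Let m := Ex P (W 0).

Let LW : L1 P (W 0). Proof. exact: L1_of_L2. Qed.

Let mV : measurable_fun setT (V 0). Proof. exact: (sample_cdf_meas mW WF). Qed.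

Let uV t : 0 <= t <= 1 -> P [set w | V 0 w <= t] = t%:E.
Proof. exact: (sample_cdf_unif mW WF F_inv). Qed.

Let Q_meas (B : set R) : open B -> (forall p, B p -> 0 < p < 1) -> measurable_fun B Q.
Proof.
move=> oB B01; apply: open_continuous_measurable_fun => // p.
by rewrite inE => /B01; exact: (cdf_inv_continuous (mW 0) (WF 0)).
Qed.

Let integral_Q (B : set R) : open B -> (forall p, B p -> 0 < p < 1) ->
  \int[mu]_(q in B) Q q = Ex P (fun w => W 0 w * \1_B (V 0 w)).
Proof.
move=> oB B01; have mB : measurable B by exact: open_measurable.
have E : (fun w => W 0 w * \1_B (V 0 w)) = (fun w => (Q \_ B) (V 0 w)).
  apply/funext => w; rewrite indicE patchE; case: ifPn => [|_]; last by rewrite mulr0.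
  by rewrite inE => /B01 V01; rewrite mulr1; exact: (cdf_inv_uniq F_inv V01).
rewrite E; apply: integral_uniform_law => //.
- by move=> p /B01/andP[p0 p1]; rewrite /= in_itv/= !ltW.
- exact: Q_meas.
rewrite -E; apply: (@L1_le _ _ _ _ _ (fun w => `|W 0 w|)); last 2 first.
- exact: L1_norm.
- by move=> w; rewrite normrM ler_piMr// indicE; case: (_ \in _); rewrite ?normr1 ?normr0.
by apply: measurable_funM => //; apply: measurableT_comp => //; exact: measurable_indic.
Qed.

(** Since [Q (F W)] is [W] almost surely, the lower integral is the expectation of [W] on [F W < p],
    that is [p Q p - Abar (Q p)]; the upper one is the mean minus this. *)
Lemma crossoverE p : 0 < p < 1 -> crossover F p =
  - (p^-1 * A (Q p)) + (1 - p)^-1 * (A (Q p) + m - Q p).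
Proof.
move=> p01; have /andP[p0 p1] := p01.
pose q := Q p.
have mind (B : set R) : measurable B -> measurable_fun setT (fun w => W 0 w * \1_B (V 0 w)).
  by move=> mB; apply: measurable_funM => //; apply: measurableT_comp => //; exact: measurable_indic.
(* Null event on which the level of the observation is 0, [p] or 1; off it the two open intervals
   form a partition. *)
pose N := V 0 @^-1` [set` [:: 0; p; 1]].
have cN : countable ([set` [:: 0; p; 1]] : set R).
  by apply: finite_set_countable; exact: finite_seq.
have mNs : measurable ([set` [:: 0; p; 1]] : set R).
  by apply: countable_measurable => // t; exact: measurable_set1.
have mN : measurable N.
  exact: measurable_preimage.
have PN : P N = 0%E.
  rewrite /N (uniform_law_lebesgue mV uV); first last.
  - move=> t /=; rewrite in_itv/= !inE => /or3P[]/eqP->; rewrite ?lexx ?ler01//.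
    by rewrite !ltW.
  - by [].
  exact: countable_lebesgue_measure0.
have N01 w : ~ N w -> 0 < V 0 w < 1 /\ V 0 w != p.
  rewrite /N/= !inE => /negP; rewrite !negb_or => /and3P[n0 np n1].
  by rewrite np !lt_neqAle n1 eq_sym n0 (cdf_fun_ge0 (WF 0)) (sample_cdf_le1 mW WF).
have ae_eq (X Y : T -> R) : measurable_fun setT X -> measurable_fun setT Y ->
    (forall w, ~ N w -> X w = Y w) -> Ex P X = Ex P Y.
  move=> mX mY XY; apply: Ex_ae_eq => //; exists N; split=> // w /= h.
  by apply: contrapT => /XY.
have Lpp : L1 P (fun w => pp (q - W 0 w)).
  apply: (@L1_le _ _ _ _ _ (fun w => `|q| + `|W 0 w|)).
  - exact: (measurableT_comp (measurable_pp q)).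
  - by apply: L1D; [exact: L1_cst|exact: L1_norm].
  by move=> w; rewrite ger0_norm ?pp_ge0// (le_trans (pp_le_norm _))// ler_normB.
have Lind := sample_ind_L1 P mW q.
have LqI : L1 P (fun w => q * ((W 0 w <= q)%R)%:R - pp (q - W 0 w)).
  by apply: L1B => //; exact: L1Z.
have lo : Ex P (fun w => W 0 w * \1_`]0, p[ (V 0 w)) = p * q - A q.
  rewrite -[p in p * q](cdf_invK F_inv p01) -(sample_ind_Ex mW WF) mulrC -ExZ// -ExB//; last exact: L1Z.
  apply: ae_eq => [||w /N01[V01 Vp]]; [by apply: mind|exact: L1_meas LqI|].
  have E : (V 0 w <= p) = (W 0 w <= q) := cdf_le_inv (mW 0) (WF 0) F_inv _ p01.
  rewrite indicE -E; have [Vle|Vgt] := leP (V 0 w) p; last first.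
    rewrite memNset/=; last by rewrite in_itv/= => /andP[_]; rewrite ltNge (ltW Vgt).
    rewrite !mulr0 sub0r; suff -> : pp (q - W 0 w) = 0 by rewrite oppr0.
    by apply/max_idPl; rewrite subr_le0 ltW// ltNge -E -ltNge.
  rewrite mem_set/=; last by rewrite in_itv/= [V 0 w < p]lt_neqAle Vp Vle; case/andP: V01 => ->.
  have -> : pp (q - W 0 w) = q - W 0 w by apply/max_idPr; rewrite subr_ge0 -E.
  by rewrite !mulr1; ring.
have hi : Ex P (fun w => W 0 w * \1_`]p, 1[ (V 0 w)) = m - (p * q - A q).
  rewrite -lo -ExB//; last first.
    apply: (@L1_le _ _ _ _ _ (fun w => `|W 0 w|)); [by apply: mind|exact: L1_norm|].
    by move=> w; rewrite normrM ler_piMr// indicE; case: (_ \in _); rewrite ?normr1 ?normr0.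
  apply: ae_eq => [||w /N01[/andP[V0 V1] Vp]]; [by apply: mind|by apply: measurable_funB => //; apply: mind|].
  rewrite !indicE; have [Vle|Vgt] := ltP (V 0 w) p.
    rewrite memNset/=; last by rewrite in_itv/= => /andP[]; rewrite ltNge (ltW Vle).
    by rewrite mem_set/= ?in_itv/= ?V0// mulr0 mulr1 subrr.
  rewrite mem_set/=; last by rewrite in_itv/= V1 [p < V 0 w]lt_neqAle eq_sym Vp Vgt.
  rewrite memNset/= ?mulr1 ?mulr0 ?subr0//.
  by rewrite in_itv/= => /andP[_]; rewrite ltNge Vgt.
rewrite /crossover !integral_Q ?lo ?hi.
- by rewrite -/q; field; rewrite [p == 0]gt_eqF// subr_eq0 [1 == p]gt_eqF.
- exact: itv_open.
- by move=> t /=; rewrite in_itv/= => /andP[tp t1]; rewrite t1 (lt_trans p0).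
- exact: itv_open.
- by move=> t /=; rewrite in_itv/= => /andP[t0 tp]; rewrite t0 (lt_trans tp).
Qed.

(* [x] is any point at which the empirical distribution function crosses [p]. *)
Lemma quantile_expansion n w K (mm : nat) eps p x : (0 < n)%N -> 0 < p < 1 ->
  (forall t, 0 <= t <= 1 -> `|alpha V n t w| <= K) ->
  (forall s t, 0 <= s <= 1 -> 0 <= t <= 1 -> `|s - t| <= (2 ^+ mm)^-1 ->
    `|alpha V n s w - alpha V n t w| <= eps) ->
  Num.sqrt n%:R * p <= (Num.sqrt n%:R)^-1 * \sum_(i < n) ((W i w <= x)%R)%:R ->
  (Num.sqrt n%:R)^-1 * \sum_(i < n) ((W i w < x)%R)%:R <=
    Num.sqrt n%:R * p + (Num.sqrt n%:R)^-1 ->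
  K + 1 <= Num.sqrt n%:R * p -> (K + 2) / Num.sqrt n%:R <= (2 ^+ mm)^-1 ->
  `|F x - p| <= (K + 2) / Num.sqrt n%:R /\
  `|Num.sqrt n%:R * (F x - p) + alpha V n p w| <= 2 * eps + 2 / Num.sqrt n%:R.
Proof.
move=> n0 /andP[p0 p1] hK hmm hx1 hx2 hKp hKm.
have FK := cdf_fun_le1 (mW 0) (WF 0) x; have F0 := cdf_fun_ge0 (WF 0) x.
pose sg : R := Num.sqrt n%:R; rewrite -/sg in hx1 hx2 hKp hKm *.
have sg1 : 1 <= sg by rewrite -[leLHS]sqrtr1 ler_wsqrtr// ler1n.
have sg0 : 0 < sg by rewrite (lt_le_trans ltr01).
pose i := sg^-1; have i0 : 0 < i by rewrite invr_gt0.
have i1 : i <= 1 by rewrite invf_le1.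
have si : sg * i = 1 by rewrite divff// gt_eqF.
rewrite -/i in hx2 hKm *; set v := F x in FK F0 *.
have Nv : sg * p <= alpha V n v w + sg * v.
  rewrite alphaE (le_trans hx1)// ler_wpM2l ?invr_ge0 ?(ltW sg0)//.
  apply: ler_sum => j _; case: (leP (W j w) x) => // Wx.
  by rewrite (cdf_homo (mW 0) (WF 0) Wx).
have /andP[k1 k2] : - K <= alpha V n v w <= K by rewrite -ler_norml hK// F0.
pose v' := v - i * i.
have Nv' : alpha V n v' w + sg * v' <= sg * p + i.
  rewrite alphaE (le_trans _ hx2)// ler_wpM2l ?(ltW i0)//.
  apply: ler_sum => j _; case: (ltP (W j w) x) => Wx; first by case: (F _ <= _).
  suff : ~~ (F (W j w) <= v') by move=> /negbTE ->.
  rewrite -ltNge (@lt_le_trans _ _ v) ?(cdf_homo (mW 0) (WF 0) Wx)//.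
  by rewrite /v' gtrBl mulr_gt0.
have sv1 : 1 <= sg * v by lra.
have v'0 : 0 <= v'.
  rewrite subr_ge0 -(@ler_pM2l _ sg)// mulrA si mul1r (le_trans i1)//.
have v'1 : v' <= 1 by rewrite /v' lerBlDr (le_trans FK)// lerDl mulr_ge0// ltW.
have /andP[k3 k4] : - K <= alpha V n v' w <= K by rewrite -ler_norml hK// v'0.
have sv' : sg * v' = sg * v - i by rewrite /v' mulrBr mulrA si mul1r.
have svp : `|sg * (v - p)| <= K + 2 by rewrite ler_norml; apply/andP; split; lra.
have vp : `|v - p| <= (K + 2) * i.
  rewrite -(@ler_pM2l _ sg)// [leRHS]mulrCA si mulr1 (le_trans _ svp)//.
  by rewrite normrM gtr0_norm.
split=> //.
have /andP[m1 m2] : - eps <= alpha V n v w - alpha V n p w <= eps.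
  by rewrite -ler_norml hmm ?F0 ?(ltW p0) ?(ltW p1)// (le_trans vp).
have /andP[m3 m4] : - eps <= alpha V n v w - alpha V n v' w <= eps.
  rewrite -ler_norml hmm ?F0 ?v'0//.
  rewrite /v' opprB addrC subrK ger0_norm ?mulr_ge0 ?(ltW i0)// (le_trans _ hKm)//.
  by rewrite ler_wpM2r ?(ltW i0)//; lra.
rewrite ler_norml; apply/andP; split; lra.
Qed.

(** Exact identity. The identity [pp (- y) = pp y - y] reduces the upper positive parts to the lower
    ones plus a linear term, so that [Aproc] and the centred sum [Sproc] suffice for both
    averages. *)
Lemma ecf_errorE n w p : (0 < n)%N -> (ecf_rank n p < n)%N -> 0 < p < 1 ->
  let k := ecf_rank n p in
  let x := order_stat (mkseq (W ^~ w) n) k in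
  let y := order_stat (mkseq (W ^~ w) n) k.+1 in
  let r := n%:R / k%:R in let r' := n%:R / (n - k)%:R in
  ecf_error F n (W ^~ w) p =
  - (r * Aproc P W n x w) + r' * (Aproc P W n y w + Sproc P W n w)
  + Num.sqrt n%:R * (- (r * A x) + p^-1 * A (Q p))
  + Num.sqrt n%:R * (r' * (A y + m - y) - (1 - p)^-1 * (A (Q p) + m - Q p)).
Proof.
move=> n0 kn p01 k x y r r'.
have k0 : (0 < k)%N by [].
pose sg : R := Num.sqrt n%:R; rewrite -/sg.
have sg0 : 0 < sg by rewrite sqrtr_gt0 ltr0n.
have sg2 : n%:R = sg * sg by rewrite -expr2 sqr_sqrtr.
have Sx z : \sum_(i < n) pp (z - W i w) = sg * Aproc P W n z w + n%:R * A z.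
  rewrite /Aproc /nsum sumrB sumr_const card_ord mulrA divff ?gt_eqF// mul1r.
  by rewrite -[_ *+ n]mulr_natl subrK.
have Sy z : \sum_(i < n) pp (W i w - z) =
    sg * (Aproc P W n z w + Sproc P W n w) + n%:R * (A z + m - z).
  rewrite (eq_bigr (fun i : 'I_n => pp (z - W i w) + ((W i w - m) - (z - m)))); last first.
    by move=> i _; rewrite -opprB ppN; ring.
  rewrite big_split/= Sx sumrB sumr_const card_ord -[(z - m) *+ n]mulr_natl.
  have -> : \sum_(i < n) (W i w - m) = sg * Sproc P W n w.
    by rewrite /Sproc /nsum mulrA divff ?gt_eqF// mul1r.
  by ring.
rewrite /ecf_error /ecf size_mkseq -/k crossoverE// -/sg.
rewrite order_stat_lower ?k0 ?(ltnW kn)// -[_ - order_stat _ k.+1]addrA order_stat_upper// -/x -/y Sx Sy.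
rewrite /r /r'.
have kR : k%:R != 0 :> R by rewrite pnatr_eq0 -lt0n.
have nkR : (n - k)%:R != 0 :> R by rewrite pnatr_eq0 -lt0n subn_gt0.
move: (k%:R) ((n - k)%:R) kR nkR => kk nn kk0 nn0.
rewrite sg2; field.
have /andP[p0 p1] := p01.
by rewrite kk0 nn0 [p == 0]gt_eqF// subr_eq0 [1 == p]gt_eqF.
Qed.

Hypothesis F_cont : continuous F.
Hypothesis F_der : forall p, 0 < p < 1 -> derivable F (Q p) 1.

Let dF p : R := derive1 F (Q p).

(** Mean value theorem for [F] between two quantiles; the intermediate point is itself a quantile,
    at a level between [t] and [u], so the derivative is read through [dF]. *)
Lemma cdf_mvt t u : 0 < t < 1 -> 0 < u < 1 ->
  exists2 r, `|r - t| <= `|u - t| & u - t = dF r * (Q u - Q t).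
Proof.
have key s v : 0 < s < 1 -> 0 < v < 1 -> s <= v ->
    exists2 r, s <= r <= v & v - s = dF r * (Q v - Q s).
  move=> s01 v01 sv; have QQ : Q s <= Q v by exact: (cdf_inv_le (mW 0) (WF 0)).
  have Fz z : Q s <= z -> z <= Q v -> s <= F z <= v.
    move=> sz zv; rewrite -{1}(cdf_invK F_inv s01) -{1}(cdf_invK F_inv v01).
    by rewrite !(cdf_homo (mW 0) (WF 0)).
  have F01 z : Q s <= z -> z <= Q v -> 0 < F z < 1.
    move=> sz zv; have /andP[h1 h2] := Fz z sz zv.
    by case/andP: s01 => s0 _; case/andP: v01 => _ v1; rewrite (lt_le_trans s0)// (le_lt_trans h2).
  have [|z|z] := @MVT_segment R F (derive1 F) (Q s) (Q v) QQ.
  - move=> z; rewrite in_itv/= => /andP[/ltW sz /ltW zv].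
    have -> : z = Q (F z) by apply: (cdf_inv_uniq F_inv) => //; exact: F01.
    apply: DeriveDef; first by apply: F_der; exact: F01.
    by rewrite derive1E.
  - exact: continuous_subspaceT.
  rewrite in_itv/= => /andP[sz zv]; rewrite !(cdf_invK F_inv)// => E.
  exists (F z); first exact: Fz.
  rewrite E /dF; congr (derive1 F _ * _).
  by apply: (cdf_inv_uniq F_inv) => //; exact: F01.
move=> t01 u01; have [tu|/ltW ut] := leP t u.
  have [r /andP[tr ru] E] := key t u t01 u01 tu; exists r => //.
  by rewrite !ger0_norm ?subr_ge0// lerD2r.
have [r /andP[ur rt] E] := key u t u01 t01 ut; exists r.
  by rewrite !ler0_norm ?subr_le0// lerN2 lerD2r.
by rewrite -opprB E; ring.
Qed.

Section interval.
Variables (a b : R).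
Hypotheses (a0 : 0 < a) (b1 : b < 1).
Hypothesis dF_cont : forall p, a <= p <= b -> {for p, continuous dF}.
Hypothesis dF_neq0 : forall p, a <= p <= b -> dF p != 0.

(** Differentiability of the quantile function, uniformly on [[a, b]]: [v - p = dF r (Q v - Q p)]
    with [dF r] uniformly close to [dF p]. *)
Lemma inv_expansion e : 0 < e -> exists2 dl : R, 0 < dl & forall p v,
  a <= p <= b -> `|v - p| <= dl -> 0 < v < 1 /\
  `|Q v - Q p - (dF p)^-1 * (v - p)| <= e * `|v - p|.
Proof.
move=> e0; have ic p : a <= p <= b -> {for p, continuous (fun p => (dF p)^-1)}.
  by move=> pab; apply: cvgV; [exact: dF_neq0|exact: dF_cont].
have [M M0 hM] := bounded_on_continuous ic.
(* The first bound lets the correction be absorbed in the left-hand side, giving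
   [|Q v - Q p| <= 2 M |v - p|]; the second turns this into the error [e]. *)
pose e' := Num.min (1 / 2 / M) (e / (2 * M * M)).
have e'0 : 0 < e' by rewrite lt_min !divr_gt0// !mulr_gt0.
have [dl dl0 hdl] := unif_on_continuous dF_cont e'0.
exists (Num.min dl (Num.min (a / 2) ((1 - b) / 2))).
  by rewrite !lt_min dl0 !divr_gt0// subr_gt0.
move=> p v pab; rewrite !le_min => /and3P[h1 h2 h3]; have /andP[ap pb] := pab.
have p01 : 0 < p < 1 by rewrite (lt_le_trans a0)// (le_lt_trans pb).
have v01 : 0 < v < 1.
  by move: h2 h3; rewrite !ler_norml => /andP[? ?] /andP[? ?]; apply/andP; split; lra.
split=> //; have [r rp E] := cdf_mvt p01 v01.
set D := Q v - Q p in E *.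
have hr : `|dF r - dF p| <= e' by apply: hdl => //; rewrite (le_trans rp).
have Dv : D = (dF p)^-1 * (v - p) - (dF p)^-1 * (dF r - dF p) * D.
  by rewrite E; field; exact: dF_neq0.
have cE : `|(dF p)^-1 * (dF r - dF p)| <= M * e' by rewrite normrM ler_pM ?hM.
have Me : M * e' <= 1 / 2.
  by rewrite mulrC -ler_pdivlMr// ge_min lexx.
have Me2 : M * e' * (2 * M) <= e.
  have : e' <= e / (2 * M * M) by rewrite ge_min lexx orbT.
  rewrite ler_pdivlMr ?mulr_gt0//; lra.
have D2 : `|D| <= 2 * M * `|v - p|.
  have h : `|D| <= M * `|v - p| + 1 / 2 * `|D|.
    rewrite {1}Dv (le_trans (ler_normB _ _))// !normrM lerD ?ler_wpM2r ?hM//.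
    by rewrite -normrM (le_trans cE).
  by lra.
have -> : D - (dF p)^-1 * (v - p) = - ((dF p)^-1 * (dF r - dF p) * D).
  by rewrite {1}Dv; ring.
rewrite normrN normrM (le_trans (ler_pM _ _ cE D2))// mulrA.
by rewrite ler_wpM2r.
Qed.

(** Purely deterministic on the intersection of four events of probability close to 1: bounds on
    [alpha], [Aproc] and [Sproc], and a modulus of continuity for [alpha]. None of them depends on
    [p], whence the uniformity. *)
Lemma ecf_remainder e : 0 < e -> whp P (fun n w => forall p, a <= p <= b ->
  `|ecf_error F n (W ^~ w) p - ecf_lin P W F n w p| <= e).
Proof.
move=> e0 eta eta0; have e4 : 0 < eta / 4 by rewrite divr_gt0.
have [ab|ba] := leP a b; last first.
  exists 0%N => n _; exists set0; split; rewrite ?measure0 ?lee_fin ?ltW//.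
  by move=> w _ p /andP[ap pb]; have := lt_le_trans ba (le_trans ap pb); rewrite ltxx.
have in01 p : a <= p <= b -> 0 < p < 1.
  by move=> /andP[ap pb]; rewrite (lt_le_trans a0)// (le_lt_trans pb).
have aV := sample_cdf_unif mW WF F_inv.
have [K K0 HK] := alpha_tight (sample_cdf_meas mW WF) (sample_cdf_indep mW iW WF)
  (sample_cdf_le1 mW WF) aV e4.
have [KA KA0 HA] := Aproc_tightp mW iW WF F_inv W2 a0 b1 e4.
have [KS KS0 HS] := Sproc_tight mW iW WF W2 e4.
have ic p : a <= p <= b -> {for p, continuous (fun p => (dF p)^-1)}.
  by move=> pab; apply: cvgV; [exact: dF_neq0|exact: dF_cont].
have [M M0 hM] := bounded_on_continuous ic.
have Qc p : a <= p <= b -> {for p, continuous Q}.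
  by move=> /in01; exact: (cdf_inv_continuous (mW 0) (WF 0)).
have [MQ MQ0 hMQ] := bounded_on_continuous Qc.
have c0 : 0 < 1 - b by rewrite subr_gt0.
have MK0 : 0 < M * K by rewrite mulr_gt0.
have ia0 : 0 < a^-1 by rewrite invr_gt0.
have ic0 : 0 < (1 - b)^-1 by rewrite invr_gt0.
(* One constant for all the bounds required by the expansion. *)
pose C := 1 + a^-1 + (1 - b)^-1 + MQ + `|m| + M * K + KS + KA + (`|A 0| + MQ) + K.
have [m0 A00] : 0 <= `|m| /\ 0 <= `|A 0| by [].
have C1 : 1 <= C by rewrite /C; lra.
have [Ca Cc] : a^-1 <= C /\ (1 - b)^-1 <= C by rewrite /C; split; lra.
have [CQ Cm] : MQ <= C /\ `|m| <= C by rewrite /C; split; lra.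
have [CMK CS] : M * K <= C /\ KS <= C by rewrite /C; split; lra.
have [CA CB] : KA <= C /\ `|A 0| + MQ <= C by rewrite /C; split; lra.
have CK : K <= C by rewrite /C; lra.
have C0 : 0 < C by rewrite (lt_le_trans ltr01).
pose h := Num.min 1 (e / (23 * C ^+ 2)).
have h0 : 0 < h by rewrite lt_min ltr01 divr_gt0// mulr_gt0// exprn_gt0.
have h1 : h <= 1 by rewrite ge_min lexx.
have hC : 23 * C ^+ 2 * h <= e.
  by rewrite -ler_pdivlMl ?mulr_gt0 ?exprn_gt0// mulrC ge_min lexx orbT.
have K2 : 0 < K + 2 by rewrite addr_gt0.
have e10 : 0 < h / 2 / (K + 2) by rewrite !divr_gt0.
have [dl dl0 hdl] := inv_expansion e10.
have eps0 : 0 < h / 8 / M by rewrite !divr_gt0.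
have [mm Hm] := alpha_modulus (sample_cdf_meas mW WF) (sample_cdf_indep mW iW WF) aV eps0 e4.
have p2 : 0 < 2 ^+ mm :> R by rewrite exprn_gt0.
(* Thresholds for [sqrt n], each ensuring one of the smallness conditions [c1] to [c9]; their sum
   serves as a common one. *)
pose t1 := (K + 1) / a; pose t2 := (K + 2) * 2 ^+ mm; pose t3 := (K + 2) / dl.
pose t4 := 8 * M / h; pose t5 := (1 + C) / h; pose t6 := (K + 2) / h.
pose t7 := (a ^+ 2)^-1 / h; pose t8 := 2 / (1 - b) ^+ 2 / h; pose t9 := 2 / (1 - b).
have t10 : 0 < t1 by rewrite divr_gt0 ?addr_gt0.
have t20 : 0 < t2 by rewrite mulr_gt0.
have t30 : 0 < t3 by rewrite divr_gt0.
have t40 : 0 < t4 by rewrite divr_gt0 ?mulr_gt0.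
have t50 : 0 < t5 by apply: divr_gt0 => //; rewrite (lt_le_trans C0)// lerDr.
have t60 : 0 < t6 by rewrite divr_gt0.
have t70 : 0 < t7 by rewrite divr_gt0 ?invr_gt0 ?exprn_gt0.
have t80 : 0 < t8 by rewrite divr_gt0 ?divr_gt0 ?exprn_gt0.
have t90 : 0 < t9 by rewrite divr_gt0.
pose S0 := 1 + t1 + t2 + t3 + t4 + t5 + t6 + t7 + t8 + t9.
have -> : eta = (eta / 4 + eta / 4) + (eta / 4 + eta / 4) by field.
apply: wpe_sub (wpe_and (wpe_and HK HA) (wpe_and HS Hm)).
exists (Num.bound (S0 ^+ 2)).+1 => n nN w [[wK wA] [wS wm]] p pab.
have n0 : (0 < n)%N by rewrite (leq_trans _ nN).
have nR0 : 0 < n%:R :> R by rewrite ltr0n.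
have := sqrt_ge_bound (ltnW nN); rewrite /S0.
set sg : R := Num.sqrt n%:R => sgS.
have [sg1 [s1 s2 s3] [s4 s5 s6] [s7 s8 s9]] :=
  le_sum9 t10 t20 t30 t40 t50 t60 t70 t80 t90 sgS.
have sg0 : 0 < sg by exact: lt_le_trans sg1.
have sg2 : n%:R = sg * sg by rewrite -expr2 sqr_sqrtr.
have divs (x y : R) : 0 < y -> x / y <= sg -> x / sg <= y.
  by move=> y0; rewrite !ler_pdivrMr// mulrC.
have /andP[ap pb] := pab; have p01 := in01 p pab; have /andP[p0 p1] := p01.
have c1 : K + 1 <= sg * p.
  by move: s1; rewrite ler_pdivrMr// => H; rewrite (le_trans H)// ler_wpM2l// ltW.
have c2 : (K + 2) / sg <= (2 ^+ mm)^-1 by apply: divs; rewrite ?invr_gt0// invrK.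
have c3 : (K + 2) / sg <= dl by exact: divs.
have c4 : 8 * M / sg <= h by exact: divs.
have c5 : (1 + C) / sg <= h by exact: divs.
have c6 : (K + 2) / sg <= h by exact: divs.
have c7 : (a ^+ 2)^-1 / sg <= h by exact: divs.
have c8 : 2 / (1 - b) ^+ 2 / sg <= h by exact: divs.
have c9 : 2 <= n%:R * (1 - b).
  move: s9; rewrite ler_pdivrMr// => H; rewrite (le_trans H)// ler_wpM2r ?(ltW c0)//.
  by rewrite sg2 ler_peMl// ltW.
have /andP[k1 k2] := ecf_rank_itv n (ltW p0).
set k := ecf_rank n p in k1 k2.
have kn : (k < n)%N.
  by rewrite -(ltr_nat R); exact: rank_lt nR0 pb c9 k2.
have hr : sg * `|n%:R / k%:R - p^-1| <= h.
  have := @ratio_upper R n%:R k%:R p a a0 ap nR0.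
  rewrite k1 k2 => /(_ isT) H; rewrite (le_trans (ler_wpM2l (ltW sg0) H))//.
  rewrite (le_trans _ c7)// sg2 le_eqVlt; apply/orP; left; apply/eqP; field.
  by rewrite !gt_eqF.
have hr' : sg * `|n%:R / (n - k)%:R - (1 - p)^-1| <= h.
  have := @ratio_lower R n%:R (n - k)%:R (1 - p) (1 - b) c0 _ nR0 c9.
  rewrite lerB// natrB ?(ltnW kn)// => /(_ isT).
  have -> : n%:R * (1 - p) - 1 <= n%:R - k%:R < n%:R * (1 - p).
    exact: rank_compl.
  move=> /(_ isT) H; rewrite (le_trans (ler_wpM2l (ltW sg0) H))//.
  rewrite (le_trans _ c8)// sg2 le_eqVlt; apply/orP; left; apply/eqP; field.
  by rewrite !gt_eqF.
pose ca := (dF p)^-1 * alpha V n p w.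
(* All that is used of an order statistic is that the empirical distribution function crosses [p]
   there up to [1 / n]; this holds for both ranks [k] and [k + 1]. *)
have stat x : sg * p <= sg^-1 * \sum_(i < n) ((W i w <= x)%R)%:R ->
    sg^-1 * \sum_(i < n) ((W i w < x)%R)%:R <= sg * p + sg^-1 ->
    [/\ `|sg * (x - Q p) + ca| <= h, `|x - Q p| <= h, `|F x - p| <= h &
      `|Aproc P W n x w - Aproc P W n (Q p) w| <= C * h].
  move=> x1 x2; have [v1 v2] := quantile_expansion n0 p01 wK wm x1 x2 c1 c2.
  have [v01 v3] := hdl p (F x) pab (le_trans v1 c3).
  have xE : x = Q (F x) by exact: (cdf_inv_uniq F_inv).
  rewrite -xE in v3.
  have caM : `|ca| <= M * K by rewrite normrM ler_pM ?hM// wK// !ltW.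
  have g1 : `|sg * (x - Q p) + ca| <= h.
    have -> : sg * (x - Q p) + ca = sg * (x - Q p - (dF p)^-1 * (F x - p)) +
        (dF p)^-1 * (sg * (F x - p) + alpha V n p w) by rewrite /ca; ring.
    rewrite (le_trans (ler_normD _ _))// [leRHS]splitr lerD//.
      rewrite normrM gtr0_norm// (le_trans (ler_wpM2l (ltW sg0) v3))//.
      have sv : sg * `|F x - p| <= K + 2 by rewrite mulrC -ler_pdivlMr.
      by rewrite mulrCA (le_trans (ler_wpM2l (ltW e10) sv))// divfK// gt_eqF.
    rewrite normrM (le_trans (ler_pM _ _ (hM _ pab) v2))//.
    have -> : M * (2 * (h / 8 / M) + 2 / sg) = h / 4 + 8 * M / sg / 4.
      by field; rewrite !gt_eqF.
    by rewrite half_le.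
  have g2 : `|x - Q p| <= h.
    rewrite (le_trans _ c5)// ler_pdivlMr//.
    have -> : `|x - Q p| * sg = `|sg * (x - Q p)| by rewrite normrM gtr0_norm// mulrC.
    rewrite -[X in `|X|](addrK ca) (le_trans (ler_normB _ _))//.
    by rewrite lerD ?(le_trans g1)// (le_trans caM).
  split=> //; first exact: le_trans v1 c6.
  rewrite xE; set v := F x in v01 v1 *.
  (* The level [v] of the order statistic may leave [[a, b]], so the Lipschitz bound is taken on the
     segment spanned by [p] and [v]. *)
  have [l0 u1] : 0 < Num.min p v /\ Num.max p v < 1.
    by rewrite lt_min gt_max p0 p1; case/andP: v01.
  have := @Aproc_norm_le _ _ _ _ _ _ mW WF F_inv W2 _ _ l0 u1 n w K v p.
  rewrite !ge_min !le_max !lexx !orbT => /(_ isT isT wK) H.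
  rewrite (le_trans H)// mulrC -xE ler_pM// ltW//.
have np_k : sg * p <= sg^-1 * k%:R by rewrite ler_pdivlMl// mulrA -sg2 ltW.
have k_np : sg^-1 * k%:R <= sg * p + sg^-1.
  rewrite ler_pdivrMl// mulrDr divff ?gt_eqF// mulrA -sg2//.
have isg0 : 0 <= sg^-1 by rewrite invr_ge0 ltW.
have kk : (0 < k <= n)%N by rewrite /= ltnW.
pose x := order_stat (mkseq (W ^~ w) n) k.
pose y := order_stat (mkseq (W ^~ w) n) k.+1.
have [||x1 x2 x3 x4] := stat x.
- by rewrite (le_trans np_k)// ler_wpM2l// order_stat_count_le.
- rewrite (le_trans _ k_np)// ler_wpM2l// (le_trans (order_stat_count_lt _ kk))//.
  by rewrite ler_nat leq_pred.
have [||y1 y2 y3 y4] := stat y.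
- rewrite (le_trans np_k)// ler_wpM2l//.
  rewrite (le_trans _ (@order_stat_count_le R (W ^~ w) n k.+1 _))//.
  by rewrite ler_nat.
- by rewrite (le_trans _ k_np)// ler_wpM2l// (@order_stat_count_lt R (W ^~ w) n k.+1).
have caM : `|ca| <= M * K by rewrite normrM ler_pM ?hM// wK// !ltW.
have QpM := hMQ p pab.
have AQ : `|A (Q p)| <= `|A 0| + MQ.
  rewrite -(subrK (A 0) (A (Q p))) (le_trans (ler_normD _ _))// addrC lerD//.
  by rewrite (le_trans (Abar_lip mW WF W2 _ _))// subr0.
have Aexp z : `|F z - p| <= h -> `|A z - A (Q p) - p * (z - Q p)| <= `|z - Q p| * h.
  move=> Fz; have := Abar_expansion mW WF W2 (Q p) z; rewrite (cdf_invK F_inv p01).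
  by move=> H; rewrite (le_trans H)// ler_wpM2l.
have pC : `|p^-1| <= C.
  rewrite ger0_norm ?invr_ge0 ?(ltW p0)//.
  by rewrite (le_trans _ Ca)// lef_pV2 ?posrE.
have pC' : `|(1 - p)^-1| <= C.
  have p10 : 0 < 1 - p by rewrite subr_gt0.
  rewrite ger0_norm ?invr_ge0 ?(ltW p10)//.
  by rewrite (le_trans _ Cc)// lef_pV2 ?posrE// lerB.
rewrite ecf_errorE// /ecf_lin -/k -/x -/y.
rewrite -[2 / _ * _]mulrA -/(dF p) -/ca.
rewrite (le_trans _ hC)//; apply: ecf_expansion => //.
- exact: ltW.
- by rewrite gt_eqF.
- by rewrite subr_eq0 gt_eqF.
- exact: le_trans CQ.
- by rewrite (le_trans caM).
- by rewrite (le_trans wS).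
- by rewrite (le_trans (wA p pab)).
- by rewrite (le_trans AQ).
all: first [exact: x1|exact: y1|exact: x2|exact: y2|exact: x4|exact: y4|exact: Aexp|exact: (Abar_lip mW WF W2)].
Qed.

End interval.

End ecf_remainder.

(** * Random cadlag paths *)

Section cadlag_functions.
Context (R : realType) (a b : R).
Implicit Types x y c : R -> R.

Lemma cadlag_ext x y : (forall p, a <= p <= b -> x p = y p) ->
  cadlag a b x -> cadlag a b y.
Proof.
move=> xy [rx lx]; split=> t /andP[at_ tb].
  rewrite -xy ?at_ ?ltW//; apply: cvg_trans (rx t _); last by rewrite at_.
  apply: near_eq_cvg; near=> s; apply: xy; apply/andP; split; last by rewrite ltW.
  by rewrite (le_trans at_)// ltW.
have := lx t; rewrite at_ tb => /(_ isT)/cvg_ex[/= L hL]; apply/cvg_ex; exists L.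
apply: cvg_trans hL; apply: near_eq_cvg; near=> s; apply: xy.
by apply/andP; split; [rewrite ltW|rewrite (le_trans _ tb)// ltW].
Unshelve. all: by end_near. Qed.

Lemma cadlag_continuous c : (forall p, a <= p <= b -> {for p, continuous c}) ->
  cadlag a b c.
Proof.
move=> cc; split=> t /andP[at_ tb].
  by apply: cvg_at_right_filter; apply: cc; rewrite at_ ltW.
apply/cvg_ex; exists (c t).
by apply: cvg_at_left_filter; apply: cc; rewrite tb ltW.
Qed.

Lemma cadlagB x y : cadlag a b x -> cadlag a b y -> cadlag a b (fun p => x p - y p).
Proof.
move=> [rx lx] [ry ly]; split=> t tab; first by apply: cvgB; [exact: rx|exact: ry].
by apply: is_cvgB; [exact: lx|exact: ly].
Qed.

Lemma cadlagZ (k : R) x : cadlag a b x -> cadlag a b (fun p => k * x p).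
Proof.
move=> [rx lx]; split=> t tab; first by apply: cvgMr; exact: rx.
by apply: is_cvgMr; exact: lx.
Qed.

(** Covers both the empirical cross-over function, a function of the integer part of [n p], and the
    step interpolations of the limit. *)
Lemma cadlag_step (c : nat -> R) (l m : R) : 0 <= l ->
  cadlag a b (fun p => c (Num.truncn (l * (p - m)))).
Proof.
move=> l0; pose g p := Num.truncn (l * (p - m)).
have gmono s t : s <= t -> (g s <= g t)%N.
  by move=> st; apply: le_truncn; rewrite ler_wpM2l// lerB.
split=> t _.
  have H : c (g t) @[_ --> t^'+] --> c (g t) by exact: cvg_cst.
  have l1 : 0 < l + 1 by rewrite ltr_wpDl.
  have tk : l * (t - m) < (g t).+1%:R by exact: truncnS_gt.
  have r0 : 0 < ((g t).+1%:R - l * (t - m)) / (l + 1) by rewrite divr_gt0// subr_gt0.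
  apply: cvg_trans H; apply: near_eq_cvg; near=> s; congr c; apply/eqP.
  have st : s < t + ((g t).+1%:R - l * (t - m)) / (l + 1).
    by near: s; apply: nbhs_right_lt; rewrite ltrDl.
  rewrite eqn_leq gmono//= /g truncn_le_nat -/(g t).
  have -> : l * (s - m) = l * (t - m) + l * (s - t) by ring.
  rewrite -ltrBrDl (@le_lt_trans _ _ ((l + 1) * (s - t)))//.
    by rewrite ler_wpM2r ?subr_ge0// lerDl.
  by rewrite -ltr_pdivlMl// mulrC ltrBlDl.
(* The left limit is the largest value of the integer part before [t]; being nondecreasing, it is
   constant once this value is reached. *)
have [k kP kmax] : exists2 k, (exists2 s, s < t & g s = k) &
    forall s, s < t -> (g s <= k)%N.
  have ex : exists k, `[< exists2 s, s < t & g s = k >].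
    by exists (g (t - 1)); apply/asboolP; exists (t - 1) => //; rewrite ltrBlDr ltrDl.
  have bd k : `[< exists2 s, s < t & g s = k >] -> (k <= g t)%N.
    by move=> /asboolP[s /ltW /gmono st <-].
  case: (ex_maxnP ex bd) => k /asboolP kP kmax; exists k => // s st.
  by apply: kmax; apply/asboolP; exists s.
have [s0 s0t gs0] := kP; apply/cvg_ex; exists (c k).
have H : c k @[_ --> t^'-] --> c k by exact: cvg_cst.
apply: cvg_trans H; apply: near_eq_cvg; near=> s; congr c; apply/eqP; rewrite eqn_leq kmax// andbT -gs0.
by apply: gmono; near: s; apply: nbhs_left_ge.
Unshelve. all: by end_near. Qed.

Lemma cadlag_unif_limit (x_ : nat -> R -> R) x : (forall k, cadlag a b (x_ k)) ->
  (forall e, 0 < e -> exists k, forall p, a <= p <= b -> `|x_ k p - x p| <= e) ->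
  cadlag a b x.
Proof.
move=> cx xx; split=> t tab; have /andP[at_ tb] := tab.
  apply/cvgrPdist_le => e e0; have e3 : 0 < e / 3 by rewrite divr_gt0.
  have [k hk] := xx _ e3; have [/(_ t tab)/cvgrPdist_le/(_ _ e3) h _] := cx k.
  near=> s.
  have h1 : `|x_ k t - x t| <= e / 3 by apply: hk; rewrite at_ ltW.
  have h2 : `|x_ k s - x s| <= e / 3.
    apply: hk; apply/andP; split; last by rewrite ltW.
    by rewrite (le_trans at_)// ltW.
  have h3 : `|x_ k t - x_ k s| <= e / 3 by near: s.
  move: h1 h2 h3; rewrite !ler_norml => /andP[? ?] /andP[? ?] /andP[? ?].
  by apply/andP; split; lra.
apply/cauchy_cvgP/cauchy_exP => e e0; have e3 : 0 < e / 3 by rewrite divr_gt0.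
have [k hk] := xx _ e3; have [_ /(_ t tab)/cvg_ex[/= L /cvgrPdist_le/(_ _ e3) h]] := cx k.
exists L; near=> s.
have h2 : `|x_ k s - x s| <= e / 3.
  apply: hk; apply/andP; split; first by rewrite ltW.
  by rewrite (le_trans _ tb)// ltW.
have h3 : `|L - x_ k s| <= e / 3 by near: s.
rewrite /ball/= ; move: h2 h3; rewrite !ler_norml ltr_norml => /andP[? ?] /andP[? ?].
by apply/andP; split; lra.
Unshelve. all: by end_near. Qed.

Lemma skorohod_restrict_cadlag x : cadlag a b x ->
  cadlag a b (fun p => if a <= p <= b then x p else 0).
Proof. by apply: cadlag_ext => p ->. Qed.

Definition mkD x (cx : cadlag a b x) : skorohod a b :=
  Skorohod (skorohod_restrict_cadlag cx) (fun t => (ifN _ _)).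

Lemma mkDE x (cx : cadlag a b x) p : a <= p <= b -> mkD cx p = x p.
Proof. by move=> pab /=; rewrite pab. Qed.

Lemma skorohod_eq (x y : skorohod a b) : (forall p, a <= p <= b -> x p = y p) -> x = y.
Proof.
move=> xy; have {}xy : Defs.path x = Defs.path y.
  apply/funext => p; have [|pab] := boolP (a <= p <= b); first exact: xy.
  by rewrite !path_out.
case: x y xy => [x cx ox] [y cy oy] /= xy; rewrite -xy in cy oy *.
by congr Skorohod; exact: Prop_irrelevance.
Qed.

Lemma mkD_eq x y (cx : cadlag a b x) (cy : cadlag a b y) :
  (forall p, a <= p <= b -> x p = y p) -> mkD cx = mkD cy.
Proof. by move=> xy; apply: skorohod_eq => p pab; rewrite !mkDE// xy. Qed.

Lemma skorohod_ball_sup (x y : skorohod a b) e e' : 0 <= e' -> e' < e ->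
  (forall p, a <= p <= b -> `|x p - y p| <= e') -> ball x e y.
Proof.
move=> e0 ee h; apply/skorohod_ballP; exists e' => //; split=> //.
exists idfun; first exact: time_change_id.
by move=> t tab; rewrite subrr normr0; split=> //; exact: h.
Qed.

Definition sup_unifc (g : skorohod a b -> R) : Prop := forall e : R, 0 < e ->
  exists2 dl : R, 0 < dl & forall x y : skorohod a b,
    (forall p, a <= p <= b -> `|x p - y p| <= dl) -> `|g x - g y| <= e.

Lemma unifc_sup_unifc (g : skorohod a b -> R) : unifc g -> sup_unifc g.
Proof.
move=> gu e /gu[dl dl0 hdl]; exists (dl / 2); first by rewrite divr_gt0.
move=> x y xy; apply: hdl; apply: (@skorohod_ball_sup _ _ _ (dl / 2)) => //.
  by rewrite divr_ge0// ltW.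
by rewrite ltr_pdivrMr// ltr_pMr// ltr1n.
Qed.

(* Measurability is tested on functionals that are uniformly continuous for
   the sup norm, which include the evaluations as well as the Skorohod ones. *)
Definition sup_random d (T : measurableType d) (X : T -> skorohod a b) : Prop :=
  forall (g : skorohod a b -> R) (C : R), sup_unifc g -> (forall x : skorohod a b, `|g x| <= C) ->
  measurable_fun setT (g \o X).

Lemma sup_random_element d (T : measurableType d) (X : T -> skorohod a b) :
  sup_random X -> random_element X.
Proof.
move=> rX; apply: random_element_unifc => g gu g1; apply: (rX g 1) => //.
exact: unifc_sup_unifc.
Qed.

Lemma sup_unifc_coords (M : nat) (Phi : ('I_M -> R) -> skorohod a b) g :
  (forall e : R, 0 < e -> exists2 dl : R, 0 < dl &
    forall y y' : 'I_M -> R, (forall i, `|y i - y' i| <= dl) ->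
    forall p, a <= p <= b -> `|Phi y p - Phi y' p| <= e) ->
  sup_unifc g -> unif_cont (g \o Phi).
Proof.
move=> PhiC gu e e0; have [dl dl0 hdl] := gu e e0.
by have [dl' dl'0 hdl'] := PhiC _ dl0; exists dl' => // y y' yy'; apply: hdl; exact: hdl'.
Qed.

Lemma sup_random_coords d (T : measurableType d) (M : nat) (X : 'I_M -> T -> R)
    (Phi : ('I_M -> R) -> skorohod a b) :
  (forall i, measurable_fun setT (X i)) ->
  (forall e : R, 0 < e -> exists2 dl : R, 0 < dl &
    forall y y' : 'I_M -> R, (forall i, `|y i - y' i| <= dl) ->
    forall p, a <= p <= b -> `|Phi y p - Phi y' p| <= e) ->
  sup_random (fun w => Phi (X ^~ w)).
Proof.
move=> mX PhiC g C gu gC.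
apply: (@unif_cont_meas _ _ _ _ X (g \o Phi) C) => //; first by move=> y; exact: gC.
exact: sup_unifc_coords.
Qed.

Lemma sup_random_lim d (T : measurableType d) (X_ : nat -> T -> skorohod a b)
    (X : T -> skorohod a b) :
  (forall k, sup_random (X_ k)) ->
  (forall w (e : R), 0 < e -> exists N, forall k, (N <= k)%N ->
    forall p, a <= p <= b -> `|X_ k w p - X w p| <= e) ->
  sup_random X.
Proof.
move=> rX XX g C gu gC; apply: (@measurable_fun_cvg _ _ _ _ (fun k => g \o X_ k)).
  by move=> k; exact: rX gu gC.
move=> w _; apply/cvgrPdist_le => e e0; have [dl dl0 hdl] := gu e e0.
have [N hN] := XX w _ dl0; exists N => // k /= Nk; rewrite distrC.
by apply: hdl; exact: hN.
Qed.

End cadlag_functions.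

Section ecf_lipschitz.
Context (R : realType) (n : nat) (y y' : nat -> R) (dl : R).
Hypothesis dl0 : 0 <= dl.
Hypothesis yy : forall i, (i < n)%N -> `|y i - y' i| <= dl.

(** Were one order statistic larger than the other by more than [dl], the at least [k] points up to
    the smaller one would correspond to points strictly below the larger one, of which there are at
    most [k - 1]. *)
Lemma order_stat_lip k : `|order_stat (mkseq y n) k - order_stat (mkseq y' n) k| <= dl.
Proof.
wlog k0 : k / (0 < k)%N.
  by move=> H; case: k => [|k]; [exact: (H 1%N)|exact: H].
have [nk|kn] := ltnP n k.
  rewrite /order_stat !nth_default ?subrr ?normr0// size_sort size_mkseq -ltnS prednK//.
have kn' : (0 < k <= n)%N by rewrite k0.
have key (z z' : nat -> R) : (forall i, (i < n)%N -> z' i <= z i + dl) ->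
    order_stat (mkseq z' n) k <= order_stat (mkseq z n) k + dl.
  move=> zz; rewrite leNgt; apply/negP => H.
  have h1 := order_stat_count_le z kn'; have h2 := order_stat_count_lt z' kn'.
  suff : k%:R <= k.-1%:R :> R by rewrite ler_nat leqNgt ltn_predL k0.
  rewrite (le_trans h1)// (le_trans _ h2)//; apply: ler_sum => i _.
  have [zi|] := leP (z i) _ => //.
  by rewrite (le_lt_trans (zz _ (ltn_ord i)))// (le_lt_trans _ H)// lerD2r.
have h i : (i < n)%N -> y' i <= y i + dl /\ y i <= y' i + dl.
  by move=> /yy; rewrite ler_norml => /andP[? ?]; split; lra.
have h1 := key y y' (fun i iN => (h i iN).1); have h2 := key y' y (fun i iN => (h i iN).2).
by rewrite ler_norml; apply/andP; split; lra.
Qed.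

Lemma order_stat_mean_lip k l :
  `|(l - k)%:R^-1 * (\sum_(k.+1 <= j < l.+1) order_stat (mkseq y n) j) -
    (l - k)%:R^-1 * (\sum_(k.+1 <= j < l.+1) order_stat (mkseq y' n) j)| <= dl.
Proof.
rewrite -mulrBr -sumrB normrM normfV normr_nat.
have [->|lk] := posnP (l - k)%N; first by rewrite invr0 mul0r.
rewrite ler_pdivrMl ?ltr0n// (le_trans (ler_norm_sum _ _ _))//.
rewrite (le_trans (ler_sum _ (fun j _ => order_stat_lip j)))//.
by rewrite sumr_const_nat subSS -[dl *+ _]mulr_natl.
Qed.

Lemma ecf_lip p : `|ecf (mkseq y n) p - ecf (mkseq y' n) p| <= 4 * dl.
Proof.
rewrite /ecf !size_mkseq; set k := ecf_rank n p.
have := order_stat_mean_lip 0 k; have := order_stat_mean_lip k n.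
have := order_stat_lip k; have := order_stat_lip k.+1; rewrite subn0.
set u1 := order_stat _ _; set u2 := order_stat _ _; set u3 := order_stat _ _.
set u4 := order_stat _ _; set v1 := _ * _; set v2 := _ * _; set v3 := _ * _.
set v4 := _ * _; rewrite !ler_norml.
move=> /andP[? ?] /andP[? ?] /andP[? ?] /andP[? ?].
by apply/andP; split; lra.
Qed.

End ecf_lipschitz.

Section ecf_paths.
Context d (T : measurableType d) (R : realType) (P : probability T R).
Variables (W : nat -> T -> R) (F : R -> R).
Hypothesis mW : forall i, measurable_fun setT (W i).
Hypothesis WF : forall i x, P (W i @^-1` `]-oo, x]) = (F x)%:E.
Hypothesis F_inv : forall p : R, 0 < p < 1 -> exists! x : R, F x = p.
Hypothesis W2 : L1 P (fun w => W 0 w ^+ 2).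
Local Notation Q := (cdf_inv F).
Local Notation A := (Abar P W).

Lemma crossover_continuous p : 0 < p < 1 -> {for p, continuous (crossover F)}.
Proof.
move=> p01; have /andP[p0 p1] := p01.
have Qc := cdf_inv_continuous (mW 0) (WF 0) F_inv p01.
have Ac : A (Q t) @[t --> p] --> A (Q p).
  apply/cvgrPdist_le => e e0; have /cvgrPdist_le/(_ _ e0) := Qc.
  by apply: filterS => t h; rewrite (le_trans (Abar_lip mW WF W2 _ _)).
have H : - (t^-1 * A (Q t)) + (1 - t)^-1 * (A (Q t) + Ex P (W 0) - Q t) @[t --> p] -->
    - (p^-1 * A (Q p)) + (1 - p)^-1 * (A (Q p) + Ex P (W 0) - Q p).
  apply: cvgD; first apply: cvgN; (apply: cvgM; first apply: cvgV) => //.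
  - by rewrite gt_eqF.
  - by rewrite subr_eq0 gt_eqF.
  - by apply: cvgB; [exact: cvg_cst|exact: cvg_id].
  by apply: cvgB => //; apply: cvgD => //; exact: cvg_cst.
rewrite /prop_for /continuous_at (crossoverE mW WF F_inv W2 p01).
have N01 : \forall t \near p, 0 < t < 1.
  apply/nbhs_ballP; exists (Num.min p (1 - p)); first by rewrite /= lt_min p0 subr_gt0.
  move=> t; rewrite /ball/= lt_min !ltr_norml => /andP[/andP[? ?] /andP[? ?]].
  by apply/andP; split; lra.
apply: cvg_trans H; apply: near_eq_cvg; near=> t; apply/esym/(crossoverE mW WF F_inv W2).
by near: t.
Unshelve. all: by end_near. Qed.

Variables a b : R.
Hypotheses (a0 : 0 < a) (b1 : b < 1).

Lemma ecf_error_cadlag n s : cadlag a b (ecf_error F n s).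
Proof.
apply: cadlagZ; apply: cadlagB.
  pose c j := let k := j.+1 in
    k%:R^-1 * (\sum_(1 <= j < k.+1) order_stat (mkseq s n) j) - order_stat (mkseq s n) k
    + (n - k)%:R^-1 * (\sum_(k.+1 <= j < n.+1) order_stat (mkseq s n) j)
    - order_stat (mkseq s n) k.+1.
  apply: cadlag_ext (cadlag_step a b c 0 (ler0n R n)) => p _.
  by rewrite /ecf /c size_mkseq subr0.
apply: cadlag_continuous => p /andP[ap pb]; apply: crossover_continuous.
by rewrite (lt_le_trans a0)// (le_lt_trans pb).
Qed.

Definition ecf_path n w : skorohod a b := mkD (ecf_error_cadlag n (W ^~ w)).

(** For fixed [n] the path is a Lipschitz function, for the supremum distance, of the [n] sample
    values; [ext] completes them by 0, as later values are never read. *)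
Lemma ecf_path_random n : sup_random (ecf_path n).
Proof.
pose ext (y : 'I_n -> R) i := if insub i is Some j then y j else 0.
pose Phi y := mkD (ecf_error_cadlag n (ext y)).
have -> : ecf_path n = fun w => Phi ((fun (i : 'I_n) w => W i w) ^~ w).
  apply/funext => w; have E : mkseq (W ^~ w) n = mkseq (ext ((fun (i : 'I_n) w => W i w) ^~ w)) n.
    apply/eq_in_map => i; rewrite mem_iota => /andP[_ iN].
    by rewrite /ext insubT.
  by apply: mkD_eq => p _; rewrite /ecf_error E.
apply: sup_random_coords => // e e0.
pose q : R := Num.sqrt n%:R; have q0 : 0 <= q by exact: sqrtr_ge0.
exists (e / (4 * (q + 1))); first by rewrite divr_gt0// mulr_gt0// ltr_wpDl.
move=> y y' yy p pab; rewrite !mkDE// /ecf_error -mulrBr.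
have -> : forall u v w : R, u - v - (w - v) = u - w by move=> *; ring.
rewrite normrM (ger0_norm q0).
set dl := e / _ in yy; have dl0 : 0 <= dl by rewrite divr_ge0 ?(ltW e0)// mulr_ge0// addr_ge0.
have := @ecf_lip R n (ext y) (ext y') dl dl0 _ p.
have H i : (i < n)%N -> `|ext y i - ext y' i| <= dl by move=> iN; rewrite /ext insubT.
move=> /(_ H) h; rewrite (le_trans (ler_wpM2l q0 h))//.
have -> : q * (4 * dl) = q / (q + 1) * e by rewrite /dl; field; rewrite gt_eqF// ltr_wpDl.
by rewrite ler_piMl ?(ltW e0)// ler_pdivrMr ?ltr_wpDl// mul1r lerDl.
Qed.

End ecf_paths.

(** * Covariance structure *)

Section square_integrable.
Context d (T : measurableType d) (R : realType) (P : probability T R).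
Implicit Types X Y : T -> R.

Definition L2 X : Prop := measurable_fun setT X /\ L1 P (fun w => X w ^+ 2).

Lemma L2_L1 X : L2 X -> L1 P X. Proof. by case=> mX; exact: L1_of_L2. Qed.

Lemma L2D X Y : L2 X -> L2 Y -> L2 (fun w => X w + Y w).
Proof.
move=> [mX X2] [mY Y2]; split; first exact: measurable_funD.
apply: (@L1_le _ _ _ _ _ (fun w => 2 * X w ^+ 2 + 2 * Y w ^+ 2)).
- by apply: measurable_funX; exact: measurable_funD.
- by apply: L1D; exact: L1Z.
by move=> w; rewrite ger0_norm ?sqr_ge0//; have := sqr_ge0 (X w - Y w); lra.
Qed.

Lemma L2Z (c : R) X : L2 X -> L2 (fun w => c * X w).
Proof.
move=> [mX X2]; split; first exact: measurable_funM.
by have := L1Z (c ^+ 2) X2; congr L1; apply/funext => w; rewrite exprMn.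
Qed.

Lemma L2_bounded X (M : R) : measurable_fun setT X -> (forall w, `|X w| <= M) -> L2 X.
Proof.
move=> mX XM; split=> //; apply: (@L1_bounded _ _ _ _ _ (M ^+ 2)).
  exact: measurable_funX.
move=> w; have M0 : 0 <= M by exact: le_trans (XM w).
by rewrite normrX lerXn2r ?nnegrE.
Qed.

Lemma L2_cst (c : R) : L2 (fun=> c).
Proof. by apply: (@L2_bounded (fun=> c) `|c|). Qed.

Lemma L2_sum I (s : seq I) (X : I -> T -> R) : (forall i, L2 (X i)) ->
  L2 (fun w => \sum_(i <- s) X i w).
Proof.
move=> XL; elim: s => [|i s IH].
  rewrite (_ : (fun w => _) = fun=> 0); first exact: L2_cst.
  by apply/funext => w; rewrite big_nil.
rewrite (_ : (fun w => _) = fun w => X i w + \sum_(j <- s) X j w); first exact: L2D.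
by apply/funext => w; rewrite big_cons.
Qed.

Lemma L2M X Y : L2 X -> L2 Y -> L1 P (fun w => X w * Y w).
Proof.
move=> [mX X2] [mY Y2]; apply: (@L1_le _ _ _ _ _ (fun w => X w ^+ 2 + Y w ^+ 2)).
- exact: measurable_funM.
- exact: L1D.
move=> w; rewrite ler_norml; have := sqr_ge0 (X w - Y w); have := sqr_ge0 (X w + Y w).
by have := sqr_ge0 (X w); have := sqr_ge0 (Y w); move=> *; apply/andP; split; lra.
Qed.

End square_integrable.

Section linearized_sum.
Context d (T : measurableType d) (R : realType) (P : probability T R).
Variables (W : nat -> T -> R) (F : R -> R).
Hypothesis mW : forall i, measurable_fun setT (W i).
Hypothesis iW : indep_fam P W.
Hypothesis WF : forall i x, P (W i @^-1` `]-oo, x]) = (F x)%:E.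
Hypothesis F_inv : forall p : R, 0 < p < 1 -> exists! x : R, F x = p.
Hypothesis W2 : L1 P (fun w => W 0 w ^+ 2).
Local Notation Q := (cdf_inv F).
Local Notation A := (Abar P W).
Local Notation m := (Ex P (W 0)).

Definition psi p y : R :=
  ((1 - p)^-1 - p^-1) * (pp (Q p - y) - A (Q p)) + (1 - p)^-1 * (y - m) +
  2 / derive1 F (Q p) * (((F y <= p)%R)%:R - p).

Lemma ecf_linE n w p : ecf_lin P W F n w p = nsum (fun i w => psi p (W i w)) n w.
Proof.
have E (x y z : 'I_n -> R) (u v t : R) : \sum_i (u * x i + v * y i + t * z i) =
    u * (\sum_i x i) + v * (\sum_i y i) + t * (\sum_i z i).
  by rewrite !big_split/= -!mulr_sumr.
by rewrite /ecf_lin /Aproc /Sproc /alpha /nsum /psi E; ring.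
Qed.

Let mF : measurable_fun setT F. Proof. exact: cdf_meas (mW 0) (WF 0). Qed.

Let ple (p : R) : measurable_fun setT (fun y : R => ((F y <= p)%R)%:R : R).
Proof.
have -> : (fun y : R => ((F y <= p)%R)%:R : R) = \1_[set y | F y <= p].
  apply/funext => y; rewrite indicE; congr (nat_of_bool _)%:R.
  by apply/idP/idP; rewrite inE.
apply: measurable_indic; rewrite -[X in measurable X]setTI.
exact: measurable_fun_le.
Qed.

Lemma measurable_psi p : measurable_fun setT (psi p).
Proof.
apply: measurable_funD; first apply: measurable_funD.
- by apply: measurable_funM => //; apply: measurable_funB => //; exact: measurable_pp.
- by apply: measurable_funM => //; exact: measurable_funB.
- by apply: measurable_funM => //; exact: measurable_funB.
Qed.

Let ppL2 p : L2 P (fun w => pp (Q p - W 0 w) - A (Q p)).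
Proof.
have mp : measurable_fun setT (fun y : R => pp (Q p - y) - A (Q p)).
  by apply: measurable_funB => //; exact: measurable_pp.
split; first exact: (measurableT_comp mp).
apply: (@L1_affine_sqr _ _ _ _ W mW W2 _ (`|Q p| + `|A (Q p)|) mp) => y.
rewrite (le_trans (ler_normB _ _))// addrAC lerD2r ger0_norm ?pp_ge0//.
by rewrite (le_trans (pp_le_norm _))// ler_normB.
Qed.

Let WmL2 : L2 P (fun w => W 0 w - m).
Proof. by apply: L2D => //; exact: L2_cst. Qed.

Let indL2 p : 0 < p < 1 -> L2 P (fun w => ((F (W 0 w) <= p)%R)%:R - p).
Proof.
move=> /andP[p0 p1]; apply: (@L2_bounded _ _ _ _ _ 1).
  by apply: measurable_funB => //; exact: (measurableT_comp (ple p)).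
by move=> w; case: (F _ <= p); rewrite /= ler_norml; apply/andP; split; lra.
Qed.

Lemma psi_L2 p : 0 < p < 1 -> L2 P (fun w => psi p (W 0 w)).
Proof.
move=> p01; apply: L2D; first apply: L2D; apply: L2Z => //; exact: indL2.
Qed.

Lemma psi_mean p : 0 < p < 1 -> Ex P (fun w => psi p (W 0 w)) = 0.
Proof.
move=> p01; have L1m := L2_L1 WmL2; have Lp := L2_L1 (ppL2 p); have Li := L2_L1 (indL2 p01).
have Lpp : L1 P (fun w => pp (Q p - W 0 w)).
  have := L1D Lp (L1_cst P (A (Q p))); congr L1; apply/funext => w /=.
  by rewrite subrK.
rewrite /psi ExD; [|by apply: L1D; exact: L1Z|exact: L1Z].
rewrite ExD; [|exact: L1Z|exact: L1Z].
rewrite !ExZ// ExB//; last exact: L1_cst.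
rewrite ExB; [|exact: L2_L1|exact: L1_cst].
have indp : L1 P (fun w => ((F (W 0 w) <= p)%R)%:R).
  have := L1D Li (L1_cst P p); congr L1; apply/funext => w /=.
  by rewrite subrK.
rewrite ExB//; last exact: L1_cst.
rewrite !Ex_cst subrr; have -> : Ex P (fun w => ((F (W 0 w) <= p)%R)%:R) = p.
  rewrite -[RHS](cdf_invK F_inv p01) -(sample_ind_Ex mW WF); congr Ex.
  by apply/funext => w; rewrite (cdf_le_inv (mW 0) (WF 0)).
by rewrite /Abar !subrr !mulr0 !addr0.
Qed.

Definition psi_cov p q : R := Ex P (fun w => psi p (W 0 w) * psi q (W 0 w)).

Lemma ecf_lin_clt k (u t : 'I_k -> R) : (forall j, 0 < t j < 1) -> forall c,
  Ex P (fun w => cos (c + \sum_(j < k) u j * ecf_lin P W F n w (t j))) @[n --> \oo] -->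
  cos c * expR (- ((\sum_(i < k) \sum_(j < k) u i * u j * psi_cov (t i) (t j)) / 2)).
Proof.
move=> t01 c; pose phi y := \sum_(j < k) u j * psi (t j) y.
have mphi : measurable_fun setT phi.
  by apply: measurable_sum => j; apply: measurable_funM => //; exact: measurable_psi.
have LZ j : L2 P (fun w => u j * psi (t j) (W 0 w)) by apply: L2Z; exact: psi_L2.
have phiL2 : L2 P (fun w => phi (W 0 w)).
  exact: (@L2_sum _ _ _ _ _ _ (fun (j : 'I_k) w => u j * psi (t j) (W 0 w))).
rewrite (_ : (fun n => _) = fun n => Ex P (fun w =>
    cos (c + (Num.sqrt n%:R)^-1 * \sum_(i < n) phi (W i w)))); last first.
  apply/funext => n; congr Ex; apply/funext => w; congr (cos (c + _)).
  under eq_bigr do rewrite ecf_linE /nsum mulrCA.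
  rewrite -mulr_sumr; congr (_ * _); under eq_bigr do rewrite mulr_sumr.
  exact: exchange_big.
apply: (@central_limit _ _ _ P (fun i w => phi (W i w))).
- by move=> i; exact: (measurableT_comp mphi).
- exact: (indep_fam_comp (phi := fun=> phi) iW).
- by move=> i B mB; exact: (sample_law mW WF i (measurable_preimage mphi mB)).
- exact: phiL2.2.
- rewrite (Ex_sum _ (fun j : 'I_k => L2_L1 (LZ j))) big1// => j _.
  by rewrite ExZ ?psi_mean ?mulr0//; exact/L2_L1/psi_L2.
have E w : phi (W 0 w) ^+ 2 = \sum_(i < k) \sum_(j < k)
    u i * u j * (psi (t i) (W 0 w) * psi (t j) (W 0 w)).
  rewrite expr2 /phi mulr_suml; apply: eq_bigr => i _; rewrite mulr_sumr.
  by apply: eq_bigr => j _; ring.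
under eq_fun do rewrite E.
have LL i j : L1 P (fun w => u i * u j * (psi (t i) (W 0 w) * psi (t j) (W 0 w))).
  by apply: L1Z; apply: L2M; exact: psi_L2.
rewrite Ex_sum; last by move=> i; exact: L1_sum.
apply: eq_bigr => i _; rewrite Ex_sum//; apply: eq_bigr => j _.
by rewrite ExZ//; apply: L2M; exact: psi_L2.
Qed.

Lemma prob_quantile0 p : 0 < p < 1 -> P [set w | W 0 w = Q p] = 0%E.
Proof.
move=> p01; have /andP[p0 p1] := p01.
have mV := sample_cdf_meas mW WF 0.
have m2 : measurable [set w | W 0 w = Q p].
  by rewrite (_ : [set w | _] = W 0 @^-1` [set Q p])//; exact: measurable_preimage.
apply/eqP; rewrite eq_le measure_ge0 andbT -(lebesgue_measure_set1 p).
rewrite -(uniform_law_lebesgue mV (sample_cdf_unif mW WF F_inv 0))//.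
  apply: le_measure; rewrite ?inE//; first exact: measurable_preimage.
  by move=> w /= ->; rewrite (cdf_invK F_inv).
by move=> t /= ->; rewrite in_itv/= !ltW.
Qed.

(** [theta] splits the line with a strict inequality at the quantile and [psi] with a large one;
    they differ by a constant except at the quantile, which is an atom of probability 0. *)
Lemma theta_psi f p : 0 < p < 1 -> f (Q p) = derive1 F (Q p) ->
  exists D, forall w, W 0 w != Q p -> theta F f p (W 0 w) = psi p (W 0 w) + D.
Proof.
move=> p01 fp; have /andP[p0 p1] := p01.
exists (((1 - p)^-1 - p^-1) * A (Q p) + (1 - p)^-1 * (m - Q p) + 2 / f (Q p) * p) => w.
set y := W 0 w => yq.
rewrite /psi (cdf_le_inv (mW 0) (WF 0) F_inv y p01) -fp /theta !indicE.
have [yle|ylt] := ltP y (Q p).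
  rewrite mem_set// memNset/=; last by move/(lt_le_trans yle); rewrite ltxx.
  rewrite (ltW yle) /pp; have /max_idPr -> : 0 <= Q p - y by rewrite subr_ge0 ltW.
  by rewrite /=; ring.
rewrite memNset/=; last by move/(le_lt_trans ylt); rewrite ltxx.
rewrite mem_set//; have -> : (y <= Q p) = false.
  by apply/negbTE; rewrite -ltNge lt_neqAle eq_sym yq.
rewrite /pp; have /max_idPl -> : Q p - y <= 0 by rewrite subr_le0.
by rewrite /=; ring.
Qed.

Lemma covariance_theta f p q : 0 < p < 1 -> 0 < q < 1 ->
  f (Q p) = derive1 F (Q p) -> f (Q q) = derive1 F (Q q) ->
  covariance P (theta F f p \o W 0) (theta F f q \o W 0) = (psi_cov p q)%:E.
Proof.
move=> p01 q01 fp fq.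
have mth t : measurable_fun setT (theta F f t).
  rewrite /theta; set lo := \1_[set y | y < Q t]; set hi := \1_[set y | Q t <= y].
  have mlo : measurable_fun setT (lo : R -> R).
    by apply: measurable_indic; rewrite (_ : [set y | y < Q t] = `]-oo, (Q t)[%classic).
  have mhi : measurable_fun setT (hi : R -> R).
    by apply: measurable_indic; rewrite -[X in measurable X]setTI; exact: measurable_fun_le.
  have mx (c : R) (g : R -> R) : measurable_fun setT g -> measurable_fun setT (fun x : R => c * x * g x).
    by move=> mg; apply: measurable_funM => //; exact: measurable_funM.
  have mc (c : R) (g : R -> R) : measurable_fun setT g -> measurable_fun setT (fun x : R => c * g x).
    by move=> mg; exact: measurable_funM.
  apply: measurable_funD; last by apply: measurable_funM => //; exact: mc.
  apply: measurable_funB; last exact: mc.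
  apply: measurable_funD; last exact: mx.
  by apply: measurable_funB; [exact: mx|exact: mc].
have mean t : 0 < t < 1 -> f (Q t) = derive1 F (Q t) -> exists2 X : T -> R,
    (fun w => theta F f t (W 0 w) - fine 'E_P[theta F f t \o W 0]) = X &
    measurable_fun setT X /\ {ae P, forall w, X w = psi t (W 0 w)}.
  move=> t01 ft; have [D hD] := theta_psi t01 ft.
  have mN : measurable [set w | W 0 w = Q t].
    by rewrite (_ : [set w | _] = W 0 @^-1` [set Q t])//; exact: measurable_preimage.
  have aeD : {ae P, forall w, theta F f t (W 0 w) = psi t (W 0 w) + D}.
    exists [set w | W 0 w = Q t]; split => //; first exact: prob_quantile0.
    by move=> w /= h; apply: contrapT => /eqP/hD.
  have mX : measurable_fun setT (fun w => theta F f t (W 0 w)) by exact: measurableT_comp.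
  have LpD : L1 P (fun w => psi t (W 0 w) + D).
    by apply: L1D; [exact/L2_L1/psi_L2|exact: L1_cst].
  have mY := L1_meas LpD.
  have E : fine 'E_P[theta F f t \o W 0] = D.
    rewrite unlock -/(Rintegral P setT (theta F f t \o W 0)) -/(Ex P _).
    rewrite (Ex_ae_eq mX mY aeD) ExD ?psi_mean ?Ex_cst ?add0r//; last exact: L1_cst.
    exact/L2_L1/psi_L2.
  eexists; first by []. rewrite E; split; first exact: measurable_funB.
  by apply: filterS aeD => w ->; rewrite addrK.
have [X XE [mX aX]] := mean p p01 fp; have [Y YE [mY aY]] := mean q q01 fq.
have -> : covariance P (theta F f p \o W 0) (theta F f q \o W 0) = 'E_P[(fun w => (X w * Y w)%R)]%E.
  by rewrite unlock -XE -YE.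
have L := L2M (psi_L2 p01) (psi_L2 q01).
have mXY : measurable_fun setT (fun w => X w * Y w) by exact: measurable_funM.
have aXY : {ae P, forall w, X w * Y w = psi p (W 0 w) * psi q (W 0 w)}.
  by apply: filterS2 aX aY => w -> ->.
rewrite /psi_cov -(expectation_Ex L) unlock.
apply: ae_eq_integral => //.
- exact/measurable_EFinP.
- exact: (measurable_int P L).
by apply: filterS aXY => w /= -> _.
Qed.

End linearized_sum.

(** * Construction of the Gaussian limit *)

Section oscillation_of_limit.
Context d (T : measurableType d) d' (T' : measurableType d') (R : realType).
Context (P : probability T R) (P' : probability T' R) (M : nat).
Variables (X : nat -> 'I_M -> T -> R) (Y : 'I_M -> T' -> R).
Hypothesis mX : forall n i, measurable_fun setT (X n i).
Hypothesis mY : forall i, measurable_fun setT (Y i).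
Hypothesis tX : forall i, tight P (fun n => X n i).
Hypothesis cosXY : forall c (u : 'I_M -> R),
  Ex P (fun w => cos (c + \sum_(i < M) u i * X n i w)) @[n --> \oo] -->
  Ex P' (fun w => cos (c + \sum_(i < M) u i * Y i w)).

Let clip (x : R) := Num.min 1 (Num.max 0 x).

Let clip_lip x y : `|clip x - clip y| <= `|x - y|.
Proof.
wlog xy : x y / x <= y.
  by move=> H; have [/H//|/ltW/H] := leP x y; rewrite distrC [ `|y - x|]distrC.
rewrite /clip [ `|x - y|]distrC [leLHS]distrC (ger0_norm (_ : 0 <= y - x)) ?subr_ge0//.
rewrite ler_norml; case: (leP 0 x); case: (leP 0 y) => hy hx; rewrite /Num.min;
  repeat case: ltP => *; apply/andP; split; lra.
Qed.

(* Tested with a Lipschitz majorant of the event that some increment exceeds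
   twice the bound. *)
Lemma oscillation_limit (rel : 'I_M -> 'I_M -> bool) (dl eta : R) : 0 < dl -> 0 <= eta ->
  wpe P eta (fun n w => forall i j, rel i j -> `|X n i w - X n j w| <= dl) ->
  exists B, [/\ measurable B, (P' B <= eta%:E)%E & forall w, ~ B w ->
    forall i j, rel i j -> `|Y i w - Y j w| <= 2 * dl].
Proof.
move=> dl0 eta0 [N HN].
pose S (y : 'I_M -> R) : R :=
  \big[Num.max/0]_(ij : 'I_M * 'I_M | rel ij.1 ij.2) `|y ij.1 - y ij.2|.
have S_ge y i j : rel i j -> `|y i - y j| <= S y.
  by move=> rij; exact: (@le_bigmax_cond _ _ _ 0 (i, j) _ (fun ij => `|y ij.1 - y ij.2|)).
have S_le y c : 0 <= c -> (forall i j, rel i j -> `|y i - y j| <= c) -> S y <= c.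
  by move=> c0 H; apply: bigmax_le => // -[i j] /= /H.
have S0 y : 0 <= S y by exact: bigmax_ge_id.
(* Vanishes when all related increments are at most [dl] and equals 1 when one of them reaches
   [2 dl]; this gap is the price of continuity. *)
pose H y := clip (S y / dl - 1).
have H01 y : 0 <= H y <= 1.
  by rewrite /H /clip ge_min lexx/= le_min ler01 le_max lexx.
have HC y : `|H y| <= 1 by have /andP[h1 h2] := H01 y; rewrite ger0_norm.
have Hu : unif_cont H.
  move=> e e0; exists (e * dl / 2); first by rewrite divr_gt0// mulr_gt0.
  move=> y y' yy.
  have half (z z' : 'I_M -> R) : (forall i, `|z i - z' i| <= e * dl / 2) -> S z <= S z' + e * dl.
    move=> zz; apply: S_le => [|i j rij]; first by rewrite addr_ge0// mulr_ge0// ltW.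
    have := zz i; have := zz j; have := S_ge z' i j rij; rewrite !ler_norml.
    by move=> /andP[? ?] /andP[? ?] /andP[? ?]; apply/andP; split; lra.
  rewrite (le_trans (clip_lip _ _))//.
  have -> : S y / dl - 1 - (S y' / dl - 1) = (S y - S y') / dl by ring.
  rewrite normrM normfV (gtr0_norm dl0) ler_pdivrMr// ler_norml.
  have h1 := half y y' yy; have h2 : S y' <= S y + e * dl.
    by apply: half => i; rewrite distrC.
  by apply/andP; split; lra.
have mHX n := unif_cont_meas (mX n) HC Hu.
have mHY := unif_cont_meas mY HC Hu.
have LHY : L1 P' (fun w => H (Y ^~ w)) by exact: (@L1_bounded _ _ _ _ _ 1).
have ExH : Ex P' (fun w => H (Y ^~ w)) <= eta.
  apply/ler_addgt0Pr => e e0.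
  have /cvgrPdist_le/(_ _ e0)[N' _ HN'] := unif_cont_cvg mX mY tX cosXY HC Hu.
  have := HN' (maxn N N') (leq_maxr _ _).
  set n := maxn N N'; have [B [mB PB hB]] := HN n (leq_maxl _ _).
  have : Ex P (fun w => H (X n ^~ w)) <= eta.
    have LB := L1_indic P mB.
    apply: (@le_trans _ _ (Ex P \1_B)).
      apply: Ex_le => //; first exact: (@L1_bounded _ _ _ _ _ 1).
      move=> w; rewrite indicE; have [_|/negP] := boolP (w \in B).
        by case/andP: (H01 (X n ^~ w)).
      rewrite in_setE => /hB h; rewrite /H /clip.
      have : S (X n ^~ w) / dl - 1 <= 0.
        rewrite subr_le0 ler_pdivrMr// mul1r; apply: S_le => //; exact: ltW.
      by move=> /max_idPl ->; rewrite ge_min lexx orbT.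
    by rewrite Ex_indic// -lee_fin EFin_prob.
  by rewrite ler_norml => h1 /andP[h2 h3]; lra.
exists [set w | 1 <= H (Y ^~ w)]; split.
- by rewrite -[X in measurable X]setTI; apply: measurable_fun_le.
- rewrite (le_trans (prob_markov LHY (fun w => (andP (H01 _)).1) ltr01))// lee_fin.
  by rewrite invr1 mul1r.
move=> w /negP; rewrite -ltNge => Hw i j rij.
rewrite leNgt; apply/negP => h; move: Hw; apply/negP; rewrite -leNgt.
rewrite /H /clip le_min lexx/= le_max; apply/orP; right.
by rewrite lerBrDr ler_pdivlMr// (le_trans (ltW _) (S_ge _ _ _ rij))//.
Qed.

End oscillation_of_limit.

Section geometric_tails.
Context (R : realType).

Lemma geometric_cauchy (u : nat -> R) (k0 : nat) :
  (forall k, (k0 <= k)%N -> `|u k.+1 - u k| <= 2 * (2 ^+ k)^-1) ->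
  cvg (u @ \oo) /\ forall k, (k0 <= k)%N -> `|u k - lim (u @ \oo)| <= 4 * (2 ^+ k)^-1.
Proof.
move=> hu.
have h k m : (k0 <= k)%N -> `|u (k + m)%N - u k| <= 4 * (2 ^+ k)^-1 - 4 * (2 ^+ (k + m))^-1.
  move=> kk; elim: m => [|m IH]; first by rewrite addn0 subrr normr0 subrr.
  have := hu _ (leq_trans kk (leq_addr m k)); rewrite addnS => h1.
  rewrite -(subrK (u (k + m)%N) (u (k + m).+1)) -addrA (le_trans (ler_normD _ _))//.
  have -> : (2 ^+ (k + m).+1)^-1 = (2 ^+ (k + m))^-1 / 2 :> R.
    by rewrite exprS invfM mulrC.
  by move: h1 IH; lra.
have {}h k m : (k0 <= k)%N -> (k <= m)%N -> `|u m - u k| <= 4 * (2 ^+ k)^-1.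
  move=> kk km; have := h k (m - k)%N kk; rewrite subnKC// => /le_trans; apply.
  by rewrite gerBl// mulr_ge0// ltW.
have small e : 0 < e -> exists2 k, (k0 <= k)%N & 4 * (2 ^+ k)^-1 <= e :> R.
  move=> e0; exists (maxn k0 (Num.bound (4 / e))); first exact: leq_maxl.
  set k := maxn _ _; rewrite ler_pdivrMr ?exprn_gt0// mulrC -ler_pdivrMr//.
  rewrite (le_trans (ltW (archi_boundP _))) ?divr_ge0 ?(ltW e0)//.
  rewrite -natrX ler_nat (leq_trans (leq_maxr k0 _))// -/k.
  exact/ltnW/ltn_expl.
have cu : cvg (u @ \oo).
  apply/cauchy_cvgP/cauchy_exP => e e0; have e2 : 0 < e / 2 by rewrite divr_gt0.
  have [k kk ke] := small _ e2; exists (u k); exists k => // m /= km.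
  rewrite /ball/= distrC (le_lt_trans (h k m kk km))// (le_lt_trans ke)//.
  by rewrite ltr_pdivrMr// ltr_pMr// ltr1n.
split=> // k kk; apply/ler_addgt0Pr => e e0.
have /cvgrPdist_le/(_ _ e0)[N _ HN] := cu.
have := HN (maxn N k) (leq_maxl _ _); have := h k (maxn N k) kk (leq_maxr _ _).
set v := u (maxn N k); set l := lim _; rewrite !ler_norml.
by move=> /andP[? ?] /andP[? ?]; apply/andP; split; lra.
Qed.

End geometric_tails.

(** The indices [f l] may repeat: coefficients with the same index are added, which reduces to an
    initial segment. *)
Lemma gaussian_family_fdd d (T : measurableType d) (R : realType) (P : probability T R)
    (A : nat -> nat -> R) (G : nat -> T -> R) :
  (forall n (x : nat -> R), isN P (fun w => \sum_(i < n) x i * G i w)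
    (\sum_(i < n) \sum_(j < n) x i * x j * A i j)) ->
  forall m (c : 'I_m -> R) (f : 'I_m -> nat), isN P (fun w => \sum_l c l * G (f l) w)
  (\sum_l \sum_l' c l * c l' * A (f l) (f l')).
Proof.
move=> GP m c f; pose n := (\max_l f l).+1.
have fn l : (f l < n)%N by rewrite ltnS; exact: leq_bigmax.
pose x i := \sum_l c l * ((f l == i)%:R : R).
have sE (g : nat -> R) : \sum_(i < n) x i * g i = \sum_l c l * g (f l).
  rewrite /x; under eq_bigr do rewrite mulr_suml; rewrite exchange_big/=.
  apply: eq_bigr => l _; rewrite (bigD1 (Ordinal (fn l)))//= eqxx mulr1 big1 ?addr0// => i il.
  rewrite (_ : (f l == i) = false) ?mulr0 ?mul0r//; apply/negbTE.
  by apply: contra il => /eqP E; apply/eqP/val_inj.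
have := GP n x; rewrite (_ : (fun w => _) = fun w => \sum_l c l * G (f l) w); last first.
  by apply/funext => w; rewrite (sE (G ^~ w)).
congr (isN P _ _); transitivity (\sum_(i < n) x i * \sum_(j < n) x j * A i j).
  by apply: eq_bigr => i _; rewrite mulr_sumr; apply: eq_bigr => j _; rewrite mulrA.
rewrite (sE (fun i => \sum_(j < n) x j * A i j)); apply: eq_bigr => l _.
by rewrite (sE (A (f l))) mulr_sumr; apply: eq_bigr => l' _; rewrite mulrA.
Qed.

Lemma cos_lip (R : realType) (x y : R) : `|cos x - cos y| <= `|x - y|.
Proof.
have -> : cos x - cos y = - (2 * (sin ((x + y) / 2) * sin ((x - y) / 2))).
  have -> : cos x = cos ((x + y) / 2 + (x - y) / 2) by congr cos; field.
  have -> : cos y = cos ((x + y) / 2 - (x - y) / 2) by congr cos; field.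
  by rewrite cosD cosB; ring.
have s1 : `|sin ((x + y) / 2)| <= 1 by rewrite ler_norml sin_geN1 sin_le1.
have s2 := normr_sin_le ((x - y) / 2).
rewrite normrN normrM normrM ger0_norm//.
have -> : `|x - y| = 2 * (1 * `|(x - y) / 2|).
  by rewrite normrM normfV (ger0_norm (ler0n _ 2)); field.
by rewrite ler_wpM2l// ler_pM.
Qed.

Lemma prob_bigcup_geometric d (T : measurableType d) (R : realType) (P : probability T R)
    (B : nat -> set T) : (forall k, measurable (B k)) ->
  (forall k, (P (B k) <= ((2 ^+ k)^-1)%:E)%E) ->
  forall k, (P (\bigcup_(j >= k) B j) <= (2 * (2 ^+ k)^-1)%:E)%E.
Proof.
move=> mB PB k; have mU : measurable (\bigcup_(j >= k) B j).
  by apply: bigcup_measurable => j _.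
rewrite (le_trans (measure_sigma_subadditive_tail P (N := k) mB mU _))//.
  by move=> w [j /= kj Bj]; exists j => //=; apply/negP; rewrite -leqNgt.
apply: lime_le; first by apply: is_cvg_nneseries => n _ _; exact: measure_ge0.
have p2 n : 0 < (2 ^+ n)^-1 :> R by rewrite invr_gt0 exprn_gt0.
have key m : (\sum_(k <= i < k + m) P (B i) <=
    (2 * (2 ^+ k)^-1 - 2 * (2 ^+ (k + m))^-1)%:E)%E.
  elim: m => [|m IH]; first by rewrite addn0 big_geq// subrr.
  rewrite addnS big_nat_recr ?leq_addr//= (le_trans (leeD IH (PB _)))// -EFinD lee_fin.
  have -> : (2 ^+ (k + m).+1)^-1 = (2 ^+ (k + m))^-1 / 2 :> R by rewrite exprS invfM mulrC.
  by have := p2 (k + m)%N; lra.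
exists k => // n /= kn; rewrite -(subnKC kn) (le_trans (key _))// lee_fin gerBl.
by rewrite mulr_ge0// ltW.
Qed.

(** * The limit process on nested scales of grids *)

Section limit_process.
Context d (T : measurableType d) (R : realType) (P : probability T R) (a b : R).
Hypothesis ab : a < b.
Variables (Y : nat -> T -> R -> R) (K : R -> R -> R) (Z : nat -> T -> R).
Hypothesis mY : forall n p, a <= p <= b -> measurable_fun setT (fun w => Y n w p).
Hypothesis tY : tightp P a b Y.
Hypothesis oY : oscp P a b Y.
Hypothesis K_psd : forall t : nat -> R, (forall i, a <= t i <= b) ->
  psd (fun i j => K (t i) (t j)).
Hypothesis cltY : forall k (u t : 'I_k -> R), (forall j, a <= t j <= b) -> forall c,
  Ex P (fun w => cos (c + \sum_(j < k) u j * Y n w (t j))) @[n --> \oo] -->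
  cos c * expR (- ((\sum_(i < k) \sum_(j < k) u i * u j * K (t i) (t j)) / 2)).
Hypothesis iZ : indep_fam P Z.
Hypothesis NZ : forall i, isN P (Z i) 1.

Let h k : R := (2 ^+ k)^-1.

Let h0 k : 0 < h k. Proof. by rewrite invr_gt0 exprn_gt0. Qed.

(* The [k]-th grid has mesh [1 / N k], at which the oscillations of [Y n] are
   eventually at most [2 ^ - k] outside an event of probability [2 ^ - k]. *)
Let scale_ex : exists N : nat -> nat, (forall k, (0 < N k)%N) /\
  (forall k l, (k <= l)%N -> (N k <= N l)%N) /\
  forall k, wpe P (h k) (fun n w => forall p p', a <= p <= b -> a <= p' <= b ->
    `|p - p'| <= (N k)%:R^-1 -> `|Y n w p - Y n w p'| <= h k).
Proof.
have ex k : exists m : nat, (0 < m)%N /\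
    forall m', (m <= m')%N -> wpe P (h k) (fun n w => forall p p', a <= p <= b -> a <= p' <= b ->
    `|p - p'| <= m'%:R^-1 -> `|Y n w p - Y n w p'| <= h k).
  have [dl dl0 H] := oY (h0 k) (h0 k); exists (Num.bound dl^-1).+1; split=> // m mm.
  apply: wpe_sub H; exists 0%N => n _ w H p p' pab pab' pp; apply: H => //.
  rewrite (le_trans pp)// -[leRHS]invrK lef_pV2 ?posrE ?invr_gt0//; last first.
    by rewrite ltr0n (leq_trans _ mm).
  rewrite (le_trans (ltW (archi_boundP _))) ?invr_ge0 ?(ltW dl0)//.
  by rewrite ler_nat (leq_trans _ mm).
(* Partial sums make the scales nondecreasing while staying above the required values. *)
have [m Hm] := choice ex; exists (fun k => \sum_(j < k.+1) m j)%N; split; [|split].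
- by move=> k; rewrite big_ord_recr/= ltn_addl//; have [] := Hm k.
- move=> k l kl; rewrite -(subnKC kl) -addSn big_split_ord/=.
  exact: leq_addr.
- by move=> k; have [_] := Hm k; apply; rewrite big_ord_recr/= leq_addl.
Qed.

Let N := sval (cid scale_ex).
Let N0 k : (0 < N k)%N. Proof. by have [] := svalP (cid scale_ex). Qed.
Let N_le k l : (k <= l)%N -> (N k <= N l)%N.
Proof. by have [_ [H _]] := svalP (cid scale_ex); exact: H. Qed.
Let oscN k : wpe P (h k) (fun n w => forall p p', a <= p <= b -> a <= p' <= b ->
    `|p - p'| <= (N k)%:R^-1 -> `|Y n w p - Y n w p'| <= h k).
Proof. by have [_ [_ H]] := svalP (cid scale_ex); exact: H. Qed.

Let NR0 k : 0 < (N k)%:R :> R. Proof. by rewrite ltr0n. Qed.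

Let ix k p := Num.truncn ((N k)%:R * (p - a)).
(** Clamped at [b], so that every grid point, even of an index beyond the last cell, lies in
    [[a, b]]. *)
Let pt k i : R := Num.min b (a + i%:R / (N k)%:R).
Let M k := ix k b.

Let pt_ab k i : a <= pt k i <= b.
Proof.
rewrite /pt le_min (ltW ab) ge_min lexx /= andbT.
by rewrite lerDl divr_ge0// ltW.
Qed.

Let ix_le k p : a <= p <= b -> (ix k p <= M k)%N.
Proof. by move=> /andP[_ pb]; apply: le_truncn; rewrite ler_wpM2l ?(ltW (NR0 k))// lerB. Qed.

Let pt_near k p : a <= p <= b -> 0 <= p - pt k (ix k p) <= (N k)%:R^-1.
Proof.
move=> /andP[ap pb]; have /truncn_itv/andP[h1 h2] : 0 <= (N k)%:R * (p - a).
  by rewrite mulr_ge0 ?subr_ge0// ltW.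
rewrite -/(ix k p) in h1 h2.
have l1 : (ix k p)%:R / (N k)%:R <= p - a by rewrite ler_pdivrMr// mulrC.
have l2 : p - a < (ix k p)%:R / (N k)%:R + (N k)%:R^-1.
  by rewrite -{2}[(N k)%:R^-1]mul1r -mulrDl natr1 ltr_pdivlMr// mulrC.
have -> : pt k (ix k p) = a + (ix k p)%:R / (N k)%:R.
  by apply/min_idPr; rewrite (le_trans _ pb)// -lerBrDl.
by apply/andP; split; lra.
Qed.

Let code (k i : nat) : nat := @choice.pickle (nat * nat)%type (k, i).

(** The points of all grids in one sequence, as the Gaussian family is indexed by integers; an
    integer that encodes no pair stands for [a]. *)
Let tj (j : nat) : R := if @choice.unpickle (nat * nat)%type j is Some (k, i) then pt k i else a.

Let tj_ab j : a <= tj j <= b.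
Proof. by rewrite /tj; case: choice.unpickle => [[k i]|]; rewrite ?pt_ab// lexx ltW. Qed.

Let tjE k i : tj (code k i) = pt k i. Proof. by rewrite /tj /code choice.pickleK. Qed.

Let G_ex := gaussian_family iZ NZ (K_psd tj_ab).
Let G := sval (cid G_ex).

Let G_fdd m (c : 'I_m -> R) (f : 'I_m -> nat) : isN P (fun w => \sum_l c l * G (f l) w)
  (\sum_l \sum_l' c l * c l' * K (tj (f l)) (tj (f l'))).
Proof. exact: (@gaussian_family_fdd _ _ _ P (fun i j => K (tj i) (tj j)) G (svalP (cid G_ex)) m c f). Qed.

Let mG i : measurable_fun setT (G i).
Proof.
have [m _] := G_fdd (fun=> 1) (fun _ : 'I_1 => i).
by move: m; congr measurable_fun; apply/funext => w; rewrite big_ord1 mul1r.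
Qed.

Let mYj n j : measurable_fun setT (fun w => Y n w (tj j)). Proof. exact: mY. Qed.

Let tYj j : tight P (fun n w => Y n w (tj j)).
Proof.
move=> e /tY[C C0 H]; exists C => //; apply: wpe_sub H; exists 0%N => n _ w H.
exact: H.
Qed.

Let cosYG m c (u : 'I_m -> R) :
  Ex P (fun w => cos (c + \sum_(j < m) u j * Y n w (tj j))) @[n --> \oo] -->
  Ex P (fun w => cos (c + \sum_(j < m) u j * G j w)).
Proof.
have [_ /(_ c 1)] := G_fdd u (fun j : 'I_m => j).
under eq_fun do rewrite mul1r; rewrite expr1n mulr1 => ->.
exact: (@cltY m u (fun j : 'I_m => tj j) (fun j => tj_ab j) c).
Qed.

(** Bounds the codes of the points of levels [k] and [k + 1], so that comparing the two levels
    involves finitely many coordinates. *)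
Let mk k := (maxn (\max_(i < (M k.+1).+1) code k.+1 i)
                  (\max_(i < (M k).+1) code k i))%N.

Let mk_le k p : a <= p <= b ->
  (code k (ix k p) <= mk k)%N /\ (code k.+1 (ix k.+1 p) <= mk k)%N.
Proof.
move=> pab; split; rewrite leq_max; apply/orP; [right|left].
  have i_lt : (ix k p < (M k).+1)%N by rewrite ltnS ix_le.
  exact: (leq_bigmax (F := fun i : 'I_(M k).+1 => code k i) (Ordinal i_lt)).
have i_lt : (ix k.+1 p < (M k.+1).+1)%N by rewrite ltnS ix_le.
exact: (leq_bigmax (F := fun i : 'I_(M k.+1).+1 => code k.+1 i) (Ordinal i_lt)).
Qed.

(** For every [p] the grid points below it at levels [k] and [k + 1] are at distance at most
    [1 / N k], so the oscillation bound of [Y n] applies to this finite set of pairs and passes to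
    [G] with a factor 2. *)
Let B_ex k : exists B : set T, [/\ measurable B, (P B <= (h k)%:E)%E & forall w, ~ B w ->
  forall p, a <= p <= b ->
  `|G (code k.+1 (ix k.+1 p)) w - G (code k (ix k p)) w| <= 2 * h k].
Proof.
pose rel (i j : 'I_(mk k).+1) := `[< exists2 p, a <= p <= b &
  i = code k.+1 (ix k.+1 p) :> nat /\ j = code k (ix k p) :> nat >].
have [|B [mB PB hB]] := @oscillation_limit _ _ _ _ _ P P (mk k).+1
    (fun n i w => Y n w (tj i)) (fun i => G i) (fun n i => mYj n i) (fun i => mG i)
    (fun i => tYj i) (@cosYG (mk k).+1) rel _ _ (h0 k) (ltW (h0 k)).
  apply: wpe_sub (oscN k); exists 0%N => n _ w H i j /asboolP[p pab [-> ->]].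
  rewrite !tjE; apply: H => //.
  have /andP[l1 l2] := pt_near k pab; have /andP[l3 l4] := pt_near k.+1 pab.
  have : ((N k.+1)%:R^-1 <= (N k)%:R^-1 :> R) by rewrite lef_pV2 ?posrE// ler_nat N_le.
  by rewrite ler_norml => *; apply/andP; split; lra.
exists B; split=> // w /hB H p pab; have [k1 k2] := mk_le k pab.
have := H (inord (code k.+1 (ix k.+1 p))) (inord (code k (ix k p))).
rewrite !inordK ?ltnS//; apply; apply/asboolP; exists p => //.
by rewrite !inordK ?ltnS.
Qed.

Let B k := sval (cid (B_ex k)).
Let mB k : measurable (B k). Proof. by have [] := svalP (cid (B_ex k)). Qed.
Let PB k : (P (B k) <= (h k)%:E)%E. Proof. by have [] := svalP (cid (B_ex k)). Qed.
Let Uk k w p := G (code k (ix k p)) w.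
Let hB k w p : ~ B k w -> a <= p <= b -> `|Uk k.+1 w p - Uk k w p| <= 2 * h k.
Proof. by have [_ _ H] := svalP (cid (B_ex k)) => /H; exact. Qed.

Let Bad k := \bigcup_(j >= k) B j.

Let mBad k : measurable (Bad k).
Proof. by apply: bigcup_measurable => j _. Qed.

Let PBad k : (P (Bad k) <= (2 * h k)%:E)%E.
Proof. exact: prob_bigcup_geometric. Qed.

Let Nul := \bigcap_k Bad k.

Let mNul : measurable Nul.
Proof. by apply: bigcap_measurableType => k _. Qed.

(** Off [Nul], the upper limit of the events [B k], the step functions form a uniform Cauchy
    sequence. The value 0 on [Nul] makes every path, not almost every one, a uniform limit of step
    functions. *)
Let upath w p : R := if w \in Nul then 0 else lim (Uk k w p @[k --> \oo]).

Let upath_near k w p : ~ Bad k w -> a <= p <= b -> `|Uk k w p - upath w p| <= 4 * h k.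
Proof.
move=> nB pab; rewrite /upath ifF; last first.
  by apply/negP; rewrite in_setE => /(_ k I).
have hu j : (k <= j)%N -> `|Uk j.+1 w p - Uk j w p| <= 2 * (2 ^+ j)^-1.
  by move=> kj; apply: hB => // Bj; apply: nB; exists j.
by have [_ H] := geometric_cauchy hu; exact: H.
Qed.

Let Bad_anti k l w : (k <= l)%N -> ~ Bad k w -> ~ Bad l w.
Proof. by move=> kl nB [j /= lj Bj]; apply: nB; exists j => //=; exact: leq_trans lj. Qed.

Let not_Nul w : ~ Nul w -> exists k, ~ Bad k w.
Proof.
by move=> nN; apply: contrapT => /forallNP H; apply: nN => k _; exact: contrapT.
Qed.

Let h_small e : 0 < e -> exists k0, forall k, (k0 <= k)%N -> h k <= e.
Proof.
move=> e0; exists (Num.bound e^-1) => k kk; rewrite /h -[leRHS]invrK.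
rewrite lef_pV2 ?posrE ?invr_gt0 ?exprn_gt0//.
rewrite (le_trans (ltW (archi_boundP _))) ?invr_ge0 ?(ltW e0)//.
by rewrite -natrX ler_nat (leq_trans kk)// ltnW// ltn_expl.
Qed.

Let Sk k (y : 'I_(mk k).+1 -> R) : skorohod a b :=
  mkD (cadlag_step a b (fun i => y (inord (code k i))) a (ltW (NR0 k))).

Let SkE k (g : nat -> R) p : a <= p <= b ->
  Sk (fun i : 'I_(mk k).+1 => g i) p = g (code k (ix k p)).
Proof.
by move=> pab; rewrite /Sk mkDE// inordK// ltnS; have [] := mk_le k pab.
Qed.

Let Sk_lip k (y y' : 'I_(mk k).+1 -> R) e : (forall i, `|y i - y' i| <= e) ->
  forall p, a <= p <= b -> `|Sk y p - Sk y' p| <= e.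
Proof. by move=> yy p pab; rewrite /Sk !mkDE. Qed.

Let Sk_cont k e : 0 < e -> exists2 dl : R, 0 < dl &
  forall y y' : 'I_(mk k).+1 -> R, (forall i, `|y i - y' i| <= dl) ->
    forall p, a <= p <= b -> `|Sk y p - Sk y' p| <= e.
Proof. by move=> e0; exists e => // y y'; exact: Sk_lip. Qed.

(** The coordinates are killed on [Nul], so that convergence to the limit path holds for every [w]
    and measurability passes to the limit. *)
Let Uk' k w := Sk (fun i : 'I_(mk k).+1 => G i w * \1_(~` Nul) w).

Let Uk'E k w p : a <= p <= b -> Uk' k w p = if w \in Nul then 0 else Uk k w p.
Proof.
move=> pab; rewrite /Uk' (SkE k (fun i => G i w * \1_(~` Nul) w) pab) indicE in_setC.
by case: ifP => _; rewrite ?mulr0 ?mulr1.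
Qed.

Let Uk'_random k : sup_random (Uk' k).
Proof.
apply: (@sup_random_coords _ _ _ _ _ _ (fun (i : 'I_(mk k).+1) w => G i w * \1_(~` Nul) w) (@Sk k)).
  by move=> i; apply: measurable_funM => //; apply: measurable_indic; exact: measurableC.
exact: Sk_cont.
Qed.

Let Uk'_cvg w e : 0 < e -> exists k0, forall k, (k0 <= k)%N -> forall p, a <= p <= b ->
  `|Uk' k w p - upath w p| <= e.
Proof.
move=> e0; have [wN|wN] := boolP (w \in Nul).
  by exists 0%N => k _ p pab; rewrite Uk'E// /upath wN subrr normr0 ltW.
have [k1 nB] : exists k, ~ Bad k w by apply: not_Nul => Nw; apply: (negP wN); rewrite in_setE.
have e4 : 0 < e / 4 by rewrite divr_gt0.
have [k0 hk] := h_small e4; exists (maxn k0 k1) => k; rewrite geq_max => /andP[kk0 kk1] p pab.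
rewrite Uk'E// (negbTE wN) (le_trans (upath_near (Bad_anti kk1 nB) pab))//.
by rewrite mulrC -ler_pdivlMr// hk.
Qed.

Let upath_cadlag w : cadlag a b (upath w).
Proof.
apply: (@cadlag_unif_limit _ _ _ (fun k => Uk' k w)); first by move=> k; exact: path_cadlag.
by move=> e e0; have [k0 H] := Uk'_cvg w e0; exists k0; exact: H.
Qed.

Let U w := mkD (upath_cadlag w).

Let UE w p : a <= p <= b -> U w p = upath w p. Proof. exact: mkDE. Qed.

Let U_random : sup_random U.
Proof.
apply: (sup_random_lim Uk'_random) => w e e0; have [k0 H] := Uk'_cvg w e0.
by exists k0 => k kk p pab; rewrite UE//; exact: H.
Qed.

Let mU p : a <= p <= b -> measurable_fun setT (fun w => U w p).
Proof.
move=> pab; apply: (@measurable_fun_cvg _ _ _ _ (fun k w => Uk' k w p)).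
  move=> k; have -> : (fun w => Uk' k w p) = fun w => G (code k (ix k p)) w * \1_(~` Nul) w.
    apply/funext => w; rewrite Uk'E// indicE in_setC.
    by case: ifP => _; rewrite ?mulr0 ?mulr1.
  by apply: measurable_funM => //; apply: measurable_indic; exact: measurableC.
move=> w _; apply/cvgrPdist_le => e e0; have [k0 H] := Uk'_cvg w e0.
by exists k0 => // k kk; rewrite distrC (UE w pab); exact: H.
Qed.

Variable X : nat -> T -> skorohod a b.
Hypothesis X_random : forall n, sup_random (X n).
Hypothesis XY : forall e, 0 < e ->
  whp P (fun n w => forall p, a <= p <= b -> `|X n w p - Y n w p| <= e).

(** The level [k] is chosen before [n]. At that level [U] is close to the step function of [G], and
    [X n] to the step function of [Y n]; between the two step functions only finitely many
    coordinates have to converge. *)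
Let functional_cvg (g : skorohod a b -> R) (C : R) : sup_unifc g ->
  (forall x : skorohod a b, `|g x| <= C) ->
  Ex P (g \o X n) @[n --> \oo] --> Ex P (g \o U).
Proof.
move=> gu gC; have C0 : 0 <= C by exact: le_trans (gC (U point)).
apply/cvgrPdist_le => e e0.
(* Each of the two replacements by step functions costs one part for the distance and one for the
   exceptional event; the fifth part is for the convergence of the coordinates. *)
have e4 : 0 < e / 5 by rewrite divr_gt0.
have [dl dl0 hdl] := gu _ e4.
pose ce := e / 5 / (8 * (C + 1)); have ce0 : 0 < ce by rewrite !divr_gt0// mulr_gt0// ltr_wpDl.
have d5 : 0 < dl / 5 by rewrite divr_gt0.
have [k1 hk1] := h_small ce0; have [k2 hk2] := h_small d5.
pose k := maxn k1 k2.
have hc : h k <= ce by apply: hk1; exact: leq_maxl.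
have hd : h k <= dl / 5 by apply: hk2; exact: leq_maxr.
have hC : 2 * C * (2 * h k) <= e / 5.
  rewrite (@le_trans _ _ (8 * (C + 1) * ce))//; last first.
    by rewrite mulrC divfK// gt_eqF// mulr_gt0// ltr_wpDl.
  by have := h0 k; nra.
have mgU := U_random gu gC; have mgX n := X_random n gu gC.
pose H := g \o @Sk k.
have HC y : `|H y| <= C by exact: gC.
have Hu : unif_cont H by apply: sup_unifc_coords => //; exact: Sk_cont.
have mHG : measurable_fun setT (fun w => H (fun i => G i w)) :=
  unif_cont_meas (fun i : 'I_(mk k).+1 => mG i) HC Hu.
have mHY n : measurable_fun setT (fun w => H (fun i => Y n w (tj i))) :=
  unif_cont_meas (fun i : 'I_(mk k).+1 => mYj n i) HC Hu.
have UG : `|Ex P (g \o U) - Ex P (fun w => H (fun i => G i w))| <= e / 5 + e / 5.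
  have close w : ~ Bad k w -> `|(g \o U) w - H (fun i => G i w)| <= e / 5.
    move=> nB; apply: hdl => p pab; rewrite UE// (SkE k (fun i => G i w) pab) distrC.
    by rewrite (le_trans (upath_near nB pab))//; move: hd (h0 k); lra.
  have := Ex_close mgU mHG (fun w => gC (U w)) (fun w => HC _) (mBad k) (PBad k) (ltW e4) close.
  by move=> /le_trans; apply; rewrite lerD2l.
have cHG := unif_cont_cvg (fun n (i : 'I_(mk k).+1) => mYj n i) (fun i => mG i)
  (fun i => tYj i) (@cosYG (mk k).+1) HC Hu.
have /cvgrPdist_le/(_ _ e4)[n1 _ hn1] := cHG.
have [n2 hn2] := wpe_and (XY d5 (h0 k)) (oscN k).
exists (maxn n1 n2) => // n /=; rewrite geq_max => /andP[nn1 nn2].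
have [B' [mB' PB' hB']] := hn2 n nn2.
have close w : ~ B' w -> `|(g \o X n) w - H (fun i => Y n w (tj i))| <= e / 5.
  move=> /hB'[H1 H2]; apply: hdl => p pab.
  rewrite (SkE k (fun i => Y n w (tj i)) pab) tjE.
  have /andP[l1 l2] := pt_near k pab.
  have := H1 p pab; have : `|Y n w p - Y n w (pt k (ix k p))| <= h k.
    by apply: H2 => //; rewrite ger0_norm.
  rewrite !ler_norml => /andP[? ?] /andP[? ?]; move: hd => ?.
  by apply/andP; split; lra.
have PB2 : (P B' <= (2 * h k)%:E)%E by rewrite mulrDl mul1r.
have XH := Ex_close (mgX n) (mHY n) (fun w => gC (X n w)) (fun w => HC _) mB' PB2 (ltW e4) close.
have := hn1 n nn1 => /=; move: UG XH hC; rewrite !ler_norml.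
move=> /andP[? ?] /andP[? ?] ? /andP[? ?].
by apply/andP; split; lra.
Qed.

Let cos_comb k (u t : 'I_k -> R) c e : (forall j, a <= t j <= b) -> 0 < e ->
  exists2 dl : R, 0 < dl & forall x y : R -> R,
    (forall p, a <= p <= b -> `|x p - y p| <= dl) ->
    `|cos (c + \sum_(j < k) u j * x (t j)) - cos (c + \sum_(j < k) u j * y (t j))| <= e.
Proof.
move=> tab e0; pose L := \sum_(j < k) `|u j| + 1.
have L0 : 0 < L by rewrite ltr_wpDl// sumr_ge0.
exists (e / L); first by rewrite divr_gt0.
move=> x y xy; rewrite (le_trans (cos_lip _ _))//.
have -> : c + \sum_(j < k) u j * x (t j) - (c + \sum_(j < k) u j * y (t j)) =
    \sum_(j < k) u j * (x (t j) - y (t j)).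
  rewrite opprD addrACA subrr add0r -sumrB.
  by apply: eq_bigr => j _; rewrite mulrBr.
rewrite (le_trans (ler_norm_sum _ _ _))//.
rewrite (@le_trans _ _ (\sum_(j < k) `|u j| * (e / L)))//.
  by apply: ler_sum => j _; rewrite normrM ler_wpM2l// xy.
rewrite -mulr_suml mulrCA ler_piMr ?(ltW e0)// ler_pdivrMr// mul1r /L.
by rewrite lerDl.
Qed.

(** The points are arbitrary, not on the grids. The cosine of a combination of evaluations is
    uniformly continuous for the supremum distance, so its expectation along [X n] tends to that of
    [U]; along the nearby [Y n] it tends to the normal value, and limits are unique. *)
Let U_fdd k (c t : 'I_k -> R) : (forall j, a <= t j <= b) ->
  isN P (fun w => \sum_(j < k) c j * U w (t j))
    (\sum_(i < k) \sum_(j < k) c i * c j * K (t i) (t j)).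
Proof.
move=> tab; split.
  by apply: measurable_sum => j; apply: measurable_funM => //; exact: mU.
move=> c0 u; pose u' j := u * c j.
have sumE (x : R -> R) : \sum_(j < k) u' j * x (t j) = u * \sum_(j < k) c j * x (t j).
  by rewrite mulr_sumr; apply: eq_bigr => j _; rewrite mulrA.
pose g (x : skorohod a b) := cos (c0 + \sum_(j < k) u' j * x (t j)).
have gu : sup_unifc g.
  by move=> e /(cos_comb u' c0 tab)[dl dl0 H]; exists dl => // x y; exact: H.
have g1 (x : skorohod a b) : `|g x| <= 1 by rewrite ler_norml cos_geN1 cos_le1.
have c1 := functional_cvg gu g1; have c2 := @cltY k u' t tab c0.
have -> : Ex P (fun w => cos (c0 + u * \sum_(j < k) c j * U w (t j))) = Ex P (g \o U).
  by congr Ex; apply/funext => w; rewrite -(sumE (U w)).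
have -> : (\sum_(i < k) \sum_(j < k) c i * c j * K (t i) (t j)) * u ^+ 2 =
    \sum_(i < k) \sum_(j < k) u' i * u' j * K (t i) (t j).
  rewrite mulr_suml; apply: eq_bigr => i _; rewrite mulr_suml; apply: eq_bigr => j _.
  by rewrite /u'; ring.
apply: (@cvg_unique _ (@norm_hausdorff _ R) _ _ _ _ c1).
apply/cvgrPdist_le => e e0; have e3 : 0 < e / 3 by rewrite divr_gt0.
have e6 : 0 < e / 3 / 2 by rewrite divr_gt0.
have [dl dl0 H] := cos_comb u' c0 tab e3.
have /cvgrPdist_le/(_ _ e3)[n1 _ hn1] := c2.
have [n2 hn2] := XY dl0 e6.
exists (maxn n1 n2) => // n /=; rewrite geq_max => /andP[nn1 nn2].
have [B' [mB' PB' hB']] := hn2 n nn2.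
have mgY : measurable_fun setT (fun w => cos (c0 + \sum_(j < k) u' j * Y n w (t j))).
  have mS : measurable_fun setT (fun w => \sum_(j < k) u' j * Y n w (t j)).
    by apply: measurable_sum => j; apply: measurable_funM => //; exact: mY.
  by have := measurable_cosu c0 1 mS; under eq_fun do rewrite mul1r.
have close w : ~ B' w -> `|(g \o X n) w - cos (c0 + \sum_(j < k) u' j * Y n w (t j))| <= e / 3.
  by move=> /hB' h'; exact: H.
have Y1 w : `|cos (c0 + \sum_(j < k) u' j * Y n w (t j))| <= 1.
  by rewrite ler_norml cos_geN1 cos_le1.
have := Ex_close (X_random n gu g1) mgY (fun w => g1 (X n w)) Y1 mB' PB' (ltW e3) close.
have := hn1 n nn1 => /=; rewrite !ler_norml.
by move=> /andP[? ?] /andP[? ?]; apply/andP; split; lra.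
Qed.

Theorem gaussian_limit : exists U : T -> skorohod a b, [/\ sup_random U,
  (forall k (c t : 'I_k -> R), (forall j, a <= t j <= b) ->
    isN P (fun w => \sum_(j < k) c j * U w (t j))
      (\sum_(i < k) \sum_(j < k) c i * c j * K (t i) (t j))) &
  forall (g : skorohod a b -> R) (C : R), sup_unifc g ->
    (forall x : skorohod a b, `|g x| <= C) ->
    Ex P (g \o X n) @[n --> \oo] --> Ex P (g \o U)].
Proof. by exists U; split; [exact: U_random|exact: U_fdd|exact: functional_cvg]. Qed.

End limit_process.

(** * Limit theorems *)

Section normal_moments.
Context d (T : measurableType d) (R : realType) (P : probability T R).

Lemma isN_expectation (X : T -> R) v : 0 <= v -> isN P X v -> 'E_P[X]%E = 0%E.
Proof.
move=> v0 NX; have LX : L1 P X by apply: L1_of_L2 (isN_L2 v0 NX); case: NX.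
by rewrite (expectation_Ex LX) (isN_mean v0 NX).
Qed.

(** Polarization from the variance of the sum. *)
Lemma isN_covariance (X Y : T -> R) vx vy vxy : 0 <= vx -> 0 <= vy ->
  isN P X vx -> isN P Y vy -> isN P (fun w => X w + Y w) (vx + 2 * vxy + vy) ->
  0 <= vx + 2 * vxy + vy -> covariance P X Y = vxy%:E.
Proof.
move=> vx0 vy0 NX NY NXY v0.
have LX2 := isN_L2 vx0 NX; have LY2 := isN_L2 vy0 NY.
have X2 : L2 P X by split; [case: NX|].
have Y2 : L2 P Y by split; [case: NY|].
have LXY := L2M X2 Y2.
rewrite unlock (isN_expectation vx0 NX) (isN_expectation vy0 NY)/=.
rewrite (_ : (X \- cst 0) * (Y \- cst 0) = fun w => X w * Y w); last first.
  by apply/funext => w; change ((X w - 0) * (Y w - 0) = X w * Y w); rewrite !subr0.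
rewrite (expectation_Ex LXY); congr EFin.
have := isN_var v0 NXY.
rewrite (_ : (fun w => _) = fun w => (X w ^+ 2 + 2 * (X w * Y w)) + Y w ^+ 2); last first.
  by apply/funext => w; ring.
rewrite ExD//; last by apply: L1D => //; exact: L1Z.
rewrite ExD//; last exact: L1Z.
by rewrite ExZ// (isN_var vx0 NX) (isN_var vy0 NY); lra.
Qed.

End normal_moments.

Section ecf_limit.
Context d (T : measurableType d) (R : realType) (P : probability T R).
Variables (W : nat -> T -> R) (F : R -> R).
Hypothesis mW : forall i, measurable_fun setT (W i).
Hypothesis iW : indep_fam P W.
Hypothesis WF : forall i x, P (W i @^-1` `]-oo, x]) = (F x)%:E.
Hypothesis F_inv : forall p : R, 0 < p < 1 -> exists! x : R, F x = p.
Hypothesis W2 : L1 P (fun w => W 0 w ^+ 2).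
Hypothesis F_cont : continuous F.
Hypothesis F_der : forall p, 0 < p < 1 -> derivable F (cdf_inv F p) 1.
Hypothesis dF_cont : forall p, 0 < p < 1 ->
  {for p, continuous (fun p => derive1 F (cdf_inv F p))}.

Lemma psi_cov_ge0 I (s : seq I) (c t : I -> R) : (forall i, 0 < t i < 1) ->
  0 <= \sum_(i <- s) \sum_(j <- s) c i * c j * psi_cov P W F (t i) (t j).
Proof.
move=> t01; have LL i j : L1 P (fun w => c i * c j * (psi P W F (t i) (W 0 w) * psi P W F (t j) (W 0 w))).
  by apply: L1Z; apply: L2M; exact: psi_L2.
have -> : \sum_(i <- s) \sum_(j <- s) c i * c j * psi_cov P W F (t i) (t j) =
    Ex P (fun w => (\sum_(i <- s) c i * psi P W F (t i) (W 0 w)) ^+ 2).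
  have -> : (fun w => (\sum_(i <- s) c i * psi P W F (t i) (W 0 w)) ^+ 2) =
      fun w => \sum_(i <- s) \sum_(j <- s)
        c i * c j * (psi P W F (t i) (W 0 w) * psi P W F (t j) (W 0 w)).
    apply/funext => w; rewrite expr2 mulr_suml; apply: eq_bigr => i _; rewrite mulr_sumr.
    by apply: eq_bigr => j _; ring.
  rewrite Ex_sum; last by move=> i; exact: L1_sum.
  apply: eq_bigr => i _; rewrite Ex_sum//; apply: eq_bigr => j _.
  by rewrite ExZ//; apply: L2M; exact: psi_L2.
by apply: Ex_ge0 => w; exact: sqr_ge0.
Qed.

Lemma sample_normal : exists Z : nat -> T -> R, indep_fam P Z /\ forall i, isN P (Z i) 1.
Proof.
have [h mh [mN NE]] := isN_quantile (mW 0) (WF 0) F_inv.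
exists (fun i w => h (W i w)); split; first exact: (indep_fam_comp (phi := fun=> h) iW).
move=> i; split=> [|c u]; first exact: (measurableT_comp mh).
rewrite -NE; pose k y := cos (c + u * h y).
have mk : measurable_fun setT k by exact: measurable_cosu.
have Lk : L1 P (k \o W 0) by exact: (@L1_cosu _ _ _ P (fun w => h (W 0 w))).
by have [_] := sample_Ex mW WF i mk Lk.
Qed.

Section interval.
Variables a b : R.
Hypotheses (a0 : 0 < a) (ab : a < b) (b1 : b < 1).
Hypothesis dF_neq0 : forall p, a <= p <= b -> derive1 F (cdf_inv F p) != 0.

Let in01 p : a <= p <= b -> 0 < p < 1.
Proof. by move=> /andP[ap pb]; rewrite (lt_le_trans a0)// (le_lt_trans pb). Qed.

Lemma ecf_gaussian_limit : exists U : T -> skorohod a b, [/\ sup_random U,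
  (forall k (c t : 'I_k -> R), (forall j, a <= t j <= b) ->
    isN P (fun w => \sum_(j < k) c j * U w (t j))
      (\sum_(i < k) \sum_(j < k) c i * c j * psi_cov P W F (t i) (t j))) &
  forall (g : skorohod a b -> R) (C : R), sup_unifc g ->
    (forall x : skorohod a b, `|g x| <= C) ->
    Ex P (g \o ecf_path mW WF F_inv W2 a0 b1 n) @[n --> \oo] --> Ex P (g \o U)].
Proof.
have [Z [iZ NZ]] := sample_normal.
have dFc p : a <= p <= b -> {for p, continuous (fun p => derive1 F (cdf_inv F p))}.
  by move=> /in01; exact: dF_cont.
apply: (gaussian_limit ab (Y := ecf_lin P W F) (K := psi_cov P W F) _ _ _ _ _ iZ NZ).
- move=> n p _; rewrite (_ : (fun w => _) = nsum (fun i w => psi P W F p (W i w)) n).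
    apply: measurable_nsum => i; apply: (measurableT_comp (measurable_psi mW WF p)).
    exact: mW.
  by apply/funext => w; exact: ecf_linE.
- exact: ecf_lin_tightp.
- exact: ecf_lin_oscp.
- move=> t tab; split=> [i j|s].
    by congr Ex; apply/funext => w; rewrite mulrC.
  by apply: (@psi_cov_ge0 _ s fst (fun x => t x.2)) => x; exact: in01.
- by move=> k u t tab c; apply: ecf_lin_clt => // j; exact: in01.
- exact: ecf_path_random.
move=> e e0; have := ecf_remainder mW iW WF F_inv W2 F_cont F_der a0 b1 dFc dF_neq0 e0.
by apply: whp_sub; exists 0%N => n _ w H p pab; rewrite mkDE//; exact: H.
Qed.

Let Y n : T -> skorohod a b := ecf_path mW WF F_inv W2 a0 b1 n.

Let cov_ge0 p : a <= p <= b -> 0 <= psi_cov P W F p p.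
Proof.
move=> pab; have := @psi_cov_ge0 _ [:: tt] (fun=> 1) (fun=> p) (fun=> in01 pab).
by rewrite !big_seq1 !mul1r.
Qed.

Lemma ecf_process_limit : exists U : T -> skorohod a b,
  [/\ cvg_in_law P P Y U, gaussian_process P `[a, b] U,
      (forall p, a <= p <= b -> ('E_P[fun w => U w p] = 0)%E) &
      (forall p q, a <= p <= b -> a <= q <= b ->
         covariance P (fun w => U w p) (fun w => U w q) = (psi_cov P W F p q)%:E)].
Proof.
have [U [rU fU cU]] := ecf_gaussian_limit.
have U1 p : a <= p <= b -> isN P (fun w => U w p) (psi_cov P W F p p).
  move=> pab; have := fU 1%N (fun=> 1) (fun=> p) (fun=> pab).
  rewrite !big_ord1 !mul1r; congr isN.
  by apply/funext => w; rewrite big_ord1 mul1r.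
exists U; split.
- apply: cvg_in_law_unifc => [n||g gu [M gM]]; try exact: sup_random_element.
    by apply: sup_random_element; exact: ecf_path_random.
  by apply: cU gM; exact: unifc_sup_unifc.
- move=> k t c tab; have {}tab i : a <= t i <= b by have := tab i; rewrite /= in_itv.
  have N := fU k c t tab; split; first by case: N.
  exists 0, (\sum_(i < k) \sum_(j < k) c i * c j * psi_cov P W F (t i) (t j)).
  have v0 : 0 <= \sum_(i < k) \sum_(j < k) c i * c j * psi_cov P W F (t i) (t j).
    by apply: psi_cov_ge0 => i; exact: in01.
  by split=> // A mA; exact: isN_law v0 N A mA.
- by move=> p pab; exact: isN_expectation (cov_ge0 pab) (U1 p pab).
move=> p q pab qab; have t01 (i : 'I_2) : a <= (if i == ord0 then p else q) <= b by case: ifP.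
have := fU 2%N (fun=> 1) _ t01; have := @psi_cov_ge0 _ (index_enum 'I_2) (fun=> 1) _ (fun i => in01 (t01 i)).
rewrite !big_ord_recl !big_ord0 !addr0/= !mul1r.
have -> : psi_cov P W F q p = psi_cov P W F p q.
  by congr Ex; apply/funext => w; rewrite mulrC.
rewrite (_ : _ + _ = psi_cov P W F p p + 2 * psi_cov P W F p q + psi_cov P W F q q); last by ring.
move=> v0 N; apply: isN_covariance (cov_ge0 pab) (cov_ge0 qab) (U1 p pab) (U1 q qab) _ v0.
move: N; congr isN; apply/funext => w.
by rewrite !big_ord_recl big_ord0 addr0/= !mul1r.
Qed.

(** Evaluation at [p], though not continuous for the Skorohod distance, is so for the supremum
    distance; the functional convergence therefore applies to it directly. *)
Lemma ecf_marginal_limit p : a <= p <= b ->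
  cvg_in_law P (gaussian 0 (psi_cov P W F p p))
    (fun n w => ecf_error F n (W ^~ w) p) (@idfun R).
Proof.
move=> pab; have [U [rU fU cU]] := ecf_gaussian_limit.
have v0 := cov_ge0 pab.
have U1 : isN P (fun w => U w p) (psi_cov P W F p p).
  have := fU 1%N (fun=> 1) (fun=> p) (fun=> pab).
  rewrite !big_ord1 !mul1r; congr isN.
  by apply/funext => w; rewrite big_ord1 mul1r.
have evu (g : R -> R) : unifc g -> sup_unifc (fun x : skorohod a b => g (x p)).
  move=> gu e /gu[dl dl0 hdl]; exists (dl / 2); first by rewrite divr_gt0.
  move=> x y xy; apply: hdl; rewrite /ball/= (le_lt_trans (xy p pab))//.
  by rewrite ltr_pdivrMr// ltr_pMr// ltr1n.
have evE (g : R -> R) n : g \o (fun w => ecf_error F n (W ^~ w) p) =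
    (fun x : skorohod a b => g (x p)) \o Y n.
  by apply/funext => w; rewrite /= pab.
apply: cvg_in_law_unifc.
- move=> n; apply: random_element_unifc => g gu g1; rewrite evE.
  apply: ecf_path_random (evu g gu) _ => x; exact: g1.
- by move=> A oA; rewrite preimage_id; exact: open_measurable.
move=> g gu [M gM].
have mg : measurable_fun setT g by apply: continuous_measurable_fun; exact: unifc_continuous.
have -> : Ex (gaussian 0 (psi_cov P W F p p)) (g \o idfun) =
    Ex P ((fun x : skorohod a b => g (x p)) \o U).
  apply/esym/(@Ex_law _ _ _ _ _ P (gaussian 0 (psi_cov P W F p p)) (fun w => U w p) idfun g) => //.
  - by case: U1.
  - exact: (@measurable_id _ _ setT).
  - exact: isN_law.
  - apply: (@L1_bounded _ _ _ _ _ M) => [|w]; last exact: gM.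
    exact: (measurableT_comp mg U1.1).
  by apply: (@L1_bounded _ _ _ _ _ M) => // x; exact: gM.
under eq_fun do rewrite evE.
by apply: cU => [|x]; [exact: evu|exact: gM].
Qed.

End interval.

End ecf_limit.

Lemma independent_seq_indep_fam d (T : measurableType d) (R : realType)
    (P : probability T R) (W : nat -> {RV P >-> R}) :
  independent_seq W -> indep_fam P (fun i => W i).
Proof.
move=> iW n A mA; pose J : {fset nat} := [fset i in iota 0 n]%fset.
have perm : perm_eq J (iota 0 n).
  apply: uniq_perm => [||i]; [exact: fset_uniq|exact: iota_uniq|].
  by rewrite !inE.
have := iW J A mA; rewrite (perm_big _ perm)/=.
have -> : iota 0 n = index_iota 0 n by rewrite /index_iota subn0.
rewrite big_mkord => <-; congr (P _); apply: eq_bigcapl.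
by split=> i /=; rewrite !inE mem_iota add0n.
Qed.

Theorem theorem2 (R : realType) (d : measure_display) (Omega : measurableType d)
    (P : probability Omega R) (W : nat -> {RV P >-> R}) (F f : R -> R)
    (W_indep : independent_seq W)
    (W_ident : identically_distributed W)
    (W_cdf : forall x : R, cdf (W 0%N) x = (F x)%:E)
    (F_cont : continuous F)
    (A1_inv : forall p : R, 0 < p < 1 -> exists! x : R, F x = p)
    (A1_dens : has_density F f)
    (A1_vers : forall p : R, 0 < p < 1 -> f (cdf_inv F p) = derive1 F (cdf_inv F p))
    (A2 : ('E_P[fun w => ((W 0%N w) ^+ 2)%R] < +oo)%E)
    (A3 : forall p : R, 0 < p < 1 -> twice_derivable F (cdf_inv F p)) :
  (forall p : R, 0 < p < 1 -> f (cdf_inv F p) != 0 ->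
     cvg_in_law P (gaussian 0 (fine 'V_P[theta F f p \o W 0%N]))
       (fun n w => ecf_error F n (W ^~ w) p) (@idfun R)) /\
  (forall a b : R, 0 < a -> a < b -> b < 1 ->
     (forall p : R, a <= p <= b -> f (cdf_inv F p) != 0) ->
     exists2 X : nat -> Omega -> skorohod a b,
       (forall (n : nat) (w : Omega) (p : R), a <= p <= b -> X n w p = ecf_error F n (W ^~ w) p) &
     exists (d' : measure_display) (Omega' : measurableType d')
       (P' : probability Omega' R) (U : Omega' -> skorohod a b),
       [/\ cvg_in_law P P' X U,
           gaussian_process P' `[a, b] U,
           (forall p : R, a <= p <= b -> ('E_P'[fun w => U w p] = 0)%E) &
           (forall p q : R, a <= p <= b -> a <= q <= b ->
              covariance P' (fun w => U w p) (fun w => U w q) =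
              covariance P (theta F f p \o W 0%N) (theta F f q \o W 0%N))]).
Proof.
pose V i w := W i w.
have mV i : measurable_fun setT (V i) by exact: measurable_funP.
have iV : indep_fam P V by exact: independent_seq_indep_fam.
have VF i x : P (V i @^-1` `]-oo, x]) = (F x)%:E.
  by rewrite -W_cdf /cdf -(W_ident i).
have V2 : L1 P (fun w => V 0 w ^+ 2).
  apply/integrableP; split.
    by apply/measurable_EFinP; apply: measurable_funX; exact: mV.
  move: A2; rewrite unlock; congr (_ < _)%E; apply: eq_integral => w _ /=.
  by rewrite ger0_norm// sqr_ge0.
have F_der p : 0 < p < 1 -> derivable F (cdf_inv F p) 1.
  by move=> /A3[H _]; exact: (nbhs_singleton H).
(* The derivative is itself differentiable at each quantile, hence continuous there; composing with
   the continuous quantile function gives continuity in the level. *)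
have dF_cont p : 0 < p < 1 -> {for p, continuous (fun p => derive1 F (cdf_inv F p))}.
  move=> p01; apply: (@continuous_comp _ _ _ (cdf_inv F) (derive1 F)).
    exact: (cdf_inv_continuous (mV 0) (VF 0)).
  by have [_ /derivable1_diffP/differentiable_continuous] := A3 p p01.
have cov p q : 0 < p < 1 -> 0 < q < 1 ->
    covariance P (theta F f p \o W 0) (theta F f q \o W 0) = (psi_cov P V F p q)%:E.
  by move=> p01 q01; apply: covariance_theta => //; exact: A1_vers.
split=> [p p01 fN0|a b a0 ab b1 fN0].
  have /andP[p0 p1] := p01.
  (* The convergence at one point is obtained from the process on a small interval around it, where
     the derivative stays away from 0 by continuity. *)
  have [r r0 hr] : exists2 r : R, 0 < r & forall t, p - r <= t <= p + r ->
      0 < t < 1 /\ derive1 F (cdf_inv F t) != 0.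
    have dN0 : derive1 F (cdf_inv F p) != 0 by rewrite -A1_vers.
    have N : \forall t \near p, 0 < t < 1 /\ derive1 F (cdf_inv F t) != 0.
      near=> t; split; last by near: t; exact: (cvgr_neq0 _ (dF_cont p p01)).
      apply/andP; split; near: t; [exact: lt_nbhsr|exact: lt_nbhsl].
    have /nbhs_ballP[e e0 he] := N; exists (e / 2); first by rewrite divr_gt0.
    move=> t /andP[pt tp]; apply: he; rewrite /ball/= /= in e0 *.
    by rewrite ltr_norml; apply/andP; split; lra.
  have in_ t : p - r <= t <= p + r -> 0 < t < 1 by move=> /hr[].
  have a0 : 0 < p - r by have /in_/andP[] : p - r <= p - r <= p + r by apply/andP; split; lra.
  have b1 : p + r < 1 by have /in_/andP[] : p - r <= p + r <= p + r by apply/andP; split; lra.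
  have -> : fine 'V_P[theta F f p \o W 0%N] = psi_cov P V F p p by rewrite /variance cov.
  apply: (ecf_marginal_limit mV iV VF A1_inv V2 F_cont F_der dF_cont a0 _ b1) => [|t /hr[]//|].
    by lra.
  by apply/andP; split; lra.
have in01 p : a <= p <= b -> 0 < p < 1.
  by move=> /andP[ap pb]; rewrite (lt_le_trans a0)// (le_lt_trans pb).
have dN0 p : a <= p <= b -> derive1 F (cdf_inv F p) != 0.
  by move=> pab; rewrite -A1_vers ?in01// fN0.
exists (ecf_path mV VF A1_inv V2 a0 b1) => [n w p pab|]; first by rewrite mkDE.
have [U [lU gU eU covU]] :=
  ecf_process_limit mV iV VF A1_inv V2 F_cont F_der dF_cont a0 ab b1 dN0.
exists _, Omega, P, U; split=> // p q pab qab.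
by rewrite covU// cov ?in01.
Unshelve. all: by end_near. Qed.
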